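(* Let $\alpha\in(\frac12,1)$, $\rho>0$, $\lambda>0$, and let $K(t)=K_{\alpha,\rho}(t)=e^{-\rho t}\frac{t^{\alpha-1}}{\Gamma(\alpha)}$, $t>0$. Let $\sigma(x)=\sqrt{\kappa_0+\kappa_1x+\kappa_2x^2}$ with $\kappa_0\ge0$, $\kappa_2>0$, $\kappa_1^2\le4\kappa_2\kappa_0$. Let $c\in\big(0,\frac{2\alpha-1}{8\kappa_2}\big)$ and let $\varsigma$ be as in the context, so that in particular $$c\lambda^2\Big(1-\Big(1-\frac{(f_\lambda*\mu)(t)}{\lambda m_0}\Big)^2\Big)=(f_\lambda^2*\varsigma^2)(t),\qquad t\ge0. \qquad(\mathrm{M})$$ Let $X_0\in L^p(\mathbb P)$ for some $p>\frac2{2\alpha-1}$ ($>2$), with $\mathbb E[X_0]=m_0$ and $\mathrm{Var}(X_0)=v_0=\frac{c\,\sigma^2(m_0)}{1-c\kappa_2}$. Then: 1. The solution $(X_t)_{t\ge0}$, starting from $X_0$, of $$X_t=X_0-\frac{X_0-m_0}{\lambda m_0}\int_0^tf_\lambda(t-s)\mu(s)ds+\frac1\lambda\int_0^tf_\lambda(t-s)\varsigma(s)\sigma(X_s)dW_s,\qquad t\ge0, \qquad(\mathrm{E})$$ has a fake stationary regime of type I, in the sense that $$\forall t\ge0,\quad\mathbb E[X_t]=m_0,\qquad\mathrm{Var}(X_t)=v_0=\frac{c\,\sigma^2(m_0)}{1-c\kappa_2},\qquad\mathbb E[\sigma^2(X_t)]=\bar\sigma_0^2=\frac{\sigma^2(m_0)}{1-c\kappa_2}.$$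 2. If $m_0=(1-a)\frac{\mu_\infty}\lambda$ (i.e. $\ell_\infty=0$), then for every $X_0'\in L^2(\mathbb P)$, the solution $(X_t')_{t\ge0}$ of (E) starting from $X_0'$ satisfies $\|X_t'-X_t\|_2\to0$ as $t\to\infty$. 3. The family of shifted processes $X_{t+\cdot}$, $t\ge0$, is $C$-tight as $t\to+\infty$, and its functional limiting distributions are all laws of weakly $L^2$-stationary processes with covariance function, for $0\le t_1\le t_2$, $$C_\infty(t_1,t_2)=\ell_\infty^2v_0+\frac{\varsigma_\infty^2v_0}{c\lambda^2}\int_0^{+\infty}f_\lambda(t_2-t_1+u)f_\lambda(u)\,du,$$ where $\varsigma_\infty^2=1$ if $\varsigma\equiv1$, and $\varsigma_\infty^2=\frac{c\lambda^2(1-\ell_\infty^2)}{\int_0^{+\infty}f_\lambda^2(s)ds}$ if $\varsigma=\varsigma_{\lambda,c}$.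
   Context: $W$ is a real standard Brownian motion on a filtered probability space $(\Omega,\mathcal F,(\mathcal F_t)_{t\ge0},\mathbb P)$ satisfying the usual conditions; $X_0,X_0'$ are real $\mathcal F_0$-measurable random variables independent of $W$. A solution is an $(\mathcal F_t)$-adapted pathwise continuous process. $C$-tight means tight in $C(\mathbb R_+,\mathbb R)$ with the topology of uniform convergence on compact sets; functional limiting distributions are weak limits in this space along sequences $t_n\to+\infty$. The $\lambda$-resolvent $R_\lambda=R_{\alpha,\rho,\lambda}$ of $K$ is the solution of $R_\lambda(t)+\lambda\int_0^tK(t-s)R_\lambda(s)ds=1$, $t\ge0$; $f_\lambda=f_{\alpha,\rho,\lambda}:=-R_\lambda'$ on $(0,+\infty)$; and $a:=\lim_{t\to+\infty}R_\lambda(t)=\frac1{1+\lambda\rho^{-\alpha}}\in(0,1)$. Convolution: $(g*h)(t)=\int_0^tg(t-s)h(s)ds$. Standing assumption on $\mu$: $m_0\ne0$ is a fixed real parameter; $\mu:\mathbb R_+\to\mathbb R$ is $C^1$, not a.e. zero, with $\lim_{t\to+\infty}\mu(t)=\mu_\infty\in\mathbb R$ and $\mu_\infty/m_0\ge0$. Put $\ell_\infty:=1-\frac{1-a}{\lambda m_0}\mu_\infty$. Equation (E) is equivalent to $X_t=X_0\phi(t)+\int_0^tK(t-s)(\mu(s)-\lambda X_s)ds+\int_0^tK(t-s)\varsigma(s)\sigma(X_s)dW_s$ with $\phi(t)=1-\lambda\int_0^tK(t-s)\big(\frac{\mu(s)}{\lambda m_0}-1\big)ds$. The function $\varsigma$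 is either a stabilizer $\varsigma=\varsigma_{\lambda,c}$, i.e. a bounded continuous function, positive on $(0,+\infty)$, solving (M), whose existence is assumed (time-dependent diffusion setting), or $\varsigma\equiv1$ when (M) holds with $\varsigma\equiv1$ (autonomous diffusion setting). *)

(* Defs.v *)
From HB Require Import structures.
From mathcomp Require Import all_boot all_order all_algebra.
From mathcomp Require Import all_classical all_reals all_analysis.

Set Implicit Arguments.
Unset Strict Implicit.
Unset Printing Implicit Defensive.

Import Order.TTheory GRing.Theory Num.Theory.
Import numFieldNormedType.Exports.

Local Open Scope classical_set_scope.
Local Open Scope ring_scope.

(* Functions and processes on [R_+] are indexed by the whole of [R]; only their
   values at times [t >= 0] matter. *)

Definition Gamma_fun (R : realType) (alpha : R) : R :=
  \int[lebesgue_measure]_(x in `]0%R, +oo[) (x `^ (alpha - 1) * expR (- x)).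

Definition gamma_kernel (R : realType) (alpha rho t : R) : R :=
  expR (- (rho * t)) * t `^ (alpha - 1) / Gamma_fun alpha.

Definition volterra_conv (R : realType) (g h : R -> R) (t : R) : R :=
  \int[lebesgue_measure]_(s in `[0%R, t]) (g (t - s) * h s).

(* Without continuity, a function whose integral does not converge could
   satisfy the equation through the default value of the integral. *)
Definition is_resolvent (R : realType) (K : R -> R) (lambda : R)
    (Rl : R -> R) :=
  {within `[0, +oo[, continuous Rl} /\
  forall t : R, 0 <= t -> Rl t + lambda * volterra_conv K Rl t = 1.

(* The value at [0] is irrelevant: [f_lambda] is only used under integrals. *)
Definition resolvent_density (R : realType) (Rl : R -> R) : R -> R :=
  fun t => - derive1 Rl t.

(* By the mean value theorem, [dg 0] is then the right derivative at [0]. *)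
Definition C1_halfline (R : realType) (g : R -> R) :=
  {within `[0, +oo[, continuous g} /\
  exists dg : R -> R, {within `[0, +oo[, continuous dg} /\
    forall t : R, 0 < t -> is_derive t (1 : R) g (dg t).

Definition diffusion_coef (R : realType) (kappa0 kappa1 kappa2 x : R) : R :=
  Num.sqrt (kappa0 + kappa1 * x + kappa2 * x ^+ 2).

Definition scaling_equation (R : realType) (lambda m0 c : R)
    (f mu vs : R -> R) :=
  forall t : R, 0 <= t ->
    c * lambda ^+ 2 * (1 - (1 - volterra_conv f mu t / (lambda * m0)) ^+ 2) =
    volterra_conv (fun s => f s ^+ 2) (fun s => vs s ^+ 2) t.

Definition is_stabilizer (R : realType) (lambda m0 c : R)
    (f mu vs : R -> R) :=
  [/\ {within `[0, +oo[, continuous vs},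
      exists M : R, forall t : R, 0 <= t -> `|vs t| <= M,
      forall t : R, 0 < t -> 0 < vs t &
      scaling_equation lambda m0 c f mu vs].

Definition usual_conditions d (Omega : measurableType d) (R : realType)
    (P : probability Omega R) (F : R -> set (set Omega)) :=
  [/\ forall t : R, 0 <= t -> sigma_algebra setT (F t) /\ F t `<=` measurable,
      forall s t : R, 0 <= s -> s <= t -> F s `<=` F t,
      forall t : R, 0 <= t -> F t = \bigcap_(s in `]t, +oo[) F s &
      forall A, P.-negligible A -> F 0 A].

Definition meas_wrt (Omega : Type) (R : realType) (G : set (set Omega))
    (Y : Omega -> R) :=
  forall B : set R, measurable B -> G (Y @^-1` B).

Definition indep_sigma d (Omega : measurableType d) (R : realType)
    (P : probability Omega R) (G H : set (set Omega)) :=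
  forall A B, G A -> H B -> P (A `&` B) = (P A * P B)%E.

Definition sigma_process (Omega : pointedType) (R : realType)
    (W : R -> Omega -> R) : set (set Omega) :=
  <<s [set A | exists (t : R) (B : set R),
         [/\ 0 <= t, measurable B & A = W t @^-1` B]] >>.

Definition is_brownian d (Omega : measurableType d) (R : realType)
    (P : probability Omega R) (F : R -> set (set Omega))
    (W : R -> Omega -> R) :=
  [/\ forall t : R, 0 <= t -> meas_wrt (F t) (W t),
      forall w, {within `[0, +oo[, continuous (W ^~ w)},
      {ae P, forall w, W 0 w = 0},
      forall s t : R, 0 <= s -> s < t ->
        indep_sigma P (F s) (g_sigma_algebra_preimage (W t \- W s)) &
      forall s t : R, 0 <= s -> s < t -> forall B : set R, measurable B ->
        P ((W t \- W s) @^-1` B) = normal_prob 0 (Num.sqrt (t - s)) B].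

(* The simple integrand [sum_(i < n) xi_i 1_{]tau_i, tau_(i+1)]}]. *)
Definition is_simple_integrand (Omega : Type) (R : realType)
    (F : R -> set (set Omega)) (n : nat) (tau : nat -> R)
    (xi : nat -> Omega -> R) :=
  [/\ forall i, 0 <= tau i,
      forall i, tau i <= tau i.+1,
      forall i, (i < n)%N -> meas_wrt (F (tau i)) (xi i) &
      forall i, (i < n)%N -> exists M : R, forall w, `|xi i w| <= M].

Definition simple_integrand (Omega : Type) (R : realType) (n : nat)
    (tau : nat -> R) (xi : nat -> Omega -> R) (s : R) (w : Omega) : R :=
  \sum_(i < n) xi i w * \1_(`]tau i, tau i.+1] : set R) s.

Definition simple_integral (Omega : Type) (R : realType)
    (W : R -> Omega -> R) (n : nat) (tau : nat -> R) (xi : nat -> Omega -> R)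
    (t : R) (w : Omega) : R :=
  \sum_(i < n) xi i w *
    (W (Num.min (tau i.+1) t) w - W (Num.min (tau i) t) w).

(* Meant for nonnegative [Y n]. *)
Definition cvg0_in_prob d (Omega : measurableType d) (R : realType)
    (P : probability Omega R) (Y : nat -> Omega -> \bar R) :=
  forall eps : R, 0 < eps ->
    (P [set w | (eps%:E <= Y n w)%E]) @[n --> \oo] --> 0%E.

(* [I] is (a version of) the Ito integral [int_0^t H_s dW_s]: the limit in
   probability of the integrals of simple integrands [H^n] such that
   [int_0^t (H^n_s - H_s)^2 ds] tends to [0] in probability.  Such [H^n] exist
   for every progressively measurable [H] with [int_0^t H_s^2 ds < +oo] a.s.,
   and [I] is then unique up to a null set. *)
Definition is_ito_integral d (Omega : measurableType d) (R : realType)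
    (P : probability Omega R) (F : R -> set (set Omega)) (W : R -> Omega -> R)
    (t : R) (H : R -> Omega -> R) (I : Omega -> R) :=
  meas_wrt (F t) I /\
  exists (n : nat -> nat) (tau : nat -> nat -> R)
         (xi : nat -> nat -> Omega -> R),
    [/\ forall k, is_simple_integrand F (n k) (tau k) (xi k),
        cvg0_in_prob P (fun k w => \int[lebesgue_measure]_(s in `[0%R, t])
          ((simple_integrand (n k) (tau k) (xi k) s w - H s w) ^+ 2)%:E)%E &
        cvg0_in_prob P (fun k w =>
          `|simple_integral W (n k) (tau k) (xi k) t w - I w|%:E)].

(* For each [t] the equation holds almost surely; by path continuity this is
   the same as indistinguishability from a continuous version of the
   right-hand side. *)
Definition is_solution d (Omega : measurableType d) (R : realType)
    (P : probability Omega R) (F : R -> set (set Omega)) (W : R -> Omega -> R)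
    (lambda m0 : R) (f mu vs sigma : R -> R)
    (X0 : Omega -> R) (X : R -> Omega -> R) :=
  [/\ forall t : R, 0 <= t -> meas_wrt (F t) (X t),
      forall w, {within `[0, +oo[, continuous (X ^~ w)} &
      forall t : R, 0 <= t -> exists I : Omega -> R,
        is_ito_integral P F W t (fun s w => f (t - s) * vs s * sigma (X s w)) I
        /\ {ae P, forall w,
              X t w = X0 w - (X0 w - m0) / (lambda * m0) * volterra_conv f mu t
                      + lambda^-1 * I w}].

Definition is_initial d (Omega : measurableType d) (R : realType)
    (P : probability Omega R) (F : R -> set (set Omega)) (W : R -> Omega -> R)
    (X0 : Omega -> R) :=
  meas_wrt (F 0) X0 /\
  indep_sigma P (g_sigma_algebra_preimage X0) (sigma_process W).

Definition halfline (R : realType) : topologicalType :=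
  set_type (`[0%R, +oo[%classic : set R).

(* The topology of uniform convergence on compact sets, induced on the
   continuous functions. *)
Definition Cspace (R : realType) :=
  initial_topology (fun z : continuousType (halfline R) R =>
    ((z : halfline R -> R) : {family compact, halfline R -> R})).

HB.instance Definition _ (R : realType) := Topological.on (Cspace R).

Lemma cst0_halfline_continuous (R : realType) :
  continuous ((fun=> 0) : halfline R -> R).
Proof. exact: cst_continuous. Qed.

HB.instance Definition _ (R : realType) := isPointed.Build (Cspace R)
  (mkcts (@cst0_halfline_continuous R) : continuousType (halfline R) R).

Definition borelC (R : realType) := g_sigma_algebraType (@open (Cspace R)).

(* The element of [C(R_+, R)] given by the restriction of [g] to [R_+], when
   that restriction is continuous (see [path_ofE]). *)
Definition path_of (R : realType) (g : R -> R) : Cspace R :=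
  if pselect (continuous (fun s : halfline R => g (set_val s))) is left h
  then (mkcts h : continuousType (halfline R) R) else point.

Lemma path_ofE (R : realType) (g : R -> R) (s : halfline R) :
  {within `[0, +oo[, continuous g} -> path_of g s = g (set_val s).
Proof.
move=> /subspace_sigL_continuousP cg; rewrite /path_of; case: pselect => //.
Qed.

Definition shifted_path (Omega : Type) (R : realType) (X : R -> Omega -> R)
    (t : R) (w : Omega) : Cspace R :=
  path_of (fun s => X (t + s) w).

Definition C_tight d (Omega : measurableType d) (R : realType)
    (P : probability Omega R) (Y : R -> Omega -> Cspace R) :=
  forall eps : R, 0 < eps -> exists C : set (Cspace R),
    compact C /\ forall t : R, 0 <= t -> ((1 - eps)%:E <= P (Y t @^-1` C))%E.

Definition functional_limiting_distribution d (Omega : measurableType d)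
    (R : realType) (P : probability Omega R) (Y : R -> Omega -> Cspace R)
    (Q : probability (borelC R) R) :=
  exists u : nat -> R, u n @[n --> \oo] --> +oo /\
    forall Phi : Cspace R -> R, continuous Phi ->
      (exists M : R, forall z, `|Phi z| <= M) ->
      ('E_P[Phi \o Y (u n)])%E @[n --> \oo] --> ('E_Q[Phi])%E.

Definition eval_at (R : realType) (s : halfline R) : borelC R -> R :=
  fun z => (z : Cspace R) s.

Definition weakly_L2_stationary (R : realType) (Q : probability (borelC R) R) :=
  [/\ forall s, eval_at s \in Lfun Q 2%:E,
      exists m : R, forall s, ('E_Q[eval_at s] = m%:E)%E &
      forall (h : R) (s t s' t' : halfline R), 0 <= h ->
        set_val s' = set_val s + h -> set_val t' = set_val t + h ->
        covariance Q (eval_at s') (eval_at t') =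
        covariance Q (eval_at s) (eval_at t)].

Definition has_covariance_function (R : realType)
    (Q : probability (borelC R) R) (C : R -> R -> R) :=
  forall t1 t2 : halfline R, set_val t1 <= set_val t2 ->
    covariance Q (eval_at t1) (eval_at t2) = (C (set_val t1) (set_val t2))%:E.

(* Main.v *)
Require Import Defs.
From HB Require Import structures.
From mathcomp Require Import all_boot all_order all_algebra.
From mathcomp Require Import all_classical all_reals all_analysis.
From mathcomp Require Import measurable_realfun normal_distribution.
From mathcomp Require Import ring lra zify.
Set Implicit Arguments.
Unset Strict Implicit.
Unset Printing Implicit Defensive.
Import Order.TTheory GRing.Theory Num.Theory.
Import numFieldNormedType.Exports.
Local Open Scope classical_set_scope.
Local Open Scope ring_scope.
Local Notation mfunT := (measurable_fun setT).
Local Notation mEFinP := measurable_EFinP.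
Local Notation mfunM := measurable_funM.
Local Notation leb R := (@lebesgue_measure R).
Local Notation mindic := measurable_indic.
Local Notation mfunTS := measurable_funTS.
Local Notation mfubiniF := measurable_fun_fubini_tonelli_F.
Local Notation cmfun := continuous_measurable_fun.
Local Notation mitv := measurable_itv.
Local Notation mfun_ifT := measurable_fun_ifT.
Local Notation mcst := measurable_cst.
Local Notation msum := measurable_sum.
Local Notation mfunX := measurable_funX.
Local Notation mfunB := measurable_funB.
Local Notation mfunD := measurable_funD.
Local Notation mcompT := measurableT_comp.

(** The resolvent density [f] of [K] is nonnegative and [exp (rho t) f t] is nonincreasing, as [K] is a mixture of
 exponentials. The noise [X_t - E X_t] is a Volterra integral with kernel [f]: conditionally on the past, a
 Brownian increment is Gaussian, which gives the isometry and, by convexity, moments of order [2q]. As [c] is small,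
 these estimates are contractions. In order 2, (M) turns the equation for [E (sigma (X_t) ^ 2)] into one with a
 constant solution, and makes the coupling converge when [phi] tends to [0]. In order [2q], with
 [q (2 alpha - 1) > 1], localising on [|X_0 - m_0| <= n], they bound the increments, hence tightness, and give
 uniform integrability of [X_t ^ 2]. Finally (M) says that [f ^ 2 * vs ^ 2] converges; as [f ^ 2] decreases
 exponentially fast, the local averages of [vs ^ 2] converge, hence so do the covariances. *)

(** * Convolutions and the resolvent density *)

Local Notation cpath Y := (forall w, {within `[0, +oo[, continuous (Y^~ w)}).

(** Two obstacles shape the proof. First, [f] is only given as a derivative of [Rl], without a
    formula. As [2 alpha - 1 > 0], [K * K] has an integrable derivative [K2], and the resolvent
    equation used twice gives [f = lambda K - lambda ^ 2 K2 * Rl]. The mixture then makes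
    [f (t + s)] a Gram kernel: its Cauchy-Schwarz inequality is the log-convexity of [f], which with
    [f <= lambda K] yields the monotonicity. Second, no moment of a solution is known to be finite
    beforehand. Estimates are made on events where the path stays bounded up to the current time, so
    that a crude bound exists; iterating the contraction replaces it by a bound that ignores the
    localisation, which Fatou's lemma removes. The Ito integrals, limits along unspecified simple
    integrands, are first transferred to explicit grids. Kolmogorov's criterion asks for
    [q (2 alpha - 1) > 1]. For the least such [q] the bound on [c] gives
    [c kappa2 (2 q - 1) <= 3 / 8], which leaves room for the contraction. As [varsigma] need not
    converge, the limit of the covariances calls for a Tauberian argument. *)

Lemma eq_ler d (T : porderType d) (x y : T) : x = y -> (x <= y)%O. Proof. by move=> ->. Qed.

Lemma expr_double_ge0 (R : realDomainType) (x : R) (q : nat) : 0 <= x ^+ q.*2.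
Proof. by rewrite -mul2n exprM exprn_ge0// sqr_ge0. Qed.

Lemma lee_sqr0 (R : realDomainType) (x : R) : (0 <= (x ^+ 2)%:E)%E. Proof. by rewrite lee_fin sqr_ge0. Qed.

(** * Affine changes of variables on the line *)

Section affine.
Variable R : realType.
Notation mu := (leb R).

(** Scaled by [|a|], the push-forward of Lebesgue measure by [x -> a x + b] gives every interval
    []l, u]] its length, hence is Lebesgue measure. For [a < 0] the preimage is closed on the other
    side, without effect on its length. *)
Lemma ge0_integral_affine (a b : R) (f : R -> \bar R) : a != 0 ->
 mfunT f -> (forall x, (0 <= f x)%E) ->
 (`|a|%:E * \int[mu]_x f (a * x + b)%R)%E = (\int[mu]_x f x)%E.
Proof.
move=> a0 mf f0.
pose T := fun x : measurableTypeR R => (a * x + b : measurableTypeR R).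
have mT : mfunT T.
 by apply: mfunD => //; apply: mfunM.
have ap : 0 <= `|a| by [].
pose r := NngNum ap.
pose pm := measure_function_pushforward__canonical__measure_function_Measure mu mT.
pose m := mscale r pm.
rewrite [RHS](_ : _ = \int[m]_x f x)%E; last first.
 apply: eq_measure_integral => A mA _. apply: lebesgue_measure_unique => // X -[[l u] /= _ <-]. rewrite /m /= /mscale /= /pushforward. have [ul|lu] := leP u l.
  rewrite set_itv_ge ?preimage_set0 ?measure0 ?mule0//. by rewrite bnd_simp -leNgt. have [ap'|an|] := ltgtP a 0; last by move/eqP; rewrite (negbTE a0).
  rewrite (_ : T @^-1` _ = `[(u - b) / a, (l - b) / a[%classic); last first. apply/seteqP; split => x /=; rewrite /T !in_itv /= ler_ndivrMr// ltr_ndivlMr//.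
    by move=> /andP[]; rewrite mulrC; move=> ? ?; apply/andP; split; lra. by move=> /andP[]; rewrite mulrC; move=> ? ?; apply/andP; split; lra.
  rewrite !lebesgue_measure_itv /= !lte_fin lu ltr_nM2r ?invr_lt0// ltrD2r lu. rewrite -!EFinB -EFinM; congr EFin.
  by rewrite (ltr0_norm ap'); field. rewrite (_ : T @^-1` _ = `](l - b) / a, (u - b) / a]%classic); last first. apply/seteqP; split => x /=; rewrite /T !in_itv /= ltr_pdivrMr// ler_pdivlMr//.
   by move=> /andP[]; rewrite mulrC; move=> ? ?; apply/andP; split; lra. by move=> /andP[]; rewrite mulrC; move=> ? ?; apply/andP; split; lra.
 rewrite !lebesgue_measure_itv /= !lte_fin lu ltr_pM2r ?invr_gt0// ltrD2r lu. rewrite -!EFinB -EFinM; congr EFin. by rewrite (gtr0_norm an); field.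
rewrite ge0_integral_mscale//= /pm/= ge0_integral_pushforward//.
Qed.

Lemma ge0_integral_reflect (t : R) (f : R -> \bar R) :
 mfunT f -> (forall x, (0 <= f x)%E) ->
 (\int[mu]_x f (t - x)%R = \int[mu]_x f x)%E.
Proof.
move=> mf f0; rewrite -(@ge0_integral_affine (-1) t f)// ?oppr_eq0 ?oner_eq0//.
rewrite normrN1 mul1e; apply: eq_integral => x _.
by congr f; rewrite mulN1r addrC.
Qed.

Lemma integral_reflect (t : R) (f : R -> \bar R) : mfunT f ->
 (\int[mu]_x f (t - x)%R = \int[mu]_x f x)%E.
Proof.
move=> mf; rewrite integralE [RHS]integralE.
have := @ge0_integral_reflect t (f^\+)%E (measurable_funepos mf) (fun=> funepos_ge0 _ _).
have := @ge0_integral_reflect t (f^\-)%E (measurable_funeneg mf) (fun=> funeneg_ge0 _ _).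
by move=> <- <-; congr (_ - _)%E; apply: eq_integral => x _; rewrite ?funeposE ?funenegE.
Qed.

Lemma integral_translate (t : R) (f : R -> \bar R) : mfunT f ->
 (\int[mu]_x f (x - t)%R = \int[mu]_x f x)%E.
Proof.
move=> mf; rewrite -[RHS](@integral_reflect 0)// -(@integral_reflect t (fun x => f (0 - x)%R)).
 by apply: eq_integral => x _; congr f; lra.
by apply: mcompT => //; exact: mfunB.
Qed.

End affine.

(** Convolution over the whole line: commutativity, associativity and translation become plain
    changes of variables. For functions vanishing on the nonpositive half-line it agrees with
    [volterra_conv], see [volterra_rconv]. *)
Definition rconv (R : realType) (a b : R -> R) (t : R) : R :=
 \int[lebesgue_measure]_s (a (t - s) * b s).

Definition L1 (R : realType) (f : R -> R) :=
 (@lebesgue_measure R).-integrable setT (EFin \o f).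

(** * Fubini's theorem for real-valued integrals *)

Section fubini_real.
Context d1 d2 (T1 : measurableType d1) (T2 : measurableType d2) (R : realType).
Variable m1 : {sigma_finite_measure set T1 -> \bar R}.
Variable m2 : {sigma_finite_measure set T2 -> \bar R}.
Variable f : T1 * T2 -> R.
Hypothesis imf : (m1 \x m2)%E.-integrable setT (EFin \o f).

(** [Rintegral] gives the value 0 to a section whose integral is infinite, so the real and the
    extended integrals of the sections agree only almost everywhere. *)
Lemma ae_Rintegral1 : {ae m1, forall x,
 (\int[m2]_y (f (x, y))%:E = (\int[m2]_y f (x, y))%:E)%E}.
Proof.
apply: filterS (ae_integrable1 imf) => x ix.
by rewrite fineK//; apply: integrable_fin_num.
Qed.

Lemma ae_Rintegral2 : {ae m2, forall y,
 (\int[m1]_x (f (x, y))%:E = (\int[m1]_x f (x, y))%:E)%E}.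
Proof.
apply: filterS (ae_integrable2 imf) => x ix.
by rewrite fineK//; apply: integrable_fin_num.
Qed.

Lemma measurable_Rfubini1 : mfunT (fun x => \int[m2]_y f (x, y)).
Proof.
apply: mcompT; first exact: fine_measurable.
exact: (measurable_fubini_F imf).
Qed.

Lemma measurable_Rfubini2 : mfunT (fun y => \int[m1]_x f (x, y)).
Proof.
apply: mcompT; first exact: fine_measurable.
exact: (measurable_fubini_G imf).
Qed.

Lemma integrable_Rfubini1 :
 m1.-integrable setT (EFin \o (fun x => \int[m2]_y f (x, y))).
Proof.
apply/integrableP; split; first exact/mEFinP/measurable_Rfubini1.
have /integrableP[_] := integrable_fubini_F imf.
apply: le_lt_trans; apply: eq_ler.
apply: ae_eq_integral => //.
- by apply: mcompT => //; exact/mEFinP/measurable_Rfubini1.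
- by apply: mcompT => //; exact: (measurable_fubini_F imf).
- by apply: filterS ae_Rintegral1 => x h _; rewrite /fubini_F/= h.
Qed.

Lemma Rfubini :
 \int[m1]_x \int[m2]_y f (x, y) = \int[m2]_y \int[m1]_x f (x, y).
Proof.
congr fine.
transitivity (\int[m1]_x fubini_F m2 (EFin \o f) x)%E.
 apply: ae_eq_integral => //.
 - exact/mEFinP/measurable_Rfubini1.
 - exact: (measurable_fubini_F imf).
 - by apply: filterS ae_Rintegral1 => x h _; rewrite /fubini_F/= h.
rewrite integral12_prod_meas1// -integral21_prod_meas1//.
apply: ae_eq_integral => //.
- exact: (measurable_fubini_G imf).
- exact/mEFinP/measurable_Rfubini2.
- by apply: filterS ae_Rintegral2 => x h _; rewrite /fubini_G/= h.
Qed.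

End fubini_real.

Definition bddm (R : realType) (c : R -> R) :=
 mfunT c /\ exists M : R, forall x, `|c x| <= M.

(** * Convolution of integrable and bounded functions *)

Section conv.
Variable R : realType.
Notation mu := (leb R).
Implicit Types (a b c : R -> R) (t : R).

(** One of the two parts has an infinite integral, so the extended integral is infinite, and [fine]
    sends it to 0. This is what frees [Rintegral_Zr] from integrability. *)
Lemma Rintegral_nonintegrable (f : R -> R) : mfunT f -> ~ L1 f ->
 \int[mu]_x f x = 0.
Proof.
move=> mf nf; rewrite /Rintegral integralE.
have mEf : mfunT (EFin \o f) by exact/mEFinP.
have : ~ (\int[mu]_x `|(EFin \o f) x| < +oo)%E.
 by move=> h; apply: nf; apply/integrableP.
rewrite (_ : (fun x => `|_|%E) = (EFin \o f)^\+ \+ (EFin \o f)^\-)%E; last by rewrite -fune_abse.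
rewrite ge0_integralD//; last 2 first.
 exact: measurable_funepos. exact: measurable_funeneg.
have p0 : (0 <= \int[mu]_x (fun x => (f x)%:E)^\+ x)%E by exact: integral_ge0.
have n0 : (0 <= \int[mu]_x (fun x => (f x)%:E)^\- x)%E by exact: integral_ge0.
move: p0 n0.
case: (\int[mu]_x (fun x => (f x)%:E)^\+ x)%E => [r| |]//;
case: (\int[mu]_x (fun x => (f x)%:E)^\- x)%E => [s| |]//.
by move=> _ _ []; rewrite -EFinD ltry.
Qed.

Lemma Rintegral_Zr (f : R -> R) (r : R) : mfunT f ->
 \int[mu]_x (f x * r) = (\int[mu]_x f x) * r.
Proof.
move=> mf; have [->|r0] := eqVneq r 0.
 rewrite mulr0 (_ : (fun x => f x * 0) = cst 0) ?Rintegral_cst// ?mul0r//. by apply/funext => x; rewrite mulr0.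
have [/(RintegralZr r)->//|nf] := pselect (L1 f).
rewrite (Rintegral_nonintegrable mf nf) mul0r Rintegral_nonintegrable//.
 exact: mfunM.
apply: contra_not nf => h.
have : L1 (fun x => r^-1 * (f x * r)).
 exact: (@integrableZl _ _ _ mu _ measurableT r^-1 (EFin \o (fun x => f x * r)) h).
by congr (mu.-integrable _ _); apply/funext => x /=; rewrite mulrCA mulVf// mulr1.
Qed.

Lemma mreflect a t : mfunT a ->
 measurable_fun [set: R] (fun s => a (t - s)).
Proof. by move=> ma; apply: mcompT => //; exact: mfunB. Qed.

Lemma L1_mfun a : L1 a -> mfunT a.
Proof. by move=> /(measurable_int mu) /mEFinP. Qed.

Lemma L1_reflect a t : L1 a -> L1 (fun s => a (t - s)).
Proof.
move=> ia; have ma := L1_mfun ia.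
apply/integrableP; split.
 by apply/mEFinP; exact: mreflect.
have /integrableP[_] := ia; apply: le_lt_trans.
rewrite -(@ge0_integral_reflect _ t (fun x => `|(a x)%:E|%E))//.
by apply: mcompT => //; exact/mEFinP.
Qed.

Lemma L1_bddM a c : L1 a -> bddm c -> L1 (fun s => a s * c s).
Proof.
move=> ia [mc [M cM]].
have ma := L1_mfun ia.
have iM : mu.-integrable setT (EFin \o (fun s => M * a s)).
 exact: (@integrableZl _ _ _ mu _ measurableT M (EFin \o a) ia).
apply: le_integrable iM => //.
 by apply/mEFinP; exact: mfunM.
move=> x _ /=; rewrite lee_fin !normrM mulrC; apply: ler_wpM2r => //.
by rewrite (le_trans (cM x))// ler_norm.
Qed.

Lemma rconv_L1_pt a c t : L1 a -> bddm c -> L1 (fun s => a (t - s) * c s).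
Proof. by move=> ia bc; apply: L1_bddM => //; exact: L1_reflect. Qed.

Lemma rconvC a b t : mfunT a -> mfunT b ->
 rconv a b t = rconv b a t.
Proof.
move=> ma mb; congr fine.
rewrite -(@integral_reflect _ t (fun s => (a (t - s) * b s)%:E)).
 by apply: eq_integral => s _; rewrite subKr mulrC.
apply/mEFinP; apply: mfunM => //; exact: mreflect.
Qed.

Lemma measurable_sub2 a : mfunT a ->
 measurable_fun [set: R * R] (fun z : R * R => a (z.1 - z.2)).
Proof. by move=> ma; apply: mcompT => //; exact: mfunB. Qed.

(** Bounding [c] by [M] and integrating in [z.2] first, translation invariance makes the integral of
    the absolute value at most [M] times the product of the L1 norms of [a] and [b]. *)
Lemma integrable_conv3 a b c t : L1 a -> L1 b -> bddm c ->
 (mu \x mu)%E.-integrable setT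
  (EFin \o (fun z : R * R => a (t - z.1) * (b (z.1 - z.2) * c z.2))).
Proof.
move=> ia ib [mc [M cM]].
have ma := L1_mfun ia.
have mb := L1_mfun ib.
have M0 : 0 <= M by exact: le_trans (cM 0).
have mabc : mfunT
  (EFin \o (fun z : R * R => a (t - z.1) * (b (z.1 - z.2) * c z.2))). apply/mEFinP; apply: mfunM. by apply: mcompT => //; exact: mfunB. apply: mfunM; first exact: measurable_sub2. exact: mcompT.
apply/integrable12ltyP => //=.
pose Nb := (\int[mu]_x `|(b x)%:E|)%E.
have Nby : (Nb < +oo)%E by have /integrableP[] := ib.
apply: (@le_lt_trans _ _ (\int[mu]_x (`|(a (t - x))%:E| * (M%:E * Nb)))%E).
 apply: ge0_le_integral => //.
 - by move=> x _; exact: integral_ge0.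
 - apply: (@mfubiniF _ _ _ _ _ mu (fun z : R * R => `|(a (t - z.1) * (b (z.1 - z.2) * c z.2))%:E|)%E) => //. exact: mcompT.
 - apply: emeasurable_funM => //; apply: mcompT => //. by apply/mEFinP; exact: mreflect.
 - move=> x _. apply: (@le_trans _ _ (\int[mu]_y (`|(a (t - x))%:E| * (M%:E * `|(b (x - y))%:E|)))%E). apply: ge0_le_integral => //.
   + apply/mEFinP; apply: mcompT => //. apply: mfunM => //; apply: mfunM => //. exact: mreflect.
   + apply: emeasurable_funM => //; apply: emeasurable_funM => //. apply: mcompT => //; apply/mEFinP. exact: mreflect.
   + move=> y _; rewrite /= lee_fin !normrM; apply: ler_wpM2l => //. by rewrite mulrC; apply: ler_wpM2r. have mby : measurable_fun [set: R] (fun y : R => `|(b (x - y))%:E|%E).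
   by apply: mcompT => //; apply/mEFinP; exact: mreflect. rewrite ge0_integralZl//; last 2 first. by apply: emeasurable_funM. by move=> y _; rewrite mule_ge0.
  rewrite ge0_integralZl// (@ge0_integral_reflect _ x (fun y => `|(b y)%:E|%E))//. by apply: mcompT => //; exact/mEFinP.
have Nb0 : (0 <= Nb)%E by exact: integral_ge0.
rewrite ge0_integralZr//.
- have /integrableP[_] := ia.
 rewrite -(@ge0_integral_reflect _ t (fun x => `|(a x)%:E|%E))//; last first. by apply: mcompT => //; exact/mEFinP.
 by move=> h; rewrite lte_mul_pinfty ?mule_ge0 ?integral_ge0// ?lte_mul_pinfty// ge0_fin_numE ?integral_ge0.
- by apply: mcompT => //; apply/mEFinP; exact: mreflect.
- by rewrite mule_ge0.
Qed.

Lemma L1_translate a t : L1 a -> L1 (fun s => a (s - t)).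
Proof.
move=> ia; have ma := L1_mfun ia.
have mat : measurable_fun [set: R] (fun s => a (s - t)).
 by apply: mcompT => //; exact: mfunB.
apply/integrableP; split; first exact/mEFinP.
have /integrableP[_] := ia; apply: le_lt_trans.
rewrite -(@integral_translate _ t (fun x => `|(a x)%:E|%E))//.
by apply: mcompT => //; exact/mEFinP.
Qed.

Lemma integrable_conv2 a b : L1 a -> L1 b ->
 (mu \x mu)%E.-integrable setT
  (EFin \o (fun z : R * R => a (z.1 - z.2) * b z.2)).
Proof.
move=> ia ib.
have ma := L1_mfun ia.
have mb := L1_mfun ib.
have mab : mfunT
  (EFin \o (fun z : R * R => a (z.1 - z.2) * b z.2)). apply/mEFinP; apply: mfunM; first exact: measurable_sub2. exact: mcompT.
apply/integrable21ltyP => //=.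
pose Na := (\int[mu]_x `|(a x)%:E|)%E.
have Nay : (Na < +oo)%E by have /integrableP[] := ia.
have Na0 : (0 <= Na)%E by exact: integral_ge0.
under eq_integral => y _.
 rewrite (_ : (\int[mu]_x _ = Na * `|(b y)%:E|)%E); last first. rewrite /Na -(@integral_translate _ y (fun x => `|(a x)%:E|)%E); last first. by apply: mcompT => //; exact/mEFinP.
  rewrite -ge0_integralZr//. by apply: eq_integral => x _; rewrite normrM. apply: mcompT => //; apply/mEFinP. by apply: mcompT => //; exact: mfunB. over.
rewrite ge0_integralZl//.
 have /integrableP[_ ?] := ib. by rewrite lte_mul_pinfty// ge0_fin_numE.
by apply: mcompT => //; exact/mEFinP.
Qed.

Lemma L1_conv a b : L1 a -> L1 b -> L1 (rconv a b).
Proof. by move=> ia ib; exact: (integrable_Rfubini1 (integrable_conv2 ia ib)). Qed.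

Lemma rconv_bddm a c : L1 a -> bddm c -> bddm (rconv a c).
Proof.
move=> ia [mc [M cM]]; have ma := L1_mfun ia; split.
 have mac : mfunT (fun z : R * R => (a (z.1 - z.2) * c z.2)%:E). apply/mEFinP; apply: mfunM; first exact: measurable_sub2. exact: mcompT. rewrite (_ : rconv a c = fun t => fine (
  (\int[mu]_y ((fun z : R * R => (a (z.1 - z.2) * c z.2)%:E)^\+ (t, y))) - (\int[mu]_y ((fun z : R * R => (a (z.1 - z.2) * c z.2)%:E)^\- (t, y))))%E); last first.
  apply/funext => t; rewrite /rconv/Rintegral integralE; congr (fine (_ - _)%E). by apply: eq_integral => y _; rewrite !funeposE. by apply: eq_integral => y _; rewrite !funenegE.
 apply: mcompT; first exact: fine_measurable. apply: emeasurable_funB. apply: (@mfubiniF _ _ _ _ _ mu) => //. exact: measurable_funepos. apply: (@mfubiniF _ _ _ _ _ mu) => //. exact: measurable_funeneg.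
have M0 : 0 <= M by exact: le_trans (cM 0).
exists (M * \int[mu]_x `|a x|) => t.
have iac : L1 (fun s => a (t - s) * c s).
 by apply: rconv_L1_pt => //; split => //; exists M.
apply: (le_trans (le_normr_Rintegral measurableT iac)).
rewrite -RintegralZl//; last exact: integrable_norm.
rewrite /Rintegral -(@integral_reflect _ t (fun x => (M * `|a x|)%:E)); last first.
 by apply/mEFinP; apply: mfunM => //; exact: mcompT.
apply: (@le_Rintegral _ _ _ mu setT) => //.
- exact: integrable_norm.
- have := @integrableZl _ _ _ mu _ measurableT M (EFin \o (fun x => `|a (t - x)|)).
 by apply; apply: (@integrable_norm _ _ _ mu); exact: L1_reflect.
- by move=> x _; rewrite normrM mulrC; apply: ler_wpM2r.
Qed.

Lemma rconvA a b c t : L1 a -> L1 b -> bddm c ->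
 rconv a (rconv b c) t = rconv (rconv a b) c t.
Proof.
move=> ia ib bc; have [mc _] := bc.
have ma := L1_mfun ia.
have mb := L1_mfun ib.
have int3 := @integrable_conv3 a b c t ia ib bc.
transitivity (\int[mu]_x \int[mu]_y (a (t - x) * (b (x - y) * c y))).
 apply: eq_Rintegral => x _; rewrite -RintegralZl//. exact: rconv_L1_pt.
rewrite (Rfubini int3)/=.
apply: eq_Rintegral => y _.
transitivity (\int[mu]_x (a (t - x) * b (x - y) * c y)).
 by apply: eq_Rintegral => x _; rewrite mulrA.
rewrite Rintegral_Zr; last first.
 apply: mfunM; first exact: mreflect. by apply: mcompT => //; exact: mfunB.
congr (_ * _); rewrite /rconv /Rintegral.
rewrite -(@integral_translate _ y (fun x => (a (t - y - x) * b x)%:E)).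
 by congr fine; apply: eq_integral => x _; congr (a _ * _)%:E; lra.
apply/mEFinP; apply: mfunM => //; exact: mreflect.
Qed.

End conv.

(** * The fundamental theorem of calculus with a singular left endpoint *)

Section ftc0.
Variable R : realType.
Notation mu := (leb R).

Lemma FTC_cc (F f : R -> R) (a b : R) : 0 < a -> a < b ->
 (forall x : R, 0 < x -> is_derive x (1:R) F (f x)) ->
 (forall x : R, 0 < x -> {for x, continuous f}) ->
 (\int[mu]_(x in `[a, b]) (f x)%:E = (F b - F a)%:E)%E.
Proof.
move=> a0 ab dF cf; have b0 := lt_trans a0 ab.
have cF x : 0 < x -> {for x, continuous F}.
 by move=> x0; apply: differentiable_continuous; apply/derivable1_diffP; have [] := dF x x0.
rewrite EFinB; apply: continuous_FTC2 => //.
- apply: continuous_in_subspaceT => x; rewrite inE/= in_itv/= => /andP[ax _].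
 by apply: cf; exact: lt_le_trans ax.
- split.
 + move=> x; rewrite in_itv/= => /andP[ax _]. by have [] := dF x (lt_trans a0 ax).
 + by apply: cvg_at_right_filter; exact: cF.
 + by apply: cvg_at_left_filter; exact: cF.
- move=> x; rewrite in_itv/= => /andP[ax _].
 by rewrite derive1E; have [_ ->] := dF x (lt_trans a0 ax).
Qed.

(** The derivative may blow up at 0: []0, T]] is exhausted by the intervals [[T / (n + 2), T]],
    where the formula is classical and which [n + 2] keeps nondegenerate. *)
Lemma ge0_FTC_oc (F f : R -> R) (F0 T : R) : 0 < T ->
 (forall x : R, 0 < x -> is_derive x (1:R) F (f x)) ->
 (forall x : R, 0 < x -> {for x, continuous f}) ->
 (forall x : R, 0 < x -> 0 <= f x) ->
 F x @[x --> 0^'+] --> F0 ->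
 (\int[mu]_(x in `]0%R, T]) (f x)%:E = (F T - F0)%:E)%E.
Proof.
move=> T0 dF cf f0 FF0.
pose I n := [set` `[T / n.+2%:R, T]].
have I0 n : 0 < T / n.+2%:R by rewrite divr_gt0.
have IT n : T / n.+2%:R < T.
 by rewrite ltr_pdivrMr// ltr_pMr// ltr1n.
have UI : \bigcup_n I n = `]0, T]%classic.
 apply/seteqP; split => x. by move=> [n _]; rewrite /I/= !in_itv/= => /andP[h ->]; rewrite (lt_le_trans (I0 n)).
 rewrite /= in_itv/= => /andP[x0 xT]. have [n _ hn] := near_infty_natSinv_lt (PosNum (divr_gt0 x0 T0)). exists n => //; rewrite /I/= in_itv/= xT andbT.
 have /= := hn n (leqnn _) => /ltW; rewrite ler_pdivlMr//; apply: le_trans. by rewrite mulrC ler_pM2r// lef_pV2 ?posrE// ler_nat.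
have H : (\int[mu]_(x in I i) (f x)%:E)%E @[i --> \oo] -->
  (\int[mu]_(x in `]0%R, T]) (f x)%:E)%E. rewrite -UI; apply: ge0_nondecreasing_set_cvg_integral => //.
 - move=> n m nm; apply/subsetPset; apply: subset_itvr. by rewrite bnd_simp ler_pM2l// lef_pV2 ?posrE// ler_nat !ltnS.
 - by move=> i; exact: mitv.
 - move=> i; apply/mEFinP; apply: subspace_continuous_measurable_fun; first exact: mitv. apply: continuous_in_subspaceT => x; rewrite inE/I/= in_itv/= => /andP[ax _]. by apply: cf; exact: lt_le_trans ax.
 - move=> i x; rewrite /I/= in_itv/= => /andP[ax _]; rewrite lee_fin. by apply: f0; exact: lt_le_trans ax.
rewrite -(cvg_lim _ H)//; apply/cvg_lim => //.
under eq_fun do rewrite (FTC_cc (I0 _) (IT _) dF cf).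
apply: cvg_EFin; first exact: nearW.
apply: cvgB; first exact: cvg_cst.
apply: (proj1 (cvg_at_rightP F 0 F0) FF0 (fun n => T / n.+2%:R)); split => //.
rewrite -[X in _ --> X](mulr0 T); apply: cvgM; first exact: cvg_cst.
by rewrite (cvg_shiftS (fun n => n.+1%:R^-1 : R)); exact: cvg_harmonic.
Qed.

Lemma FTC_oc (F f : R -> R) (F0 T : R) : 0 < T ->
 (forall x : R, 0 < x -> is_derive x (1:R) F (f x)) ->
 (forall x : R, 0 < x -> {for x, continuous f}) ->
 mu.-integrable `[0, T] (EFin \o f) ->
 F x @[x --> 0^'+] --> F0 ->
 \int[mu]_(x in `[0, T]) f x = F T - F0.
Proof.
move=> T0 dF cf iF FF0.
have h0 := cvg_at_right_filter (parameterized_integral_cvg_left T0 iF).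
(* By the formula on [[x, T]], this function of [x] is constantly the integral over [[0, T]]; its
   limit at [0+] is the right-hand side. *)
have h1 : F T - F x + parameterized_integral mu 0 x f @[x --> 0^'+] --> F T - F0 + 0.
 by apply: cvgD => //; apply: cvgB => //; exact: cvg_cst.
rewrite -[RHS]addr0; apply/esym/(cvg_unique _ h1) => //.
apply: cvg_near_cst; near=> x.
have x0 : 0 < x by near: x; exact: nbhs_right_gt.
have xT : x < T by near: x; exact: nbhs_right_lt.
have h := @Rintegral_itvB _ f (BLeft 0) (BRight T) x iF.
rewrite /parameterized_integral -[LHS]/(_) addrC -[RHS](subrK (\int[mu]_(t in `[0, x]) f t)) h ?bnd_simp ?ltW//.
rewrite addrC; congr (_ + _).
rewrite Rintegral_itv_obnd_cbnd; last first.
 apply: integrableS iF => //. by apply: subset_itvr; rewrite bnd_simp ltW.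
by rewrite /Rintegral (FTC_cc x0 xT dF cf).
Unshelve. all: end_near. Qed.
End ftc0.

(** Up to the factor [1 / Gamma a], the gamma kernel of index [a] extended by 0. One family serves
    for [K], for its square ([pk_sqr]), for [K * K] ([pk_conv]) and its derivative, and for the
    density of the mixture of exponentials. *)
Definition pk (R : realType) (a rho t : R) : R :=
 if 0 < t then expR (- (rho * t)) * t `^ (a - 1) else 0.

(** * Gamma kernels: integrability, scaling, convolution *)

Section pk.
Variable R : realType.
Notation mu := (leb R).
Implicit Types (a b rho t : R).

Lemma pk_ge0 a rho t : 0 <= pk a rho t.
Proof. by rewrite /pk; case: ifP => // _; rewrite mulr_ge0 ?expR_ge0 ?powR_ge0. Qed.

Lemma pk_le0 a rho t : t <= 0 -> pk a rho t = 0.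
Proof. by rewrite /pk ltNge => ->. Qed.

Lemma measurable_pk a rho : mfunT (pk a rho).
Proof.
apply: mfun_ifT => //.
 by apply: measurable_fun_ltr => //.
apply: mfunM.
 by apply: mcompT => //; apply: mcompT => //; apply: mfunM.
exact: measurable_powR.
Qed.

Lemma is_derive_powR a t : 0 < t -> is_derive t (1:R) (fun x => x `^ a) (a * t `^ (a - 1)).
Proof.
move=> t0; apply: DeriveDef.
 by apply: derivable_powR; rewrite in_itv/= t0.
by rewrite -derive1E powR_derive1// in_itv/= t0.
Qed.

Lemma continuous_powRl a t : 0 < t -> {for t, continuous (fun x => x `^ a)}.
Proof.
move=> t0; apply: differentiable_continuous; apply/derivable1_diffP.
by have [] := is_derive_powR a t0.
Qed.

Lemma is_derive_pk_raw a rho t : 0 < t ->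
 is_derive t (1:R) (fun x => expR (- (rho * x)) * x `^ (a - 1))
  ((a - 1) * (expR (- (rho * t)) * t `^ (a - 1 - 1)) - rho * (expR (- (rho * t)) * t `^ (a - 1))).
Proof.
move=> t0; have h := is_derive_powR (a - 1) t0.
have h2 : is_derive t (1:R) (fun x => expR (- (rho * x))) (- rho * expR (- (rho * t))).
 have h3 : is_derive t (1:R) (fun x : R => - (rho * x)) (- rho). by apply: is_derive_eq; rewrite /GRing.scale/= mulr1.
 have h4 := @is_derive1_comp R expR (fun x => - (rho * x)) t _ _ (is_derive_expR _) h3. apply: is_derive_eq h4 _; rewrite /GRing.scale/=; ring.
apply: is_derive_eq.
rewrite /GRing.scale/=; ring.
Qed.

Lemma continuous_expk rho t : {for t, continuous (fun x => expR (- (rho * x)))}.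
Proof.
apply: continuous_comp; last exact: continuous_expR.
by apply: continuousN; apply: continuousM; [exact: cst_continuous|].
Qed.

Lemma integrable_expN c : 0 < c ->
 mu.-integrable `[0, +oo[ (fun t => (expR (- (c * t)))%:E).
Proof.
move=> c0.
have dF (x : R) : is_derive x (1:R) (fun x => - (c^-1 * expR (- (c * x)))) (expR (- (c * x))).
 have h3 : is_derive x (1:R) (fun x : R => - (c * x)) (- c). by apply: is_derive_eq; rewrite /GRing.scale/= mulr1. have h4 := @is_derive1_comp R expR (fun x => - (c * x)) x _ _ (is_derive_expR _) h3.
 apply: is_derive_eq; rewrite /GRing.scale/=; field; exact: lt0r_neq0.
apply/integrableP; split.
 apply/mEFinP; apply: mfunTS. by apply: mcompT => //; apply: mcompT => //; apply: mfunM.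
under eq_integral do rewrite gee0_abs ?lee_fin ?expR_ge0//.
rewrite (@ge0_continuous_FTC2y R _ (fun x => - (c^-1 * expR (- (c * x)))) 0 0).
- by rewrite -EFinB ltry.
- by move=> x _; exact: expR_ge0.
- by apply: continuous_subspaceT => x; exact: continuous_expk.
- rewrite -oppr0; apply: cvgN; rewrite -(mulr0 c^-1); apply: cvgM; first exact: cvg_cst.
 have : (expR \o -%R) x @[x --> +oo] --> (0:R) by exact: cvgr_expR. move=> h; apply: (cvg_comp (fun x => c * x) (expR \o -%R) _ h). by apply: gt0_cvgMry => //; exact: cvg_id.
- by move=> x _; have [] := dF x.
- apply: cvg_at_right_filter; apply: cvgN; apply: cvgM; first exact: cvg_cst.
 exact: continuous_expk.
- by move=> x _; rewrite derive1E; have [_ ->] := dF x.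
Qed.

Lemma integrable_powR01 a : 0 < a ->
 mu.-integrable `]0, 1] (fun t => (t `^ (a - 1))%:E).
Proof.
move=> a0; apply/integrableP; split.
 by apply/mEFinP; apply: mfunTS; exact: measurable_powR.
under eq_integral do rewrite gee0_abs ?lee_fin ?powR_ge0//.
have dF (x : R) : 0 < x -> is_derive x (1:R) (fun x => a^-1 * x `^ a) (x `^ (a - 1)).
 move=> x0; have h := is_derive_powR a x0. apply: is_derive_eq; rewrite /GRing.scale/=; field; exact: lt0r_neq0.
rewrite (ge0_FTC_oc (F0 := 0) ltr01 dF).
- by rewrite ltry.
- by move=> x x0; exact: continuous_powRl.
- by move=> x _; exact: powR_ge0.
- rewrite -[X in _ --> X](mulr0 a^-1); apply: cvgM; first exact: cvg_cst.
 exact: powR_cvg0.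
Qed.

Lemma pk_L1 a rho : 0 < a <= 2 -> 0 < rho -> L1 (pk a rho).
Proof.
move=> /andP[a0 a2] r0.
have r20 : 0 < rho / 2 by rewrite divr_gt0.
have i1 := integrable_powR01 a0.
have i2 := integrable_expN r20.
have /integrable_mkcond {}i1 := i1; have {}i1 := i1 (mitv _).
have /integrable_mkcond {}i2 := i2; have {}i2 := i2 (mitv _).
have {i2}i2 := @integrableZl _ _ _ mu _ measurableT (2 / rho) _ i2.
have := integrableD measurableT i1 i2; apply: le_integrable => //.
 by apply/mEFinP; exact: measurable_pk.
move=> x _; rewrite /= ger0_norm ?pk_ge0// /pk.
have p1 : (0 <= ((fun t : R => (t `^ (a - 1))%:E) \_ `]0%R, 1%R]) x)%E.
 by apply: erestrict_ge0 => y _; rewrite lee_fin powR_ge0.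
have p2 : (0 <= (2 / rho)%:E * ((fun t : R => (expR (- (rho / 2 * t)))%:E) \_ `[0%R, +oo[) x)%E.
 apply: mule_ge0; first by rewrite lee_fin divr_ge0 ?ltW. by apply: erestrict_ge0 => y _; rewrite lee_fin expR_ge0.
rewrite gee0_abs ?adde_ge0//.
case: ifPn => x0; last by rewrite adde_ge0.
have [x1|x1] := leP x 1.
 apply: le_trans (leeDl _ p2). rewrite patchE mem_set/= ?in_itv/= ?x0// lee_fin ler_piMl ?powR_ge0//. by rewrite -expR0 ler_expR oppr_le0 mulr_ge0 ?ltW.
apply: le_trans (leeDr _ p1).
rewrite patchE mem_set; last by rewrite /= in_itv/= andbT ltW.
rewrite -EFinM lee_fin.
(* For [x > 1], [x ^ (a - 1) <= x] because [a <= 2], and half of the exponential decay absorbs the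
   factor [x]. *)
have xx : x `^ (a - 1) <= 2 / rho * expR (rho / 2 * x).
 apply: (@le_trans _ _ x). have {2}-> : x = x `^ 1 by rewrite powRr1// ltW. by apply: ler_powR; [exact: ltW|lra].
 rewrite -ler_pdivrMl ?divr_gt0//. have := @expR_ge1Dx R (rho / 2 * x); apply: le_trans. rewrite invf_div; lra.
apply: (le_trans (ler_wpM2l (expR_ge0 _) xx)).
rewrite mulrCA ler_pM2l ?divr_gt0// -expRD ler_expR; lra.
Qed.

Lemma pk_scale a rho t s : 0 < t ->
 pk a rho (t * s) = t `^ (a - 1) * pk a (rho * t) s.
Proof.
move=> t0; rewrite /pk pmulr_rgt0//; case: ifPn => s0; last by rewrite mulr0.
by rewrite powRM ?ltW// (mulrA rho); ring.
Qed.

Lemma pk_expE a rho t : pk a rho t = expR (- (rho * t)) * pk a 0 t.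
Proof.
by rewrite /pk; case: ifPn; rewrite ?mulr0// mul0r oppr0 expR0 mul1r.
Qed.

(** Euler's Beta integral [B (a, b)], left unevaluated: the convolution of two kernels is wanted up
    to a constant. *)
Definition pkB a b := \int[mu]_s (pk a 0 (1 - s) * pk b 0 s).

Lemma pk_conv_pt a b rho t s : 0 < t ->
 pk a rho (t - s) * pk b rho s =
 expR (- (rho * t)) * t `^ (a + b - 2) * (pk a 0 (1 - t^-1 * s) * pk b 0 (t^-1 * s)).
Proof.
move=> t0; rewrite pk_expE (pk_expE b).
have tn0 := lt0r_neq0 t0.
have -> : pk a 0 (t - s) = t `^ (a - 1) * pk a 0 (1 - t^-1 * s).
 by rewrite -[0 in RHS](mul0r t) -pk_scale//; congr pk; field.
have -> : pk b 0 s = t `^ (b - 1) * pk b 0 (t^-1 * s).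
 by rewrite -[0 in RHS](mul0r t) -pk_scale//; congr pk; field.
have -> : a + b - 2 = (a - 1) + (b - 1) by lra.
rewrite (@powRD _ t (a - 1) (b - 1)) ?tn0 ?implybT//.
have -> : - (rho * t) = - (rho * (t - s)) + - (rho * s) by ring.
by rewrite expRD; ring.
Qed.

Lemma pk_conv0 a b rho t s : t <= 0 -> pk a rho (t - s) * pk b rho s = 0.
Proof.
move=> t0; have [s0|s0] := ltP 0 s; last by rewrite (pk_le0 b)// mulr0.
by rewrite pk_le0 ?mul0r//; lra.
Qed.

Lemma measurable_pkB a b : measurable_fun [set: R] (fun s : R => pk a 0 (1 - s) * pk b 0 s).
Proof.
apply: mfunM; last exact: measurable_pk.
by apply: mreflect; exact: measurable_pk.
Qed.

Lemma ge0_integral_scale t (f : R -> \bar R) : 0 < t ->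
 mfunT f -> (forall x, (0 <= f x)%E) ->
 (\int[mu]_s f (t^-1 * s)%R = t%:E * \int[mu]_s f s)%E.
Proof.
move=> t0 mf f0; rewrite -(@ge0_integral_affine _ t^-1 0 f)//; last first.
 by rewrite invr_neq0// gt_eqF.
rewrite muleA -EFinM gtr0_norm ?invr_gt0// divff ?gt_eqF// mul1e.
by apply: eq_integral => s _; rewrite addr0.
Qed.

Lemma integral_pk_conv a b rho t : 0 < t ->
 (\int[mu]_s (pk a rho (t - s) * pk b rho s)%:E =
 (expR (- (rho * t)) * t `^ (a + b - 1))%:E * \int[mu]_s (pk a 0 (1 - s) * pk b 0 s)%:E)%E.
Proof.
move=> t0.
under eq_integral do rewrite pk_conv_pt//.
have key (c : R) (h : R -> R) : 0 <= c -> mfunT h -> (forall s, 0 <= h s) ->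
  (\int[mu]_s (c * h (t^-1 * s))%:E = (c * t)%:E * \int[mu]_s (h s)%:E)%E. move=> c0 mh h0. under eq_integral do rewrite EFinM. rewrite ge0_integralZl; first last.
 - by rewrite lee_fin.
 - by move=> s _; rewrite lee_fin.
 - apply/mEFinP; apply: (mcompT mh). exact: mfunM.
 - exact: measurableT. rewrite (ge0_integral_scale t0 (f := fun s => (h s)%:E)); last 2 first.
 - exact/mEFinP.
 - by move=> s; rewrite lee_fin. by rewrite muleA -EFinM.
rewrite (key _ (fun s => pk a 0 (1 - s) * pk b 0 s)); first last.
- by move=> s; rewrite mulr_ge0 ?pk_ge0.
- exact: measurable_pkB.
- by rewrite mulr_ge0 ?expR_ge0 ?powR_ge0.
congr (_%:E * _)%E.
rewrite -mulrA; congr (_ * _).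
have -> : a + b - 1 = (a + b - 2) + 1 by lra.
by rewrite (@powRD _ _ _ 1) ?(gt_eqF t0) ?implybT// powRr1 ?ltW.
Qed.

Lemma pk_conv a b rho t :
 rconv (pk a rho) (pk b rho) t = pkB a b * pk (a + b) rho t.
Proof.
rewrite /rconv /Rintegral; have [t0|t0] := ltP 0 t; last first.
 rewrite (pk_le0 (a + b))// mulr0 integral0_eq// => s _. by rewrite pk_conv0.
rewrite integral_pk_conv// /pk t0.
have := integral_ge0; set I := (\int[mu]_s _)%E => _.
rewrite /pkB /Rintegral -/I.
case: I => [r| |]/=.
- by rewrite mulrC.
(* A divergent Beta integral gives the default value 0 on both sides. *)
- rewrite gt0_muley ?lte_fin ?mulr_gt0 ?expR_gt0 ?powR_gt0//= mul0r//.
- by rewrite gt0_muleNy ?lte_fin ?mulr_gt0 ?expR_gt0 ?powR_gt0//= mul0r//.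
Qed.

Lemma ae_exists_itv (P : R -> Prop) (u v : R) : u < v ->
 {ae mu, forall x, P x} -> exists x, u < x < v /\ P x.
Proof.
move=> uv [N [mN N0 hN]]; apply/not_existsP => h.
have : (mu `]u, v[ <= mu N)%E.
 apply: le_measure; rewrite ?inE//=. by move=> x; rewrite /= in_itv/= => xuv; apply: hN => /= Px; apply: (h x).
by rewrite N0 lebesgue_measure_itv/= lte_fin uv leNgt lte_fin subr_gt0 uv.
Qed.

(** Fubini gives finiteness at almost every time, in particular at one time of []0, 1[]; by the
    scaling of [integral_pk_conv] the integral at any other positive time is also finite. *)
Lemma pk_conv_L1 a b rho t : 0 < a <= 2 -> 0 < b <= 2 -> 0 < rho ->
 L1 (fun s => pk a rho (t - s) * pk b rho s).
Proof.
move=> a02 b02 r0.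
have mab (x : R) : measurable_fun [set: R] (fun s => (pk a rho (x - s) * pk b rho s)%:E).
 apply/mEFinP; apply: mfunM; last exact: measurable_pk. by apply: mreflect; exact: measurable_pk.
have H (x : R) : (\int[mu]_s `|(pk a rho (x - s) * pk b rho s)%:E| =
  \int[mu]_s (pk a rho (x - s) * pk b rho s)%:E)%E. by apply: eq_integral => s _; rewrite gee0_abs// lee_fin mulr_ge0 ?pk_ge0.
have := ae_integrable1 (integrable_conv2 (pk_L1 a02 r0) (pk_L1 b02 r0)).
move=> /(ae_exists_itv ltr01)[x [/andP[x0 _] /integrableP[_ ix]]].
move: ix; rewrite H (integral_pk_conv _ _ _ x0) => ix.
apply/integrableP; split; first exact: mab.
rewrite -[X in (X < _)%E]/(\int[mu]_s `|(pk a rho (t - s) * pk b rho s)%:E|)%E H.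
have [t0|t0] := ltP 0 t; last by rewrite integral0_eq// => s _; rewrite pk_conv0.
rewrite integral_pk_conv// lte_mul_pinfty ?lee_fin ?mulr_ge0 ?expR_ge0 ?powR_ge0//.
move: ix; set I := (\int[mu]_s _)%E.
have : (0 <= I)%E by apply: integral_ge0 => s _; rewrite lee_fin mulr_ge0 ?pk_ge0.
case: I => [r _ _| |]//; first exact: ltry.
by rewrite gt0_muley// lte_fin mulr_gt0 ?expR_gt0 ?powR_gt0.
Qed.

(** The integral of [x ^ (- a) exp (- t x)] is [Gamma (1 - a) t ^ (a - 1)], by scaling from [t = 1].
    This is the source of the mixture of exponentials. *)
Lemma integral_pk_dual a t : 0 < t ->
 (\int[mu]_x (pk (1 - a) t x)%:E =
  (t `^ (a - 1))%:E * \int[mu]_x (pk (1 - a) 1 x)%:E)%E.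
Proof.
move=> t0.
rewrite -[in RHS](@ge0_integral_affine _ t 0)//; last 3 first.
 by rewrite gt_eqF. by apply/mEFinP; exact: measurable_pk. by move=> x; rewrite lee_fin pk_ge0.
rewrite muleA -EFinM gtr0_norm//.
under [in RHS]eq_integral do rewrite addr0 pk_scale// mul1r EFinM.
rewrite ge0_integralZl//; last 3 first.
 by apply/mEFinP; exact: measurable_pk. by move=> x _; rewrite lee_fin pk_ge0. by rewrite lee_fin powR_ge0.
rewrite muleA -EFinM [X in (X%:E * _)%E](_ : _ = 1) ?mul1e//.
rewrite -[X in _ * X * _]powRr1 ?ltW// -!powRD ?(gt_eqF t0) ?implybT//.
by rewrite (_ : _ + _ = 0) ?powRr0//; lra.
Qed.

End pk.

Definition ppart (R : realType) (g : R -> R) (t : R) : R := if 0 < t then g t else 0.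

(** * Functions on the half-line and causal convolutions *)

Section halfline_cont.
Variable R : realType.
Notation mu := (leb R).

(** Freezing the argument at 0 extends a function continuous on the half-line to one continuous on
    the line, to which measurability and the extreme value theorem apply directly. *)
Lemma max0_continuous (g : R -> R) :
 {within `[0, +oo[, continuous g} -> continuous (fun t : R => g (Num.max 0 t)).
Proof.
move=> /subspace_continuousP cg t.
have m0 : `[0, +oo[%classic (Num.max 0 t) by rewrite /= in_itv/= andbT le_max lexx.
have := cg _ m0; apply: cvg_comp => U.
rewrite /within/= => hU.
have cmax : {for t, continuous (fun y : R => Num.max 0 y)}.
 by apply: continuous_max; [exact: cst_continuous|exact: cvg_id].
have h2 : \forall y \near t, `[0, +oo[%classic (Num.max 0 y) -> U (Num.max 0 y) := cmax _ hU.
by apply: filterS h2 => y h2; apply: h2; rewrite /= in_itv/= andbT le_max lexx.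
Qed.

Lemma mppart (g : R -> R) :
 {within `[0, +oo[, continuous g} -> mfunT (ppart g).
Proof.
move=> cg.
rewrite (_ : ppart g = fun t => if 0 < t then g (Num.max 0 t) else 0).
 apply: mfun_ifT => //; first exact: measurable_fun_ltr. exact: (cmfun (max0_continuous cg)).
apply/funext => t; rewrite /ppart; case: ifPn => // t0.
by rewrite max_r// ltW.
Qed.

Lemma volterra_rconv (g h : R -> R) (t : R) : 0 <= t ->
 mfunT (ppart g) -> mfunT (ppart h) ->
 volterra_conv g h t = rconv (ppart g) (ppart h) t.
Proof.
move=> t0 mg mh.
have E : rconv (ppart g) (ppart h) t = \int[mu]_(s in `]0, t[) (ppart g (t - s) * ppart h s).
 rewrite [RHS]Rintegral_mkcond; apply: eq_Rintegral => s _; rewrite patchE. case: ifPn => //; rewrite notin_setE/= in_itv/= => /negP; rewrite negb_and -!leNgt.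
 by rewrite /ppart subr_gt0 => /orP[h1|h1]; rewrite ?(ltNge 0 s) ?(ltNge s t) h1 ?mulr0 ?mul0r.
rewrite E /volterra_conv /Rintegral; congr fine.
have E2 : {in `]0%R, t[%classic : set R, (fun s => (ppart g (t - s) * ppart h s)%:E) =1 (fun s => (g (t - s) * h s)%:E)}.
 by move=> s; rewrite inE/= in_itv/= => /andP[s0 st]; rewrite /ppart subr_gt0 s0 st.
transitivity (\int[mu]_(s in `]0%R, t[) (g (t - s) * h s)%:E)%E; last first.
 by apply: eq_integral => s sI; rewrite -E2.
have mgh : measurable_fun `]0, t[ (fun s : R => (g (t - s) * h s)%:E).
 apply: (eq_measurable_fun _ E2); apply/mEFinP; apply: mfunTS. by apply: mfunM => //; exact: mreflect.
rewrite [RHS]integral_itv_bndo_bndc//.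
rewrite [RHS]integral_itv_obnd_cbnd//.
exact/emeasurable_fun_itv_bndo_bndcP.
Qed.

Definition suppos (a : R -> R) := forall s, s <= 0 -> a s = 0.

Lemma ppart_supp (g : R -> R) : suppos (ppart g).
Proof. by move=> s; rewrite /ppart ltNge => ->. Qed.

(** Causality: against a kernel carried by the positive half-line only the past of [t] matters.
    Equations known up to a horizon [T] can thus be substituted inside convolutions. *)
Lemma rconv_local (a b b' : R -> R) t : suppos a ->
 (forall s, s < t -> b s = b' s) -> rconv a b t = rconv a b' t.
Proof.
move=> a0 bb'; apply: eq_Rintegral => s _.
have [st|st] := ltP s t; first by rewrite bb'.
by rewrite a0 ?mul0r// subr_le0.
Qed.

Lemma rconv_supp (a b : R -> R) : suppos a -> suppos b -> suppos (rconv a b).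
Proof.
move=> a0 b0 t t0.
rewrite (@rconv_local _ _ (fun=> 0))//.
 by rewrite /rconv; under eq_Rintegral do rewrite mulr0; rewrite Rintegral_cst// mul0r.
by move=> s st; rewrite b0//; lra.
Qed.

Lemma L1D (a b : R -> R) : L1 a -> L1 b -> L1 (fun s => a s + b s).
Proof. by move=> ia ib; exact: (integrableD measurableT ia ib). Qed.

Lemma L1Z (x : R) (a : R -> R) : L1 a -> L1 (fun s => x * a s).
Proof. by move=> ia; exact: (@integrableZl _ _ _ mu _ measurableT x (EFin \o a) ia). Qed.

Lemma L1B (a b : R -> R) : L1 a -> L1 b -> L1 (fun s => a s - b s).
Proof. by move=> ia ib; exact: (integrableB measurableT ia ib). Qed.

Lemma rconvB_pt (a b b' : R -> R) t (x y : R) :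
 L1 (fun s => a (t - s) * b s) -> L1 (fun s => a (t - s) * b' s) ->
 rconv a (fun s => x * b s - y * b' s) t = x * rconv a b t - y * rconv a b' t.
Proof.
move=> ib ib'; rewrite /rconv -!RintegralZl// -RintegralB//; last 2 first.
 exact: (L1Z x ib). exact: (L1Z y ib').
by apply: eq_Rintegral => s _; ring.
Qed.

Lemma bddmB (b b' : R -> R) (x y : R) : bddm b -> bddm b' -> bddm (fun s => x * b s - y * b' s).
Proof.
move=> [mb [M hM]] [mb' [M' hM']]; split.
 by apply: mfunB; exact: mfunM.
exists (`|x| * M + `|y| * M') => s; rewrite (le_trans (ler_normB _ _))// !normrM.
by rewrite lerD// ler_wpM2l.
Qed.

(** The right-hand side 1 of the resolvent equation, cut at [T] so as to be integrable. Up to time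
    [T], convolution by it is integration from 0, see [rconv_uT]. *)
Definition uT (T t : R) : R := if (0 < t) && (t <= T) then 1 else 0.

Lemma measurable_cutoff (T : R) (g : R -> R) : mfunT g ->
 measurable_fun [set: R] (fun t : R => if (0 < t) && (t <= T) then g t else 0).
Proof.
move=> mg; apply: mfun_ifT => //.
by apply: measurable_and; [exact: measurable_fun_ltr|exact: measurable_fun_ler].
Qed.

Lemma bddm_uT T : bddm (uT T).
Proof.
split; first exact: (@measurable_cutoff T (fun=> 1)).
by exists 1 => x; rewrite /uT; case: ifP; rewrite ?normr1 ?normr0.
Qed.

Lemma bddm_L1 (T : R) (g : R -> R) : bddm g ->
 (forall t, ~~ ((0 < t) && (t <= T)) -> g t = 0) -> L1 g.
Proof.
move=> [mg [M gM]] g0.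
have M0 : 0 <= M by exact: le_trans (gM 0).
have := integrable_indic_itv 0 T false false.
move=> /(@integrableZl _ _ _ mu _ measurableT M); apply: le_integrable => //.
 exact/mEFinP.
move=> x _ /=; rewrite indicE lee_fin.
have [h|h] := boolP ((0 < x) && (x <= T)); last by rewrite g0// normr0.
by rewrite mem_set/= ?in_itv// mulr1 (le_trans (gM x))// ler_norm.
Qed.

Lemma uT_supp T : suppos (uT T).
Proof. by move=> s s0; rewrite /uT ltNge s0. Qed.

Lemma uT_L1 T : L1 (uT T).
Proof. by apply: (@bddm_L1 T _ (bddm_uT T)) => t /negbTE h; rewrite /uT h. Qed.

Lemma rconv_uT T (g : R -> R) t : t <= T -> suppos g -> mfunT g ->
 rconv (uT T) g t = \int[mu]_(s in `[0, t]) g s.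
Proof.
move=> tT g0 mg; rewrite [RHS](_ : _ = \int[mu]_(s in `]0, t[) g s); last first.
 have [t0|t0] := ltP t 0. rewrite set_itv_ge ?bnd_simp -?ltNge// set_itv_ge//. by rewrite bnd_simp -leNgt ltW. rewrite /Rintegral; congr fine. have mgI (I : set R) : measurable_fun I (EFin \o g).
  by apply/mEFinP; exact: mfunTS. rewrite [RHS]integral_itv_bndo_bndc; last exact: mgI. by rewrite [RHS]integral_itv_obnd_cbnd//; exact: mgI.
rewrite [RHS]Rintegral_mkcond; apply: eq_Rintegral => s _; rewrite patchE /uT subr_gt0.
have [s0|s0] := leP s 0.
 by rewrite g0// mulr0; case: ifP.
have -> /= : t - s <= T by lra.
have [st|st] := ltP s t.
 by rewrite mem_set/= ?mul1r// in_itv/= s0.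
rewrite memNset ?mul0r//= in_itv/= => /andP[_]; lra.
Qed.

End halfline_cont.

(** * Algebra of the resolvent equation *)

Section resolvent_alg.
Variables (R : realType) (k dk c u : R -> R) (lambda T : R).
Hypotheses (ik : L1 k) (idk : L1 dk) (ic : L1 c) (bc : bddm c) (iu : L1 u) (bu : bddm u).
Hypotheses (sk : suppos k) (sdk : suppos dk) (sc : suppos c) (su : suppos u) (kk : forall t, L1 (fun s => k (t - s) * k s)) (E1 : forall t, t <= T -> c t + lambda * rconv k c t = u t).
Hypothesis Ek : forall t, t <= T -> rconv k k t = rconv u dk t.

Let mk := L1_mfun ik.
Let mdk := L1_mfun idk.
Let mc := L1_mfun ic.
Let mu_ := L1_mfun iu.

(** The equation [c = u - lambda k * c] used twice gives [c = u - lambda u * k + lambda ^ 2 (k * k)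
    * c], and [k * k = u * dk]. Factoring [u] out, [c = u - u * resdens], so that [resdens] is a
    density of [- c]. For the gamma kernel [k] has no integrable derivative, whereas [k * k] has
    one. *)
Definition resdens (t : R) := lambda * k t - lambda ^+ 2 * rconv dk c t.

Lemma resdens_L1 : L1 resdens.
Proof. by apply: L1B; apply: L1Z => //; exact: L1_conv. Qed.

Lemma resdens_supp : suppos resdens.
Proof. by move=> s s0; rewrite /resdens sk// rconv_supp// !mulr0 subr0. Qed.

Let mkk := L1_mfun (L1_conv ik ik).
Let mkdk := L1_mfun (L1_conv ik idk).
Let mdkk := L1_mfun (L1_conv idk ik).
Let mcdk := L1_mfun (L1_conv ic idk).
Let bkc := rconv_bddm ik bc.
Let bdkc := rconv_bddm idk bc.

Let rL1 (a b : R -> R) t (ia : L1 a) (bb : bddm b) : L1 (fun s => a (t - s) * b s) :=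
 rconv_L1_pt t ia bb.

Lemma rconv_kkc t : t <= T -> rconv k (rconv k c) t = rconv u (rconv dk c) t.
Proof.
move=> tT; rewrite (rconvA t ik ik bc) (rconvC t mkk mc).
rewrite (@rconv_local _ _ _ (rconv u dk) t sc); last first.
 by move=> s st; apply: Ek; rewrite (le_trans (ltW st)).
rewrite (@rconv_local _ _ _ (rconv dk u) t sc); last by move=> s _; rewrite (rconvC s mu_ mdk).
rewrite (rconvA t ic idk bu) (rconvC t mcdk mu_).
by apply: rconv_local => // s _; rewrite (rconvC s mc mdk).
Qed.

Lemma rconv_u_resdens t : t <= T -> c t = u t - rconv u resdens t.
Proof.
move=> tT.
have h1 : rconv u resdens t = lambda * rconv u k t - lambda ^+ 2 * rconv u (rconv dk c) t.
 rewrite /resdens rconvB_pt.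
 - by [].
 - rewrite (_ : (fun s => _) = fun s => k s * u (t - s)); last by apply/funext => s; rewrite mulrC. apply: (L1_bddM ik); have [_ [M hM]] := bu.
  by split; [exact: (mreflect t mu_)|exists M => x; exact: hM].
 - exact: (rL1 t iu bdkc).
have h2 : rconv u k t = rconv k c t + lambda * rconv k (rconv k c) t.
 rewrite (rconvC t mu_ mk) (@rconv_local _ k u (fun s => 1 * c s - (- lambda) * rconv k c s) t sk). rewrite (rconvB_pt _ _ (rL1 t ik bc) (rL1 t ik bkc)); ring.
 by move=> s st; rewrite -E1 ?(le_trans (ltW st) tT) //; ring.
by rewrite h1 h2 -(rconv_kkc tT) -(E1 tT); ring.
Qed.

(** Since [k * k = dk * u], the equation [u = c + lambda k * c] convolved with [dk] produces exactly
    the terms in [dk * c] and [dk * k * c] that have to cancel. *)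
Lemma resdens_eq t : t <= T -> resdens t + lambda * rconv k resdens t = lambda * k t.
Proof.
move=> tT.
have h1 : rconv k resdens t = lambda * rconv k k t - lambda ^+ 2 * rconv k (rconv dk c) t.
 by rewrite /resdens (rconvB_pt _ _ (kk t) (rL1 t ik bdkc)).
have h2 : rconv k (rconv dk c) t = rconv dk (rconv k c) t.
 rewrite (rconvA t ik idk bc) (rconvA t idk ik bc) (rconvC t mkdk mc). rewrite (@rconv_local _ _ _ (rconv dk k) t sc). by rewrite (rconvC t mc mdkk). by move=> s _; rewrite (rconvC s mk mdk).
have h3 : rconv dk u t = rconv dk c t + lambda * rconv dk (rconv k c) t.
 rewrite (@rconv_local _ dk u (fun s => 1 * c s - (- lambda) * rconv k c s) t sdk). rewrite (rconvB_pt _ _ (rL1 t idk bc) (rL1 t idk bkc)); ring.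
 by move=> s st; rewrite -E1 ?(le_trans (ltW st) tT) //; ring.
rewrite h1 h2 (Ek tT) (rconvC t mu_ mdk) h3 /resdens; ring.
Qed.

(* With [g s = f (t + s)], the resolvent equation at [t + s] reads
  [g + lambda k * g = lambda B]; convolving with [f] gives [g = lambda (B - f * B)]. *)
Lemma resdens_shift (t s : R) (M : R) : lambda != 0 -> 0 < t -> 0 < s -> t + s <= T ->
 (forall v, t <= v -> `|resdens v| <= M) ->
 let B v := k (t + v) - \int[lebesgue_measure]_(x in `]0, t]) (k (t + v - x) * resdens x) in
 resdens (t + s) = lambda * B s - \int[lebesgue_measure]_(x in `]0, s[) (lambda * B (s - x) * resdens x).
Proof.
move=> lambda0 t0 s0 tsT hM B.
have ir := resdens_L1.
have mr := L1_mfun ir.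
pose g (v : R) := if 0 < v then resdens (t + v) else 0.
have sg : suppos g by move=> v v0; rewrite /g ltNge v0.
have mg : mfunT g.
 apply: mfun_ifT; [exact: measurable_fun_ltr| |exact: mcst]. by apply: (mcompT mr); exact: mfunD.
have bg : bddm g.
 split; first exact: mg. exists M => x; rewrite /g; case: ifPn => x0; first by apply: hM; lra. by rewrite normr0; apply: le_trans (hM t (lexx _)).
have bkg := rconv_bddm ik bg.
have HB v : 0 < v -> t + v <= T -> lambda * B v = g v + lambda * rconv k g v.
 move=> v0 tvT. have i1 : L1 (fun x => k (t + v - x) * resdens x). rewrite (_ : (fun _ => _) = fun x => lambda * (k (t + v - x) * k x) -
    lambda ^+ 2 * (k (t + v - x) * rconv dk c x)); last first. by apply/funext => x; rewrite /resdens; ring. by apply: L1B; apply: L1Z; [exact: kk|exact: rL1]. have h : rconv k resdens (t + v) =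
   \int[lebesgue_measure]_(x in `]0, t]) (k (t + v - x) * resdens x) + rconv k g v. have mA : measurable [set x : R | x <= t] by rewrite -set_itvNyc; exact: mitv.
  have mAc : measurable [set x : R | t < x] by rewrite -set_itvoy; exact: mitv. have UE : [set: R] = [set x : R | x <= t] `|` [set x : R | t < x].
   by apply/seteqP; split => x // _; have [?|?] := leP x t; [left|right]. rewrite {1}/rconv {1}UE Rintegral_setU; first last.
  - apply/disj_setPLR => x /= xt; apply/negP; rewrite -leNgt; exact: xt.
  - by rewrite -UE; exact: i1.
  - exact: mAc.
  - exact: mA. congr (_ + _). rewrite Rintegral_mkcond [RHS]Rintegral_mkcond; apply: eq_Rintegral => x _. rewrite !patchE; have [x0|x0] := ltP 0 x.
    by congr (if _ then _ else _); apply/idP/idP; rewrite !inE/= in_itv/= x0. by rewrite (resdens_supp x0) mulr0; do 2 case: ifP. rewrite -set_itvoy Rintegral_mkcond.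
  rewrite /rconv /Rintegral; congr fine. rewrite -[RHS](@integral_translate _ t (fun x : R => (k (v - x) * g x)%:E)); last first.
   by apply/mEFinP; apply: mfunM; [exact: mreflect|exact: mg]. apply: eq_integral => x _; rewrite patchE.
  rewrite /g subr_gt0; case: ltP => xt. rewrite mem_set/= ?in_itv/= ?xt//; congr (k _ * resdens _)%:E; lra. by rewrite memNset/= ?mulr0// in_itv/= andbT; apply/negP; rewrite -leNgt.
 rewrite mulrBr -(resdens_eq tvT) h /g v0; ring.
pose Bp (v : R) := 1 * g v - (- lambda) * rconv k g v.
have bBp : bddm Bp by exact: bddmB.
have [mBp _] := bBp.
have sBp : suppos Bp.
 by move=> v v0; rewrite /Bp sg// (rconv_supp sk sg)// !mulr0 subr0.
have HBp v : 0 < v -> t + v <= T -> lambda * B v = Bp v.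
 by move=> v0 vT; rewrite HB// /Bp; ring.
have E5 : rconv resdens Bp s = lambda * rconv k g s.
 rewrite /Bp (rconvB_pt _ _ (rL1 s ir bg) (rL1 s ir bkg)). rewrite (rconvA s ir ik bg). have mrk := L1_mfun (L1_conv ir ik). rewrite (rconvC s mrk mg).
 rewrite (@rconv_local _ g _ (fun v => 1 * k v - lambda^-1 * resdens v) s sg); last first. move=> v vs; rewrite (rconvC v mr mk). have vT : v <= T by lra.
  by have := resdens_eq vT => h; apply: (mulfI lambda0); rewrite mulrBr mulVKf//; lra. have L1g (a : R -> R) : L1 a -> L1 (fun x => g (s - x) * a x).
  move=> ia; rewrite (_ : (fun x => _) = fun x => a x * g (s - x)); last by apply/funext => x; rewrite mulrC. apply: (L1_bddM ia); have [_ [M' hM']] := bg.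
  by split; [exact: (mreflect s mg)|exists M' => x; exact: hM']. rewrite (rconvB_pt _ _ (L1g _ ik) (L1g _ ir)) (rconvC s mg mk) (rconvC s mg mr). by field.
have E6 : \int[lebesgue_measure]_(x in `]0, s[) (lambda * B (s - x) * resdens x) = rconv Bp resdens s.
 rewrite Rintegral_mkcond; apply: eq_Rintegral => x _; rewrite patchE. have [xI|] := boolP (x \in _). move: xI; rewrite inE/= in_itv/= => /andP[x0 xs]. by rewrite HBp//; lra.
 rewrite notin_setE/= in_itv/= => /negP; rewrite negb_and -!leNgt => /orP[x0|x0]. by rewrite (resdens_supp x0) mulr0. by rewrite sBp ?mul0r// subr_le0.
rewrite E6 (rconvC s mBp mr) E5 (HB _ s0 tsT) /g s0; ring.
Qed.

End resolvent_alg.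

Lemma integrable_Rfubini2 d1 d2 (T1 : measurableType d1) (T2 : measurableType d2)
  (R : realType) (m1 : {sigma_finite_measure set T1 -> \bar R})
  (m2 : {sigma_finite_measure set T2 -> \bar R}) (f : T1 * T2 -> R) :
 (m1 \x m2)%E.-integrable setT (EFin \o f) ->
 m2.-integrable setT (EFin \o (fun y => \int[m1]_x f (x, y))).
Proof.
move=> imf.
apply/integrableP; split; first exact/mEFinP/(measurable_Rfubini2 imf).
have mf := measurable_int _ imf.
have := (integrable21ltyP m1 m2 mf).1 imf; apply: le_lt_trans.
have fine_le (x : \bar R) : (`|(fine x)%:E| <= `|x|)%E.
 by case: x => [x| |] //=; rewrite normr0 leey.
apply: ge0_le_integral => //.
- by apply: mcompT => //; exact/mEFinP/(measurable_Rfubini2 imf).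
- apply: (@measurable_fun_fubini_tonelli_G _ _ _ _ _ m1 (fun z => `|(EFin \o f) z|)%E) => //.
 exact: mcompT.
- move=> y _; apply: le_trans (fine_le _) _.
 apply: le_abse_integral => //. exact: (mcompT mf).
Qed.

Lemma measurable_Rparam d1 d2 (T1 : measurableType d1) (T2 : measurableType d2)
  (R : realType) (m2 : {sigma_finite_measure set T2 -> \bar R}) (f : T1 * T2 -> R) :
 mfunT f -> mfunT (fun x => \int[m2]_y f (x, y)).
Proof.
move=> mf; have mEf : mfunT (EFin \o f) by exact/mEFinP.
rewrite (_ : (fun x => _) = fun t => fine (
 (\int[m2]_y ((EFin \o f)^\+ (t, y))) - (\int[m2]_y ((EFin \o f)^\- (t, y))))%E); last first. apply/funext => t; rewrite /Rintegral integralE; congr (fine (_ - _)%E).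
  by apply: eq_integral => y _; rewrite !funeposE. by apply: eq_integral => y _; rewrite !funenegE.
apply: mcompT; first exact: fine_measurable.
apply: emeasurable_funB.
 apply: (@mfubiniF _ _ _ _ _ m2) => //. exact: measurable_funepos.
apply: (@mfubiniF _ _ _ _ _ m2) => //.
exact: measurable_funeneg.
Qed.

(** * The gamma kernel as a mixture of exponentials *)

Section mixture.
Variables (R : realType) (a rho : R).
Hypotheses (a0 : 0 < a) (a1 : a < 1) (rho0 : 0 < rho).
Notation mu := (leb R).

(** Weights of the mixture: the integral over [x] of [mixw x * mixe x t] is
    [Gamma (1 - a) * pk a rho t], for [t > 0]. The exponentials have the semigroup property [mixeD],
    which the kernel lacks. *)
Definition mixw (x : R) : R := if 0 < x then x `^ (- a) else 0.
Definition mixe (x t : R) : R := expR (- ((x + rho) * t)).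
Definition mixG : R := \int[mu]_x pk (1 - a) 1 x.

Lemma mixw_ge0 x : 0 <= mixw x.
Proof. by rewrite /mixw; case: ifP => // _; exact: powR_ge0. Qed.

Lemma mixe_ge0 x t : 0 <= mixe x t. Proof. exact: expR_ge0. Qed.

Lemma mixeD x t s : mixe x (t + s) = mixe x t * mixe x s.
Proof. by rewrite /mixe -expRD; congr expR; ring. Qed.

Lemma mmixw : mfunT mixw.
Proof.
by apply: mfun_ifT => //; exact: measurable_fun_ltr.
Qed.

Lemma mmixe t : measurable_fun [set: R] (fun x : R => mixe x t).
Proof.
apply: mcompT => //; apply: mcompT => //.
by apply: mfunM => //; exact: mfunD.
Qed.

Lemma measurable_mixer (x : R) : mfunT (mixe x).
Proof.
by apply: mcompT => //; apply: mcompT => //.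
Qed.

Lemma measurable_mixe2 s : measurable_fun [set: R * R] (fun z : R * R => mixe z.2 (s - z.1)).
Proof.
apply: mcompT => //; apply: mcompT => //.
by apply: mfunM; [exact: mfunD|exact: mfunB].
Qed.

Lemma measurable_mixe1 s : measurable_fun [set: R * R] (fun z : R * R => mixe z.1 (s - z.2)).
Proof.
apply: mcompT => //; apply: mcompT => //.
by apply: mfunM; [exact: mfunD|exact: mfunB].
Qed.

Lemma mixwe x v : mixw x * mixe x v = expR (- (rho * v)) * pk (1 - a) v x.
Proof.
rewrite /mixw /mixe /pk; case: ifPn => x0; last by rewrite mul0r mulr0.
rewrite (_ : 1 - a - 1 = - a); last by ring.
rewrite mulrA -expRD mulrC; congr (expR _ * _); ring.
Qed.

Lemma pk1_lt_pinfty : (\int[mu]_x (pk (1 - a) 1 x)%:E)%E = (mixG)%:E.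
Proof.
rewrite fineK//; apply: integrable_fin_num => //.
by apply: pk_L1; [apply/andP; split; [by rewrite subr_gt0|by move: a0; lra]|exact: ltr01].
Qed.

Lemma mixG_gt0 : 0 < mixG.
Proof.
rewrite -lte_fin -pk1_lt_pinfty.
apply: (@lt_le_trans _ _ (\int[mu]_x (expR (- 2) * 2 `^ (- a) * \1_(`[1, 2]%classic : set R) x)%:E)%E).
 under eq_integral do rewrite EFinM. rewrite ge0_integralZl//; first last.
 - by apply/mEFinP; exact: mindic. rewrite integral_indic; [|exact: measurableT|exact: mitv]. rewrite setIT /= lebesgue_measure_itv/= lte_fin ltr1n.
 by rewrite -EFinB -EFinM lte_fin; apply: mulr_gt0; [rewrite mulr_gt0 ?expR_gt0 ?powR_gt0|lra].
apply: ge0_le_integral => //.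
- by apply/mEFinP; apply: mfunM => //; exact: mindic.
- by apply/mEFinP; exact: measurable_pk.
- move=> x _; rewrite lee_fin indicE.
 have [|] := boolP (x \in _); last by rewrite mulr0 pk_ge0. rewrite inE/= in_itv/= => /andP[x1 x2]; rewrite mulr1 /pk. have x0 : 0 < x by lra.
 rewrite x0; apply: ler_pM; rewrite ?expR_ge0 ?powR_ge0//. by rewrite ler_expR; lra. rewrite (_ : 1 - a - 1 = - a); last by ring. rewrite !powRN lef_pV2 ?posrE ?powR_gt0//.
 by apply: ge0_ler_powR => //; rewrite ?nnegrE ltW.
Qed.

Lemma integral_mixwe v : 0 < v ->
 (\int[mu]_x (mixw x * mixe x v)%:E = (mixG * pk a rho v)%:E)%E.
Proof.
move=> v0; under eq_integral do rewrite mixwe EFinM.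
rewrite ge0_integralZl; first last.
- by rewrite lee_fin expR_ge0.
- by move=> x _; rewrite lee_fin pk_ge0.
- by apply/mEFinP; exact: measurable_pk.
- exact: measurableT.
rewrite integral_pk_dual// pk1_lt_pinfty -!EFinM /pk v0; congr EFin; ring.
Qed.

Lemma mixe_le1 (x v : R) : 0 <= v -> 0 < x -> mixe x v <= 1.
Proof.
by move=> v0 x0; rewrite -expR0 ler_expR oppr_le0 mulr_ge0// addr_ge0 ?ltW.
Qed.

Variable r : R -> R.
Hypotheses (ir : L1 r) (sr : suppos r).
Let mr := L1_mfun ir.

Definition rcut (s z : R) : R := if (0 < z) && (z < s) then r z else 0.

Lemma rcut_L1 s : L1 (rcut s).
Proof.
have mrc : mfunT (rcut s).
 apply: mfun_ifT => //. by apply: measurable_and; exact: measurable_fun_ltr.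
apply: le_integrable ir => //; first exact/mEFinP.
by move=> x _; rewrite /= lee_fin /rcut; case: ifP; rewrite ?normr0.
Qed.

Lemma measurable_rcut s : mfunT (rcut s).
Proof. exact: L1_mfun (rcut_L1 s). Qed.

Lemma Rintegral_rcut s (h : R -> R) :
 \int[mu]_(z in `]0, s[) (h z * r z) = \int[mu]_z (h z * rcut s z).
Proof.
rewrite Rintegral_mkcond; apply: eq_Rintegral => z _; rewrite patchE /rcut.
have [zI|] := boolP (z \in _).
 by move: zI; rewrite inE/= in_itv/= => ->.
by rewrite notin_setE/= in_itv/= => /negP/negbTE->; rewrite mulr0.
Qed.

(** The value at time [s] of [e - e * r] for the exponential [e = mixe x]: when [r] is the resolvent
    density of [k], this is the solution of [y + lambda k * y = e]. *)
Definition mixm (s x : R) : R := mixe x s - \int[mu]_z (mixe x (s - z) * rcut s z).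

Variables (s : R) (y : R -> R) (D : R).
Hypotheses (s0 : 0 < s) (my : mfunT y) (y0 : forall x, x <= 0 -> y x = 0) (yD : forall v, 0 < v -> (\int[mu]_x (`|y x| * mixe x v)%:E <= D%:E)%E).

Let F (z : R * R) := y z.2 * mixe z.2 (s - z.1) * rcut s z.1.

Let mF : mfunT F.
Proof.
apply: mfunM.
 apply: mfunM; last exact: measurable_mixe2. exact: (mcompT my).
exact: (mcompT (measurable_rcut s)).
Qed.

(** The bound [D] on the mixture of absolute values is uniform in the time [v > 0], so it survives
    integration against the integrable [r]. *)
Lemma mix_fubini_integrable : (mu \x mu)%E.-integrable setT (EFin \o F).
Proof.
apply/integrable12ltyP; first exact/mEFinP.
have irc := @integrable_norm _ _ _ mu _ _ (rcut_L1 s).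
have D0 : 0 <= D.
 by rewrite -lee_fin; apply: le_trans (yD ltr01); apply: integral_ge0 => x _; rewrite lee_fin mulr_ge0 ?mixe_ge0.
apply: (@le_lt_trans _ _ (\int[mu]_z `|(D * `|rcut s z|)%:E|)%E); last first.
 by have /integrableP[] := L1Z D irc.
apply: ge0_le_integral => //.
- by move=> z _; exact: integral_ge0.
- apply: (@mfubiniF _ _ _ _ _ mu (fun z => `|(F z)%:E|)%E) => //.
 by apply: mcompT => //; exact/mEFinP.
- apply: mcompT => //; apply/mEFinP; apply: mfunM => //.
 apply: mcompT => //; exact: measurable_rcut.
move=> z _; rewrite gee0_abs ?lee_fin ?mulr_ge0//.
rewrite /F/=; have [h|h] := boolP ((0 < z) && (z < s)); last first.
 rewrite integral0_eq ?lee_fin ?mulr_ge0// => x _. by rewrite /rcut (negbTE h) mulr0 normr0.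
have /andP[z0 zs] := h.
under eq_integral do rewrite normrM EFinM.
rewrite ge0_integralZr//; last first.
 apply/mEFinP; apply: mcompT => //. by apply: mfunM => //; exact: mmixe.
rewrite EFinM; apply: lee_wpmul2r; first by rewrite lee_fin.
under eq_integral do rewrite normrM [X in _ * X]ger0_norm ?mixe_ge0//.
by apply: yD; rewrite subr_gt0.
Qed.

Lemma mix_fubini :
 \int[mu]_(z in `]0, s[) ((\int[mu]_x (y x * mixe x (s - z))) * r z) =
 \int[mu]_x (y x * \int[mu]_z (mixe x (s - z) * rcut s z)).
Proof.
rewrite (Rintegral_rcut s (fun z => \int[mu]_x (y x * mixe x (s - z)))).
have mym z : measurable_fun [set: R] (fun x : R => y x * mixe x (s - z)).
 by apply: mfunM => //; exact: mmixe.
transitivity (\int[mu]_z \int[mu]_x F (z, x)).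
 by apply: eq_Rintegral => z _; rewrite -Rintegral_Zr.
rewrite (Rfubini mix_fubini_integrable); apply: eq_Rintegral => x _.
rewrite /F/= [RHS]mulrC -Rintegral_Zr.
 by apply: eq_Rintegral => z _; ring.
apply: mfunM; last exact: measurable_rcut.
exact: (mreflect s (measurable_mixer x)).
Qed.

Lemma mix_L1 v : 0 < v -> L1 (fun x => y x * mixe x v).
Proof.
move=> v0; apply/integrableP; split.
 by apply/mEFinP; apply: mfunM => //; exact: mmixe.
apply: le_lt_trans (ltry D); apply: le_trans (yD v0).
apply: eq_ler; apply: eq_integral => x _ /=.
by rewrite normrM [X in _ * X]ger0_norm ?mixe_ge0.
Qed.

Lemma mix_L1_m : L1 (fun x => y x * \int[mu]_z (mixe x (s - z) * rcut s z)).
Proof.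
have := integrable_Rfubini2 mix_fubini_integrable.
congr (mu.-integrable _ _); apply/funext => x /=; congr EFin.
rewrite /F/= [RHS]mulrC -Rintegral_Zr.
 by apply: eq_Rintegral => z _; ring.
apply: mfunM; last exact: measurable_rcut.
exact: (mreflect s (measurable_mixer x)).
Qed.

Lemma mix_sub :
 \int[mu]_x (y x * mixe x s) -
 \int[mu]_(z in `]0, s[) ((\int[mu]_x (y x * mixe x (s - z))) * r z) =
 \int[mu]_x (y x * mixm s x).
Proof.
rewrite mix_fubini -RintegralB//; first by apply: eq_Rintegral => x _; rewrite /mixm mulrBr.
 exact: mix_L1.
exact: mix_L1_m.
Qed.

End mixture.

Lemma abse_fine_le (R : realType) (x : \bar R) : (`|(fine x)%:E| <= `|x|)%E.
Proof. by case: x => [x| |] //=; rewrite normr0 leey. Qed.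

Lemma pk_nincr (R : realType) (a rho : R) (x y : R) : a < 1 -> 0 < rho -> 0 < x -> x <= y ->
 pk a rho y <= pk a rho x.
Proof.
move=> a1 rho0 x0 xy; have y0 := lt_le_trans x0 xy.
rewrite /pk x0 y0; apply: ler_pM; rewrite ?expR_ge0 ?powR_ge0//.
 by rewrite ler_expR lerN2 ler_pM2l.
rewrite -(opprB 1) !powRN lef_pV2 ?posrE ?powR_gt0//.
by apply: ge0_ler_powR => //; rewrite ?nnegrE ?subr_ge0 ltW.
Qed.

(** * Positivity and Cauchy-Schwarz inequality for the resolvent density *)

Section resolvent_pos.
Variables (R : realType) (a rho C lambda T : R) (r : R -> R).
Hypotheses (a0 : 0 < a) (a1 : a < 1) (rho0 : 0 < rho).
Notation mu := (leb R).
Hypotheses (ir : L1 r) (sr : suppos r) (ikr : forall t, L1 (fun x => pk a rho (t - x) * r x)).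
Let mr := L1_mfun ir.
Let k t := C * pk a rho t.
Let B t v := k (t + v) - \int[mu]_(x in `]0, t]) (k (t + v - x) * r x).
Hypothesis shift : forall t s, 0 < t -> 0 < s -> t + s <= T ->
 r (t + s) = lambda * B t s - \int[mu]_(x in `]0, s[) (lambda * B t (s - x) * r x).

Let G := mixG a.
Let w := mixw a.
Let e := mixe rho.
Let m := mixm rho r.
Let G0 : 0 < G := mixG_gt0 a0 a1.
Let mw : mfunT w := mmixw a.

Let Rint_we v : 0 < v -> \int[mu]_x (w x * e x v) = G * pk a rho v.
Proof. by move=> v0; rewrite /Rintegral /w /e integral_mixwe. Qed.

Let weD (t v : R) (y : R -> R) : 0 < t -> 0 < v ->
 (\int[mu]_x (`|w x * e x t| * e x v)%:E <= (G * pk a rho t)%:E)%E.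
Proof.
move=> t0 v0; rewrite -integral_mixwe//.
apply: ge0_le_integral => //.
- by move=> x _; rewrite lee_fin mulr_ge0 ?mixe_ge0.
- apply/mEFinP; apply: mfunM; last exact: mmixe.
 apply: mcompT => //; apply: mfunM => //; exact: mmixe.
- apply/mEFinP; apply: mfunM => //; exact: mmixe.
- move=> x _; rewrite lee_fin ger0_norm ?mulr_ge0 ?mixw_ge0 ?mixe_ge0//.
 have [x0|x0] := ltP 0 x. by rewrite ler_piMr ?mulr_ge0 ?mixw_ge0 ?mixe_ge0// mixe_le1// ltW. by rewrite /w /mixw ltNge x0/= !mul0r.
Qed.

(** As [e x (t + v) = e x t * e x v], subtracting the past of the resolvent only changes the weight
    of [e x v] from [w x * e x t] to [w x * m t x]: what remains after time [t] is again a mixture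
    of exponentials. *)
Lemma B_mix t v : 0 < t -> 0 < v ->
 B t v = C / G * \int[mu]_x (w x * e x v * m t x).
Proof.
move=> t0 v0.
have mwe : mfunT (fun x => w x * e x v).
 by apply: mfunM => //; exact: mmixe.
have we0 x : x <= 0 -> w x * e x v = 0.
 by move=> x0; rewrite /w /mixw ltNge x0 mul0r.
have := mix_sub ir t0 mwe (fun u u0 => weD (fun=> 0) v0 u0).
rewrite -/m => <-; rewrite mulrBr; congr (_ - _).
 under eq_Rintegral do rewrite -mulrA -mixeD. by rewrite Rint_we ?addr_gt0// (addrC v) /k; field; exact: lt0r_neq0.
have ik1 : mu.-integrable `]0, t[ (EFin \o (fun x => pk a rho (t + v - x) * r x)).
 by apply: integrableS (ikr (t + v)).
have ik2 : mu.-integrable `]0, t[ (EFin \o (fun x => k (t + v - x) * r x)).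
 have := @integrableZl _ _ _ mu _ (mitv _) C _ ik1. by congr (mu.-integrable _ _); apply/funext => x /=; rewrite /k -mulrA.
rewrite -Rintegral_itv_bndo_bndc//.
transitivity (C * \int[mu]_(x in `]0, t[) (pk a rho (t + v - x) * r x)).
 by rewrite -RintegralZl//; apply: eq_Rintegral => x _; rewrite /k mulrA.
transitivity (C / G * (G * \int[mu]_(x in `]0, t[) (pk a rho (t + v - x) * r x))).
 by field; exact: lt0r_neq0.
congr (_ * _); rewrite -RintegralZl//.
apply: eq_Rintegral => z; rewrite inE/= in_itv/= => /andP[z0 zt].
have tz : 0 < t - z by rewrite subr_gt0.
under eq_Rintegral do rewrite -mulrA -mixeD.
rewrite (Rint_we (addr_gt0 v0 tz)) mulrA; congr (_ * pk _ _ _ * _); ring.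
Qed.

Lemma measurable_mixm t : mfunT (m t).
Proof.
apply: mfunB; first exact: mmixe.
apply: (@measurable_Rparam _ _ _ _ _ mu (fun z : R * R => mixe rho z.1 (t - z.2) * rcut r t z.2)).
apply: mfunM; last exact: (mcompT (measurable_rcut ir t)).
exact: measurable_mixe1.
Qed.

Let D t : \bar R := ((G * pk a rho t)%:E + \int[mu]_z (G * pk a rho (t - z) * `|r z|)%:E)%E.

(** The sign of [m t x] being unknown, it is bounded by its two terms. Their mixtures are kernels at
    times delayed by [v]; as these kernels decrease, the bound [D t] does not depend on [v], which
    Fubini's theorem requires. *)
Lemma mixm_bound t v : 0 < t -> 0 < v ->
 (\int[mu]_x (`|w x * m t x| * e x v)%:E <= D t)%E.
Proof.
move=> t0 v0.
have mrc := measurable_rcut ir t.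
have mI x : measurable_fun [set: R] (fun z : R => mixe rho x (t - z) * rcut r t z).
 by apply: mfunM => //; exact: (mreflect t (measurable_mixer rho x)).
have mm := measurable_mixm t.
have H2 : mfunT (fun z : R * R => (w z.1 * e z.1 (t + v - z.2) * `|rcut r t z.2|)%:E).
 apply/mEFinP; apply: mfunM. apply: mfunM; first exact: (mcompT mw). exact: measurable_mixe1. by apply: mcompT => //; exact: (mcompT mrc).
have H2ge0 (z : R * R) : (0 <= (w z.1 * e z.1 (t + v - z.2) * `|rcut r t z.2|)%:E)%E.
 by rewrite lee_fin !mulr_ge0 ?mixw_ge0 ?mixe_ge0.
apply: (@le_trans _ _ (\int[mu]_x ((w x * e x (t + v))%:E +
  \int[mu]_z (w x * e x (t + v - z) * `|rcut r t z|)%:E))%E). apply: ge0_le_integral => //.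
 - by move=> x _; rewrite lee_fin mulr_ge0 ?mixe_ge0.
 - apply/mEFinP; apply: mfunM; last exact: mmixe. by apply: mcompT => //; exact: mfunM.
 - apply: emeasurable_funD. by apply/mEFinP; apply: mfunM => //; exact: mmixe. exact: (@mfubiniF _ _ _ _ _ mu _ H2 H2ge0). move=> x _. have [x0|x0] := leP x 0.
  rewrite /w /mixw ltNge x0/= !mul0r normr0 mul0r. by apply: adde_ge0 => //; apply: integral_ge0 => z _; rewrite mul0r mul0r. have w0 : 0 <= w x by exact: mixw_ge0.
 rewrite normrM ger0_norm//. apply: (@le_trans _ _ ((w x * e x v)%:E * ((e x t)%:E + \int[mu]_z (e x (t - z) * `|rcut r t z|)%:E))%E). rewrite mulrAC EFinM; apply: lee_wpmul2l.
   by rewrite lee_fin mulr_ge0 ?mixe_ge0. rewrite /m /mixm. apply: (@le_trans _ _ (`|mixe rho x t|%:E + `|\int[mu]_z (mixe rho x (t - z) * rcut r t z)|%:E)%E).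
   by rewrite -EFinD lee_fin ler_normB. apply: leeD; first by rewrite ger0_norm ?mixe_ge0. apply: le_trans (abse_fine_le _) _; apply: le_trans (le_abse_integral _ measurableT _) _.
   by apply/mEFinP; exact: mI. apply: eq_ler; apply: eq_integral => z _ /=. by rewrite normrM ger0_norm ?mixe_ge0. rewrite ge0_muleDr ?lee_fin ?mixe_ge0//; last first.
  by apply: integral_ge0 => z _; rewrite lee_fin mulr_ge0 ?mixe_ge0. apply: leeD; first by rewrite -EFinM lee_fin -mulrA -mixeD addrC. rewrite -ge0_integralZl//; first last.
 - by rewrite lee_fin mulr_ge0 ?mixe_ge0.
 - by move=> z _; rewrite lee_fin mulr_ge0 ?mixe_ge0.
 - apply/mEFinP; apply: mfunM. exact: (mreflect t (measurable_mixer rho x)). exact: mcompT. apply: eq_ler; apply: eq_integral => z _.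
 have -> : e x (t + v - z) = e x v * e x (t - z). by rewrite /e -mixeD; congr mixe; ring. by rewrite -EFinM; congr EFin; ring.
rewrite ge0_integralD//; first last.
- exact: (@mfubiniF _ _ _ _ _ mu _ H2 H2ge0).
- by move=> x _; apply: integral_ge0 => z _; rewrite lee_fin !mulr_ge0 ?mixw_ge0 ?mixe_ge0.
- by apply/mEFinP; apply: mfunM => //; exact: mmixe.
- by move=> x _; rewrite lee_fin mulr_ge0 ?mixw_ge0 ?mixe_ge0.
apply: leeD.
 rewrite integral_mixwe ?addr_gt0// lee_fin ler_pM2l//. by apply: pk_nincr => //; rewrite lerDl ltW.
rewrite (@fubini_tonelli _ _ _ _ _ mu mu _ H2 H2ge0).
apply: ge0_le_integral => //.
- by move=> z _; apply: integral_ge0 => x _; rewrite lee_fin !mulr_ge0 ?mixw_ge0 ?mixe_ge0.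
- exact: (@measurable_fun_fubini_tonelli_G _ _ _ _ _ mu _ H2 H2ge0).
- apply/mEFinP; apply: mfunM; last exact: mcompT.
 by apply: mfunM => //; apply: mreflect; exact: measurable_pk.
move=> z _ /=.
under eq_integral do rewrite EFinM.
rewrite ge0_integralZr//; first last.
- by move=> x _; rewrite lee_fin mulr_ge0 ?mixw_ge0 ?mixe_ge0.
- by apply/mEFinP; apply: mfunM => //; exact: mmixe.
rewrite /rcut; case: ifPn => [/andP[z0 zt]|_]; last first.
 by rewrite normr0 mule0 lee_fin !mulr_ge0 ?pk_ge0 ?(ltW G0).
have tz : 0 < t - z by rewrite subr_gt0.
rewrite integral_mixwe//; last by lra.
rewrite -EFinM lee_fin; apply: ler_wpM2r => //; rewrite ler_pM2l//.
by apply: pk_nincr => //; lra.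
Qed.

Let Dfin t : 0 < t -> D t = (fine (D t))%:E.
Proof.
move=> t0; rewrite fineK// /D fin_numD/= ge0_fin_numE; last first.
 by apply: integral_ge0 => z _; rewrite lee_fin !mulr_ge0 ?pk_ge0// ltW.
have /integrableP[_] := L1Z G (ikr t); apply: le_lt_trans.
apply: eq_ler; apply: eq_integral => z _ /=.
by rewrite !normrM (gtr0_norm G0) (ger0_norm (pk_ge0 _ _ _)) mulrA.
Qed.

Let mwm t : mfunT (fun x => w x * m t x).
Proof. by apply: mfunM => //; exact: measurable_mixm. Qed.

Let wmD t v : 0 < t -> 0 < v ->
 (\int[mu]_x (`|w x * m t x| * e x v)%:E <= (fine (D t))%:E)%E.
Proof. by move=> t0 v0; rewrite -Dfin//; exact: mixm_bound. Qed.

Lemma wmm_L1 t s : 0 < t -> 0 < s -> L1 (fun x => w x * m t x * m s x).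
Proof.
move=> t0 s0.
have h1 := mix_L1 (mwm t) (fun v => @wmD t v t0) s0.
have h2 := mix_L1_m ir s (mwm t) (fun v => @wmD t v t0).
have := L1B h1 h2; congr (mu.-integrable _ _); apply/funext => x /=.
by rewrite -mulrBr.
Qed.

(** [B t] is the mixture of exponentials with weights [w * m t], and the shifted equation replaces
    each exponential by its response [m s]. The outcome is symmetric in [t] and [s]: a Gram
    kernel. *)
Lemma res_quad t s : 0 < t -> 0 < s -> t + s <= T ->
 r (t + s) = lambda * C / G * \int[mu]_x (w x * m t x * m s x).
Proof.
move=> t0 s0 tsT; rewrite (shift t0 s0 tsT).
have := mix_sub ir s0 (mwm t) (fun v => @wmD t v t0).
rewrite -/m => <-; rewrite (mulrBr (lambda * C / G)); congr (_ - _).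
 rewrite B_mix// !(mulrA lambda); congr (_ * _). by apply: eq_Rintegral => x _; exact: mulrAC.
have i1 : mu.-integrable `]0, s[ (EFin \o (fun z => \int[mu]_x (w x * m t x * e x (s - z)) * r z)).
 have h := integrable_Rfubini1 (mix_fubini_integrable ir s (mwm t) (fun v => @wmD t v t0)). pose g x := \int[mu]_y (w y * m t y * mixe rho y (s - x) * rcut r s x).
 have : mu.-integrable `]0, s[ (EFin \o g) by exact: integrableS h. apply: eq_integrable => // z; rewrite inE/= in_itv/= => /andP[z0 zs]. congr EFin; rewrite -Rintegral_Zr.
  by apply: eq_Rintegral => x _; rewrite /rcut z0 zs. by apply: mfunM; [exact: mwm|exact: mmixe].
rewrite -RintegralZl//; apply: eq_Rintegral => z; rewrite inE/= in_itv/= => /andP[z0 zs].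
rewrite B_mix ?subr_gt0// !(mulrA lambda) [RHS]mulrA; congr (_ * _ * _).
by apply: eq_Rintegral => x _; exact: mulrAC.
Qed.

Hypotheses (lambda0 : 0 < lambda) (C0 : 0 <= C).

Lemma res_form (p q t s : R) : 0 < t -> 0 < s -> t + t <= T -> s + s <= T ->
 0 <= p ^+ 2 * r (t + t) + 2 * p * q * r (t + s) + q ^+ 2 * r (s + s).
Proof.
move=> t0 s0 tT sT; have tsT : t + s <= T by lra.
rewrite !res_quad//.
have L0 : 0 <= lambda * C / G by rewrite divr_ge0 ?(ltW G0)// mulr_ge0 ?(ltW lambda0).
have i1 := wmm_L1 t0 t0. have i2 := wmm_L1 t0 s0. have i3 := wmm_L1 s0 s0.
have Q0 : 0 <= p ^+ 2 * \int[mu]_x (w x * m t x * m t x) +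
  2 * p * q * \int[mu]_x (w x * m t x * m s x) + q ^+ 2 * \int[mu]_x (w x * m s x * m s x). rewrite -!RintegralZl// -RintegralD//; [|exact: (L1Z _ i1)|exact: (L1Z _ i2)].
 rewrite -RintegralD//; [|exact: (L1D (L1Z _ i1) (L1Z _ i2))|exact: (L1Z _ i3)]. apply: Rintegral_ge0 => x _.
 have -> : forall u a b : R, p ^+ 2 * (u * a * a) + 2 * p * q * (u * a * b) + q ^+ 2 * (u * b * b) = u * (p * a + q * b) ^+ 2 by move=> *; ring. by rewrite mulr_ge0 ?sqr_ge0// mixw_ge0.
move: L0 Q0; move: (lambda * C / G) => L.
move: (\int[mu]_x _) => I1; move: (\int[mu]_x _) => I2; move: (\int[mu]_x _) => I3 L0 Q0.
by rewrite (_ : _ + _ = L * (p ^+ 2 * I1 + 2 * p * q * I2 + q ^+ 2 * I3)) ?mulr_ge0//; ring.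
Qed.

Lemma res_ge0 (t : R) : 0 < t -> t + t <= T -> 0 <= r (t + t).
Proof. by move=> t0 tT; have := res_form 1 0 t0 t0 tT tT; rewrite !(expr0n, mulr0, mul0r, expr1n, mul1r, addr0). Qed.

Lemma res_CS (t s : R) : 0 < t -> 0 < s -> t + t <= T -> s + s <= T ->
 r (t + s) ^+ 2 <= r (t + t) * r (s + s).
Proof.
move=> t0 s0 tT sT.
have A0 := res_ge0 t0 tT. have C1 := res_ge0 s0 sT.
have H p q := res_form p q t0 s0 tT sT.
move: A0 C1 H; move: (r (t + t)) (r (t + s)) (r (s + s)) => A B1 C2 A0 C1 H.
have [C2p|] := ltP 0 C2.
 have := H C2 (- B1). rewrite (_ : _ + _ + _ = C2 * (A * C2 - B1 ^+ 2)); last by ring. by rewrite pmulr_rge0// subr_ge0.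
move=> C2n; have C20 : C2 = 0 by apply/eqP; rewrite eq_le C1 C2n.
have [->|B0] := eqVneq B1 0; first by rewrite expr0n/= C20 mulr0.
(* When [r (s + s) = 0] the form is affine in its second coefficient; this choice makes it equal to
   [-1]. *)
have := H 1 (- ((A + 1) / (2 * B1))).
rewrite C20 (_ : _ + _ + _ = - 1); last by field.
by rewrite ler0N1.
Qed.

End resolvent_pos.

(** * The density of the resolvent of the gamma kernel *)

Section kernel.
Variables (R : realType) (alpha rho lambda : R) (Rl : R -> R).
Hypotheses (alpha1 : 2^-1 < alpha) (alpha2 : alpha < 1) (rho0 : 0 < rho) (lambda0 : 0 < lambda) (hRl : is_resolvent (gamma_kernel alpha rho) lambda Rl).
Notation mu := (leb R).

Let a0 : 0 < alpha. Proof. by apply: lt_trans alpha1; rewrite invr_gt0. Qed.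
Let a21 : 0 < 2 * alpha - 1. Proof. by move: alpha1; rewrite -(ltr_pM2l (x:=2))// divff ?pnatr_eq0// subr_gt0. Qed.

Definition gamC : R := (Gamma_fun alpha)^-1.
Let C := gamC.

Lemma gamC_ge0 : 0 <= C.
Proof.
rewrite invr_ge0; apply: Rintegral_ge0 => x _.
by rewrite mulr_ge0 ?powR_ge0 ?expR_ge0.
Qed.

Definition gk (t : R) : R := C * pk alpha rho t.
Let k := gk.
Let Dc : R := C ^+ 2 * pkB alpha alpha.
(** The derivative of [k * k = Dc pk (2 alpha) rho]; its singularity at 0 is of order
    [t ^ (2 alpha - 2)], integrable as [alpha > 1 / 2]. *)
Let dk (t : R) : R := Dc * ((2 * alpha - 1) * pk (2 * alpha - 1) rho t - rho * pk (2 * alpha) rho t).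

Lemma gk_ppart : ppart (gamma_kernel alpha rho) = k.
Proof.
apply/funext => t; rewrite /ppart /k /gk /gamma_kernel /pk; case: ifP; rewrite ?mulr0//.
by rewrite /C /gamC mulrC.
Qed.

Lemma gk_ge0 t : 0 <= k t.
Proof. by rewrite mulr_ge0 ?gamC_ge0 ?pk_ge0. Qed.

Lemma gk_L1 : L1 k.
Proof. by apply: L1Z; apply: pk_L1 => //; rewrite a0/=; move: alpha2; lra. Qed.

Lemma gk_supp : suppos k.
Proof. by move=> s s0; rewrite /k /gk pk_le0// mulr0. Qed.

Let dk_L1 : L1 dk.
Proof.
apply: L1Z; apply: L1B; apply: L1Z; apply: pk_L1 => //; rewrite ?a21/=.
 by move: alpha2; lra.
by rewrite mulr_gt0//=; move: alpha2; lra.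
Qed.

Let dk_supp : suppos dk.
Proof. by move=> s s0; rewrite /dk !pk_le0// !mulr0 subr0 mulr0. Qed.

Lemma gk_conv t : rconv k k t = Dc * pk (2 * alpha) rho t.
Proof.
have := pk_conv alpha alpha rho t.
rewrite (_ : alpha + alpha = 2 * alpha) => [h|]; last by ring.
have -> : rconv k k t = C ^+ 2 * rconv (pk alpha rho) (pk alpha rho) t.
 rewrite /rconv -RintegralZl//. by apply: eq_Rintegral => s _; rewrite /k /gk; ring. by apply: pk_conv_L1 => //; rewrite a0/=; move: alpha2; lra.
by rewrite h mulrA.
Qed.

Let rawD (t : R) : 0 < t -> is_derive t (1:R)
 (fun x => Dc * (expR (- (rho * x)) * x `^ (2 * alpha - 1))) (dk t).
Proof.
move=> t0; have h := is_derive_pk_raw (2 * alpha) rho t0.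
apply: is_derive_eq; rewrite /GRing.scale/= /dk /pk t0.
by congr (_ * (_ - _)); rewrite mulrA.
Qed.

Lemma continuous_pk (b t : R) : 0 < t -> {for t, continuous (pk b rho)}.
Proof.
move=> t0.
apply: (@cvg_trans _ (expR (- (rho * x)) * x `^ (b - 1) @[x --> t])).
 apply: near_eq_cvg; near=> x; rewrite /pk. by have -> : 0 < x by near: x; exact: lt_nbhsr.
rewrite {1}/pk t0.
have h1 : expR (- (rho * x)) @[x --> t] --> expR (- (rho * t)) := @continuous_expk R rho t.
have h2 : (x : R) `^ (b - 1) @[x --> t] --> t `^ (b - 1) := continuous_powRl t0.
exact: (cvgM h1 h2).
Unshelve. all: end_near. Qed.

Let rawDc (t : R) : 0 < t -> {for t, continuous dk}.
Proof.
move=> t0; apply: cvgM; first exact: cvg_cst.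
by apply: cvgB; apply: cvgM; (try exact: cvg_cst); exact: continuous_pk.
Qed.

Lemma dk_prim t T : t <= T -> rconv (uT T) dk t = Dc * pk (2 * alpha) rho t.
Proof.
move=> tT; rewrite rconv_uT//; last exact: L1_mfun.
have [t0|t0] := ltP 0 t; last first.
 rewrite pk_le0// mulr0; move: t0; rewrite le_eqVlt => /predU1P[->|t0]. by rewrite set_itv1 Rintegral_set1. by rewrite set_itv_ge ?Rintegral_set0// bnd_simp -ltNge.
have i : mu.-integrable `[0, t] (EFin \o dk) by exact: integrableS dk_L1.
have c0 : Dc * (expR (- (rho * x)) * x `^ (2 * alpha - 1)) @[x --> 0^'+] --> (0 : R).
 rewrite -[X in _ --> X](mulr0 Dc); apply: cvgM; first exact: cvg_cst. rewrite -[X in _ --> X](mulr0 (expR (- (rho * 0)))); apply: cvgM.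
  by apply: cvg_at_right_filter; exact: continuous_expk. exact: powR_cvg0.
by rewrite (FTC_oc t0 rawD rawDc i c0) subr0 /pk t0.
Qed.

Lemma Rl0 : Rl 0 = 1.
Proof.
have [_ h] := hRl; rewrite -(h 0 (lexx _)) /volterra_conv set_itv1 Rintegral_set1.
by rewrite mulr0 addr0.
Qed.

Section atT.
Variable T : R.
Hypothesis T0 : 0 < T.
(** The resolvent up to a horizon: [Rl] need not be integrable on the half-line, while the algebra
    of convolutions asks for integrable functions. Before [T] the density found does not depend on
    [T], see [resfE]. *)
Let c (t : R) : R := if (0 < t) && (t <= T) then Rl t else 0.

Let cRl := max0_continuous hRl.1.

Lemma Rl_bounded : exists M : R, forall t, 0 <= t -> t <= T -> `|Rl t| <= M.
Proof.
have cn : {within `[0, T], continuous (fun t : R => `|Rl (Num.max 0 t)|)}.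
 apply: continuous_subspaceT => t. by apply: continuous_comp; [exact: cRl|exact: norm_continuous].
have [m _ hm] := EVT_max (ltW T0) cn.
exists `|Rl (Num.max 0 m)| => t t0 tT.
by have := hm t; rewrite in_itv/= t0 tT => /(_ isT); rewrite (max_r t0).
Qed.

Let bc : bddm c.
Proof.
split.
 rewrite (_ : c = fun t => if (0 < t) && (t <= T) then ppart Rl t else 0). by apply: measurable_cutoff; apply: mppart; exact: hRl.1. by apply/funext => t; rewrite /c /ppart; case: ifP => // /andP[->].
have [M hM] := Rl_bounded; exists M => t; rewrite /c; case: ifP => [/andP[t0 tT]|_].
 by apply: hM => //; exact: ltW.
by rewrite normr0; apply: le_trans (hM 0 (lexx _) (ltW T0)).
Qed.

Let sc : suppos c. Proof. by move=> s s0; rewrite /c ltNge s0. Qed.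

Let ic : L1 c.
Proof. by apply: (@bddm_L1 _ T _ bc) => t /negbTE h; rewrite /c h. Qed.

Let E1 t : t <= T -> c t + lambda * rconv k c t = uT T t.
Proof.
move=> tT; have [t0|t0] := ltP 0 t; last first.
 by rewrite sc// rconv_supp ?uT_supp ?mulr0 ?addr0//; exact: gk_supp.
rewrite /uT {1}/c t0 tT/= -(hRl.2 t (ltW t0)); congr (_ + _ * _).
rewrite volterra_rconv ?(ltW t0)//; last 2 first.
- by rewrite gk_ppart; exact: L1_mfun gk_L1.
- by apply: mppart; exact: hRl.1.
rewrite gk_ppart; apply: rconv_local; first exact: gk_supp.
by move=> s st; rewrite /c /ppart (le_trans (ltW st) tT) andbT.
Qed.

Let kk t : L1 (fun s => k (t - s) * k s).
Proof.
have := L1Z (C ^+ 2) (@pk_conv_L1 R alpha alpha rho t _ _ rho0).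
rewrite (_ : (fun s => C ^+ 2 * _) = (fun s => k (t - s) * k s)); last first.
 by apply/funext => s; rewrite /k /gk; ring.
by apply; rewrite a0/=; move: alpha2; lra.
Qed.

Let Ek t : t <= T -> rconv k k t = rconv (uT T) dk t.
Proof. by move=> tT; rewrite gk_conv dk_prim. Qed.

Definition resT := resdens k dk c lambda.

Lemma resT_L1 : L1 resT. Proof. exact: (resdens_L1 lambda gk_L1 dk_L1 ic). Qed.
Lemma resT_supp : suppos resT. Proof. exact: (resdens_supp lambda gk_supp dk_supp sc). Qed.

Lemma Rl_resT t : 0 < t -> t <= T -> Rl t = 1 - \int[mu]_(s in `[0, t]) resT s.
Proof.
move=> t0 tT.
have := rconv_u_resdens gk_L1 dk_L1 ic bc (uT_L1 T) (bddm_uT T) gk_supp sc (@uT_supp R T) E1 Ek tT.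
by rewrite rconv_uT//; [rewrite /c /uT t0 tT|exact: resT_supp|exact: L1_mfun resT_L1].
Qed.

Lemma resT_eq t : t <= T -> resT t + lambda * rconv k resT t = lambda * k t.
Proof.
exact: (resdens_eq gk_L1 dk_L1 ic bc (uT_L1 T) dk_supp sc kk E1 Ek).
Qed.

Let bdkc := rconv_bddm dk_L1 bc.

Lemma resT_bounded t : 0 < t -> exists M : R, forall v, t <= v -> `|resT v| <= M.
Proof.
move=> t0; have [_ [M hM]] := bdkc.
exists (lambda * k t + lambda ^+ 2 * M) => v tv.
rewrite /resT /resdens (le_trans (ler_normB _ _))// lerD//.
 rewrite ger0_norm; last by rewrite mulr_ge0 ?gk_ge0 ?(ltW lambda0). rewrite ler_pM2l//. by apply: ler_wpM2l; [exact: gamC_ge0|exact: pk_nincr].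
by rewrite normrM ger0_norm ?sqr_ge0// ler_wpM2l ?sqr_ge0.
Qed.

Let ikr t : L1 (fun x => pk alpha rho (t - x) * resT x).
Proof.
rewrite (_ : (fun _ => _) = fun x => (lambda * C) * (pk alpha rho (t - x) * pk alpha rho x) -
  lambda ^+ 2 * (pk alpha rho (t - x) * rconv dk c x)); last first. by apply/funext => x; rewrite /resT /resdens /k /gk; ring.
have aa : 0 < alpha <= 2 by rewrite a0/=; move: alpha2; lra.
apply: L1B; apply: L1Z; first exact: pk_conv_L1.
by apply: rconv_L1_pt; [exact: pk_L1|].
Qed.

Let shift t s : 0 < t -> 0 < s -> t + s <= T ->
 let B t v := C * pk alpha rho (t + v) - \int[mu]_(x in `]0, t]) (C * pk alpha rho (t + v - x) * resT x) in
 resT (t + s) = lambda * B t s - \int[mu]_(x in `]0, s[) (lambda * B t (s - x) * resT x).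
Proof.
move=> t0 s0 ts; have [M hM] := resT_bounded t0.
exact: (resdens_shift gk_L1 dk_L1 ic bc (uT_L1 T) gk_supp dk_supp sc kk E1 Ek (lt0r_neq0 lambda0) t0 s0 ts hM).
Qed.

Lemma resT_ge0 (t : R) : 0 < t -> t + t <= T -> 0 <= resT (t + t).
Proof.
exact: (res_ge0 a0 alpha2 rho0 resT_L1 ikr shift lambda0 gamC_ge0).
Qed.

Lemma resT_CS (t s : R) : 0 < t -> 0 < s -> t + t <= T -> s + s <= T ->
 resT (t + s) ^+ 2 <= resT (t + t) * resT (s + s).
Proof.
exact: (res_CS a0 alpha2 rho0 resT_L1 ikr shift lambda0 gamC_ge0).
Qed.

(** The cut resolvent jumps from 0 to 1 at 0. Before [T] it is [uT T + g] with [g] continuous: the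
    jump contributes the explicit [pk (2 alpha)], and [g * dk] is continuous by dominated
    convergence. *)
Lemma resT_continuous (t : R) : 0 < t -> t < T -> {for t, continuous resT}.
Proof.
move=> t0 tT.
pose g (s : R) := Rl (Num.max 0 (Num.min s T)) - 1.
have cg : continuous g.
 move=> s; apply: cvgB; last exact: cvg_cst. apply: (@continuous_comp _ _ _ (fun s : R => Num.min s T) (fun s : R => Rl (Num.max 0 s))); last exact: cRl.
 by apply: continuous_min; [exact: cvg_id|exact: cst_continuous].
have [M hM] := Rl_bounded.
have bg : bddm g.
 split; first exact: cmfun. exists (M + 1) => s; rewrite (le_trans (ler_normB _ _))// normr1 lerD2r. by apply: hM; rewrite ?le_max ?lexx// ge_max (ltW T0)/= ge_min lexx orbT.
have Ec s : s <= T -> rconv dk c s = Dc * pk (2 * alpha) rho s + rconv g dk s.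
 move=> sT; rewrite -(dk_prim sT) (rconvC _ (L1_mfun (uT_L1 T)) (L1_mfun dk_L1)). rewrite (rconvC _ bg.1 (L1_mfun dk_L1)).
 rewrite (@rconv_local _ dk c (fun s => 1 * uT T s - (-1) * g s) s dk_supp). rewrite rconvB_pt; first by ring. by apply: rconv_L1_pt => //; exact: bddm_uT. exact: rconv_L1_pt.
 move=> v vs; have vT : v <= T by rewrite (le_trans (ltW vs)). rewrite /c /uT /g vT andbT (min_l vT); case: ltP => v0. by ring. by rewrite Rl0; ring.
have cr : {for t, continuous (rconv g dk)}.
 have ci : {in `]0, T[%classic, continuous (fun l => \int[mu]_s (g (l - s) * dk s))}. have [mg _] := bg.
  apply: (@continuity_under_integral _ _ _ mu (fun x s => g (x - s) * dk s) setT measurableT 0 T _ _ (fun s => (M + 1) * `|dk s|)).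
  - move=> x _; have := rconv_L1_pt x dk_L1 bg. move=> _; rewrite (_ : (fun s => _) = (fun s => dk s * g (x - s))); last by apply/funext => s; rewrite mulrC.
   apply: (L1_bddM dk_L1); have [_ [M' hM']] := bg. by split; [exact: (mreflect x mg)|exists M' => y; exact: hM'].
  - apply: aeW => s _ x _; apply: cvgM; last exact: cvg_cst. apply: (@continuous_comp _ _ _ (fun x : R => x - s) g); last exact: cg. by apply: cvgB; [exact: cvg_id|exact: cvg_cst].
  - by apply: L1Z; exact: (integrable_norm dk_L1).
  - move=> x _; apply: aeW => s _; rewrite normrM ler_wpM2r//. rewrite (le_trans (ler_normB _ _))// normr1 lerD2r. by apply: hM; rewrite ?le_max ?lexx// ge_max (ltW T0)/= ge_min lexx orbT.
 by apply: ci; rewrite inE/= in_itv/= t0.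
have E (s : R) : s <= T -> resT s = lambda * k s - lambda ^+ 2 * (Dc * pk (2 * alpha) rho s + rconv g dk s).
 by move=> sT; rewrite /resT /resdens Ec.
apply: (@cvg_trans _ (lambda * k x - lambda ^+ 2 * (Dc * pk (2 * alpha) rho x + rconv g dk x) @[x --> t])).
 apply: near_eq_cvg; near=> x; rewrite E//. by apply: ltW; near: x; exact: lt_nbhsl.
rewrite (E t (ltW tT)).
have cp (b : R) : pk b rho x @[x --> t] --> pk b rho t := @continuous_pk b t t0.
have h1 : lambda * k x @[x --> t] --> lambda * k t.
 by apply: cvgM; [exact: cvg_cst|apply: cvgM; [exact: cvg_cst|exact: cp]].
have h2 : lambda ^+ 2 * (Dc * pk (2 * alpha) rho x + rconv g dk x) @[x --> t] -->
  lambda ^+ 2 * (Dc * pk (2 * alpha) rho t + rconv g dk t). by apply: cvgM; [exact: cvg_cst|apply: cvgD => //; apply: cvgM; [exact: cvg_cst|exact: cp]].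
exact: (cvgB h1 h2).
Unshelve. all: end_near. Qed.

Lemma resT_derive (t : R) : 0 < t -> t < T -> resolvent_density Rl t = resT t.
Proof.
move=> t0 tT.
have i : mu.-integrable `[0, T] (EFin \o resT) by exact: integrableS resT_L1.
have [dF FE] := continuous_FTC1_closed tT i t0 (resT_continuous t0 tT).
rewrite /resolvent_density.
have H : is_derive t (1:R) (fun x => 1 - \int[mu]_(s in `[0, x]) resT s) (- resT t).
 have d1 : is_derive t (1:R) (fun x => \int[mu]_(s in `[0, x]) resT s) (resT t). by apply: DeriveDef; [exact: dF|rewrite -derive1E; exact: FE].
 by have := is_deriveB (is_derive_cst (1:R) t (1:R)) d1; rewrite sub0r.
rewrite derive1E -[RHS]opprK; congr (- _).
have := @near_eq_derive _ _ _ Rl (fun x => 1 - \int[mu]_(s in `[0, x]) resT s) t 1.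
move=> ->//; first by have [_ ->] := H.
near=> x; apply: Rl_resT.
 by near: x; exact: lt_nbhsr.
by apply: ltW; near: x; exact: lt_nbhsl.
Unshelve. all: end_near. Qed.

End atT.
End kernel.

(** * Bounds, monotonicity and decay of the resolvent density *)

Section kernel_props.
Variables (R : realType) (alpha rho lambda : R) (Rl : R -> R).
Hypotheses (alpha1 : 2^-1 < alpha) (alpha2 : alpha < 1) (rho0 : 0 < rho) (lambda0 : 0 < lambda) (hRl : is_resolvent (gamma_kernel alpha rho) lambda Rl).
Notation mu := (leb R).
Let a0 : 0 < alpha. Proof. by apply: lt_trans alpha1; rewrite invr_gt0. Qed.
Let a21 : 0 < 2 * alpha - 1. Proof. by move: alpha1; rewrite -(ltr_pM2l (x:=2))// divff ?pnatr_eq0// subr_gt0. Qed.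
Let C := gamC alpha.

Definition resf : R -> R := ppart (resolvent_density Rl).
Let f := resf.
Let rT := resT alpha rho lambda Rl.

Lemma resf_supp : suppos f. Proof. exact: ppart_supp. Qed.

Lemma resfE (T t : R) : 0 < T -> t < T -> f t = rT T t.
Proof.
move=> T0 tT; rewrite /f /resf /ppart; case: ltP => t0.
 exact: (resT_derive alpha1 alpha2 rho0 hRl T0 t0 tT).
by rewrite /rT resT_supp.
Qed.

Lemma resf_ge0 (t : R) : 0 <= f t.
Proof.
have [t0|t0] := ltP 0 t; last by rewrite resf_supp.
rewrite (@resfE (t + 1))//; [|lra|lra].
have -> : t = t / 2 + t / 2 by field.
by apply: (resT_ge0 alpha1 alpha2 rho0 lambda0 hRl) => //; lra.
Qed.

Lemma resf_CS (t s : R) : 0 < t -> 0 < s -> f (t + s) ^+ 2 <= f (t + t) * f (s + s).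
Proof.
move=> t0 s0; pose T := 2 * t + 2 * s + 1.
have T0 : 0 < T by rewrite /T; lra.
have [h1 h2 h3] : [/\ t + s < T, t + t < T & s + s < T] by rewrite /T; split; lra.
rewrite !(@resfE T); [|by []..].
by apply: (resT_CS alpha1 alpha2 rho0 lambda0 hRl) => //; rewrite /T; lra.
Qed.

(** In [f + lambda k * f = lambda k] the convolution is nonnegative. *)
Lemma resf_le (t : R) : f t <= lambda * gk alpha rho t.
Proof.
have [t0|t0] := ltP 0 t; last first.
 by rewrite resf_supp// mulr_ge0 ?(ltW lambda0)//; exact: gk_ge0.
have T0 : 0 < t + 1 by lra.
have tT : t < t + 1 by lra.
rewrite (@resfE (t + 1))//.
rewrite -(resT_eq alpha1 alpha2 rho0 hRl T0 (ltW tT)) lerDl.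
rewrite mulr_ge0 ?(ltW lambda0)//; apply: Rintegral_ge0 => s _.
have [ts|st] := leP t s.
 by rewrite gk_supp ?mul0r// subr_le0.
by rewrite mulr_ge0 ?gk_ge0// -/(rT (t+1) s) -resfE ?resf_ge0//; lra.
Qed.

Lemma resf_measurable : mfunT f.
Proof.
apply: (@measurable_fun_cvg _ _ _ setT (fun n : nat => rT n.+1%:R)).
- by move=> n; apply: L1_mfun; exact: (resT_L1 alpha1 alpha2 rho0 hRl).
- move=> x _; apply: cvg_near_cst; near=> n.
 rewrite -resfE//. have : x < n%:R by near: n; exact: nbhs_infty_gtr. by move=> /lt_le_trans -> //; rewrite ler_nat.
Unshelve. all: end_near. Qed.

Lemma L1_le (g h : R -> R) : mfunT g -> L1 h ->
 (forall x, `|g x| <= h x) -> L1 g.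
Proof.
move=> mg ih gh; apply: (le_integrable measurableT _ _ ih); first exact/mEFinP.
by move=> x _ /=; rewrite lee_fin (le_trans (gh x))// ler_norm.
Qed.

Lemma resf_L1 : L1 f.
Proof.
apply: (L1_le resf_measurable (L1Z lambda (gk_L1 alpha1 alpha2 rho0))) => x.
by rewrite ger0_norm ?resf_ge0 ?resf_le.
Qed.

Lemma pk_sqr b r (t : R) : pk b r t ^+ 2 = pk (2 * b - 1) (2 * r) t.
Proof.
rewrite /pk; case: ifP => t0; last by rewrite expr0n.
rewrite exprMn -expRM_natl -powR_mulrn ?powR_ge0// -powRrM.
by congr (expR _ * _ `^ _); ring.
Qed.

Lemma resf_sqr_le (t : R) : f t ^+ 2 <= (lambda * C) ^+ 2 * pk (2 * alpha - 1) (2 * rho) t.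
Proof.
rewrite -pk_sqr -exprMn ler_pXn2r ?nnegrE ?resf_ge0//.
 by rewrite -mulrA; exact: resf_le.
by rewrite mulr_ge0 ?pk_ge0// mulr_ge0 ?gamC_ge0 ?(ltW lambda0).
Qed.

Lemma resf2_L1 : L1 (fun t => f t ^+ 2).
Proof.
have i : L1 (pk (2 * alpha - 1) (2 * rho)).
 by apply: pk_L1; [rewrite a21/=; move: alpha2; lra|rewrite mulr_gt0].
apply: (L1_le _ (L1Z ((lambda * C) ^+ 2) i)).
 by apply: mfunX; exact: resf_measurable.
by move=> x; rewrite ger0_norm ?sqr_ge0 ?resf_sqr_le.
Qed.

Let Fe t := expR (rho * t) * f t.
Let Fe_CS t s : 0 < t -> 0 < s -> Fe (t + s) ^+ 2 <= Fe (t + t) * Fe (s + s).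
Proof.
move=> t0 s0; rewrite /Fe exprMn -expRM_natl mulrACA -expRD.
rewrite (_ : 2%:R * (rho * (t + s)) = rho * (t + t) + rho * (s + s)); last by ring.
by rewrite ler_pM2l ?expR_gt0// resf_CS.
Qed.

Let Fe_le t : 0 < t -> Fe t * t `^ (1 - alpha) <= lambda * C.
Proof.
move=> t0; rewrite /Fe.
have := resf_le t; rewrite /gk /pk t0 => h.
apply: (@le_trans _ _ (expR (rho * t) * (lambda * (C * (expR (- (rho * t)) * t `^ (alpha - 1)))) * t `^ (1 - alpha))).
 by rewrite ler_pM2r ?powR_gt0// ler_pM2l ?expR_gt0.
rewrite expRN (_ : 1 - alpha = - (alpha - 1)); last by ring.
rewrite powRN; have e0 := expR_gt0 (rho * t); have p0 : 0 < t `^ (alpha - 1) by exact: powR_gt0.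
by apply: eq_ler; field; rewrite !gt_eqF.
Qed.

(** [Fe] is midpoint log-convex. Were it to increase from [u] to [v], it would be nondecreasing
    along the arithmetic progression of step [v - u], hence bounded below by a positive constant
    there, against [Fe t <= lambda C t ^ (alpha - 1)]. *)
Lemma resf_expincr (u v : R) : 0 < u -> u <= v -> Fe v <= Fe u.
Proof.
move=> u0; rewrite le_eqVlt => /predU1P[->//|uv].
rewrite leNgt; apply/negP => h.
pose x n := Fe (u + n%:R * (v - u)).
have up n : 0 < u + n%:R * (v - u) by rewrite ltr_wpDr// mulr_ge0// subr_ge0 ltW.
have xCS n : x n.+1 ^+ 2 <= x n * x n.+2.
 rewrite /x; have := @Fe_CS ((u + n%:R * (v - u)) / 2) ((u + n.+2%:R * (v - u)) / 2). rewrite !divr_gt0// => /(_ isT isT). rewrite -!splitr.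
 by rewrite (_ : _ / 2 + _ / 2 = u + n.+1%:R * (v - u)); last by rewrite -!natr1; field.
have x01 : x 0%N < x 1%N by rewrite /x mul0r addr0 mul1r addrC subrK.
have x0 n : 0 <= x n by rewrite mulr_ge0 ?expR_ge0 ?resf_ge0.
have xi n : x 0%N < x n.+1 /\ x n <= x n.+1.
 elim: n => [|n [IH0 IH]]; first by split => //; exact: ltW. have xn : 0 < x n.+1 by exact: le_lt_trans (x0 0%N) IH0.
 have hn : x n.+1 <= x n.+2. have h1 : x n.+1 ^+ 2 <= x n.+1 * x n.+2. by rewrite (le_trans (xCS n))// ler_wpM2r. by move: h1; rewrite expr2 ler_pM2l. split; [exact: lt_le_trans IH0 hn|exact: hn].
have x1n n : x 1%N <= x n.+1.
 elim: n => [|n IH]; [exact: lexx|exact: le_trans IH (xi n.+1).2].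
have x1p : 0 < x 1%N by exact: le_lt_trans (x0 0%N) x01.
(* The time where the lower bound contradicts [Fe_le]: [x 1 * y ^ (1 - alpha) = lambda C + 1]. *)
pose y := ((lambda * C + 1) / x 1%N) `^ ((1 - alpha)^-1).
have [n hn] : exists n : nat, y < u + n.+1%:R * (v - u).
 have vu : 0 < v - u by rewrite subr_gt0. have q0 : 0 <= y / (v - u) by rewrite divr_ge0 ?powR_ge0 ?(ltW vu).
 exists (Num.bound (y / (v - u))); have := archi_boundP q0. rewrite ltr_pdivrMr// => /lt_trans; apply. by rewrite -natr1; move: (_%:R) => z; lra.
have lC0 : 0 <= lambda * C by rewrite mulr_ge0 ?gamC_ge0 ?(ltW lambda0).
have y0 : 0 <= y by exact: powR_ge0.
have := Fe_le (up n.+1).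
apply/negP; rewrite -ltNge.
have hy : y `^ (1 - alpha) = (lambda * C + 1) / x 1%N.
 rewrite /y -powRrM mulVf ?powRr1//; first by rewrite divr_ge0// addr_ge0. by rewrite gt_eqF// subr_gt0.
have : (lambda * C + 1) / x 1%N <= (u + n.+1%:R * (v - u)) `^ (1 - alpha).
 rewrite -hy ge0_ler_powR ?nnegrE ?(ltW hn) ?(ltW (up _))//. by rewrite subr_ge0 ltW.
rewrite ler_pdivrMr// => h2.
apply: (@lt_le_trans _ _ (lambda * C + 1)); first by rewrite ltrDl.
by rewrite (le_trans h2)// mulrC ler_wpM2r ?powR_ge0//; exact: x1n.
Qed.

Lemma resf_decay (u h : R) : 0 < u -> 0 <= h -> f (u + h) <= expR (- (rho * h)) * f u.
Proof.
move=> u0 h0; have := @resf_expincr u (u + h) u0; rewrite lerDl h0 => /(_ isT).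
rewrite /Fe mulrDr expRD -mulrA ler_pM2l ?expR_gt0// => H.
by rewrite expRN ler_pdivlMl ?expR_gt0.
Qed.

Lemma resf_nincr (u v : R) : 0 < u -> u <= v -> f v <= f u.
Proof.
move=> u0 uv; have := @resf_decay u (v - u) u0; rewrite subr_ge0 uv addrC subrK => /(_ isT).
move=> /le_trans; apply; rewrite ler_piMl ?resf_ge0//.
by rewrite -expR0 ler_expR oppr_le0 mulr_ge0 ?subr_ge0// ltW.
Qed.

Lemma resf_continuous (t : R) : 0 < t -> {for t, continuous f}.
Proof.
move=> t0; have T0 : 0 < t + 1 by lra.
have tT : t < t + 1 by lra.
have h : rT (t + 1) x @[x --> t] --> rT (t + 1) t :=
 @resT_continuous _ _ _ _ _ alpha1 alpha2 rho0 hRl _ T0 t t0 tT.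
suff H : f x @[x --> t] --> f t by exact: H.
rewrite (@resfE (t + 1) t T0 tT).
apply: cvg_trans h; apply: near_eq_cvg; near=> x; rewrite (@resfE (t + 1) x T0)//.
by near: x; exact: lt_nbhsl.
Unshelve. all: end_near. Qed.

Lemma Rl_resf (t : R) : 0 <= t -> Rl t = 1 - \int[mu]_(s in `[0, t]) f s.
Proof.
rewrite le_eqVlt => /predU1P[<-|t0].
 by rewrite set_itv1 Rintegral_set1 subr0 (Rl0 hRl).
have T0 : 0 < t + 1 by lra.
rewrite (@Rl_resT _ _ _ _ _ alpha1 alpha2 rho0 hRl _ T0 _ t0); last lra.
congr (_ - _); apply: eq_Rintegral => s; rewrite inE/= in_itv/= => /andP[_ st].
by rewrite (@resfE (t + 1))//; lra.
Qed.

Lemma integral_powR0 (b h : R) : 0 < b -> 0 < h ->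
 (\int[mu]_(x in `]0%R, h]) (x `^ (b - 1))%:E = (h `^ b / b)%:E)%E.
Proof.
move=> b0 h0.
have E : (h `^ b / b)%:E = (b^-1 * h `^ b - 0)%:E by rewrite subr0 mulrC.
rewrite E; apply: (@ge0_FTC_oc R (fun x => b^-1 * x `^ b)) => //.
- move=> x x0; have dp := is_derive_powR b x0.
 by have := is_deriveZ b^-1 dp; rewrite /GRing.scale/= mulKf// gt_eqF.
- by move=> x x0; exact: continuous_powRl.
- by move=> x _; exact: powR_ge0.
- rewrite -[X in _ --> X](mulr0 b^-1); apply: cvgM; first exact: cvg_cst.
 exact: powR_cvg0.
Qed.

Let small_le (g : R -> R) (c b h : R) : 0 < b -> 0 < h -> 0 <= c -> mfunT g ->
 (forall x, 0 <= g x) -> (forall x, 0 < x -> g x <= c * x `^ (b - 1)) ->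
 \int[mu]_(x in `]0, h]) g x <= c * (h `^ b / b).
Proof.
move=> b0 h0 c0 mg g0 gle.
have H : (\int[mu]_(x in `]0%R, h]) (g x)%:E <= (c * (h `^ b / b))%:E)%E.
 rewrite EFinM -integral_powR0// -ge0_integralZl_EFin//; last 2 first.
 - by move=> x _; rewrite lee_fin powR_ge0.
 - by apply/mEFinP; apply: mfunTS; exact: measurable_powR. apply: ge0_le_integral => //.
 - by move=> x _; rewrite lee_fin.
 - by apply/mEFinP; apply: mfunTS.
 - apply/mEFinP; apply: mfunTS; exact: mfunM.
 - by move=> x; rewrite /= in_itv/= => /andP[x0 _]; rewrite -EFinM lee_fin gle.
rewrite /Rintegral -[leRHS]/(fine (c * (h `^ b / b))%:E) fine_le//.
rewrite ge0_fin_numE; first exact: le_lt_trans H (ltry _).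
by apply: integral_ge0 => x _; rewrite lee_fin.
Qed.

Lemma resf_small (h : R) : 0 < h -> \int[mu]_(x in `]0, h]) f x <= lambda * C * (h `^ alpha / alpha).
Proof.
move=> h0; apply: small_le => //.
- by rewrite mulr_ge0 ?gamC_ge0 ?(ltW lambda0).
- exact: resf_measurable.
- exact: resf_ge0.
- move=> x x0; rewrite (le_trans (resf_le x))// /gk /pk x0 -mulrA.
 rewrite ler_pM2l// ler_wpM2l ?gamC_ge0// ler_piMl ?powR_ge0//. by rewrite -expR0 ler_expR oppr_le0 mulr_ge0 ?ltW.
Qed.

Lemma resf2_small (h : R) : 0 < h ->
 \int[mu]_(x in `]0, h]) (f x ^+ 2) <= (lambda * C) ^+ 2 * (h `^ (2 * alpha - 1) / (2 * alpha - 1)).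
Proof.
move=> h0; apply: small_le => //.
- exact: sqr_ge0.
- by apply: mfunX; exact: resf_measurable.
- by move=> x; exact: sqr_ge0.
- move=> x x0; rewrite (le_trans (resf_sqr_le x))// /pk x0.
 rewrite ler_wpM2l ?sqr_ge0// ler_piMl ?powR_ge0//. by rewrite -expR0 ler_expR oppr_le0 !mulr_ge0 ?ltW.
Qed.

End kernel_props.

(** * Translates of nonincreasing functions and limits of convolutions *)

Section shift_estimates.
Variable R : realType.
Notation mu := (leb R).
Implicit Types (g m : R -> R).

Lemma RintB_L1 g m : L1 g -> L1 m ->
 \int[mu]_x (g x - m x) = \int[mu]_x g x - \int[mu]_x m x.
Proof. by move=> ig im; rewrite RintegralB. Qed.

Lemma Rint_translate g (h : R) : mfunT g ->
 \int[mu]_x g (x + h) = \int[mu]_x g x.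
Proof.
move=> mg; have := @integral_translate R (- h) (EFin \o g).
rewrite /Rintegral => <-; last exact/mEFinP.
by congr fine; apply: eq_integral => x _ /=; rewrite opprK.
Qed.

Lemma Rint_le_L1 g m : L1 g -> L1 m -> (forall x, g x <= m x) ->
 \int[mu]_x g x <= \int[mu]_x m x.
Proof. by move=> ig im gm; apply: le_Rintegral. Qed.

(** For [v > 0] monotonicity removes the absolute value, and [g v - g (v + h)] has integral 0 over
    the line. For [v <= 0] only [g (v + h)] is present, with the wrong sign; the term [2 w (v + h)]
    corrects it. *)
Lemma nincr_shift g (h : R) : L1 g -> suppos g -> (forall x, 0 <= g x) ->
 (forall u v, 0 < u -> u <= v -> g v <= g u) -> 0 < h ->
 \int[mu]_v `|g (v + h) - g v| <= 2 * \int[mu]_(x in `]0, h]) g x.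
Proof.
move=> ig sg g0 gn h0; have mg := L1_mfun ig.
have igh : L1 (fun v => g (v + h)).
 by have := L1_translate (- h) ig; under eq_fun do rewrite opprK.
pose w (v : R) := if v <= h then g v else 0.
have iw : L1 w.
 have -> : w = fun v => g v * \1_(`]-oo, h]%classic) v. apply/funext => v; rewrite /w indicE mem_setE in_itv/=; case: ifP => _; [by rewrite mulr1|by rewrite mulr0].
 apply: L1_bddM => //; split. by apply: mindic; exact: mitv. by exists 1 => x; rewrite indicE; case: (_ \in _); rewrite ?normr1 ?normr0.
have iwh : L1 (fun v => w (v + h)).
 by have := L1_translate (- h) iw; under eq_fun do rewrite opprK.
have le : forall v, `|g (v + h) - g v| <= g v - g (v + h) + 2 * w (v + h).
 move=> v; rewrite /w gerDr; have [v0|v0] := leP v 0. rewrite (sg v)// subr0 sub0r ger0_norm//; lra. rewrite ler0_norm; first by rewrite opprB mulr0 addr0. by rewrite subr_le0 gn// lerDl ltW.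
apply: (@le_trans _ _ (\int[mu]_v (g v - g (v + h) + 2 * w (v + h)))).
 apply: Rint_le_L1 => //; first exact: (integrable_norm (L1B igh ig)). by apply: L1D; [exact: L1B|exact: L1Z].
rewrite RintegralD//; [|exact: L1B|exact: L1Z].
rewrite RintB_L1// Rint_translate// subrr add0r RintegralZl//.
rewrite Rint_translate; last exact: L1_mfun.
rewrite [X in _ <= _ * X]Rintegral_mkcond le_eqVlt; apply/orP; left; apply/eqP; congr (_ * _).
apply: eq_Rintegral => x _; rewrite patchE mem_setE in_itv/= /w.
by have [x0|x0] := ltP 0 x; case: ifP => //= _; rewrite sg.
Qed.

(** [(x - y) ^ 2 <= |x ^ 2 - y ^ 2|] for nonnegative [x] and [y] reduces the claim to the
    nonincreasing function [g ^ 2]. *)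
Lemma nincr_shift2 g (h : R) : L1 (fun x => g x ^+ 2) -> suppos g -> mfunT g -> (forall x, 0 <= g x) ->
 (forall u v, 0 < u -> u <= v -> g v <= g u) -> 0 < h ->
 L1 (fun v => (g (v + h) - g v) ^+ 2) /\
 \int[mu]_v ((g (v + h) - g v) ^+ 2) <= 2 * \int[mu]_(x in `]0, h]) g x ^+ 2.
Proof.
move=> ig sg mg g0 gn h0.
have le (x y : R) : 0 <= x -> 0 <= y -> (x - y) ^+ 2 <= `|x ^+ 2 - y ^+ 2|.
 move=> x0 y0; rewrite -(ger0_norm (sqr_ge0 (x - y))) subr_sqr expr2 !normrM ler_wpM2l//. by rewrite (ger0_norm (addr_ge0 x0 y0)) ler_norml; apply/andP; split; lra.
have igh : L1 (fun v => g (v + h) ^+ 2).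
 by have := L1_translate (- h) ig; under eq_fun do rewrite opprK.
have igd : L1 (fun v => `|g (v + h) ^+ 2 - g v ^+ 2|) by exact: (integrable_norm (L1B igh ig)).
have i : L1 (fun v => (g (v + h) - g v) ^+ 2).
 apply: (L1_le _ igd). apply: mfunX; apply: mfunB => //. by apply: mcompT => //; exact: mfunD. by move=> v; rewrite ger0_norm ?sqr_ge0// le.
split=> //.
apply: le_trans (nincr_shift ig _ _ _ h0); last 3 first.
- by move=> s s0; rewrite sg// expr0n.
- by move=> x; exact: sqr_ge0.
- by move=> u v u0 uv; rewrite ler_pXn2r ?nnegrE//; exact: gn.
by apply: Rint_le_L1 => // v; exact: le.
Qed.

Lemma rconv_cvg g m (l : R) : L1 g -> bddm m -> m t @[t --> +oo] --> l ->
 rconv g m t @[t --> +oo] --> l * \int[mu]_x g x.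
Proof.
move=> ig [mm [M hM]] ml; have mg := L1_mfun ig.
apply/cvg_pinftyP => u uoo.
have -> : (fun n => rconv g m (u n)) = fun n => fine (\int[mu]_s (m (u n - s) * g s)%:E)%E.
 by apply/funext => n; rewrite rconvC.
have -> : l * \int[mu]_x g x = fine (\int[mu]_s (l * g s)%:E)%E.
 by rewrite -RintegralZl.
have il : L1 (fun s => l * g s) by exact: L1Z.
apply: fine_cvg; rewrite fineK; last exact: integrable_fin_num.
have := @dominated_cvg _ _ _ mu setT measurableT (fun n s => (m (u n - s) * g s)%:E) (fun s => (l * g s)%:E) (fun s => (M * `|g s|)%:E).
apply.
- move=> n; apply/mEFinP; apply: mfunM => //.
 exact: mreflect.
- move=> s _; apply: cvg_EFin; first by near=> n.
 apply: cvgM; last exact: cvg_cst. move/cvg_pinftyP : ml; apply. by apply/cvgryPge => A; near=> n; rewrite lerBrDr; near: n; move/cvgryPge : uoo; apply.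
- by [].
- by apply: L1Z; exact: (integrable_norm ig).
- by move=> n s _; rewrite lee_fin normrM ler_wpM2r.
Unshelve. all: end_near. Qed.

Lemma rconv_bound g m (M t : R) : L1 g -> bddm m -> (forall x, `|m x| <= M) ->
 `|rconv g m t| <= M * \int[mu]_x `|g x|.
Proof.
move=> ig bm hM; have mg := L1_mfun ig; rewrite rconvC//; last by case: bm.
have i : L1 (fun s => m (t - s) * g s).
 rewrite (_ : (fun s => _) = fun s => g s * m (t - s)); last by apply/funext => s; rewrite mulrC. apply: (L1_bddM ig); have [mm [M' hM']] := bm.
 by split; [exact: (mreflect t mm)|exists M' => y; exact: hM'].
rewrite (le_trans (le_normr_Rintegral measurableT i))// -RintegralZl//; last exact: (integrable_norm ig).
apply: Rint_le_L1; [exact: (integrable_norm i)|by apply: L1Z; exact: (integrable_norm ig)|].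
by move=> x; rewrite normrM ler_wpM2r.
Qed.

Lemma rconv_shift g m (M t h : R) : L1 g -> suppos g -> (forall x, 0 <= g x) ->
 (forall u v, 0 < u -> u <= v -> g v <= g u) -> bddm m -> (forall x, `|m x| <= M) -> 0 <= M -> 0 < h ->
 `|rconv g m (t + h) - rconv g m t| <= 2 * M * \int[mu]_(x in `]0, h]) g x.
Proof.
move=> ig sg g0 gn bm hM M0 h0.
have igh : L1 (fun v => g (v + h)).
 by have := L1_translate (- h) ig; under eq_fun do rewrite opprK.
have -> : rconv g m (t + h) - rconv g m t = rconv (fun v => g (v + h) - g v) m t.
 rewrite /rconv -RintB_L1; [|exact: rconv_L1_pt|exact: rconv_L1_pt]. by apply: eq_Rintegral => s _; rewrite mulrBl; congr (g _ * _ - _); ring.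
rewrite (le_trans (rconv_bound t (L1B igh ig) bm hM))// mulrAC mulrC -mulrA.
by rewrite mulrA ler_wpM2r//; exact: nincr_shift.
Qed.
End shift_estimates.

Section resolvent_limits.
Variables (R : realType) (alpha rho lambda : R) (Rl : R -> R).
Hypotheses (alpha1 : 2^-1 < alpha) (alpha2 : alpha < 1) (rho0 : 0 < rho) (lambda0 : 0 < lambda) (hRl : is_resolvent (gamma_kernel alpha rho) lambda Rl).
Notation mu := (leb R).
Notation f := (resf Rl).

Lemma Rl_cvg : Rl t @[t --> +oo] --> 1 - \int[mu]_x f x.
Proof.
have i := resf_L1 alpha1 alpha2 rho0 lambda0 hRl.
have mf := L1_mfun i.
pose m : R -> R := \1_(`[0, +oo[%classic).
have bu : bddm m.
 split; first by apply: mindic; exact: mitv. by exists 1 => x; rewrite /m indicE; case: (_ \in _); rewrite ?normr1 ?normr0.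
have c1 : m t @[t --> +oo] --> (1 : R).
 apply: cvg_near_cst; near=> t; rewrite /m indicE mem_setE in_itv/= andbT. by have -> : 0 <= t by near: t; exact: nbhs_pinfty_ge.
have := rconv_cvg i bu c1; rewrite mul1r => h.
have h2 : 1 - rconv f m t @[t --> +oo] --> 1 - \int[mu]_x f x.
 by apply: cvgB => //; exact: cvg_cst.
apply: cvg_trans h2; apply: near_eq_cvg; near=> t.
have t0 : 0 <= t by near: t; exact: nbhs_pinfty_ge.
rewrite (Rl_resf alpha1 alpha2 rho0 hRl t0) rconvC//; last by case: bu.
congr (_ - _); rewrite [RHS]Rintegral_mkcond; apply: eq_Rintegral => s _.
rewrite patchE /m indicE !mem_setE !in_itv/= andbT subr_ge0.
have [s0|s0] := leP 0 s; first by case: (s <= t); rewrite /= ?mul1r ?mul0r.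
by rewrite /= resf_supp ?mulr0// ltW.
Unshelve. all: end_near. Qed.
End resolvent_limits.

(** * Moments of stochastic integrals of simple integrands *)

Section binomial_gauss.
(** The double factorial [(2 j - 1)!!], moment of order [2 j] of the standard Gaussian law. *)
Fixpoint dfact (j : nat) : nat := if j is i.+1 then (i.*2.+1 * dfact i)%N else 1%N.

(** From [j] to [j + 1] the left side is multiplied by [(2 q - 2 j) (2 q - 2 j - 1) / (2 j + 2)],
    the right side by [(2 q - 2 j) (2 q - 1) / (2 j + 2)]. *)
Lemma bin_dfact (q j : nat) :
 ('C(q.*2, j.*2) * dfact j <= 'C(q, j) * (q.*2.-1) ^ j)%N.
Proof.
elim: j => [|j IH]; first by rewrite !bin0.
have [qj|jq] := leqP q j.
 by rewrite bin_small // ltn_double ltnS.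
have e1 : (j.*2.+2 * j.*2.+1 * 'C(q.*2, j.*2.+2) = (q.*2 - j.*2) * (q.*2 - j.*2.+1) * 'C(q.*2, j.*2))%N.
 by rewrite [RHS]mulnAC -mul_bin_left mulnAC -[RHS]mulnA [X in (_ = _ * X)%N]mulnC -mul_bin_left; ring.
have e2 := mul_bin_left q j.
have -> : (j.+1).*2 = j.*2.+2 by rewrite doubleS.
rewrite /= -(leq_pmul2l (isT : (0 < j.*2.+2)%N)).
have -> : (j.*2.+2 * ('C(q.*2, j.*2.+2) * (j.*2.+1 * dfact j)) = (q.*2 - j.*2) * (q.*2 - j.*2.+1) * ('C(q.*2, j.*2) * dfact j))%N.
 by rewrite !mulnA -e1; ring.
have -> : (j.*2.+2 * ('C(q, j.+1) * q.*2.-1 ^ j.+1) = (q.*2 - j.*2) * q.*2.-1 * ('C(q, j) * q.*2.-1 ^ j))%N.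
 rewrite -doubleB -!muln2 expnS; transitivity (2 * (j.+1 * 'C(q, j.+1)) * ((q * 2).-1 * (q*2).-1 ^ j))%N; first by ring. by rewrite e2; ring.
apply: leq_mul => //; apply: leq_mul => //.
by rewrite -subn1; apply: leq_sub2l.
Qed.

Lemma sum_parity (V : nmodType) (F : nat -> V) (q : nat) :
 \sum_(k < q.*2.+1) F k = \sum_(j < q.+1) F j.*2 + \sum_(j < q) F j.*2.+1.
Proof.
elim: q => [|q IH]; first by rewrite /= !big_ord_recl !big_ord0 !addr0.
rewrite doubleS !big_ord_recr /= -(big_ord_recr (q.*2) (fun i : 'I_ _ => F i)) /= IH.
rewrite !big_ord_recr /= -!addrA; congr (_ + _).
by congr (_ + _); rewrite addrA [RHS]addrC doubleS.
Qed.

End binomial_gauss.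

Section density.
Import HBNNSimple.
Local Open Scope ereal_scope.
Variables (d : measure_display) (T : measurableType d) (R : realType).
Variables (m mu : {measure set T -> \bar R}) (p : T -> R).
Hypotheses (mp : mfunT p) (p0 : forall x, (0 <= p x)%R) (mE : forall A, measurable A -> m A = \int[mu]_(x in A) (p x)%:E).

Let indicE' (A : set T) : measurable A ->
 \int[m]_x (\1_A x)%:E = \int[mu]_x ((\1_A x) * p x)%:E.
Proof.
move=> mA; rewrite integral_indic// setIT mE//.
rewrite [LHS]integral_mkcond; apply: eq_integral => x _.
by rewrite patchE indicE; case: (x \in A); rewrite ?mul1r ?mul0r.
Qed.

Let nnsfunE (f : {nnsfun T >-> R}) :
 \int[m]_x (f x)%:E = \int[mu]_x ((f x) * p x)%:E.
Proof.
under [LHS]eq_integral do rewrite fimfunE -fsumEFin//.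
rewrite [LHS]ge0_integral_fsum//; last 2 first.
 - by move=> r; exact/mEFinP/mcompT.
 - by move=> n x _; rewrite EFinM nnfun_muleindic_ge0.
under [RHS]eq_integral.
 move=> x xD; rewrite EFinM fimfunE -fsumEFin// muleC ge0_mule_fsumr; last first. by move=> r; rewrite EFinM nnfun_muleindic_ge0. over.
rewrite [RHS]ge0_integral_fsum//; last 2 first.
 - by move=> r; apply/mEFinP; apply: mfunM => //; apply: mfunM.
 - move=> n x _; rewrite EFinM mule_ge0//; first by rewrite lee_fin. by rewrite nnfun_muleindic_ge0.
apply: eq_fsbigr => r _.
have [r0|r0] := leP 0%R r.
 transitivity (r%:E * \int[m]_x (\1_(f @^-1` [set r]) x)%:E). rewrite -ge0_integralZl//. exact/mEFinP/mindic. rewrite indicE'// -ge0_integralZl//.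
 - by apply: eq_integral => x _; rewrite -!EFinM; congr EFin; ring.
 - by apply/mEFinP; apply: mfunM => //; exact: mindic.
 - by move=> x _; rewrite lee_fin mulr_ge0.
have e0 : f @^-1` [set r] = set0.
 apply/seteqP; split => x //= fx; have : (0 <= f x)%R by []. by rewrite fx leNgt r0.
rewrite e0 !integral0_eq//.
 by move=> x _; rewrite indic0 mulr0 mule0.
by move=> x _; rewrite indic0 mulr0.
Qed.

Lemma ge0_integral_density (g : T -> R) : mfunT g -> (forall x, (0 <= g x)%R) ->
 \int[m]_x (g x)%:E = \int[mu]_x (g x * p x)%:E.
Proof.
move=> mg g0; have mE' : mfunT (EFin \o g) by exact/mEFinP.
pose f_ := nnsfun_approx measurableT mE'.
have cf x : (f_ n x)%:E @[n --> \oo] --> (g x)%:E.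
 by apply: cvg_nnsfun_approx => // y _; rewrite lee_fin.
transitivity (lim (\int[m]_x (f_ n x)%:E @[n --> \oo])).
 rewrite -monotone_convergence//=.
 - by apply: eq_integral => x _; apply/esym/cvg_lim => //; exact: cf.
 - by move=> n; exact/mEFinP/mfunTS.
 - by move=> n x _; rewrite lee_fin.
 - by move=> x _ a b mn; rewrite lee_fin; exact/lefP/nd_nnsfun_approx.
rewrite [X in lim (X @ _)](_ : _ = fun n => \int[mu]_x ((f_ n x) * p x)%:E); last first.
 by apply/funext => n; exact: nnsfunE.
rewrite -monotone_convergence//=.
- apply: eq_integral => x _; apply/cvg_lim => //; rewrite EFinM.
 by under eq_fun do rewrite EFinM; apply: cvgeZr => //; exact: cf.
- by move=> n; apply/mEFinP; apply: mfunM => //; exact: mfunTS.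
- by move=> n x _; rewrite lee_fin mulr_ge0.
- by move=> x _ a b mn; rewrite lee_fin ler_wpM2r//; exact/lefP/nd_nnsfun_approx.
Qed.

End density.

(** * Gaussian moments *)

Section gaussian_moments.
Variables (R : realType).
Notation mu := (leb R).

Let ge_ (c x : R) := expR (- (c * x ^+ 2)).

Let ge_bound (j : nat) (c : R) : 0 < c -> exists C : R, forall x : R, `|x| ^+ j * ge_ c x <= C.
Proof.
move=> c0; exists (1 + c^-1 ^+ j.+1 * (j.+1)`!%:R) => x; rewrite /ge_.
have y0 : 0 <= c * x ^+ 2 by rewrite mulr_ge0 ?sqr_ge0 ?(ltW c0).
have h1 : (c * x ^+ 2) ^+ j.+1 <= (j.+1)`!%:R * expR (c * x ^+ 2).
 have := expR_ge1Dxn j y0; move: (expR _) => e h. rewrite [leRHS]mulrC -ler_pdivrMr ?ltr0n ?fact_gt0//. by rewrite (le_trans _ h)// lerDr.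
have h2 : `|x| ^+ j <= 1 + (x ^+ 2) ^+ j.+1.
 have [x1|x1] := leP `|x| 1. by rewrite (le_trans (exprn_ile1 j (normr_ge0 x) x1))// lerDl exprn_ge0// sqr_ge0.
 rewrite -[x ^+ 2]real_normK ?num_real// -exprM ler_wpDl//. by apply: ler_weXn2l; [exact: ltW|lia].
rewrite expRN ler_pdivrMr ?expR_gt0// (le_trans h2)//.
rewrite mulrDl mul1r lerD//.
 by rewrite -expR0 ler_expR.
rewrite -mulrA; move: h1; rewrite exprMn => h1.
by rewrite exprVn ler_pdivlMl ?exprn_gt0.
Qed.

Let ge_L1 (c : R) : 0 < c -> L1 (ge_ c).
Proof.
move=> c0; pose s := Num.sqrt (2 * c)^-1.
have s0 : s != 0 by rewrite gt_eqF// sqrtr_gt0 invr_gt0 mulr_gt0.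
have p0 : normal_peak s != 0 by rewrite gt_eqF// normal_peak_gt0.
have := L1Z (normal_peak s)^-1 (@integrable_normal_pdf R 0 s).
rewrite (_ : (fun s0 => _) = ge_ c)//; apply/funext => x.
rewrite normal_pdfE//= mulKf// /normal_fun /ge_ subr0 sqr_sqrtr; last first.
 by rewrite invr_ge0 mulr_ge0 ?(ltW c0).
by congr expR; field; rewrite gt_eqF.
Qed.

Let ge_cont (c : R) : continuous (ge_ c).
Proof.
move=> x; apply: continuous_comp; last exact: continuous_expR.
by apply: cvgN; apply: cvgM; [exact: cvg_cst|exact: exprn_continuous].
Qed.

Let xge_cont (j : nat) (c : R) : continuous (fun x : R => x ^+ j * ge_ c x).
Proof. by move=> x; apply: cvgM; [exact: exprn_continuous|exact: ge_cont]. Qed.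

Let xge_L1 (j : nat) (c : R) : 0 < c -> L1 (fun x : R => x ^+ j * ge_ c x).
Proof.
move=> c0; have c20 : 0 < c / 2 by rewrite divr_gt0.
have [C hC] := ge_bound j c20.
apply: (L1_le _ (L1Z C (ge_L1 c20))).
 by apply: cmfun; exact: xge_cont.
move=> x; rewrite normrM normrX [`|ge_ c x|]ger0_norm ?expR_ge0//.
rewrite (_ : ge_ c x = ge_ (c / 2) x * ge_ (c / 2) x).
 by rewrite mulrA ler_wpM2r ?expR_ge0.
by rewrite /ge_ -expRD; congr expR; field.
Qed.

Let ge_derive (j : nat) (c x : R) : is_derive x (1:R) (fun x : R => x ^+ j * ge_ c x)
 (j%:R * (x ^+ j.-1 * ge_ c x) - 2 * c * (x ^+ j.+1 * ge_ c x)).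
Proof.
have d1 : is_derive x (1:R) (fun x : R => - (c * x ^+ 2)) (- (c * (2%:R * x ^+ 1))).
 by apply: is_derive_eq; rewrite /GRing.scale/=; ring.
have d2 : is_derive x (1:R) (ge_ c) (- (c * (2%:R * x ^+ 1)) * ge_ c x).
 have := @is_derive1_comp R expR (fun x : R => - (c * x ^+ 2)) x _ _ (is_derive_expR _) d1. by rewrite mulrC.
have d3 : is_derive x (1:R) (fun x : R => x ^+ j) (j%:R * x ^+ j.-1).
 by apply: DeriveDef; [exact: exprn_derivable|rewrite exp_derive /GRing.scale/= mulr1].
have := is_deriveM d3 d2; rewrite /GRing.scale/= => H.
by apply: is_derive_eq H _; rewrite expr1 exprS; ring.
Qed.

Let tail0 (j : nat) (c : R) : 0 < c -> (n%:R ^+ j * ge_ c n%:R) @[n --> \oo] --> (0 : R).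
Proof.
move=> c0; have [C hC] := ge_bound j.+1 c0.
have hc : (C * n.+1%:R^-1 : R) @[n --> \oo] --> (0 : R).
 by rewrite -[X in _ --> X](mulr0 C); apply: cvgM; [exact: cvg_cst|exact: cvg_harmonic].
rewrite -(cvg_shiftS (fun n => n%:R ^+ j * ge_ c n%:R)).
apply: (@squeeze_cvgr _ _ _ _ (fun=> 0) (fun n => C * n.+1%:R^-1)) => //; last exact: cvg_cst.
near=> n; rewrite mulr_ge0 ?expR_ge0//= ler_pdivlMr//.
by have := hC n.+1%:R; rewrite ger0_norm// exprSr mulrAC.
Unshelve. all: end_near. Qed.

Let ge_N (c x : R) : ge_ c (- x) = ge_ c x. Proof. by rewrite /ge_ sqrrN. Qed.

(** The derivative of [x ^ j exp (- c x ^ 2)] has integral 0 over the line, its integrals over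
    bounded intervals being boundary values that vanish in the limit. This gives the recursion of
    the Gaussian moments. *)
Let ibp (j : nat) (c : R) : 0 < c ->
 j%:R * \int[mu]_x (x ^+ j.-1 * ge_ c x) = 2 * c * \int[mu]_x (x ^+ j.+1 * ge_ c x).
Proof.
move=> c0; apply/eqP; rewrite -subr_eq0; apply/eqP.
have i1 := L1Z j%:R (xge_L1 j.-1 c0); have i2 := L1Z (2 * c) (xge_L1 j.+1 c0).
rewrite -RintegralZl//; last exact: xge_L1.
rewrite -RintegralZl//; last exact: xge_L1.
rewrite -RintB_L1//.
set g := fun x : R => _.
have ig : L1 g by exact: L1B.
pose F x := x ^+ j * ge_ c x.
have cg : continuous g.
 by move=> x; apply: cvgB; (apply: cvgM; [exact: cvg_cst|exact: xge_cont]).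
have E n : \int[mu]_(x in `[- n.+1%:R, n.+1%:R]) g x = F n.+1%:R - F (- n.+1%:R).
 rewrite /Rintegral (@continuous_FTC2 _ g F)//.
 - by rewrite ltrNl (lt_trans (_ : _ < 0))// ?oppr_lt0.
 - exact: continuous_subspaceT.
 - split.
  + by move=> x _; have [] := ge_derive j c x.
  + by apply: cvg_at_right_filter; exact: xge_cont.
  + by apply: cvg_at_left_filter; exact: xge_cont.
 - by move=> x _; rewrite derive1E; have [_ ->] := ge_derive j c x.
have c1 : \int[mu]_(x in `[- n.+1%:R, n.+1%:R]) g x @[n --> \oo] --> (0 : R).
 rewrite (_ : (fun n => _) = (fun n : nat => F n.+1%:R - (-1) ^+ j * F n.+1%:R)); last first. by apply/funext => n; rewrite E /F ge_N -(mulN1r n.+1%:R) exprMn mulrA.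
 have cF : F n.+1%:R @[n --> \oo] --> (0 : R). by have := tail0 j c0; rewrite -(cvg_shiftS (fun n => n%:R ^+ j * ge_ c n%:R)).
 have cF2 : (-1) ^+ j * F n.+1%:R @[n --> \oo] --> ((-1) ^+ j * 0 : R). by apply: cvgM => //; exact: cvg_cst. rewrite -[X in _ --> X](subr0 (0:R)) -[X in _ --> 0 - X](mulr0 ((-1) ^+ j)). exact: cvgB.
apply: (cvg_unique _ _ c1) => //.
pose gn n x := (\1_(`[- n.+1%:R, n.+1%:R]%classic) x * g x : R).
have -> : (fun n => \int[mu]_(x in `[- n.+1%:R, n.+1%:R]) g x) = fun n => fine (\int[mu]_x (gn n x)%:E)%E.
 apply/funext => n; rewrite Rintegral_mkcond; congr fine; apply: eq_integral => x _. by rewrite patchE /gn indicE; case: (x \in _); rewrite ?mul1r ?mul0r.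
apply: fine_cvg; rewrite fineK; last exact: integrable_fin_num.
apply: (@dominated_cvg _ _ _ mu setT measurableT (fun n x => (gn n x)%:E) _ (fun x => `|g x|%:E)).
- move=> n; apply/mEFinP; apply: mfunM; last exact: L1_mfun.
 by apply: mindic; exact: mitv.
- move=> x _; apply: cvg_near_cst; near=> n; rewrite /gn indicE mem_setE in_itv/=.
 have : `|x| < n%:R by near: n; exact: nbhs_infty_gtr. move=> /ltW/le_trans -/(_ n.+1%:R); rewrite ler_nat leqnSn => /(_ isT). by rewrite ler_norml => ->; rewrite mul1r.
- by [].
- exact: (integrable_norm ig).
- move=> n x _; rewrite lee_fin /gn normrM indicE.
 by case: (x \in _); rewrite ?normr1 ?normr0 ?mul1r ?mul0r.
Unshelve. all: end_near. Qed.

Section var.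
Variable h : R.
Hypothesis h0 : 0 < h.
Notation s := (Num.sqrt h).
Notation N := (normal_prob 0 s).

Let s0 : s != 0. Proof. by rewrite gt_eqF// sqrtr_gt0. Qed.
Let c : R := (h *+ 2)^-1.
Let c0 : 0 < c. Proof. by rewrite invr_gt0 pmulrn_lgt0. Qed.

Let pdfE x : normal_pdf 0 s x = normal_peak s * ge_ c x.
Proof.
rewrite normal_pdfE// /normal_fun /ge_ subr0 sqr_sqrtr; last exact: ltW.
by congr (_ * expR _); rewrite /c mulNr mulrC.
Qed.

Definition gmom (j : nat) : R := \int[mu]_x (x ^+ j * normal_pdf 0 s x).

Let gmomE j : gmom j = normal_peak s * \int[mu]_x (x ^+ j * ge_ c x).
Proof.
rewrite -RintegralZl//; last exact: xge_L1.
by apply: eq_Rintegral => x _; rewrite pdfE mulrCA.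
Qed.

Lemma gmom_L1 j : L1 (fun x : R => x ^+ j * normal_pdf 0 s x).
Proof.
have := L1Z (normal_peak s) (xge_L1 j c0).
by rewrite (_ : (fun _ => _) = fun x => x ^+ j * normal_pdf 0 s x)//; apply/funext => x; rewrite pdfE mulrCA.
Qed.

Lemma gmom0 : gmom 0 = 1.
Proof.
rewrite /gmom (_ : \int[mu]_x _ = \int[mu]_x normal_pdf 0 s x).
 by rewrite /Rintegral integral_normal_pdf.
by apply: eq_Rintegral => x _; rewrite mul1r.
Qed.

Lemma gmomSS j : gmom j.+2 = j.+1%:R * h * gmom j.
Proof.
rewrite !gmomE; have := ibp j.+1 c0; rewrite /= => e.
have -> : \int[mu]_x (x ^+ j.+2 * ge_ c x) = j.+1%:R * \int[mu]_x (x ^+ j * ge_ c x) / (2 * c).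
 by rewrite e mulrC mulKf// gt_eqF// mulr_gt0.
by rewrite /c; field; rewrite !gt_eqF// ?pmulrn_lgt0.
Qed.

Lemma gmom1 : gmom 1 = 0.
Proof.
rewrite gmomE; have := ibp 0 c0; rewrite mul0r => /esym/eqP.
by rewrite mulf_eq0 gt_eqF ?mulr_gt0//= => /eqP ->; rewrite mulr0.
Qed.

Lemma gmom_odd j : gmom j.*2.+1 = 0.
Proof. by elim: j => [|j IH]; rewrite ?gmom1// doubleS gmomSS IH mulr0. Qed.

Lemma gmom_even j : gmom j.*2 = (dfact j)%:R * h ^+ j.
Proof.
elim: j => [|j IH]; first by rewrite gmom0 mulr1.
by rewrite doubleS gmomSS IH /= natrM exprS; ring.
Qed.

Let momE (q : nat) (x y : R) :
 (\int[N]_g ((x + y * g) ^+ q.*2)%:E)%E =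
 (\sum_(k < q.*2.+1) (x ^+ (q.*2 - k) * y ^+ k * gmom k) *+ 'C(q.*2, k))%:E.
Proof.
rewrite (@ge0_integral_density _ _ _ N mu (normal_pdf 0 s)); last 5 first.
- exact: measurable_normal_pdf.
- by move=> z; exact: normal_pdf_ge0.
- by [].
- by apply: mfunX; apply: mfunD => //; exact: mfunM.
- by move=> z; rewrite -mul2n exprM exprn_ge0// sqr_ge0.
pose t (k : nat) (g : R) := (x ^+ (q.*2 - k) * y ^+ k * 'C(q.*2, k)%:R) * (g ^+ k * normal_pdf 0 s g).
have it k : L1 (t k) by apply: L1Z; exact: gmom_L1.
transitivity (\int[mu]_g (\sum_(k < q.*2.+1) (t k g)%:E))%E.
 apply: eq_integral => g _; rewrite exprDn sumEFin mulr_suml; congr EFin. by apply: eq_bigr => k _; rewrite /t exprMn -mulr_natr; ring.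
rewrite integral_sum//; last by move=> k; exact: it.
rewrite -sumEFin; apply: eq_bigr => k _.
rewrite -[LHS]fineK; last by apply: integrable_fin_num => //; exact: it.
congr EFin; rewrite -/(Rintegral mu setT (t k)) RintegralZl//; last exact: gmom_L1.
by rewrite -mulr_natr -/(gmom k); ring.
Qed.

Lemma gauss_sqr (x y : R) :
 (\int[N]_g ((x + y * g) ^+ 2)%:E = (x ^+ 2 + h * y ^+ 2)%:E)%E.
Proof.
rewrite (momE 1) !big_ord_recl big_ord0 /= /bump /= gmom0 gmom1 (gmom_even 1) /=.
congr EFin.
change (x ^+ 2 * 1 * 1 *+ 1 + ((x ^+ 1 * y ^+ 1 * 0) *+ 2 + ((1 * y ^+ 2 * (1%:R * h ^+ 1)) *+ 1 + 0)) = x ^+ 2 + h * y ^+ 2).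
ring.
Qed.

(** Both sides are expanded in powers of [x ^ 2] and [h y ^ 2], the odd moments being zero, and
    compared term by term with [bin_dfact]. The constant [2 q - 1] is the one that the smallness of
    [c] has to beat. *)
Lemma gauss_hyper (q : nat) (x y : R) :
 (\int[N]_g ((x + y * g) ^+ q.*2)%:E <= ((x ^+ 2 + (q.*2.-1)%:R * h * y ^+ 2) ^+ q)%:E)%E.
Proof.
rewrite momE lee_fin (sum_parity (fun k => x ^+ (q.*2 - k) * y ^+ k * gmom k *+ 'C(q.*2, k)) q) [X in _ + X]big1 ?addr0; last first.
 by move=> j _; rewrite gmom_odd mulr0 mul0rn.
rewrite exprDn; apply: ler_sum => j _; rewrite gmom_even.
have jq : (j <= q)%N by rewrite -ltnS.
have dE (z : R) i : z ^+ i.*2 = z ^+ 2 ^+ i by rewrite -mul2n exprM.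
rewrite -doubleB !dE -[leLHS]mulr_natr -[leRHS]mulr_natr.
have := sqr_ge0 y; have := sqr_ge0 x; move: (x ^+ 2) (y ^+ 2) => X Y X0 Y0; rewrite !exprMn.
have -> : X ^+ (q - j) * Y ^+ j * ((dfact j)%:R * h ^+ j) * 'C(q.*2, j.*2)%:R =
 (X ^+ (q - j) * Y ^+ j * h ^+ j) * ('C(q.*2, j.*2) * dfact j)%:R. by rewrite natrM; ring.
have -> : X ^+ (q - j) * (q.*2.-1%:R ^+ j * h ^+ j * Y ^+ j) * 'C(q, j)%:R =
 (X ^+ (q - j) * Y ^+ j * h ^+ j) * ('C(q, j) * (q.*2.-1) ^ j)%:R. by rewrite natrM natrX; ring.
rewrite ler_wpM2l ?ler_nat ?bin_dfact// !mulr_ge0 ?exprn_ge0//.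
exact: ltW.
Qed.
End var.
End gaussian_moments.

Lemma pow_convex (R : realDomainType) (q : nat) (th u v : R) : 0 <= th <= 1 -> 0 <= u -> 0 <= v ->
 (th * u + (1 - th) * v) ^+ q <= th * u ^+ q + (1 - th) * v ^+ q.
Proof.
move=> /andP[t0 t1] u0 v0; have t10 : 0 <= 1 - th by rewrite subr_ge0.
elim: q => [|q IH]; first by rewrite !expr0 !mulr1 addrC subrK.
rewrite exprS; apply: (@le_trans _ _ ((th * u + (1 - th) * v) * (th * u ^+ q + (1 - th) * v ^+ q))).
 by rewrite ler_wpM2l// addr_ge0// mulr_ge0.
rewrite -subr_ge0.
rewrite (_ : _ - _ = th * (1 - th) * ((u ^+ q - v ^+ q) * (u - v))); last first.
 by rewrite !exprS; ring.
rewrite mulr_ge0//; first exact: mulr_ge0.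
have [uv|/ltW vu] := leP u v.
 by rewrite mulr_le0 ?subr_le0//; apply: lerXn2r => //; rewrite nnegrE.
by rewrite mulr_ge0 ?subr_ge0//; apply: lerXn2r => //; rewrite nnegrE.
Qed.

(** Jensen's inequality with weights proportional to [a] and [b]. Integrated against moments of
    order [q] at most [a ^ q G] and [b ^ q G], it gives [(a + b) ^ q G]: Minkowski's inequality
    without roots. *)
Lemma pow_add_le (R : realFieldType) (q : nat) (a b x y : R) : 0 < a -> 0 < b -> 0 <= x -> 0 <= y ->
 (x + y) ^+ q <= (a + b) ^+ q * (a / (a + b) * (x / a) ^+ q + b / (a + b) * (y / b) ^+ q).
Proof.
move=> a0 b0 x0 y0; have ab : 0 < a + b by exact: addr_gt0.
have -> : x + y = (a + b) * (a / (a + b) * (x / a) + (1 - a / (a + b)) * (y / b)).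
 by field; rewrite !gt_eqF.
have -> : b / (a + b) = 1 - a / (a + b) by field; rewrite gt_eqF.
rewrite exprMn ler_pM2l ?exprn_gt0//; apply: pow_convex; rewrite ?divr_ge0 ?(ltW a0) ?(ltW b0)//.
 by rewrite ler_pdivrMr// mul1r lerDl ltW.
exact: ltW.
Qed.

(** * Sums of adapted coefficients against Brownian increments *)

Section brownian.
Context d (Omega : measurableType d) (R : realType) (P : probability Omega R).
Variables (F : R -> set (set Omega)) (W : R -> Omega -> R).
Hypotheses (hF : usual_conditions P F) (hW : is_brownian P F W).

(** Adaptedness phrased as measurability on the space carrying the sigma-algebra generated by [F t],
    so that the general lemmas on measurable functions apply; [meas_wrtP] links it to [meas_wrt]. *)
Definition mF d' (T : measurableType d') (t : R) (Y : Omega -> T) :=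
 measurable_fun [set: g_sigma_algebraType (F t)] Y.

Lemma mF_set d' (T : measurableType d') t (Y : Omega -> T) : 0 <= t ->
 mF t Y <-> (forall B, measurable B -> F t (Y @^-1` B)).
Proof.
move=> t0; have [h _ _ _] := hF; have [sF _] := h t t0.
have E : <<s F t >> = F t by exact: sigma_algebra_id.
split=> [mY B mB|mY _ B mB].
 by have := mY measurableT _ mB; rewrite setTI /measurable/= E.
by rewrite setTI /measurable/= E; exact: mY.
Qed.

Lemma meas_wrtP t (Y : Omega -> R) : 0 <= t -> meas_wrt (F t) Y <-> mF t Y.
Proof. by move=> t0; split => h; [apply/mF_set|move/(mF_set _ t0) : h]. Qed.

Lemma mF_mono d' (T : measurableType d') s t (Y : Omega -> T) : 0 <= s -> s <= t -> mF s Y -> mF t Y.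
Proof.
move=> s0 st /(mF_set _ s0) mY; have [_ h _ _] := hF.
by apply/(mF_set _ (le_trans s0 st)) => B mB; apply: (h s t s0 st); exact: mY.
Qed.

Lemma mF_meas d' (T : measurableType d') t (Y : Omega -> T) : 0 <= t -> mF t Y -> mfunT Y.
Proof.
move=> t0 /(mF_set _ t0) mY _ B mB; have [h _ _ _] := hF; have [_ sF] := h t t0.
by rewrite setTI; apply: sF; exact: mY.
Qed.

Lemma W_mF t : 0 <= t -> mF t (W t).
Proof. by move=> t0; apply/meas_wrtP => //; have [h _ _ _ _] := hW; exact: h. Qed.

(** In place of conditional expectations: the past [Y] and the increment are independent, so their
    joint law is the product of the law of [Y] and a Gaussian law, and Tonelli's theorem applies. *)
Lemma step_law d' (T : measurableType d') (s t : R) (Y : Omega -> T) (Phi : T * R -> R) :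
 0 <= s -> s < t -> mF s Y -> mfunT Phi -> (forall x, 0 <= Phi x) ->
 (\int[P]_w (Phi (Y w, W t w - W s w))%:E =
  \int[P]_w \int[normal_prob 0 (Num.sqrt (t - s))]_g (Phi (Y w, g))%:E)%E.
Proof.
move=> s0 st mY mPhi Phi0.
have t0 : 0 <= t by rewrite (le_trans s0)// ltW.
have mYO := mF_meas s0 mY.
have mD : mfunT (fun w => W t w - W s w).
 by apply: mfunB; [exact: (mF_meas t0 (W_mF t0))|exact: (mF_meas s0 (W_mF s0))].
have mZ : mfunT (fun w => (Y w, W t w - W s w)) by exact: measurable_fun_pair.
pose Y' : {mfun Omega >-> T} := mfun_Sub (mem_set mYO).
pose Z' : {mfun Omega >-> (T * measurableTypeR R)%type} := mfun_Sub (mem_set (mZ : mfunT (fun w => (Y w, W t w - W s w : measurableTypeR R)))).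
pose N : probability (measurableTypeR R) R := normal_prob 0 (Num.sqrt (t - s)).
have mE : mfunT (EFin \o Phi) by exact/mEFinP.
have -> : (\int[P]_w (Phi (Y w, W t w - W s w))%:E = \int[distribution P Z']_z (Phi z)%:E)%E.
 by rewrite ge0_integral_distribution//; move=> z /=; rewrite lee_fin.
pose PZ : probability (T * measurableTypeR R)%type R := distribution P Z'.
pose PY : probability T R := distribution P Y'.
have key : (\int[PZ]_z (Phi z)%:E = \int[(PY \x N)]_z (Phi z)%:E)%E.
 apply: eq_measure_integral => A mA _; apply/esym. apply: product_measure_unique => // A1 B1 mA1 mB1. rewrite /PZ /PY. rewrite /distribution /pushforward /=. have [_ _ _ hi hn] := hW.
 have := hi s t s0 st (Y @^-1` A1) ((W t \- W s) @^-1` B1). move=> H; transitivity (P (Y @^-1` A1 `&` (W t \- W s) @^-1` B1)); first by []. rewrite H.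
 - by rewrite hn.
 - by move/(mF_set _ s0) : mY; exact.
 - by exists B1; [exact: mB1|rewrite setTI].
rewrite -/PZ key fubini_tonelli1//.
rewrite ge0_integral_distribution//=.
 exact: mfubiniF.
by move=> y; apply: integral_ge0 => g _ /=; rewrite lee_fin.
Qed.

Let mstep (q : nat) : mfunT (fun z : (R * R) * R => (z.1.1 + z.1.2 * z.2) ^+ q).
Proof.
apply: mfunX; apply: mfunD.
 exact: (mcompT measurable_fst measurable_fst).
apply: mfunM => //.
exact: (mcompT measurable_snd measurable_fst).
Qed.

Lemma step_sqr (s t : R) (U V : Omega -> R) : 0 <= s -> s <= t -> mF s U -> mF s V ->
 (\int[P]_w ((U w + V w * (W t w - W s w)) ^+ 2)%:E = \int[P]_w (U w ^+ 2 + (t - s) * V w ^+ 2)%:E)%E.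
Proof.
move=> s0; rewrite le_eqVlt => /predU1P[<- _ _|st mU mV].
 by apply: eq_integral => w _; rewrite !subrr mulr0 mul0r !addr0.
rewrite (@step_law _ _ s t (fun w => (U w, V w)) (fun z : (R * R) * R => (z.1.1 + z.1.2 * z.2) ^+ 2))//=.
- by apply: eq_integral => w _; rewrite gauss_sqr ?subr_gt0.
- exact: measurable_fun_pair.
- by move=> x; exact: sqr_ge0.
Qed.

Lemma step_pow (q : nat) (s t : R) (U V : Omega -> R) : 0 <= s -> s <= t -> mF s U -> mF s V ->
 (\int[P]_w ((U w + V w * (W t w - W s w)) ^+ q.*2)%:E <=
  \int[P]_w ((U w ^+ 2 + (q.*2.-1)%:R * (t - s) * V w ^+ 2) ^+ q)%:E)%E.
Proof.
have ev (x : R) := expr_double_ge0 x q.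
move=> s0; rewrite le_eqVlt => /predU1P[<- _ _|st mU mV].
 apply: eq_ler. by apply: eq_integral => w _; rewrite !subrr !mulr0 mul0r !addr0 -mul2n exprM.
have mUV : mF s (fun w => (U w, V w)) by exact: measurable_fun_pair.
rewrite (@step_law _ _ s t (fun w => (U w, V w)) (fun z : (R * R) * R => (z.1.1 + z.1.2 * z.2) ^+ q.*2))//=.
apply: ge0_le_integral => //=.
- by move=> w _; apply: integral_ge0 => g _; rewrite lee_fin.
- have m1 := @mfubiniF _ _ _ _ _ (normal_prob 0 (Num.sqrt (t - s)) : probability _ R)
   (fun z : (R * R) * R => ((z.1.1 + z.1.2 * z.2) ^+ q.*2)%:E). have h1 : mfunT (fun z : (R * R) * R => ((z.1.1 + z.1.2 * z.2) ^+ q.*2)%:E). by apply/mEFinP; exact: mstep.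
 have h2 : forall z : (R * R) * R, (0 <= ((z.1.1 + z.1.2 * z.2) ^+ q.*2)%:E)%E by move=> z; rewrite lee_fin. exact: (mcompT (m1 h1 h2) (mF_meas s0 mUV)).
- apply/mEFinP; apply: mfunX; apply: mfunD.
  by apply: mfunX; exact: (mF_meas s0 mU). by apply: mfunM => //; apply: mfunX; exact: (mF_meas s0 mV).
- by move=> w _; apply: gauss_hyper; rewrite subr_gt0.
Qed.

Section grid.
Variables (p : nat -> R) (Z : Omega -> R) (V : nat -> Omega -> R).
Hypotheses (p0 : forall i, 0 <= p i) (pS : forall i, p i <= p i.+1).
Hypotheses (mZ : mF (p 0%N) Z) (mV : forall i, mF (p i) (V i)).

Definition grid_sum (n : nat) (w : Omega) : R := Z w + \sum_(i < n) V i w * (W (p i.+1) w - W (p i) w).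

Lemma grid_sumS n w : grid_sum n.+1 w = grid_sum n w + V n w * (W (p n.+1) w - W (p n) w).
Proof. by rewrite /grid_sum big_ord_recr/= addrA. Qed.

Lemma grid_sum_mF n : mF (p n) (grid_sum n).
Proof.
elim: n => [|n IH].
 by rewrite (_ : grid_sum 0 = Z)//; apply/funext => w; rewrite /grid_sum big_ord0 addr0.
rewrite (_ : grid_sum n.+1 = fun w => grid_sum n w + V n w * (W (p n.+1) w - W (p n) w)); last first.
 by apply/funext => w; exact: grid_sumS.
apply: mfunD; first exact: (mF_mono (p0 n) (pS n) IH).
apply: mfunM; first exact: (mF_mono (p0 n) (pS n)).
by apply: mfunB; [exact: W_mF|exact: (mF_mono (p0 n) (pS n) (W_mF (p0 n)))].
Qed.

Lemma grid_isometry n :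
 (\int[P]_w (grid_sum n w ^+ 2)%:E = \int[P]_w (Z w ^+ 2 + \sum_(i < n) (p i.+1 - p i) * V i w ^+ 2)%:E)%E.
Proof.
elim: n => [|n IH].
 by apply: eq_integral => w _; rewrite /grid_sum !big_ord0 !addr0.
under eq_integral do rewrite grid_sumS.
rewrite step_sqr//; last exact: grid_sum_mF.
have dp i : 0 <= p i.+1 - p i by rewrite subr_ge0.
have mV' i : mfunT (fun w => ((p i.+1 - p i) * V i w ^+ 2)).
 by apply: mfunM => //; apply: mfunX; exact: (mF_meas (p0 i)).
have mS : mfunT (fun w => Z w ^+ 2 + \sum_(i < n) (p i.+1 - p i) * V i w ^+ 2).
 apply: mfunD; first by apply: mfunX; exact: (mF_meas (p0 0%N)). by apply: msum => i; exact: mV'.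
under eq_integral do rewrite EFinD.
rewrite ge0_integralD//; last 4 first.
- by move=> w _; exact: lee_sqr0.
- by apply/mEFinP; apply: mfunX; exact: (mF_meas (p0 n) (@grid_sum_mF n)).
- by move=> w _; rewrite lee_fin mulr_ge0// sqr_ge0.
- by apply/mEFinP; exact: mV'.
rewrite IH -ge0_integralD//; last 4 first.
- move=> w _; rewrite lee_fin addr_ge0 ?sqr_ge0// sumr_ge0// => i _.
 by rewrite mulr_ge0// sqr_ge0.
- exact/mEFinP.
- by move=> w _; rewrite lee_fin mulr_ge0// sqr_ge0.
- by apply/mEFinP; exact: mV'.
by apply: eq_integral => w _; rewrite big_ord_recr/= -EFinD addrA.
Qed.

(** [a0] and [b i] bound norms of order [q] of the squared terms, up to the common factor [G]. Each
    new increment is averaged by [step_pow], and [pow_add_le] adds the norms, so that they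
    accumulate linearly, as in the isometry. *)
Lemma grid_moment (q n : nat) (a0 : R) (b : nat -> R) (G : R) : 0 < a0 -> (forall i, 0 < b i) ->
 (\int[P]_w (Z w ^+ q.*2)%:E <= (a0 ^+ q * G)%:E)%E ->
 (forall i, (\int[P]_w (((q.*2.-1)%:R * (p i.+1 - p i) * V i w ^+ 2) ^+ q)%:E <= (b i ^+ q * G)%:E)%E) ->
 (\int[P]_w (grid_sum n w ^+ q.*2)%:E <= ((a0 + \sum_(i < n) b i) ^+ q * G)%:E)%E.
Proof.
move=> a00 b0 hZ hV.
have dp i : 0 <= p i.+1 - p i by rewrite subr_ge0.
elim: n => [|n IH].
 rewrite big_ord0 addr0 (eq_integral (fun w => (Z w ^+ q.*2)%:E))// => w _. by rewrite /grid_sum big_ord0 addr0.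
under eq_integral do rewrite grid_sumS.
have hs := step_pow q (p0 n) (pS n) (@grid_sum_mF n) (@mV n).
apply: le_trans hs _.
rewrite big_ord_recr/= addrA.
set A := a0 + _ in IH *; have A0 : 0 < A by rewrite ltr_wpDr// sumr_ge0// => i _; rewrite ltW.
pose B (w : Omega) := (q.*2.-1)%:R * (p n.+1 - p n) * V n w ^+ 2.
have B0 w : 0 <= B w by apply: mulr_ge0; [exact: mulr_ge0|exact: sqr_ge0].
have mS := mF_meas (p0 n) (@grid_sum_mF n).
have mVn := mF_meas (p0 n) (@mV n).
have mB : mfunT B by apply: mfunM => //; exact: mfunX.
have Ab : 0 < A + b n by rewrite addr_gt0.
apply: (@le_trans _ _ (\int[P]_w (((A + b n) ^+ q * (A / (A + b n)) / A ^+ q * (grid_sum n w ^+ q.*2))%:E +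
  ((A + b n) ^+ q * (b n / (A + b n)) / b n ^+ q * (B w ^+ q))%:E))%E). apply: ge0_le_integral => //=.
 - by move=> w _; rewrite lee_fin exprn_ge0// addr_ge0 ?sqr_ge0//; exact: B0.
 - by apply/mEFinP; apply: mfunX; apply: mfunD => //; exact: mfunX.
 - apply/mEFinP; apply: mfunD; apply: mfunM => //; exact: mfunX.
 - move=> w _; rewrite -EFinD lee_fin. apply: le_trans (pow_add_le q A0 (b0 n) (sqr_ge0 (grid_sum n w)) (B0 w)) _.
  rewrite !expr_div_n -exprM mul2n le_eqVlt; apply/orP; left; apply/eqP. by rewrite mulrDr; congr (_ + _); ring.
have cA : 0 <= (A + b n) ^+ q * (A / (A + b n)) / A ^+ q.
 by rewrite !mulr_ge0 ?exprn_ge0 ?invr_ge0 ?exprn_ge0// ltW.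
have cB : 0 <= (A + b n) ^+ q * (b n / (A + b n)) / b n ^+ q.
 by rewrite !mulr_ge0 ?exprn_ge0 ?invr_ge0 ?exprn_ge0// ltW.
have ev (x : R) := expr_double_ge0 x q.
rewrite ge0_integralD//=; last 4 first.
- by move=> w _; rewrite lee_fin mulr_ge0.
- by apply/mEFinP; apply: mfunM => //; exact: mfunX.
- by move=> w _; rewrite lee_fin mulr_ge0// exprn_ge0// B0.
- by apply/mEFinP; apply: mfunM => //; exact: mfunX.
under eq_integral do rewrite EFinM.
under [X in (_ + X <= _)%E]eq_integral do rewrite EFinM.
rewrite !ge0_integralZl//=; last 4 first.
- by apply/mEFinP; exact: mfunX.
- by move=> w _; rewrite lee_fin exprn_ge0// B0.
- by apply/mEFinP; exact: mfunX.
- by move=> w _; rewrite lee_fin.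
apply: (@le_trans _ _ (((A + b n) ^+ q * (A / (A + b n)) / A ^+ q)%:E * (A ^+ q * G)%:E +
 ((A + b n) ^+ q * (b n / (A + b n)) / b n ^+ q)%:E * (b n ^+ q * G)%:E)%E). by apply: leeD; apply: lee_wpmul2l; rewrite ?lee_fin//; exact: hV.
rewrite -!EFinM -EFinD lee_fin le_eqVlt; apply/orP; left; apply/eqP.
by field; rewrite !gt_eqF// exprn_gt0.
Qed.

End grid.
End brownian.

Lemma seq_mono (R : realType) (p : nat -> R) i j : (forall i, p i <= p i.+1) -> (i <= j)%N -> p i <= p j.
Proof. by move=> /nondecreasing_seqP pS; exact: pS. Qed.

(** Cells are selected by comparing values rather than indices: repeated grid points are allowed,
    and their cells contribute zero increments. *)
Lemma telescope_below (R : realType) (V : zmodType) (h : R -> V) (p : nat -> R) (m j0 : nat) :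
 (forall i, p i <= p i.+1) -> (j0 <= m)%N ->
 \sum_(j < m) (if p j < p j0 then h (p j.+1) - h (p j) else 0) = h (p j0) - h (p 0%N).
Proof.
move=> pS jm; have pm i j := @seq_mono _ p i j pS.
rewrite -(big_mkord xpredT (fun j => if p j < p j0 then h (p j.+1) - h (p j) else 0)).
rewrite (big_cat_nat (leq0n _) jm)//= [X in _ + X]big_nat_cond [X in _ + X]big1 ?addr0; last first.
 by move=> j; rewrite andbT => /andP[j1 _]; rewrite ltNge pm.
rewrite -(telescope_sumr (fun k => h (p k)) (leq0n j0)); apply: eq_big_nat => j /andP[_ jj0].
case: ltP => // h1; have e1 : p j = p j0 by apply/le_anti; rewrite h1 pm// ltnW.
have e2 : p j.+1 = p j0 by apply/le_anti; rewrite pm//= -e1.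
by rewrite e1 e2 subrr.
Qed.

Lemma measurable_le01 (R : realType) (x : R) : measurable_fun [set: R] (fun s : R => (s <= x)%R%:R : R).
Proof.
rewrite (_ : (fun s => _) = \1_(`]-oo, x]%classic)); last first.
 by apply/funext => s; rewrite indicE mem_setE in_itv.
by apply: mindic; exact: mitv.
Qed.

(** * Common refinements of grids *)

Section merge.
Variables (R : realType) (t : R).
Hypothesis t0 : 0 <= t.
Variable L : seq R.
Hypotheses (Lt : all (fun x => (0 <= x) && (x <= t)) L).
(** The default value [t] keeps the grid at [t] beyond its last point, hence nondecreasing with
    values in [[0, t]] at every index. *)
Definition mgrid (j : nat) : R := nth t (sort <=%R L) j.
Local Notation p := mgrid.

Let Ls := sort <=%R L.

Let Lst : all (fun x => (0 <= x) && (x <= t)) Ls.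
Proof. by rewrite all_sort. Qed.

Lemma mgrid_bnd j : 0 <= p j <= t.
Proof.
have [js|js] := ltnP j (size Ls); last by rewrite /p nth_default// t0 lexx.
by have /all_nthP -/(_ t j js) := Lst.
Qed.

Lemma mgridS j : p j <= p j.+1.
Proof.
have [js|js] := ltnP j.+1 (size Ls); last first.
 by rewrite [leRHS]/p nth_default//; have /andP[] := mgrid_bnd j.
have := sort_sorted (@le_total _ R) L; rewrite -/Ls => /(sortedP t).
by move=> /(_ j js).
Qed.

(** Stated for any [h], since it is applied to the paths of [W], for the integrals, and to
    [x -> (s <= x)], for the integrands. *)
Lemma mgrid_telescope (V : pzRingType) (h : R -> V) (a b : R) : a \in L -> b \in L -> a <= b ->
 \sum_(j < size L) ((a <= p j) && (p j < b))%:R * (h (p j.+1) - h (p j)) = h b - h a.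
Proof.
move=> aL bL ab.
have ex x : x \in L -> exists2 j, (j <= size L)%N & p j = x.
 move=> xL; exists (index x Ls); last by rewrite /p nth_index// mem_sort. by rewrite -(size_sort <=%R L) index_size.
have [ja ja1 ea] := ex _ aL; have [jb jb1 eb] := ex _ bL.
have Ta := telescope_below h mgridS ja1; have Tb := telescope_below h mgridS jb1.
rewrite ea in Ta; rewrite eb in Tb.
have -> : h b - h a = (h b - h (p 0%N)) - (h a - h (p 0%N)) by rewrite opprB addrA subrK.
rewrite -Ta -Tb -sumrB; apply: eq_bigr => j _.
have [pa|pa] := ltP (p j) a; first by rewrite (lt_le_trans pa ab) /= mul0r subrr.
by rewrite /=; case: ifP => _; rewrite ?mul1r ?mul0r subr0.
Qed.
End merge.

Section disjoint_square.
Variables (R : realType) (p : nat -> R) (v : nat -> R).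
Hypothesis pS : forall i, p i <= p i.+1.

(** The indicator of []p i, p i.+1]] is written as an increment of one function of the grid point,
    so that integrands and integrals telescope in the same way. *)
Definition stepf (n : nat) (s : R) : R := \sum_(i < n) v i * ((s <= p i.+1)%R%:R - (s <= p i)%R%:R).

Lemma stepf_sqr n s : stepf n s ^+ 2 = \sum_(i < n) v i ^+ 2 * ((s <= p i.+1)%R%:R - (s <= p i)%R%:R).
Proof.
have pm i j := @seq_mono _ p i j pS.
elim: n => [|n IH]; first by rewrite /stepf !big_ord0 expr0n.
rewrite /stepf !big_ord_recr/= -/(stepf n s) sqrrD IH.
have [sp|sp] := leP s (p n).
 by rewrite (le_trans sp)// subrr !mulr0 mul0rn expr0n/= !addr0.
have -> : stepf n s = 0.
 rewrite /stepf big1// => i _; rewrite leNgt (le_lt_trans _ sp) ?pm//= leNgt (le_lt_trans _ sp) ?pm// ?subrr ?mulr0//. exact: ltnW.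
rewrite mul0r mul0rn addr0; congr (_ + _).
by case: (s <= p n.+1); rewrite /= ?subr0 ?mulr1 ?mulr0 ?expr0n.
Qed.

Lemma stepf_measurable n : mfunT (stepf n).
Proof.
apply: msum => i; apply: mfunM => //.
exact: (mfunB (measurable_le01 _) (measurable_le01 _)).
Qed.

Lemma integral_stepf_sqr (t : R) n : 0 <= p 0%N -> (forall i, p i <= t) ->
 (\int[lebesgue_measure]_(s in `[0%R, t]) (stepf n s ^+ 2)%:E =
  (\sum_(i < n) (p i.+1 - p i) * v i ^+ 2)%:E)%E.
Proof.
move=> p0 pt.
have pm i j := @seq_mono _ p i j pS.
under eq_integral do rewrite stepf_sqr -sumEFin.
rewrite ge0_integral_sum//; last 2 first.
- move=> i; apply/mEFinP; apply: mfunTS; apply: mfunM => //.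
 exact: (mfunB (measurable_le01 _) (measurable_le01 _)).
- move=> i s _; rewrite lee_fin mulr_ge0 ?sqr_ge0// subr_ge0 ler_nat.
 by have [sp|//] := leP s (p i); rewrite (le_trans sp).
rewrite -sumEFin; apply: eq_bigr => i _.
transitivity (\int[lebesgue_measure]_(s in `[0%R, t]) ((v i ^+ 2)%:E * (\1_(`]p i, p i.+1]%classic) s)%:E))%E.
 apply: eq_integral => s _; rewrite -EFinM indicE mem_setE in_itv/=; congr (_ * _)%:E. by have [sp|sp] := leP s (p i); rewrite /= ?subr0// (le_trans sp)// subrr.
rewrite ge0_integralZl_EFin ?sqr_ge0//; last first.
 by apply/mEFinP; apply: mfunTS; apply: mindic; exact: mitv.
rewrite integral_indic; [|exact: mitv|exact: mitv].
rewrite setIidl; last first.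
 move=> s /=; rewrite !in_itv/= => /andP[s1 s2]. by rewrite (le_trans s2 (pt _)) andbT ltW// (le_lt_trans _ s1)// (le_trans p0)// pm.
rewrite [X in (_ * X)%E](@lebesgue_measure_itv R `]p i, p i.+1])/= lte_fin; case: ltP => h.
 by rewrite -EFinB -EFinM mulrC.
have -> : p i.+1 = p i by apply/le_anti; rewrite h pS.
by rewrite subrr mul0r mule0.
Qed.
End disjoint_square.

Section brownian.
Context d (Omega : measurableType d) (R : realType) (P : probability Omega R).
Variables (F : R -> set (set Omega)) (W : R -> Omega -> R).
Hypotheses (hF : usual_conditions P F) (hW : is_brownian P F W).
Local Notation mF := (mF F).

Lemma markov_set (A : set Omega) (g : Omega -> \bar R) (c : R) : measurable A -> mfunT g ->
 (forall w, 0 <= g w)%E -> (forall w, A w -> c%:E <= g w)%E -> 0 <= c ->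
 (c%:E * P A <= \int[P]_w g w)%E.
Proof.
move=> mA mg g0 gA c0; apply: (@le_trans _ _ (\int[P]_(w in A) g w)%E).
 rewrite -integral_cst//; apply: ge0_le_integral => //. exact: mfunTS.
by apply: ge0_subset_integral => //; exact: mfunTS.
Qed.

(** A Lenglart inequality: the coefficients are set to 0 once the quadratic sum exceeds [K]. Off the
    event that it does, nothing changes, and the stopped sum has second moment at most [K] by the
    isometry. *)
Lemma grid_prob (p : nat -> R) (V : nat -> Omega -> R) (n : nat) (K eps : R) :
 (forall i, 0 <= p i) -> (forall i, p i <= p i.+1) -> (forall i, mF (p i) (V i)) -> 0 <= K -> 0 < eps ->
 (P [set w | (eps <= `|\sum_(i < n) V i w * (W (p i.+1) w - W (p i) w)|)%R] <=
  P [set w | (K < \sum_(i < n) (p i.+1 - p i) * V i w ^+ 2)%R] + (K / eps ^+ 2)%:E)%E.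
Proof.
move=> p0 pS mV K0 eps0.
pose Q j w := \sum_(i < j) (p i.+1 - p i) * V i w ^+ 2.
have dp i : 0 <= p i.+1 - p i by rewrite subr_ge0.
have QS j w : Q j w <= Q j.+1 w by rewrite /Q big_ord_recr/= lerDl mulr_ge0// sqr_ge0.
have Qm i j w := @seq_mono _ (fun k => Q k w) i j (QS^~ w).
have pm i j := @seq_mono _ p i j pS.
have mQ j : mF (p j) (Q j.+1).
 change (measurable_fun [set: g_sigma_algebraType (F (p j))] (Q j.+1)); rewrite /Q; apply: msum => i; apply: mfunM => //; apply: mfunX. by apply: (mF_mono hF (p0 i) _ (mV i)); rewrite pm// -ltnS.
(* The quadratic sum up to and including cell [j] is known at time [p j], so cutting on it preserves
   adaptedness. *)
pose V' j w := V j w * (Q j.+1 w <= K)%R%:R.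
have mV' j : mF (p j) (V' j).
 apply: mfunM; first exact: mV. exact: (mcompT (measurable_le01 K) (mQ j)).
have QV' j w : \sum_(i < j) (p i.+1 - p i) * V' i w ^+ 2 <= K.
 elim: j => [|j IH]; first by rewrite big_ord0. rewrite big_ord_recr/= {2}/V'; have [h|h] := leP (Q j.+1 w) K; last by rewrite mulr0 expr0n/= mulr0 addr0.
 apply: le_trans h; rewrite mulr1 /Q big_ord_recr/= lerD2r; apply: ler_sum => i _. rewrite ler_wpM2l// /V' exprMn ler_piMr ?sqr_ge0//. by case: (_ <= K); rewrite ?expr1n ?expr0n.
pose S' w := \sum_(i < n) V' i w * (W (p i.+1) w - W (p i) w).
have mZ : mF (p 0%N) (fun _ : Omega => 0 : R) by exact: mcst.
have ES : (\int[P]_w (S' w ^+ 2)%:E <= K%:E)%E.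
 have -> : (\int[P]_w (S' w ^+ 2)%:E = \int[P]_w (grid_sum W p (fun=> 0%R) V' n w ^+ 2)%:E)%E. by apply: eq_integral => w _; rewrite /grid_sum add0r. rewrite (grid_isometry hF hW p0 pS mZ mV').
 apply: (@le_trans _ _ (\int[P]_w (cst K%:E w))%E). apply: ge0_le_integral => //.
  - move=> w _; rewrite lee_fin addr_ge0 ?sqr_ge0// sumr_ge0// => i _. by rewrite mulr_ge0// sqr_ge0.
  - apply/mEFinP; apply: mfunD => //; apply: msum => i. by apply: mfunM => //; apply: mfunX; exact: (mF_meas hF (p0 i) (mV' i)).
  - by move=> w _; rewrite lee_fin expr0n/= add0r; exact: QV'. by rewrite integral_cst//; have /= -> := @probability_setT _ _ _ P; rewrite mule1.
have mS' : mfunT S'.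
 apply: msum => i; apply: mfunM; first exact: (mF_meas hF (p0 i) (mV' i)). by apply: mfunB; [exact: (mF_meas hF (p0 i.+1) (W_mF hF hW (p0 i.+1)))|exact: (mF_meas hF (p0 i) (W_mF hF hW (p0 i)))].
have mS : mfunT (fun w => \sum_(i < n) V i w * (W (p i.+1) w - W (p i) w)).
 apply: msum => i; apply: mfunM; first exact: (mF_meas hF (p0 i) (mV i)). by apply: mfunB; [exact: (mF_meas hF (p0 i.+1) (W_mF hF hW (p0 i.+1)))|exact: (mF_meas hF (p0 i) (W_mF hF hW (p0 i)))].
have mge (Y : Omega -> R) x : mfunT Y -> measurable [set w | x <= `|Y w|].
 move=> mY; rewrite (_ : [set w | _] = (fun w => `|Y w|) @^-1` `[x, +oo[%classic). by rewrite -[X in measurable X]setTI; apply: mcompT => //; exact: mitv.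
 by apply/seteqP; split => w /=; rewrite in_itv/= andbT.
have mQn : measurable [set w | K < Q n w].
 rewrite (_ : [set w | _] = (Q n) @^-1` `]K, +oo[%classic). have mQO : mfunT (Q n). apply: msum => i; apply: mfunM => //; apply: mfunX. exact: (mF_meas hF (p0 i) (mV i)).
  by rewrite -[X in measurable X]setTI; apply: mQO => //; exact: mitv. by apply/seteqP; split => w /=; rewrite in_itv/= andbT.
apply: (@le_trans _ _ (P ([set w | K < Q n w] `|` [set w | eps <= `|S' w|]))).
 apply: le_measure; rewrite ?inE//; [exact: mge|apply: measurableU => //; exact: mge|]. move=> w /= hw; have [h|h] := ltP K (Q n w); [by left|right].
 rewrite /S' (eq_bigr (fun i : 'I_n => V i w * (W (p i.+1) w - W (p i) w)))// => i _. by rewrite /V' (le_trans (Qm i.+1 n w (ltn_ord i)) h) mulr1.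
apply: (le_trans (measureU2 _ mQn (mge _ _ mS'))); rewrite leeD2l//.
have e20 : 0 < eps ^+ 2 by rewrite exprn_gt0.
have := @markov_set [set w | eps <= `|S' w|] (fun w => (S' w ^+ 2)%:E) (eps ^+ 2).
have mS2 : mfunT (fun w => (S' w ^+ 2)%:E) by apply/mEFinP; exact: mfunX.
have g0 w : (0 <= (S' w ^+ 2)%:E)%E by rewrite lee_fin sqr_ge0.
move=> /(_ (mge _ _ mS') mS2 g0).
have gA w : [set w | eps <= `|S' w|] w -> ((eps ^+ 2)%:E <= (S' w ^+ 2)%:E)%E.
 by move=> /= h; rewrite lee_fin -[leRHS]real_normK ?num_real// lerXn2r ?nnegrE// ltW.
move=> /(_ gA (ltW e20)) h; rewrite -(lee_pmul2l (_ : (eps ^+ 2)%:E \is a fin_num))// ?lte_fin//.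
apply: (le_trans h); rewrite -EFinM mulrC divfK ?gt_eqF//.
Qed.
End brownian.

(** * Simple integrands on a common grid and uniqueness of the Ito integral *)

Section brownian.
Context d (Omega : measurableType d) (R : realType) (P : probability Omega R).
Variables (F : R -> set (set Omega)) (W : R -> Omega -> R).
Hypotheses (hF : usual_conditions P F) (hW : is_brownian P F W).
Local Notation mF := (mF F).
Notation mu := (leb R).

Section merge2.
Variable t : R.
Hypothesis t0 : 0 <= t.

Definition clipped (n : nat) (tau : nat -> R) : seq R := [seq Num.min (tau i) t | i <- iota 0 n.+1].

Definition recoef (p : nat -> R) (n : nat) (tau : nat -> R) (xi : nat -> Omega -> R) (j : nat) (w : Omega) : R :=
 \sum_(i < n) xi i w * ((Num.min (tau i) t <= p j) && (p j < Num.min (tau i.+1) t))%R%:R.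

Lemma recoefE (h : R -> R) (L : seq R) n tau xi (w : Omega) : is_simple_integrand F n tau xi ->
 all (fun x => (0 <= x) && (x <= t)) L -> {subset clipped n tau <= L} ->
 \sum_(j < size L) recoef (mgrid t L) n tau xi j w * (h (mgrid t L j.+1) - h (mgrid t L j)) =
 \sum_(i < n) xi i w * (h (Num.min (tau i.+1) t) - h (Num.min (tau i) t)).
Proof.
move=> [_ tS _ _] hL sub.
under eq_bigr do rewrite mulr_suml.
rewrite exchange_big/=; apply: eq_bigr => i _.
have inL k : (k <= n)%N -> Num.min (tau k) t \in L.
 by move=> kn; apply: sub; apply/mapP; exists k => //; rewrite mem_iota add0n ltnS.
rewrite -(mgrid_telescope t0 hL h (inL i (ltnW (ltn_ord i))) (inL i.+1 (ltn_ord i))).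
 by rewrite mulr_sumr; apply: eq_bigr => j _; rewrite mulrA.
by rewrite le_min !ge_min tS lexx orbT.
Qed.

Lemma recoef_mF (L : seq R) n tau xi j : is_simple_integrand F n tau xi ->
 all (fun x => (0 <= x) && (x <= t)) L -> mF (mgrid t L j) (recoef (mgrid t L) n tau xi j).
Proof.
move=> [tau0 tS mxi _] hL; apply: msum => i.
case: (boolP (_ && _)) => [/andP[h1 h2]|_]; last first.
 by rewrite (_ : (fun w => _) = cst 0)//; apply/funext => w; rewrite mulr0.
rewrite (_ : (fun w => _) = xi i); last by apply/funext => w; rewrite mulr1.
have st : tau i <= t.
 by rewrite leNgt; apply/negP => /ltW ts; have := le_lt_trans h1 h2; rewrite (min_r ts) lt_min ltxx andbF.
have h := (meas_wrtP hF (xi i) (tau0 i)).1 (mxi i (ltn_ord i)).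
apply: (mF_mono hF (tau0 i) _ h); by move: h1; rewrite min_l.
Qed.

Lemma simple_integrandE n tau (xi : nat -> Omega -> R) (s : R) (w : Omega) : is_simple_integrand F n tau xi -> s <= t ->
 simple_integrand n tau xi s w =
 \sum_(i < n) xi i w * ((s <= Num.min (tau i.+1) t)%R%:R - (s <= Num.min (tau i) t)%R%:R).
Proof.
move=> [_ tS _ _] st; apply: eq_bigr => i _; rewrite indicE mem_setE in_itv/= !le_min st !andbT.
by have [h|h] := leP s (tau i); rewrite /= ?subr0// (le_trans h)// subrr.
Qed.

(** The difference of two simple integrands becomes a single one on a common grid, to which
    [grid_prob] applies. *)
Lemma merge_simple n1 tau1 xi1 n2 tau2 xi2 :
 is_simple_integrand F n1 tau1 xi1 -> is_simple_integrand F n2 tau2 xi2 ->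
 exists (p : nat -> R) (V : nat -> Omega -> R) (m : nat),
  [/\ forall i, 0 <= p i <= t, forall i, p i <= p i.+1, forall i, mF (p i) (V i),
   (forall w, simple_integral W n1 tau1 xi1 t w - simple_integral W n2 tau2 xi2 t w =
    \sum_(i < m) V i w * (W (p i.+1) w - W (p i) w)) &
   (forall w s, s <= t -> simple_integrand n1 tau1 xi1 s w - simple_integrand n2 tau2 xi2 s w =
    stepf p (V^~ w) m s)].
Proof.
move=> h1 h2.
pose L := clipped n1 tau1 ++ clipped n2 tau2.
have hc n tau xi : is_simple_integrand F n tau xi -> all (fun x => (0 <= x) && (x <= t)) (clipped n tau).
 move=> [tau0 _ _ _]; apply/allP => x /mapP[i _ ->]. by rewrite le_min tau0 t0 ge_min lexx orbT.
have hL : all (fun x => (0 <= x) && (x <= t)) L.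
 by rewrite all_cat (hc _ _ _ h1) (hc _ _ _ h2).
have s1 : {subset clipped n1 tau1 <= L} by move=> x h; rewrite mem_cat h.
have s2 : {subset clipped n2 tau2 <= L} by move=> x h; rewrite mem_cat h orbT.
pose p := mgrid t L.
pose V j w := recoef p n1 tau1 xi1 j w - recoef p n2 tau2 xi2 j w.
have VE w h : \sum_(j < size L) V j w * (h (p j.+1) - h (p j)) =
  \sum_(i < n1) xi1 i w * (h (Num.min (tau1 i.+1) t) - h (Num.min (tau1 i) t)) - \sum_(i < n2) xi2 i w * (h (Num.min (tau2 i.+1) t) - h (Num.min (tau2 i) t)).
 rewrite -(recoefE h w h1 hL s1) -(recoefE h w h2 hL s2) -sumrB. by apply: eq_bigr => j _; rewrite mulrBl.
exists p, V, (size L); split.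
- by move=> i; exact: mgrid_bnd.
- by move=> i; exact: mgridS.
- by move=> i; apply: mfunB; exact: recoef_mF.
- by move=> w; rewrite (VE w (W^~ w)).
- move=> w s st; rewrite /stepf (VE w (fun x => (s <= x)%R%:R)).
 by rewrite (simple_integrandE w h1 st) (simple_integrandE w h2 st).
Qed.

End merge2.

Lemma simple_mfun n tau xi : is_simple_integrand F n tau xi ->
 mfunT (fun z : Omega * R => simple_integrand n tau xi z.2 z.1).
Proof.
move=> [tau0 _ mxi _]; apply: msum => i; apply: mfunM.
 have h := (meas_wrtP hF (xi i) (tau0 i)).1 (mxi i (ltn_ord i)). exact: (mcompT (mF_meas hF (tau0 i) h) measurable_fst).
apply: (mcompT _ measurable_snd); apply: mindic; exact: mitv.
Qed.

Lemma simple_integral_mF n tau xi t : 0 <= t -> is_simple_integrand F n tau xi ->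
 mF t (simple_integral W n tau xi t).
Proof.
move=> t0 h; have hz : is_simple_integrand F 0 (fun=> 0) (fun _ _ => 0 : R) by split.
have [p [V [m [pt pS mV E _]]]] := merge_simple t0 h hz.
have -> : simple_integral W n tau xi t = fun w => \sum_(i < m) V i w * (W (p i.+1) w - W (p i) w).
 by apply/funext => w; rewrite -E [X in _ - X]big_ord0 subr0.
have p0 i : 0 <= p i by have /andP[] := pt i.
have pt' i : p i <= t by have /andP[] := pt i.
apply: msum => i; apply: mfunM; first exact: (mF_mono hF (p0 i) (pt' i) (mV i)).
by apply: mfunB; [exact: (mF_mono hF (p0 i.+1) (pt' i.+1) (W_mF hF hW (p0 i.+1)))|exact: (mF_mono hF (p0 i) (pt' i) (W_mF hF hW (p0 i)))].
Qed.

Lemma section_measurable (G : R -> Omega -> R) w : mfunT (fun z : Omega * R => G z.2 z.1) ->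
 mfunT (G^~ w).
Proof.
move=> mG; exact: (mcompT mG (measurable_fun_pair (mcst w) (@measurable_id _ _ setT))).
Qed.

Lemma measurable_qint (t : R) (G : R -> Omega -> R) : mfunT (fun z : Omega * R => G z.2 z.1) ->
 mfunT (fun w => \int[mu]_(s in `[0%R, t]) (G s w ^+ 2)%:E)%E.
Proof.
move=> mG.
pose g (z : Omega * R) := ((G z.2 z.1) ^+ 2 * \1_(`[0, t]%classic) z.2)%:E.
have mg : mfunT g.
 apply/mEFinP; apply: mfunM; first exact: mfunX. apply: (mcompT _ measurable_snd); apply: mindic; exact: mitv.
have g0 z : (0 <= g z)%E by rewrite lee_fin mulr_ge0 ?sqr_ge0.
have := @mfubiniF _ _ _ _ _ mu g mg g0.
congr measurable_fun; apply/funext => w; rewrite /fubini_F [RHS]integral_mkcond.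
by apply: eq_integral => s _; rewrite patchE /g indicE; case: (s \in _); rewrite ?mulr1 ?mulr0.
Qed.

Lemma mge_set (Y : Omega -> \bar R) (x : \bar R) : mfunT Y -> measurable [set w | (x <= Y w)%E].
Proof.
by move=> mY; rewrite (_ : [set w | _] = Y @^-1` `[x, +oo[%classic) => [|//];
  first (rewrite -[X in measurable X]setTI; apply: mY => //; exact: emeasurable_itv); apply/seteqP; split => w /=; rewrite in_itv/= andbT.
Qed.

Lemma cvg0_in_prob_le (Y Y1 Y2 : nat -> Omega -> \bar R) :
 (forall k, mfunT (Y k)) -> (forall k, mfunT (Y1 k)) -> (forall k, mfunT (Y2 k)) ->
 (forall e : R, 0 < e -> exists2 e' : R, 0 < e' & forall k w, (e%:E <= Y k w -> e'%:E <= Y1 k w \/ e'%:E <= Y2 k w)%E) ->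
 cvg0_in_prob P Y1 -> cvg0_in_prob P Y2 -> cvg0_in_prob P Y.
Proof.
move=> mY mY1 mY2 h c1 c2 e e0; have [e' e'0 he] := h e e0.
apply: (@squeeze_cvge _ _ _ _ (fun=> 0%E) _ (fun k => P [set w | (e'%:E <= Y1 k w)%E] + P [set w | (e'%:E <= Y2 k w)%E])%E).
- apply: nearW => k; rewrite measure_ge0/=.
 apply: (@le_trans _ _ (P ([set w | (e'%:E <= Y1 k w)%E] `|` [set w | (e'%:E <= Y2 k w)%E]))). apply: le_measure; rewrite ?inE; [exact: mge_set|apply: measurableU; exact: mge_set|].
  by move=> w /= /he. by apply: measureU2; exact: mge_set.
- exact: cvg_cst.
- by rewrite -[X in _ --> X](adde0 0%E); apply: cvgeD => //; [exact: c1|exact: c2].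
Qed.

Lemma sqr_diff_le (a b c : R) : (a - b) ^+ 2 <= 2 * (a - c) ^+ 2 + 2 * (b - c) ^+ 2.
Proof. by have := sqr_ge0 (a - c + (b - c)); rewrite !expr2; lra. Qed.

(** The definition provides one approximating sequence, not the one at hand. The two are compared on
    a common grid, where [grid_prob] controls the difference of the integrals by the integral of the
    squared difference. [H1] is a jointly measurable function equal to [H] on [[0, t]]. *)
Lemma ito_unique t H H1 I (n : nat -> nat) (tau : nat -> nat -> R) (xi : nat -> nat -> Omega -> R) :
 0 <= t -> is_ito_integral P F W t H I ->
 mfunT (fun z : Omega * R => H1 z.2 z.1) ->
 (forall s w, 0 <= s <= t -> H s w = H1 s w) ->
 (forall k, is_simple_integrand F (n k) (tau k) (xi k)) ->
 cvg0_in_prob P (fun k w => \int[mu]_(s in `[0%R, t])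
     ((simple_integrand (n k) (tau k) (xi k) s w - H1 s w) ^+ 2)%:E)%E ->
 cvg0_in_prob P (fun k w => `|simple_integral W (n k) (tau k) (xi k) t w - I w|%:E).
Proof.
move=> t0 [mI [n' [tau' [xi' [hs' hQ' hI']]]]] mH1 HH1 hs hQ.
have mIO : mfunT I by exact: (mF_meas hF t0 ((meas_wrtP hF I t0).1 mI)).
pose Q k w := (\int[mu]_(s in `[0%R, t]) ((simple_integrand (n k) (tau k) (xi k) s w - H1 s w) ^+ 2)%:E)%E.
pose Q' k w := (\int[mu]_(s in `[0%R, t]) ((simple_integrand (n' k) (tau' k) (xi' k) s w - H1 s w) ^+ 2)%:E)%E.
have hQ'1 : cvg0_in_prob P Q'.
 rewrite (_ : Q' = fun k w => \int[mu]_(s in `[0%R, t]) ((simple_integrand (n' k) (tau' k) (xi' k) s w - H s w) ^+ 2)%:E)%E//.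
 apply/funext => k; apply/funext => w; apply: eq_integral => s. by rewrite inE/= in_itv/= => st; rewrite HH1.
have mQ k : mfunT (Q k).
 by apply: (@measurable_qint t (fun s w => simple_integrand (n k) (tau k) (xi k) s w - H1 s w)); apply: mfunB => //; exact: simple_mfun.
have mQ' k : mfunT (Q' k).
 by apply: (@measurable_qint t (fun s w => simple_integrand (n' k) (tau' k) (xi' k) s w - H1 s w)); apply: mfunB => //; exact: simple_mfun.
pose S k := simple_integral W (n k) (tau k) (xi k) t.
pose S' k := simple_integral W (n' k) (tau' k) (xi' k) t.
have mS k : mfunT (S k) by exact: (mF_meas hF t0 (simple_integral_mF t0 (hs k))).
have mS' k : mfunT (S' k) by exact: (mF_meas hF t0 (simple_integral_mF t0 (hs' k))).
have mabs (Y : Omega -> R) : mfunT Y -> mfunT (fun w => `|Y w|%:E).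
 by move=> mY; apply/mEFinP; exact: mcompT.
have cD : cvg0_in_prob P (fun k w => `|S k w - S' k w|%:E).
 (* [K / e ^ 2 = eta / 2], and each squared approximation error reaches [K / 4] with probability at
    most [eta / 4]. *)
 move=> e e0; apply/fine_cvgP; split. by apply: nearW => k; apply: fin_num_measure; apply: mge_set; apply: mabs; exact: mfunB. apply/cvgrPdist_le => eta eta0. pose K := eta / 2 * e ^+ 2.
 have K0 : 0 < K by rewrite mulr_gt0 ?divr_gt0 ?exprn_gt0. have K4 : 0 < K / 4 by rewrite divr_gt0. have eta4 : 0 < eta / 4 by rewrite divr_gt0. have /fine_cvgP[_ /cvgrPdist_le/(_ _ eta4) n1] := hQ _ K4.
 have /fine_cvgP[_ /cvgrPdist_le/(_ _ eta4) n2] := hQ'1 _ K4. near=> k. have b1 : fine (P [set w | ((K / 4)%:E <= Q k w)%E]) <= eta / 4.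
  have : `|0 - fine (P [set w | ((K / 4)%:E <= Q k w)%E])| <= eta / 4 by near: k. by rewrite sub0r normrN; apply: le_trans; exact: ler_norm.
 have b2 : fine (P [set w | ((K / 4)%:E <= Q' k w)%E]) <= eta / 4. have : `|0 - fine (P [set w | ((K / 4)%:E <= Q' k w)%E])| <= eta / 4 by near: k.
  by rewrite sub0r normrN; apply: le_trans; exact: ler_norm. have m1 : measurable [set w | ((K / 4)%:E <= Q k w)%E] by exact: mge_set.
 have m2 : measurable [set w | ((K / 4)%:E <= Q' k w)%E] by exact: mge_set. have [p [V [m [pt pS mV E Es]]]] := merge_simple t0 (hs k) (hs' k). have p0 i : 0 <= p i by have /andP[] := pt i.
 have pt' i : p i <= t by have /andP[] := pt i. have := grid_prob hF hW m p0 pS mV (ltW K0) e0.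
 have -> : [set w | e <= `|\sum_(i < m) V i w * (W (p i.+1) w - W (p i) w)|] = [set w | (e%:E <= `|S k w - S' k w|%:E)%E]. by apply/seteqP; split => w /=; rewrite -E lee_fin.
 have sub : [set w | K < \sum_(i < m) (p i.+1 - p i) * V i w ^+ 2] `<=` [set w | ((K / 4)%:E <= Q k w)%E] `|` [set w | ((K / 4)%:E <= Q' k w)%E].
  move=> w /= hK. have := integral_stepf_sqr (V^~ w) pS m (p0 0%N) pt' => eI. have : ((\sum_(i < m) (p i.+1 - p i) * V i w ^+ 2)%:E <= 2%:E * Q k w + 2%:E * Q' k w)%E.
   have ma : mfunT (fun s : R => (simple_integrand (n k) (tau k) (xi k) s w - H1 s w) ^+ 2).
    by apply: mfunX; apply: mfunB; [exact: (section_measurable w (simple_mfun (hs k)))|exact: section_measurable].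
   have mb : mfunT (fun s : R => (simple_integrand (n' k) (tau' k) (xi' k) s w - H1 s w) ^+ 2).
    by apply: mfunX; apply: mfunB; [exact: (section_measurable w (simple_mfun (hs' k)))|exact: section_measurable].
   rewrite -eI; apply: (@le_trans _ _ (\int[mu]_(s in `[0%R, t]) ((2 * (simple_integrand (n k) (tau k) (xi k) s w - H1 s w) ^+ 2)%:E + (2 * (simple_integrand (n' k) (tau' k) (xi' k) s w - H1 s w) ^+ 2)%:E))%E).
    apply: ge0_le_integral => //.
    - by move=> s _; rewrite lee_fin sqr_ge0.
    - by apply/mEFinP; apply: mfunTS; apply: mfunX; exact: stepf_measurable.
    - by apply/mEFinP; apply: mfunTS; apply: mfunD; exact: mfunM.
    - move=> s; rewrite /= in_itv/= => /andP[_ st]. by rewrite -EFinD lee_fin -Es//; exact: sqr_diff_le. rewrite ge0_integralD//; last 4 first.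
   - by move=> s _; rewrite lee_fin mulr_ge0// sqr_ge0.
   - by apply/mEFinP; apply: mfunTS; exact: mfunM.
   - by move=> s _; rewrite lee_fin mulr_ge0// sqr_ge0.
   - by apply/mEFinP; apply: mfunTS; exact: mfunM. under eq_integral do rewrite EFinM. under [X in (_ + X <= _)%E]eq_integral do rewrite EFinM. rewrite !ge0_integralZl_EFin//; first last.
   - by apply/mEFinP; exact: mfunTS.
   - by move=> s _; rewrite lee_fin sqr_ge0.
   - by apply/mEFinP; exact: mfunTS.
   - by move=> s _; rewrite lee_fin sqr_ge0. move=> hle; have [h|h] := leP (K / 4)%:E (Q k w); [by left|right]. have [//|h'] := leP (K / 4)%:E (Q' k w); exfalso.
  have Qf : (Q k w) \is a fin_num by rewrite ge0_fin_numE ?(lt_trans h) ?ltry//; apply: integral_ge0 => s _; rewrite lee_fin sqr_ge0.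
  have Qf' : (Q' k w) \is a fin_num by rewrite ge0_fin_numE ?(lt_trans h') ?ltry//; apply: integral_ge0 => s _; rewrite lee_fin sqr_ge0.
  move: hle h h' hK; rewrite -(fineK Qf) -(fineK Qf') -!EFinM -EFinD lee_fin !lte_fin. by move: (fine _) (fine _) (\sum_(i < m) _) => x y z; lra.
 move=> hP; rewrite sub0r normrN ger0_norm; last by rewrite fine_ge0 ?measure_ge0. have mA : measurable [set w | (e%:E <= `|S k w - S' k w|%:E)%E] by apply: mge_set; apply: mabs; exact: mfunB.
 have mB : measurable [set w | K < \sum_(i < m) (p i.+1 - p i) * V i w ^+ 2]. rewrite (_ : [set w | _] = (fun w => \sum_(i < m) (p i.+1 - p i) * V i w ^+ 2) @^-1` `]K, +oo[%classic).
   have mQO : mfunT (fun w => \sum_(i < m) (p i.+1 - p i) * V i w ^+ 2). apply: msum => i; apply: mfunM => //; apply: mfunX. exact: (mF_meas hF (p0 i) (mV i)).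
   by rewrite -[X in measurable X]setTI; apply: mQO => //; exact: mitv. by apply/seteqP; split => w /=; rewrite in_itv/= andbT. have mU := measurableU _ _ m1 m2.
 have hB : (P [set w | (K < \sum_(i < m) (p i.+1 - p i) * V i w ^+ 2)%R] <= P [set w | ((K / 4)%:E <= Q k w)%E] + P [set w | ((K / 4)%:E <= Q' k w)%E])%E.
  by apply: le_trans (measureU2 _ m1 m2); apply: le_measure; rewrite ?inE. have KE : K / e ^+ 2 = eta / 2 by rewrite /K mulfK// gt_eqF// exprn_gt0. move: hP hB; rewrite KE.
 have f1 := fin_num_measure P _ m1; have f2 := fin_num_measure P _ m2. have f3 := fin_num_measure P _ mA; have f4 := fin_num_measure P _ mB.
 rewrite -(fineK f1) -(fineK f2) -(fineK f4) -(fineK f3) /= -!EFinD !lee_fin.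
 move: b1 b2; move: (fine (P [set w | ((K / 4)%:E <= Q k w)%E])) (fine (P [set w | ((K / 4)%:E <= Q' k w)%E])) (fine _) (fine _) => x1 x2 x3 x4. lra.
apply: (cvg0_in_prob_le (Y1 := fun k w => `|S k w - S' k w|%:E) (Y2 := fun k w => `|S' k w - I w|%:E)) => //.
- by move=> k; apply: mabs; exact: (mfunB (mS k) mIO).
- by move=> k; apply: mabs; exact: (mfunB (mS k) (mS' k)).
- by move=> k; apply: mabs; exact: (mfunB (mS' k) mIO).
- move=> e e0; exists (e / 2); first by rewrite divr_gt0.
 move=> k w; rewrite !lee_fin => h. have [h1|h1] := leP (e / 2) `|S k w - S' k w|; [by left|right]. have := ler_normD (S k w - S' k w) (S' k w - I w); rewrite addrA subrK.
 by move: h h1; rewrite -/(S k w); move: `|_| `|_| `|_| => x y z; lra.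
Unshelve. all: end_near. Qed.
End brownian.

(** * Localisation and joint measurability of continuous adapted processes *)

Section paths.
Context d (Omega : measurableType d) (R : realType) (P : probability Omega R).
Variables (F : R -> set (set Omega)).
Hypothesis hF : usual_conditions P F.
Local Notation mF := (mF F).
Notation mu := (leb R).
Variable G : R -> Omega -> R.
Hypotheses (cG : cpath G) (aG : forall t, 0 <= t -> mF t (G t)).

(** These events replace stopping times: [stay N u] is known at time [u], decreases with [u], and
    contains any given path once [N] is large. *)
Definition stay (N u : R) : set Omega := [set w | forall v, 0 <= v <= u -> `|G v w| <= N].

Lemma stay_le N u v w : v <= u -> stay N u w -> stay N v w.
Proof. by move=> vu h x /andP[x0 xv]; apply: h; rewrite x0 (le_trans xv). Qed.

Lemma path_open (N v : R) w : 0 <= v -> N < `|G v w| ->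
 exists2 e : R, 0 < e & forall x, 0 <= x -> `|x - v| < e -> N < `|G x w|.
Proof.
move=> v0 Nv; have c1 := max0_continuous (@cG w).
have c2 : `|G (Num.max 0 x) w| @[x --> v] --> `|G (Num.max 0 v) w| by apply: cvg_norm; exact: c1.
rewrite (max_r v0) in c2.
have /nbhs_ballP[e /= e0 he] : \forall x \near v, N < `|G (Num.max 0 x) w| by exact: (cvgr_gt _ c2).
exists e => // x x0 xv.
by have := he x; rewrite /ball/= distrC => /(_ xv); rewrite (max_r x0).
Qed.

(** By continuity the times [q u] with [q] rational in [[0, 1]] suffice; the countable intersection
    is indexed through [unpickle]. *)
Lemma stay_mF (N u : R) : 0 <= u -> mF u (\1_(stay N u) : Omega -> R).
Proof.
move=> u0; apply: mindic.
have -> : stay N u = \bigcap_(q : rat) [set w | ~~ (0 <= (ratr q : R) <= 1) || (`|G (ratr q * u) w| <= N)].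
 apply/seteqP; split => w. move=> h q _ /=; case: (boolP (0 <= _ <= 1)) => //= /andP[q0 q1]. by apply: h; rewrite mulr_ge0//= ler_piMl. move=> h v /andP[v0 vu]; rewrite leNgt; apply/negP => Nv.
 have [e e0 he] := path_open v0 Nv. have key : exists q : rat, 0 <= (ratr q : R) <= 1 /\ `|ratr q * u - v| < e.
  move: v0; rewrite le_eqVlt => /predU1P[v0|v0]. by exists 0; rewrite rmorph0 lexx ler01 mul0r -v0 subr0 normr0. have up : 0 < u by exact: lt_le_trans vu. have ab : Num.max 0 (v - e) / u < v / u.
   by rewrite ltr_pM2r ?invr_gt0// gt_max v0/=; lra. have [q] := rat_in_itvoo ab; rewrite in_itv/= => /andP[q1 q2]; exists q.
  have q0 : 0 <= (ratr q : R) by rewrite ltW// (le_lt_trans _ q1)// divr_ge0 ?le_max ?lexx. rewrite q0 (le_trans (ltW q2)) ?ler_pdivrMr ?mul1r//; split => //.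
  move: q1 q2; rewrite ltr_pdivrMr// ltr_pdivlMr// gt_max => /andP[_ q1] q2. by rewrite ltr_norml; apply/andP; split; lra.
 have [q [q01 qe]] := key; have /= := h q I; rewrite q01/= leNgt he//. by rewrite mulr_ge0//; have /andP[] := q01.
set S := fun q : rat => [set w | _].
have -> : \bigcap_q S q = \bigcap_n (if unpickle n is Some q then S q else setT).
 apply/seteqP; split => w h; first by move=> n _; case: (unpickle n) => [q|//]; exact: h. by move=> q _; have := h (pickle q) I; rewrite pickleK.
apply: bigcapT_measurable => n; case: (unpickle n) => [q|]; last exact: measurableT.
rewrite /S.
case: (boolP (0 <= _ <= 1)) => /= [/andP[q0 q1]|_]; last first.
 by rewrite (_ : [set w | _] = setT)//; apply/seteqP; split => w.
have qu : 0 <= ratr q * u by rewrite mulr_ge0.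
have mq : mF u (G (ratr q * u)).
 by apply: (mF_mono hF qu _ (aG qu)); rewrite ler_piMl.
rewrite (_ : [set w | _] = (fun w => `|G (ratr q * u) w|) @^-1` `]-oo, N]%classic); last first.
 by apply/seteqP; split => w /=; rewrite in_itv.
rewrite -[X in measurable X]setTI; have mn : measurable_fun [set: g_sigma_algebraType (F u)] (fun w => `|G (ratr q * u) w|).
 exact: mcompT.
by apply: mn => //; exact: mitv.
Qed.

Lemma stay_ev w u : 0 <= u -> exists N0 : nat, forall N : nat, (N0 <= N)%N -> stay N%:R u w.
Proof.
move=> u0; have c1 := max0_continuous (@cG w).
have cn : {within `[0, u], continuous (fun x : R => `|G (Num.max 0 x) w|)}.
 apply: continuous_subspaceT => x. by apply: continuous_comp; [exact: c1|exact: norm_continuous].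
have [m _ hm] := EVT_max u0 cn.
exists (Num.bound `|G (Num.max 0 m) w|) => N hN v /andP[v0 vu].
have := hm v; rewrite in_itv/= v0 vu (max_r v0) => /(_ isT) /le_trans; apply.
by rewrite (le_trans (ltW (archi_boundP _)))// ler_nat.
Qed.

Lemma step_measurable n tau (xi : nat -> Omega -> R) : (forall i, (i < n)%N -> mfunT (xi i)) ->
 mfunT (fun z : Omega * R => simple_integrand n tau xi z.2 z.1).
Proof.
move=> mxi; apply: msum => i; apply: mfunM.
 exact: (mcompT (mxi i (ltn_ord i)) measurable_fst).
apply: (mcompT _ measurable_snd); apply: mindic; exact: mitv.
Qed.

Lemma simple_integrand_at n (tau : nat -> R) u : (forall i, tau i <= tau i.+1) ->
 tau 0%N < u -> u <= tau n -> exists2 i, (i < n)%N & tau i < u <= tau i.+1 /\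
  forall (xi : nat -> Omega -> R) w, simple_integrand n tau xi u w = xi i w.
Proof.
move=> tS t0u; elim: n => [|n IH] h; first by move: t0u; rewrite ltNge h.
have [un|nu] := leP u (tau n).
 have [i iN [hi E]] := IH un; exists i; first exact: ltnW. split=> // xi w; rewrite /simple_integrand big_ord_recr/= -/(simple_integrand n tau xi u w) E.
 by rewrite indicE mem_setE in_itv/= ltNge un mulr0 addr0.
exists n => //; split=> [|xi w]; first by rewrite nu h.
rewrite /simple_integrand big_ord_recr/= big1 ?add0r; first by rewrite indicE mem_setE in_itv/= nu h mulr1.
by move=> i _; rewrite indicE mem_setE in_itv/= [u <= _]leNgt (le_lt_trans (seq_mono tS (ltn_ord i)) nu) andbF mulr0//.
Qed.

(** By continuity, for [u > 0] the process is the limit of its values at the left endpoints of grids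
    of mesh [1 / (k + 1)] covering []0, k + 1]]. *)
Lemma joint_measurable : mfunT (fun z : Omega * R => G (Num.max 0 z.2) z.1).
Proof.
pose tau k i : R := i%:R / k.+1%:R.
have tS k i : tau k i <= tau k i.+1 by rewrite ler_pM2r ?invr_gt0// ler_nat.
have t0 k i : 0 <= tau k i by rewrite divr_ge0.
pose h k (z : Omega * R) := simple_integrand (k.+1 * k.+1) (tau k) (fun i => G (tau k i)) z.2 z.1 + G 0 z.1 * (z.2 <= 0)%R%:R.
apply: (@measurable_fun_cvg _ _ _ setT h).
 move=> k; apply: mfunD. by apply: step_measurable => i _; exact: (mF_meas hF (t0 k i) (aG (t0 k i))). apply: mfunM; first exact: (mcompT (mF_meas hF (lexx 0) (aG (lexx 0))) measurable_fst).
 exact: (mcompT (measurable_le01 0) measurable_snd).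
move=> [w u] _ /=; have [u0|u0] := ltP 0 u; last first.
 apply: cvg_near_cst; apply: nearW => k; rewrite /h/= u0 mulr1 /simple_integrand big1 ?add0r// => i _. by rewrite indicE mem_setE in_itv/= ltNge (le_trans u0 (t0 k i)) mulr0.
have c1 := max0_continuous (@cG w).
apply/cvgrPdist_le => e e0.
have := c1 u; rewrite /continuous_at (max_r (ltW u0)) => /cvgrPdist_le/(_ e e0)/nbhs_ballP[r /= r0 hr].
near=> k; rewrite /h/= [u <= 0]leNgt u0 mulr0 addr0.
have uk : u <= tau k (k.+1 * k.+1)%N.
 rewrite /tau natrM mulfK ?pnatr_eq0//. have : u < k%:R by near: k; exact: nbhs_infty_gtr. by move=> /ltW/le_trans; apply; rewrite ler_nat.
have [|i _ [/andP[i1 i2] ->]] := @simple_integrand_at _ (tau k) u (tS k) _ uk.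
 by rewrite /tau mul0r.
have := hr (tau k i); rewrite (max_r (t0 k i)); apply; rewrite /ball/=.
rewrite gtr0_norm ?subr_gt0//.
have : (k.+1%:R^-1 : R) < r by near: k; apply: near_infty_natSinv_lt (PosNum r0).
have e1 : tau k i.+1 = tau k i + k.+1%:R^-1 by rewrite /tau -[i.+1%:R]natr1 mulrDl mul1r.
move: i2; rewrite e1; move: (tau k i) (k.+1%:R^-1) => x y; lra.
Unshelve. all: end_near. Qed.

End paths.

(** * Grids containing an intermediate time *)

Section dyadic_grid.
Variables (R : realType) (s t : R).
Hypotheses (s0 : 0 <= s) (st : s <= t).

(** [k + 1] equal cells of [[0, s]] followed by [k + 1] equal cells of [[s, t]]: at every level [s]
    is a grid point, so no cell straddles the singularity at [s] of the kernels used below. *)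
Definition dtau (k i : nat) : R :=
 if (i <= k.+1)%N then s * (i%:R / k.+1%:R) else s + (t - s) * ((i - k.+1)%:R / k.+1%:R).
Definition dn (k : nat) : nat := (k.+1 + k.+1)%N.

Let t0 : 0 <= t. Proof. exact: le_trans st. Qed.

Lemma dtau0 k : dtau k 0 = 0. Proof. by rewrite /dtau /= mul0r mulr0. Qed.

Lemma dtau_mid k : dtau k k.+1 = s.
Proof. by rewrite /dtau leqnn divff ?pnatr_eq0// mulr1. Qed.

Lemma dtau_end k : dtau k (dn k) = t.
Proof.
rewrite /dtau /dn ifF; last by apply/negbTE; rewrite -ltnNge -addSnnS ltn_addr.
by rewrite addnK divff ?pnatr_eq0// mulr1 addrC subrK.
Qed.

Lemma dtau_step k i : dtau k i.+1 - dtau k i = (if (i < k.+1)%N then s else t - s) / k.+1%:R.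
Proof.
have k0 : (k.+1%:R : R) != 0 by rewrite pnatr_eq0.
rewrite /dtau; case: ltngtP => [ik|ik|->].
- by rewrite -[i.+1%:R]natr1; move: (i%:R) (k.+1%:R) k0 => x z z0; field.
- by rewrite subSn ?(ltnW ik)// -natr1; move: ((i - _)%:R) (k.+1%:R) k0 => x z z0; field.
- by rewrite subSnn; move: (k.+1%:R) k0 => z z0; field.
Qed.

Lemma dtauS k i : dtau k i <= dtau k i.+1.
Proof. by rewrite -subr_ge0 dtau_step divr_ge0//; case: ifP => _ //; rewrite subr_ge0. Qed.

Lemma dtau_ge0 k i : 0 <= dtau k i.
Proof. by rewrite -(dtau0 k); apply: seq_mono => // j; exact: dtauS. Qed.

Lemma dtau_le k i : (i <= dn k)%N -> dtau k i <= t.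
Proof. by move=> h; rewrite -[leRHS](dtau_end k); apply: seq_mono => // j; exact: dtauS. Qed.

Lemma dtau_mesh k i : dtau k i.+1 - dtau k i <= t / k.+1%:R.
Proof. by rewrite dtau_step ler_pM2r ?invr_gt0//; case: ifP => _ //; rewrite lerBlDr lerDl. Qed.

End dyadic_grid.

(** * Convergence in probability *)

Section vanishing.
Context d (Omega : measurableType d) (R : realType) (P : probability Omega R).

Lemma cvg_in_prob (Y : nat -> Omega -> \bar R) : (forall k, mfunT (Y k)) -> (forall k w, 0 <= Y k w)%E ->
 (forall w, Y k w @[k --> \oo] --> 0%E) -> cvg0_in_prob P Y.
Proof.
move=> mY Y0 cY e e0.
have mA k : measurable [set w | (e%:E <= Y k w)%E] by exact: mge_set.
have E k : P [set w | (e%:E <= Y k w)%E] = (\int[P]_w (\1_[set w | (e%:E <= Y k w)%E] w)%:E)%E.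
 by rewrite integral_indic// setIT.
under eq_fun do rewrite E.
have -> : 0%E = (\int[P]_w (0 : R)%:E)%E by rewrite integral0.
apply: (@dominated_cvg _ _ _ P setT measurableT (fun k w => (\1_[set w | (e%:E <= Y k w)%E] w)%:E) (fun=> 0%:E) (fun=> 1%:E)) => //.
- by move=> k; apply/mEFinP; exact: mindic.
- move=> w _; apply: cvg_near_cst.
 have : \forall k \near \oo, (Y k w < e%:E)%E. have h : nbhs (0%E : \bar R) [set y | (y < e%:E)%E] by apply: open_ereal_lt'; rewrite lte_fin. exact: (cY w _ h).
 apply: filterS => k h; rewrite indicE memNset//=; apply/negP; rewrite -ltNge//.
- by apply/integrableP; split=> //; rewrite (eq_integral (cst 1%E)) ?integral_cst//= ?probability_setT ?mul1e ?ltry// => w _; rewrite /= normr1.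
- by move=> k w _; rewrite lee_fin indicE; case: (_ \in _); rewrite ?normr1 ?normr0.
Qed.

(** [phi k] is chosen so that [|Y|] reaches [2 ^ - k] with probability at most [2 ^ - (k + 1)], and
    the Borel-Cantelli lemma applies. The indices satisfy [k <= phi k], which is enough to tend to
    infinity. *)
Lemma cvg_prob_subseq (Y : nat -> Omega -> R) : (forall k, mfunT (Y k)) ->
 cvg0_in_prob P (fun k w => `|Y k w|%:E) ->
 exists2 phi : nat -> nat, (forall k, (k <= phi k)%N) & {ae P, forall w, Y (phi k) w @[k --> \oo] --> 0}.
Proof.
move=> mY cY.
have mA k (e : R) : measurable [set w | (e%:E <= `|Y k w|%:E)%E].
 by apply: mge_set; apply/mEFinP; exact: mcompT.
have e0 (k : nat) : 0 < (2^-1 ^+ k : R) by rewrite exprn_gt0.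
have ex k : exists2 m : nat, (k <= m)%N & (P [set w | ((2^-1 ^+ k)%:E <= `|Y m w|%:E)%E] <= (2^-1 ^+ k.+1)%:E)%E.
 have /fine_cvgP[_ /cvgrPdist_le/(_ _ (e0 k.+1)) [n0 _ h]] := cY _ (e0 k). exists (maxn k n0); first exact: leq_maxl.
 have := h (maxn k n0); rewrite /= leq_maxr => /(_ isT). rewrite sub0r normrN => /(le_trans (ler_norm _)) hh. by rewrite -(fineK (fin_num_measure P _ (mA _ _))) lee_fin.
have [phi hphi] := choice (fun k => let: ex_intro2 m h1 h2 := ex k in ex_intro (fun m => (k <= m)%N /\ (P [set w | ((2^-1 ^+ k)%:E <= `|Y m w|%:E)%E] <= (2^-1 ^+ k.+1)%:E)%E) m (conj h1 h2)).
exists phi; first by move=> k; have [] := hphi k.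
pose A k := [set w | ((2^-1 ^+ k)%:E <= `|Y (phi k) w|%:E)%E].
have sA : (\sum_(k <oo) P (A k) < +oo)%E.
 apply: (@le_lt_trans _ _ (\sum_(k <oo) ((2^-1 : R) ^+ k.+1)%:E)%E). by apply: lee_nneseries => k _ //; have [] := hphi k. apply: (@le_lt_trans _ _ 1%:E); last exact: ltry.
 apply: le_trans (@epsilon_trick0 R 1 xpredT ler01); apply: eq_ler. by apply: eq_eseriesr => k _; rewrite div1r exprVn natrX.
have := lim_sup_set_cvg0 (fun k => mA (phi k) (2^-1 ^+ k)) sA => h0.
exists (lim_sup_set A); split => //.
 apply: bigcap_measurable => // n _; apply: bigcup_measurable => // k _; exact: mA.
apply: subsetCl => w /= hw; apply/cvgrPdist_le => e ep.
have [n hn] : exists n, forall k, (n <= k)%N -> `|Y (phi k) w| < 2^-1 ^+ k.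
 apply: contrapT => h; apply: hw => n _. apply: contrapT => h'; apply: h; exists n => k nk. by rewrite ltNge; apply/negP => hk; apply: h'; exists k => //=; rewrite /A/= lee_fin.
have c0 : (2^-1 : R) ^+ k @[k --> \oo] --> (0 : R) by apply: cvg_expr; rewrite ger0_norm; lra.
have /cvgrPdist_le/(_ e ep) c1 := c0.
near=> k; rewrite sub0r normrN.
have h1 : `|Y (phi k) w| < 2^-1 ^+ k by apply: hn; near: k; exact: nbhs_infty_ge.
apply: (le_trans (ltW h1)).
have : `|0 - (2^-1 : R) ^+ k| <= e by near: k.
by rewrite sub0r normrN ger0_norm// ltW.
Unshelve. all: end_near. Qed.

End vanishing.

(** * Limits under moment bounds *)

Section fatou_vitali.
Variables (d : measure_display) (T : measurableType d) (R : realType) (m : {measure set T -> \bar R}).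

Lemma fatou_le (f : nat -> T -> R) (g : T -> R) (c : nat -> R) (l : R) :
 (forall k, mfunT (f k)) -> (forall k x, 0 <= f k x) -> mfunT g -> (forall x, 0 <= g x) ->
 {ae m, forall x, f k x @[k --> \oo] --> g x} ->
 (forall k, (\int[m]_x (f k x)%:E <= (c k)%:E)%E) -> c k @[k --> \oo] --> l ->
 (\int[m]_x (g x)%:E <= l%:E)%E.
Proof.
move=> mf f0 mg g0 fg fc cl.
pose F k x := (f k x)%:E.
have mF k : mfunT (F k) by exact/mEFinP.
apply: (@le_trans _ _ (\int[m]_x limn_einf (F^~ x))%E).
 apply: ae_ge0_le_integral => //.
 - by move=> x _; rewrite lee_fin.
 - exact/mEFinP.
 - by move=> x _; rewrite limn_einf_lim; apply: lime_ge; [exact: is_cvg_einfs|apply: nearW => n; apply: le_ereal_inf_tmp => _ [k _ <-]; rewrite lee_fin].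
 - apply: (@emeasurable_fun_cvg _ _ _ setT (fun n x => einfs (F^~ x) n)); first exact: measurable_fun_einfs. by move=> x _; rewrite limn_einf_lim; exact: is_cvg_einfs.
 - apply: filterS fg => x h _. have h' : F k x @[k --> \oo] --> (g x)%:E by apply: cvg_EFin => //; exact: nearW.
  rewrite is_cvg_limn_einfE; last by apply/cvg_ex; exists (g x)%:E. by rewrite (cvg_lim _ h').
apply: (le_trans (@fatou _ _ _ m setT measurableT F mF _)); first by move=> n x _; rewrite lee_fin.
have cl' : (c k)%:E @[k --> \oo] --> l%:E by apply: cvg_EFin => //; exact: nearW.
rewrite limn_einf_lim -(cvg_lim _ cl')//; apply: lee_lim.
- exact: is_cvg_einfs.
- by apply/cvg_ex; exists l%:E.
- apply: nearW => n; apply: le_trans (fc n); apply: ereal_inf_lbound; exists n => //=.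
Qed.

End fatou_vitali.

Section vitali.
Context d (T : measurableType d) (R : realType) (P : probability T R).

Lemma sqr_le_pow (q : nat) (x K : R) : (0 < q)%N -> 0 < K -> x ^+ 2 <= Num.min (x ^+ 2) K + x ^+ q.*2 / K ^+ q.-1.
Proof.
move=> q0 K0; have p0 : 0 <= x ^+ q.*2 / K ^+ q.-1.
 by rewrite divr_ge0//; [rewrite -mul2n exprM exprn_ge0// sqr_ge0|rewrite exprn_ge0// ltW].
have [h|h] := leP (x ^+ 2) K; first by rewrite lerDl.
apply: (@le_trans _ _ (x ^+ q.*2 / K ^+ q.-1)); last by rewrite lerDr ltW.
rewrite ler_pdivlMr ?exprn_gt0// -mul2n exprM -[in leRHS](prednK q0) [leRHS]exprS.
by rewrite ler_wpM2l ?sqr_ge0// lerXn2r ?nnegrE ?sqr_ge0 ?(ltW K0)// ltW.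
Qed.

Lemma pow_sqr_le1 (q : nat) (x : R) : (0 < q)%N -> x ^+ 2 <= 1 + x ^+ q.*2.
Proof.
move=> q0; have := sqr_le_pow x q0 ltr01; rewrite expr1n divr1 => /le_trans; apply.
by rewrite lerD2r ge_min lexx orbT.
Qed.

(** Bounded moments of order [2 q > 2] make the squares uniformly integrable: by [sqr_le_pow],
    truncation at [K] loses at most [C / K ^ (q - 1)], and the truncated squares converge by
    dominated convergence. *)
Lemma vitali_sqr (q : nat) (X : nat -> T -> R) (Y : T -> R) (C : R) : (1 < q)%N ->
 (forall k, mfunT (X k)) -> mfunT Y ->
 {ae P, forall x, X k x @[k --> \oo] --> Y x} ->
 (forall k, (\int[P]_x (X k x ^+ q.*2)%:E <= C%:E)%E) ->
 (\int[P]_x (Y x ^+ q.*2)%:E <= C%:E)%E /\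
 (\int[P]_x (X k x ^+ 2)%:E @[k --> \oo] --> \int[P]_x (Y x ^+ 2)%:E)%E.
Proof.
move=> q1 mX mY XY XC.
have ev (x : R) := expr_double_ge0 x q.
have YC : (\int[P]_x (Y x ^+ q.*2)%:E <= C%:E)%E.
 apply: (@fatou_le _ _ _ P (fun k x => X k x ^+ q.*2) _ (fun=> C)) => //.
 - by move=> k; exact: mfunX.
 - exact: mfunX.
 - by apply: filterS XY => x h; exact: (cvg_comp _ _ h (@exprn_continuous R q.*2 (Y x))).
 - exact: cvg_cst.
split=> //.
have q0 : (0 < q)%N by exact: ltnW.
have C0 : 0 <= C by rewrite -lee_fin; apply: le_trans YC; apply: integral_ge0 => x _; rewrite lee_fin.
have fX (Z : T -> R) : mfunT Z -> (\int[P]_x (Z x ^+ q.*2)%:E <= C%:E)%E ->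
  forall K : R, 0 < K -> (\int[P]_x (Num.min (Z x ^+ 2) K)%:E <= \int[P]_x (Z x ^+ 2)%:E <= \int[P]_x (Num.min (Z x ^+ 2) K)%:E + (C / K ^+ q.-1)%:E)%E /\ (\int[P]_x (Num.min (Z x ^+ 2) K)%:E <= K%:E)%E.
 move=> mZ ZC K K0; have mn : mfunT (fun x => Num.min (Z x ^+ 2) K). by apply: measurable_minr => //; exact: mfunX.
 have min0 x : 0 <= Num.min (Z x ^+ 2) K by rewrite le_min sqr_ge0 ltW. split; last first. apply: (@le_trans _ _ (\int[P]_x (cst K%:E x))%E). apply: ge0_le_integral => //.
   - by move=> x _; rewrite lee_fin.
   - exact/mEFinP.
   - by move=> x _; rewrite lee_fin ge_min lexx orbT. by rewrite integral_cst//; have /= -> := @probability_setT _ _ _ P; rewrite mule1. apply/andP; split. apply: ge0_le_integral => //.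
  - by move=> x _; rewrite lee_fin.
  - exact/mEFinP.
  - by apply/mEFinP; exact: mfunX.
  - by move=> x _; rewrite lee_fin ge_min lexx. apply: (@le_trans _ _ (\int[P]_x ((Num.min (Z x ^+ 2) K)%:E + ((K ^+ q.-1)^-1%:E * (Z x ^+ q.*2)%:E)))%E). apply: ge0_le_integral => //.
  - by move=> x _; exact: lee_sqr0.
  - by apply/mEFinP; exact: mfunX.
  - apply/mEFinP; apply: mfunD => //; apply: mfunM => //; exact: mfunX.
  - by move=> x _; rewrite -EFinM -EFinD lee_fin mulrC; exact: sqr_le_pow. have Ki : 0 <= (K ^+ q.-1)^-1 by rewrite invr_ge0 exprn_ge0// ltW. rewrite ge0_integralD//; last 4 first.
 - by move=> x _; rewrite lee_fin.
 - exact/mEFinP.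
 - by move=> x _; rewrite -EFinM lee_fin mulr_ge0.
 - by apply/mEFinP; apply: mfunM => //; exact: mfunX. rewrite leeD2l// ge0_integralZl_EFin//; last 2 first.
 - by move=> x _; rewrite lee_fin.
 - by apply/mEFinP; exact: mfunX. by rewrite mulrC EFinM; apply: lee_wpmul2l; rewrite ?lee_fin.
have fin (Z : T -> R) : mfunT Z -> (\int[P]_x (Z x ^+ q.*2)%:E <= C%:E)%E -> (\int[P]_x (Z x ^+ 2)%:E)%E \is a fin_num.
 move=> mZ ZC; have [/andP[_ h] h2] := fX Z mZ ZC 1 ltr01. rewrite ge0_fin_numE; last by apply: integral_ge0 => x _; exact: lee_sqr0.
 by apply: (le_lt_trans h); apply: (@le_lt_trans _ _ (1 + (C / 1 ^+ q.-1)%:E)%E); [rewrite leeD2r|rewrite -EFinD ltry].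
rewrite -(fineK (fin Y mY YC)); apply/fine_cvgP; split.
 by apply: nearW => k; apply: fin => //; exact: XC.
apply/cvgrPdist_le => e e0.
have [K K0 hK] : exists2 K : R, 0 < K & C / K ^+ q.-1 <= e / 3.
 (* As [K >= 1] and [q > 1], [K ^ (q - 1) >= K], and [C / K <= e / 3]. *)
 exists (1 + 3 * C / e) => //; first by rewrite ltr_pwDl// divr_ge0 ?mulr_ge0 ?(ltW e0). set K := 1 + _; have K1 : 1 <= K by rewrite lerDl divr_ge0 ?mulr_ge0 ?(ltW e0).
 rewrite ler_pdivrMr ?exprn_gt0 ?(lt_le_trans ltr01)//. apply: (@le_trans _ _ (e / 3 * K)). rewrite /K mulrDr mulr1 (_ : e / 3 * (3 * C / e) = C) ?lerDr; first by rewrite ltW// divr_gt0.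
  by field; rewrite gt_eqF. rewrite ler_wpM2l ?divr_ge0 ?(ltW e0)// -{1}[K]expr1; apply: ler_weXn2l => //; lia.
have c1 : (\int[P]_x (Num.min (X k x ^+ 2) K)%:E @[k --> \oo] --> \int[P]_x (Num.min (Y x ^+ 2) K)%:E)%E.
 have mn (Z : T -> R) : mfunT Z -> mfunT (fun x => (Num.min (Z x ^+ 2) K)%:E). by move=> mZ; apply/mEFinP; apply: measurable_minr => //; exact: mfunX.
 have [] // := @dominated_convergence _ _ _ P setT measurableT (fun k x => (Num.min (X k x ^+ 2) K)%:E) (fun x => (Num.min (Y x ^+ 2) K)%:E) (fun=> K%:E).
 - by move=> k; exact: mn.
 - exact: mn.
 - apply: filterS XY => x h _; apply: cvg_EFin; first exact: nearW. have cm : continuous (fun z : R => Num.min (z ^+ 2) K).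
   move=> z; exact: (@continuous_min R R (fun z : R => z ^+ 2) (fun=> K) z (@exprn_continuous R 2 z) (@cst_continuous _ _ K z)). exact: (cvg_comp _ _ h (cm (Y x))).
 - apply/integrableP; split => //. rewrite (eq_integral (cst K%:E)); last by move=> x _; rewrite /= ger0_norm// ltW. by rewrite integral_cst//; have /= -> := @probability_setT _ _ _ P; rewrite mule1 ltry.
 - apply: aeW => x k _ ; rewrite lee_fin ger0_norm ?ge_min ?lexx ?orbT//. by rewrite le_min sqr_ge0 ltW.
have fm (Z : T -> R) : mfunT Z -> (\int[P]_x (Z x ^+ q.*2)%:E <= C%:E)%E -> (\int[P]_x (Num.min (Z x ^+ 2) K)%:E)%E \is a fin_num.
 move=> mZ ZC; have [_ h] := fX Z mZ ZC K K0. rewrite ge0_fin_numE; first exact: (le_lt_trans h (ltry _)). by apply: integral_ge0 => x _; rewrite lee_fin le_min sqr_ge0 ltW.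
have e3 : 0 < e / 3 by rewrite divr_gt0.
rewrite -(fineK (fm Y mY YC)) in c1; move/fine_cvgP : c1 => [_ /cvgrPdist_le/(_ _ e3) c1].
near=> k.
have h1 : `|fine (\int[P]_x (Num.min (Y x ^+ 2) K)%:E)%E - fine (\int[P]_x (Num.min (X k x ^+ 2) K)%:E)%E| <= e / 3 by near: k.
have [/andP[a1 a2] _] := fX Y mY YC K K0; have [/andP[b1 b2] _] := fX (X k) (mX k) (XC k) K K0.
move: a1 a2 b1 b2; rewrite -(fineK (fm Y mY YC)) -(fineK (fm _ (mX k) (XC k))) -(fineK (fin Y mY YC)) -(fineK (fin _ (mX k) (XC k))) -!EFinD !lee_fin /=.
move: h1; rewrite !ler_norml; move: (fine _) (fine _) (fine _) (fine _) => x y z v; lra.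
Unshelve. all: end_near. Qed.
End vitali.

Lemma simple_integrand_stepf (Omega : Type) (R : realType) n (tau : nat -> R) (xi : nat -> Omega -> R) u w :
 (forall i, tau i <= tau i.+1) -> simple_integrand n tau xi u w = stepf tau (xi^~ w) n u.
Proof.
move=> tS; apply: eq_bigr => i _; rewrite indicE mem_setE in_itv/=.
by have [h|h] := leP u (tau i); rewrite /= ?subr0// (le_trans h)// subrr.
Qed.

Lemma ae_lebS (R : realType) (P Q : R -> Prop) : (forall u, P u -> Q u) ->
 {ae @lebesgue_measure R, forall u : R, P u} -> {ae @lebesgue_measure R, forall u : R, Q u}.
Proof. by move=> PQ; apply: negligibleS => u /= hQ hP; apply: hQ; exact: PQ. Qed.

Lemma ae_neq3 (R : realType) (s t : R) : {ae @lebesgue_measure R, forall u : R, [/\ u != 0, u != s & u != t]}.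
Proof.
exists ([set 0] `|` [set s] `|` [set t]); split.
- by apply: measurableU; [apply: measurableU|]; exact: measurable_set1.
- apply: countable_lebesgue_measure0; apply: finite_set_countable.
 by rewrite !finite_setU; split; [split|]; exact: finite_set1.
- move=> u /= h; apply: contrapT => h2; apply: h; split; apply/eqP => e; apply: h2; rewrite e.
 + by left; left.
 + by left; right.
 + by right.
Qed.

(** * Riemann sums of singular kernels *)

Section grid_limits.
Variables (R : realType) (s t : R) (psi g : R -> R).
Notation mu := (leb R).
Hypotheses (s0 : 0 <= s) (st : s <= t).
Hypotheses (mpsi : mfunT psi) (ig : L1 (fun u => g u ^+ 2)) (cpsi : forall u, 0 < u < t -> u != s -> {for u, continuous psi}).
Hypothesis gpsi : forall x u, 0 <= x <= u -> 0 < u < t -> u != s -> (s < u -> s <= x) -> `|psi x| <= g u.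
Local Notation tau := (dtau s t).

(* The left endpoints of the grid cells containing [u]. *)
Lemma grid_points u : 0 < u < t -> u != s -> exists x : nat -> R,
 [/\ forall k, 0 <= x k < u, x k @[k --> \oo] --> u, forall k, (s < u -> s <= x k) &
  forall (Omega : Type) k (zeta : R -> Omega -> R) w,
   simple_integrand (dn k) (tau k) (fun i => zeta (tau k i)) u w = zeta (x k) w].
Proof.
move=> /andP[u0 ut] us.
have h k : exists x : R, [/\ 0 <= x < u, u - x <= t / k.+1%:R, (s < u -> s <= x) &
  forall (Omega : Type) (zeta : R -> Omega -> R) w, simple_integrand (dn k) (tau k) (fun i => zeta (tau k i)) u w = zeta x w].
 have tS := dtauS s0 st k. have ex : exists2 i, (i < dn k)%N & tau k i < u <= tau k i.+1. have: u <= tau k (dn k) by rewrite dtau_end// ltW.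
  elim: (dn k) => [|n IH] hn; first by move: u0; rewrite ltNge -(dtau0 s t k) hn. have [h1|h1] := leP u (tau k n); last by exists n => //; rewrite h1 hn.
  by have [i i1 i2] := IH h1; exists i => //; exact: ltnW. have [i iN /andP[h1 h2]] := ex; exists (tau k i); split.
 - by rewrite dtau_ge0.
 - by apply: le_trans (dtau_mesh s0 st k i); rewrite lerD2r.
 - move=> su; have [ik|ik] := leqP k.+1 i. by have := seq_mono tS ik; rewrite dtau_mid. have h3 := seq_mono tS ik; rewrite dtau_mid in h3. by move: (lt_le_trans su (le_trans h2 h3)); rewrite ltxx.
 - move=> Omega zeta w; rewrite /simple_integrand (bigD1 (Ordinal iN))//= indicE mem_setE in_itv/= h1 h2 mulr1. rewrite big1 ?addr0// => j ji; rewrite indicE mem_setE in_itv/=.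
  have [jl|jl|je] := ltngtP j i; last by move: ji; rewrite -val_eqE/= je eqxx. by rewrite [u <= _]leNgt (le_lt_trans (seq_mono tS jl) h1) andbF mulr0.
  by rewrite ltNge (le_trans h2 (seq_mono tS jl)) mulr0.
have [x hx] := choice h; exists x; split.
- by move=> k; have [] := hx k.
- apply/cvgrPdist_le => e e0.
 have c0 : t * k.+1%:R^-1 @[k --> \oo] --> (0 : R). by rewrite -[X in _ --> X](mulr0 t); apply: cvgM; [exact: cvg_cst|exact: cvg_harmonic].
 have /cvgrPdist_le/(_ e e0) c1 := c0. near=> k; have [/andP[x0 xu] h2 _ _] := hx k. rewrite ger0_norm ?subr_ge0 ?(ltW xu)//; apply: (le_trans h2). have : `|0 - t * k.+1%:R^-1| <= e by near: k.
 by rewrite sub0r normrN; apply: le_trans; exact: ler_norm.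
- by move=> k; have [] := hx k.
- by move=> Omega k; have [_ _ _] := hx k; apply.
Unshelve. all: end_near. Qed.

Lemma psi_cvg u (x : nat -> R) : 0 < u < t -> u != s -> x k @[k --> \oo] --> u -> psi (x k) @[k --> \oo] --> psi u.
Proof. by move=> u0 us xu; exact: (cvg_comp _ _ xu (cpsi u0 us)). Qed.

(** With [zeta = psi * sqrt y_], the sum is the integral of the square of a step function. The
    hypothesis [gpsi] bounds [psi] at the left endpoint of the cell of [u] by [g u], so [C g ^ 2]
    dominates in spite of the singularities. *)
Lemma riemann_sum (y_ : nat -> R -> R) (y : R -> R) (C : R) : mfunT y ->
 (forall k x, 0 <= x <= t -> 0 <= y_ k x <= C) ->
 (forall u, 0 < u < t -> u != s -> forall x : nat -> R, (forall k, 0 <= x k < u) -> x k @[k --> \oo] --> u ->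
  y_ k (x k) @[k --> \oo] --> y u) ->
 \sum_(i < dn k) (tau k i.+1 - tau k i) * (psi (tau k i) ^+ 2 * y_ k (tau k i)) @[k --> \oo] -->
  \int[mu]_(u in `[0, t]) (psi u ^+ 2 * y u).
Proof.
move=> my yC ycvg.
pose zeta k (x : R) (_ : unit) := psi x * Num.sqrt (y_ k x).
pose h k u := stepf (tau k) (fun i => zeta k (tau k i) tt) (dn k) u ^+ 2.
have tp k i : (i <= dn k)%N -> 0 <= tau k i <= t by move=> hi; rewrite dtau_ge0//= dtau_le.
have E k : \sum_(i < dn k) (tau k i.+1 - tau k i) * (psi (tau k i) ^+ 2 * y_ k (tau k i)) =
  fine (\int[mu]_(u in `[0%R, t]) (h k u)%:E)%E. pose p i := Num.min (tau k i) t. have Ep : forall i, (i <= dn k)%N -> p i = tau k i by move=> i /tp/andP[_ h1]; exact: min_l.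
 have pS i : p i <= p i.+1 by rewrite le_min !ge_min dtauS// lexx orbT. have Eh u : h k u = stepf p (fun i => zeta k (tau k i) tt) (dn k) u ^+ 2.
  rewrite /h; congr (_ ^+ 2); apply: eq_bigr => i _. by rewrite !Ep// ltnW. under [in RHS]eq_integral do rewrite Eh. rewrite integral_stepf_sqr//=.
 - apply: eq_bigr => i _; rewrite !Ep//; last exact: ltnW. rewrite exprMn sqr_sqrtr//. by have /andP[] := yC k _ (tp k i (ltnW (ltn_ord i))).
 - by rewrite Ep// dtau0.
 - by move=> i; rewrite ge_min lexx orbT.
rewrite (_ : (fun k => _) = fun k => fine (\int[mu]_(u in `[0%R, t]) (h k u)%:E)%E); last by apply/funext => k; exact: E.
have t0 : 0 <= t by exact: le_trans st.
have C0 : 0 <= C by have := yC 0%N 0; rewrite lexx t0 => /(_ isT)/andP[]; exact: le_trans.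
have bnd u k : 0 < u < t -> u != s -> `|h k u| <= C * g u ^+ 2.
 move=> u0 us; have [x [x0 _ xs E']] := grid_points u0 us. rewrite /h -(simple_integrand_stepf (dn k) (fun i => zeta k (tau k i)) u tt (dtauS s0 st k)) E'.
 have /andP[xk0 xku] := x0 k; have /andP[u00 ut] := u0. have xt : 0 <= x k <= t by rewrite xk0 (ltW (lt_trans xku ut)). have /andP[y0 yc] := yC k _ xt.
 rewrite ger0_norm ?sqr_ge0// exprMn sqr_sqrtr// mulrC. apply: ler_pM => //; first exact: sqr_ge0. have b := gpsi _ u0 us (xs k); rewrite -[leLHS]real_normK ?num_real// lerXn2r ?nnegrE//.
  by apply: le_trans (b _); rewrite ?xk0 ?(ltW xku). by apply: b; rewrite xk0 ltW.
have cv u : 0 < u < t -> u != s -> h k u @[k --> \oo] --> psi u ^+ 2 * y u.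
 move=> u0 us; have [x [x0 xu xs E']] := grid_points u0 us. have yx := ycvg u u0 us x x0 xu; have px := psi_cvg u0 us xu. have H : psi (x k) ^+ 2 * y_ k (x k) @[k --> \oo] --> psi u ^+ 2 * y u.
  by apply: cvgM => //; exact: (cvg_comp _ _ px (@exprn_continuous R 2 (psi u))). apply: cvg_trans H; apply: near_eq_cvg; apply: nearW => k.
 rewrite /h -(simple_integrand_stepf (dn k) (fun i => zeta k (tau k i)) u tt (dtauS s0 st k)) E'. have /andP[xk0 xku] := x0 k; have /andP[u00 ut] := u0.
 have xt : 0 <= x k <= t by rewrite xk0 (ltW (lt_trans xku ut)). by have /andP[y0 yc] := yC k _ xt; rewrite exprMn sqr_sqrtr.
have [] := @dominated_convergence _ _ _ mu `[0%R, t]%classic (mitv _) (fun k u => (h k u)%:E) (fun u => (psi u ^+ 2 * y u)%:E) (fun u => (C * g u ^+ 2)%:E).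
- move=> k; apply/mEFinP; apply: mfunTS; apply: mfunX; exact: stepf_measurable.
- apply/mEFinP; apply: mfunTS; apply: mfunM => //; exact: mfunX.
- apply: ae_lebS (ae_neq3 s t) => u [u0 us ut]; rewrite /= in_itv/= => /andP[u0' ut'].
 apply: cvg_EFin; first exact: nearW. by apply: cv => //; rewrite !lt_neqAle eq_sym u0 u0' ut ut'.
- by apply: integrableS (L1Z C ig).
- apply: ae_lebS (ae_neq3 s t) => u [u0 us ut] k; rewrite /= in_itv/= => /andP[u0' ut'].
 by rewrite lee_fin; apply: bnd => //; rewrite !lt_neqAle eq_sym u0 u0' ut ut'.
by move=> ip _ H; apply: fine_cvg; rewrite fineK//; exact: integrable_fin_num.
Qed.

End grid_limits.

(** * Discretised stochastic integrals *)

Section disc.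
Context d (Omega : measurableType d) (R : realType) (P : probability Omega R).
Variables (F : R -> set (set Omega)) (W : R -> Omega -> R).
Hypotheses (hF : usual_conditions P F) (hW : is_brownian P F W).
Local Notation mF := (mF F).
Notation mu := (leb R).
Variables (Y G : R -> Omega -> R).
Hypotheses (cY : cpath Y) (aY : forall u, 0 <= u -> mF u (Y u)).
Hypotheses (cG : cpath G) (aG : forall u, 0 <= u -> mF u (G u)) (YG : forall N : R, exists L : R, forall u w, `|G u w| <= N -> `|Y u w| <= L).
Variables (s t : R) (psi g : R -> R).
Hypotheses (s0 : 0 <= s) (st : s <= t).
Hypotheses (mpsi : mfunT psi) (ig : L1 (fun u => g u ^+ 2)) (cpsi : forall u, 0 < u < t -> u != s -> {for u, continuous psi}).
Hypothesis gpsi : forall x u, 0 <= x <= u -> 0 < u < t -> u != s -> (s < u -> s <= x) -> `|psi x| <= g u.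
Local Notation tau := (dtau s t).
Local Notation stay := (stay G).

(** The cut-off by [stay N x], known at time [x], makes the values at grid points bounded, as simple
    integrands must be. *)
Definition zeta (N x : R) (w : Omega) : R := psi x * Y x w * \1_(stay N x) w.

Lemma zeta_mF N x : 0 <= x -> mF x (zeta N x).
Proof.
by move=> x0; apply: mfunM; [apply: mfunM => //; exact: aY|exact: (stay_mF hF cG aG)].
Qed.

Lemma zeta_bnd N x : 0 <= x -> exists M : R, forall w, `|zeta N x w| <= M.
Proof.
move=> x0; have [L hL] := YG N; exists (`|psi x| * `|L|) => w.
rewrite /zeta !normrM -mulrA ler_wpM2l// indicE; case: (boolP (_ \in _)) => [|_]; last by rewrite normr0 mulr0.
rewrite inE normr1 mulr1 => h; apply: le_trans (ler_norm L); apply: hL; apply: h.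
by rewrite x0 lexx.
Qed.

Lemma zeta_simple N k : is_simple_integrand F (dn k) (tau k) (fun i => zeta N (tau k i)).
Proof.
split=> [i|i|i _|i _].
- exact: dtau_ge0.
- exact: dtauS.
- by apply/(meas_wrtP hF); [exact: dtau_ge0|apply: zeta_mF; exact: dtau_ge0].
- by apply: zeta_bnd; exact: dtau_ge0.
Qed.

Definition zsum (N : R) (k : nat) (w : Omega) : R :=
 \sum_(i < dn k) zeta N (tau k i) w * (W (tau k i.+1) w - W (tau k i) w).

Let YM w : exists2 C : R, 0 <= C & forall u, 0 <= u <= t -> `|Y u w| <= C.
Proof.
have [N0 hN] := stay_ev cG w (le_trans s0 st).
have [L hL] := YG N0%:R; exists `|L| => // u u0.
apply: le_trans (ler_norm L); apply: hL; exact: hN u0.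
Qed.

Local Notation zint k := (simple_integrand (dn k) (tau k) (fun i => zeta k%:R (tau k i))).

(** The index [k] is both the grid and the cut-off level: on a fixed path the cut-off is eventually
    inactive up to [t], and dominated convergence applies with a multiple of [g ^ 2]. *)
Lemma zeta_path w : (\int[mu]_(u in `[0%R, t]) ((zint k u w - psi u * Y (Num.max 0 u) w) ^+ 2)%:E)%E @[k --> \oo] --> 0%E.
Proof.
have [C C0 hC] := YM w.
have [N0 hN] := stay_ev cG w (le_trans s0 st).
have cv u : 0 < u < t -> u != s -> zint k u w @[k --> \oo] --> psi u * Y (Num.max 0 u) w.
 move=> u0 us; have [x [x0 xu xs E']] := grid_points s0 st u0 us. have /andP[u00 ut] := u0. have px := psi_cvg cpsi u0 us xu. have Yx : Y (Num.max 0 (x k)) w @[k --> \oo] --> Y (Num.max 0 u) w.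
  exact: (cvg_comp _ _ xu (@max0_continuous _ _ (@cY w) u)). have H : psi (x k) * Y (Num.max 0 (x k)) w @[k --> \oo] --> psi u * Y (Num.max 0 u) w by exact: cvgM.
 apply: cvg_trans H; apply: near_eq_cvg; near=> k; rewrite E' /zeta. have /andP[xk0 xku] := x0 k. rewrite (max_r xk0) indicE mem_set ?mulr1//; apply: (@stay_le _ _ _ _ _ t) => //.
  by rewrite (ltW (lt_trans xku ut)). by apply: hN; near: k; exact: nbhs_infty_ge.
have bd k u : 0 < u < t -> u != s -> `|(zint k u w - psi u * Y (Num.max 0 u) w) ^+ 2| <= 4 * C ^+ 2 * g u ^+ 2.
 move=> u0 us; have [x [x0 xu xs E']] := grid_points s0 st u0 us. rewrite E' /zeta ger0_norm ?sqr_ge0//.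
 have /andP[xk0 xku] := x0 k; have /andP[u00 ut] := u0. have g1 := @gpsi (x k) u; rewrite xk0 (ltW xku) in g1. have {}g1 := g1 isT u0 us (xs k). have g2 := @gpsi u u; rewrite lexx (ltW u00) in g2.
 have {}g2 := g2 isT u0 us (@ltW _ _ _ _). have y1 : `|Y (x k) w| <= C by apply: hC; rewrite xk0 (ltW (lt_trans xku ut)).
 have y2 : `|Y (Num.max 0 u) w| <= C by rewrite max_r ?(ltW u00)//; apply: hC; rewrite !ltW. have a1 : `|psi (x k) * Y (x k) w * \1_(stay k%:R (x k)) w| <= g u * C.
  rewrite !normrM; apply: (@le_trans _ _ (`|psi (x k)| * `|Y (x k) w|)); last exact: ler_pM. by rewrite ler_piMr ?mulr_ge0// indicE; case: (_ \in _); rewrite ?normr1 ?normr0.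
 have a2 : `|psi u * Y (Num.max 0 u) w| <= g u * C by rewrite normrM ler_pM. rewrite -[leLHS]real_normK ?num_real//. rewrite (_ : 4 * C ^+ 2 * g u ^+ 2 = (g u * C + g u * C) ^+ 2); last by ring.
 rewrite lerXn2r ?nnegrE//; first by rewrite addr_ge0// (le_trans _ a2). by rewrite (le_trans (ler_normB _ _))// lerD.
have mV k : mfunT (fun u => zint k u w).
 exact: (section_measurable w (simple_mfun hF (zeta_simple k%:R k))).
have mH : mfunT (fun u : R => psi u * Y (Num.max 0 u) w).
 by apply: mfunM => //; exact: (@section_measurable _ _ _ (fun u w => Y (Num.max 0 u) w) w (joint_measurable hF cY aY)).
have [] := @dominated_convergence _ _ _ mu `[0%R, t]%classic (mitv _) (fun k u => ((zint k u w - psi u * Y (Num.max 0 u) w) ^+ 2)%:E) (fun=> 0%:E) (fun u => (4 * C ^+ 2 * g u ^+ 2)%:E).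
- by move=> k; apply/mEFinP; apply: mfunTS; apply: mfunX; exact: (mfunB (mV k) mH).
- exact: mcst.
- apply: ae_lebS (ae_neq3 s t) => u [u0 us ut]; rewrite /= in_itv/= => /andP[u0' ut'].
 apply: cvg_EFin; first exact: nearW. have c1 : zint k u w @[k --> \oo] --> psi u * Y (Num.max 0 u) w. by apply: cv => //; rewrite !lt_neqAle eq_sym u0 u0' ut ut'.
 have c2 : zint k u w - psi u * Y (Num.max 0 u) w @[k --> \oo] --> (0 : R). by rewrite -[X in _ --> X](subrr (psi u * Y (Num.max 0 u) w)); apply: cvgB => //; exact: cvg_cst.
 by have := cvg_comp _ _ c2 (@exprn_continuous R 2 0); rewrite expr0n.
- by apply: integrableS (L1Z (4 * C ^+ 2) ig).
- apply: ae_lebS (ae_neq3 s t) => u [u0 us ut] k; rewrite /= in_itv/= => /andP[u0' ut'].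
 by rewrite lee_fin; apply: bd => //; rewrite !lt_neqAle eq_sym u0 u0' ut ut'.
by move=> _ _; rewrite integral0.
Unshelve. all: end_near. Qed.

(** The same sums on the grid of [[0, t]] approximate an integral up to [t] or, when [psi] vanishes
    from [s] on, up to [s]: the noises at two times live on one grid. The function [c] may differ
    from [psi] at [T], where the kernel is singular. *)
Lemma zsum_ito (T : R) (H : R -> Omega -> R) (c : R -> R) (I : Omega -> R) :
 (T = t \/ T = s /\ forall x, s <= x -> psi x = 0) ->
 (forall u, 0 <= u < T -> c u = psi u) -> mfunT c ->
 (forall u w, 0 <= u <= T -> H u w = c u * Y u w) ->
 is_ito_integral P F W T H I ->
 cvg0_in_prob P (fun k w => `|zsum k%:R k w - I w|%:E).
Proof.
move=> hT hc mc HE hI.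
have T0 : 0 <= T by case: hT => [->|[-> _]] //; exact: le_trans st.
have Tt : T <= t by case: hT => [->|[-> _]].
have mH1 : mfunT (fun z : Omega * R => c z.2 * Y (Num.max 0 z.2) z.1).
 by apply: mfunM; [exact: (mcompT mc measurable_snd)|exact: (joint_measurable hF cY aY)].
have mH2 : mfunT (fun z : Omega * R => psi z.2 * Y (Num.max 0 z.2) z.1).
 by apply: mfunM; [exact: (mcompT mpsi measurable_snd)|exact: (joint_measurable hF cY aY)].
have := @ito_unique _ _ _ _ _ _ hF hW T H (fun u w => c u * Y (Num.max 0 u) w) I dn tau (fun k i => zeta k%:R (tau k i)) T0 hI mH1.
have h1 : forall (u : R) (w : Omega), 0 <= u <= T -> H u w = c u * Y (Num.max 0 u) w.
 by move=> u w u0; rewrite HE// max_r//; have /andP[] := u0.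
move=> /(_ h1 (fun k => zeta_simple k%:R k)).
have E k w : simple_integral W (dn k) (tau k) (fun i => zeta k%:R (tau k i)) T w = zsum k%:R k w.
 apply: eq_bigr => i _; case: hT => [->|[-> psi0]]. by rewrite !min_l ?dtau_le// ltnW. have [ik|ik] := ltnP i k.+1.
  by rewrite !min_l// -[leRHS](dtau_mid s t k); apply: seq_mono => //; (try exact: ltnW); move=> j; exact: dtauS.
 have h := @seq_mono _ (tau k) _ _ (dtauS s0 st k) ik; rewrite dtau_mid in h. by rewrite /zeta psi0// !mul0r.
have -> : (fun k w => `|simple_integral W (dn k) (tau k) (fun i => zeta k%:R (tau k i)) T w - I w|%:E) =
  (fun k w => `|zsum k%:R k w - I w|%:E) by apply/funext => k; apply/funext => w; rewrite E.
apply; apply: cvg_in_prob.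
- move=> k; apply: (@measurable_qint _ _ _ T (fun u w => zint k u w - c u * Y (Num.max 0 u) w)).
 exact: (mfunB (simple_mfun hF (zeta_simple k%:R k)) mH1).
- by move=> k w; apply: integral_ge0 => u _; rewrite lee_fin sqr_ge0.
move=> w; apply: (@squeeze_cvge _ _ _ _ (fun=> 0%E) _ (fun k => (\int[mu]_(u in `[0%R, t]) ((zint k u w - psi u * Y (Num.max 0 u) w) ^+ 2)%:E)%E)).
- apply: nearW => k; apply/andP; split; first by apply: integral_ge0 => u _; rewrite lee_fin sqr_ge0.
 have mV := section_measurable w (simple_mfun hF (zeta_simple k%:R k)). have m1 := @section_measurable _ _ _ (fun u w => c u * Y (Num.max 0 u) w) w mH1.
 have m2 := @section_measurable _ _ _ (fun u w => psi u * Y (Num.max 0 u) w) w mH2. have f1 : mfunT (fun u : R => ((zint k u w - c u * Y (Num.max 0 u) w) ^+ 2)%:E).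
  by apply/mEFinP; apply: mfunX; exact: (mfunB mV m1). have f2 : mfunT (fun u : R => ((zint k u w - psi u * Y (Num.max 0 u) w) ^+ 2)%:E). by apply/mEFinP; apply: mfunX; exact: (mfunB mV m2).
 rewrite (@ge0_ae_eq_integral _ _ _ mu `[0%R, T]%classic _ (fun u => ((zint k u w - psi u * Y (Num.max 0 u) w) ^+ 2)%:E)%E); first last.
 + apply: ae_lebS (ae_neq3 T T) => u [_ uT _]; rewrite /= in_itv/= => /andP[u0 uT']. by rewrite hc// u0 lt_neqAle uT.
 + by move=> u _; rewrite lee_fin sqr_ge0.
 + by move=> u _; rewrite lee_fin sqr_ge0.
 + exact: mfunTS.
 + exact: mfunTS.
 + exact: mitv. apply: ge0_subset_integral; [exact: mitv|exact: mitv|exact: mfunTS| |]. by move=> u _; rewrite lee_fin sqr_ge0. by apply: subset_itvl; rewrite bnd_simp.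
- exact: cvg_cst.
- exact: zeta_path.
Qed.

End disc.

(** * Moments and isometry of the Ito integral *)

Section ito_moments.
Context d (Omega : measurableType d) (R : realType) (P : probability Omega R).
Variables (F : R -> set (set Omega)) (W : R -> Omega -> R).
Hypotheses (hF : usual_conditions P F) (hW : is_brownian P F W).
Local Notation mF := (mF F).
Notation mu := (leb R).
Variables (Y G : R -> Omega -> R).
Hypotheses (cY : cpath Y) (aY : forall u, 0 <= u -> mF u (Y u)).
Hypotheses (cG : cpath G) (aG : forall u, 0 <= u -> mF u (G u)) (YG : forall N : R, exists L : R, forall u w, `|G u w| <= N -> `|Y u w| <= L).
Variables (s t : R) (psi g : R -> R).
Hypotheses (s0 : 0 <= s) (st : s <= t).
Hypotheses (mpsi : mfunT psi) (ig : L1 (fun u => g u ^+ 2)) (cpsi : forall u, 0 < u < t -> u != s -> {for u, continuous psi}).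
Hypothesis gpsi : forall x u, 0 <= x <= u -> 0 < u < t -> u != s -> (s < u -> s <= x) -> `|psi x| <= g u.
Local Notation tau := (dtau s t).
Local Notation stay := (stay G).

Local Notation zeta := (zeta Y G psi).
Local Notation zsum := (zsum W Y G s t psi).
Variables (I Z : Omega -> R) (A : set Omega).
Hypotheses (mI : mfunT I) (mZ : mF 0 Z) (mA : mF 0 (\1_A : Omega -> R)) (hI : cvg0_in_prob P (fun k w => `|zsum k%:R k w - I w|%:E)).

Let t0 : 0 <= t. Proof. exact: le_trans st. Qed.
Let mZO : mfunT Z. Proof. exact: (mF_meas hF (lexx 0) mZ). Qed.
Let mAO : mfunT (\1_A : Omega -> R). Proof. exact: (mF_meas hF (lexx 0) mA). Qed.
Let mzeta N x : 0 <= x -> mF x (zeta N x). Proof. exact: (zeta_mF hF aY cG aG). Qed.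

Let mzsum N k : mfunT (zsum N k).
Proof.
apply: msum => i; apply: mfunM; first exact: (mF_meas hF (dtau_ge0 s0 st k i) (mzeta N (dtau_ge0 s0 st k i))).
by apply: mfunB; exact: (mF_meas hF (dtau_ge0 s0 st k _) (W_mF hF hW (dtau_ge0 s0 st k _))).
Qed.

Let gridE N k w : \1_A w * (Z w + zsum N k w) =
 grid_sum W (tau k) (fun w => \1_A w * Z w) (fun i w => \1_A w * zeta N (tau k i) w) (dn k) w.
Proof. by rewrite /grid_sum mulrDr mulr_sumr; congr (_ + _); apply: eq_bigr => i _; rewrite mulrA. Qed.

Let mAZ k : mF (tau k 0%N) (fun w => \1_A w * Z w).
Proof. by rewrite dtau0; exact: mfunM. Qed.

Let mAz N k i : mF (tau k i) (fun w => \1_A w * zeta N (tau k i) w).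
Proof.
apply: mfunM; first exact: (mF_mono hF (lexx 0) (dtau_ge0 s0 st k i) mA).
by apply: mzeta; exact: dtau_ge0.
Qed.

Let phi_ex : exists2 phi : nat -> nat, (forall k, (k <= phi k)%N) &
 {ae P, forall w, zsum (phi k)%:R (phi k) w @[k --> \oo] --> I w}.
Proof.
have [phi h1 h2] := @cvg_prob_subseq _ _ _ P (fun k w => zsum k%:R k w - I w) (fun k => mfunB (mzsum k%:R k) mI) hI.
exists phi => //; apply: filterS h2 => w /= h.
have -> : (fun k => zsum (phi k)%:R (phi k) w) = (fun k => (zsum (phi k)%:R (phi k) w - I w) + I w).
 by apply/funext => k; rewrite subrK.
by rewrite -[X in _ --> X]add0r; apply: cvgD => //; exact: cvg_cst.
Qed.

Let phi_oo (phi : nat -> nat) N : (forall k, (k <= phi k)%N) -> phi (k + N)%N @[k --> \oo] --> \oo.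
Proof.
move=> h B [n0 _ hn]; exists n0 => // k /= nk; apply: hn => /=.
by apply: leq_trans (h _); apply: leq_trans nk _; exact: leq_addr.
Qed.

Let qsum k := \sum_(i < dn k) (tau k i.+1 - tau k i) * psi (tau k i) ^+ 2.

Let qsum_cvg : qsum k @[k --> \oo] --> \int[mu]_(u in `[0, t]) (psi u ^+ 2).
Proof.
have := @riemann_sum _ s t psi g s0 st mpsi ig cpsi gpsi (fun _ _ => 1) (fun=> 1) 1 (mcst _).
have h1 : forall (k : nat) (x : R), 0 <= x <= t -> 0 <= (1 : R) <= (1 : R) by move=> k x _; rewrite ler01 lexx.
have h2 : forall u, 0 < u < t -> u != s -> forall x : nat -> R, (forall k, 0 <= x k < u) -> x k @[k --> \oo] --> u -> (1 : R) @[k --> \oo] --> (1 : R).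
 by move=> *; exact: cvg_cst.
move=> /(_ h1 h2); rewrite (_ : (fun k => \sum_(i < dn k) _) = qsum); last first.
 by apply/funext => k; apply: eq_bigr => i _; rewrite mulr1.
by rewrite (_ : \int[mu]_(u in `[0, t]) (psi u ^+ 2 * 1) = \int[mu]_(u in `[0, t]) (psi u ^+ 2))//; apply: eq_Rintegral => u _; rewrite mulr1.
Qed.

Let zmom (q k : nat) (N z Gam e : R) : (0 < q)%N -> 0 < z -> 0 < e -> 0 <= Gam ->
 (\int[P]_w ((\1_A w * Z w) ^+ q.*2)%:E <= (z ^+ q * Gam)%:E)%E ->
 (forall u, 0 <= u <= t -> (\int[P]_w ((\1_A w * \1_(stay N u) w * Y u w) ^+ q.*2)%:E <= Gam%:E)%E) ->
 (\int[P]_w ((\1_A w * (Z w + zsum N k w)) ^+ q.*2)%:E <= ((z + ((q.*2.-1)%:R * qsum k + e)) ^+ q * Gam)%:E)%E.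
Proof.
move=> q0 z0 e0 G0 hZ hY; under eq_integral do rewrite gridE.
have ev (x : R) := expr_double_ge0 x q.
have dp i : 0 <= tau k i.+1 - tau k i by rewrite subr_ge0 dtauS.
(* The slack [e], spread over the cells, keeps each [b i] positive where [psi] vanishes; it tends to
   0 with the mesh in [bound_cvg]. *)
pose b i := (q.*2.-1)%:R * ((tau k i.+1 - tau k i) * psi (tau k i) ^+ 2) + e / (dn k)%:R.
have dn0 : 0 < (dn k)%:R :> R by rewrite ltr0n.
have b0 i : 0 < b i by rewrite ltr_wpDl ?divr_gt0//; apply: mulr_ge0 => //; apply: mulr_ge0 => //; exact: sqr_ge0.
have Eb : \sum_(i < dn k) b i = (q.*2.-1)%:R * qsum k + e.
 rewrite big_split/= -mulr_sumr; congr (_ + _). by rewrite sumr_const card_ord -[LHS]mulr_natr divfK// gt_eqF.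
pose V i w := if (i < dn k)%N then \1_A w * zeta N (tau k i) w else 0.
have mV i : mF (tau k i) (V i).
 case E : (i < dn k)%N; last by rewrite (_ : V i = cst 0)//; [exact: mcst|apply/funext => w; rewrite /V E].
 by rewrite (_ : V i = fun w => \1_A w * zeta N (tau k i) w); [exact: mAz|apply/funext => w; rewrite /V E].
have -> : (\int[P]_w ((grid_sum W (tau k) (fun w => \1_A w * Z w) (fun i w => \1_A w * zeta N (tau k i) w) (dn k) w) ^+ q.*2)%:E =
 \int[P]_w ((grid_sum W (tau k) (fun w => \1_A w * Z w) V (dn k) w) ^+ q.*2)%:E)%E. by apply: eq_integral => w _; rewrite /grid_sum; congr ((_ + _) ^+ _)%:E; apply: eq_bigr => i _; rewrite /V ltn_ord.
rewrite -Eb; apply: (grid_moment hF hW (dtau_ge0 s0 st k) (dtauS s0 st k) _ mV (dn k) z0 b0 hZ).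
 by rewrite dtau0; exact: mfunM.
move=> i; under eq_integral do rewrite /V; case iN : (i < dn k)%N; last first.
 rewrite integral0_eq; first by rewrite lee_fin mulr_ge0 ?exprn_ge0 ?(ltW (b0 i)). by move=> w _; rewrite expr0n/= mulr0 expr0n gtn_eqF.
have tauk : 0 <= tau k i <= t by rewrite dtau_ge0//= dtau_le// ltnW.
pose U w := \1_A w * \1_(stay N (tau k i)) w * Y (tau k i) w.
have mU : mfunT U.
 apply: mfunM; last exact: (mF_meas hF (dtau_ge0 s0 st k i) (aY (dtau_ge0 s0 st k i))). apply: mfunM => //; exact: (mF_meas hF (dtau_ge0 s0 st k i) (stay_mF hF cG aG N (dtau_ge0 s0 st k i))).
apply: (@le_trans _ _ (\int[P]_w ((b i ^+ q)%:E * (U w ^+ q.*2)%:E))%E).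
 apply: ge0_le_integral => //.
 - by move=> w _; rewrite lee_fin exprn_ge0// mulr_ge0 ?sqr_ge0// mulr_ge0.
 - apply/mEFinP; apply: mfunX; apply: mfunM => //; apply: mfunX. exact: (mF_meas hF (dtau_ge0 s0 st k i) (@mAz N k i)).
 - by apply/mEFinP; apply: mfunM => //; exact: mfunX.
 - move=> w _; rewrite -EFinM lee_fin -mul2n exprM -exprMn. have -> : \1_A w * zeta N (tau k i) w = psi (tau k i) * U w by rewrite /zeta /U; ring.
  have h0 : 0 <= (q.*2.-1)%:R * ((tau k i.+1 - tau k i) * psi (tau k i) ^+ 2). by apply: mulr_ge0 => //; apply: mulr_ge0 => //; exact: sqr_ge0.
  rewrite (_ : _ * (psi (tau k i) * U w) ^+ 2 = (q.*2.-1)%:R * ((tau k i.+1 - tau k i) * psi (tau k i) ^+ 2) * U w ^+ 2); last by rewrite mul2n; ring.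
  apply: lerXn2r; rewrite ?nnegrE ?(mulr_ge0 _ (sqr_ge0 _)) ?(ltW (b0 i))//; apply: ler_wpM2r; first exact: sqr_ge0. by rewrite /b lerDl divr_ge0 ?(ltW e0).
rewrite ge0_integralZl_EFin ?exprn_ge0 ?(ltW (b0 i))//; last 2 first.
- by move=> w _; rewrite lee_fin.
- by apply/mEFinP; exact: mfunX.
by rewrite EFinM; apply: lee_wpmul2l; rewrite ?lee_fin ?exprn_ge0 ?(ltW (b0 i))//; exact: hY.
Qed.

Let cvgX (n : nat) (u : nat -> R) (l : R) : u k @[k --> \oo] --> l -> u k ^+ n @[k --> \oo] --> l ^+ n.
Proof. by move=> h; exact: (cvg_comp _ _ h (@exprn_continuous R n l)). Qed.

Let bound_cvg (phi : nat -> nat) (q : nat) (z Gam : R) N : (forall k, (k <= phi k)%N) ->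
 (z + ((q.*2.-1)%:R * qsum (phi (k + N)%N) + k.+1%:R^-1)) ^+ q * Gam @[k --> \oo] -->
 (z + (q.*2.-1)%:R * \int[mu]_(u in `[0, t]) (psi u ^+ 2)) ^+ q * Gam.
Proof.
move=> hphi; apply: cvgM; last exact: cvg_cst.
apply: cvgX; apply: cvgD; first exact: cvg_cst.
rewrite -[X in _ --> X]addr0; apply: cvgD; last exact: cvg_harmonic.
apply: cvgM; first exact: cvg_cst.
exact: (cvg_comp _ _ (@phi_oo phi N hphi) qsum_cvg).
Qed.

(** Almost sure convergence along a subsequence and Fatou's lemma carry [grid_moment] to the limit,
    where the sum of the [b i] becomes [2 q - 1] times the integral of [psi ^ 2]. *)
Lemma ito_moment (q N : nat) (z Gam : R) : (0 < q)%N -> 0 < z -> 0 <= Gam ->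
 (\int[P]_w ((\1_A w * Z w) ^+ q.*2)%:E <= (z ^+ q * Gam)%:E)%E ->
 (forall u, 0 <= u <= t -> (\int[P]_w ((\1_A w * \1_(stay N%:R u) w * Y u w) ^+ q.*2)%:E <= Gam%:E)%E) ->
 (\int[P]_w ((\1_A w * \1_(stay N%:R t) w * (Z w + I w)) ^+ q.*2)%:E <=
  ((z + (q.*2.-1)%:R * \int[mu]_(u in `[0, t]) (psi u ^+ 2)) ^+ q * Gam)%:E)%E.
Proof.
move=> q0 z0 G0 hZ hY; have [phi hphi ae] := phi_ex.
have ev (x : R) := expr_double_ge0 x q.
have ms : mfunT (\1_(stay N%:R t) : Omega -> R) by exact: (mF_meas hF t0 (stay_mF hF cG aG N%:R t0)).
apply: (@fatou_le _ _ _ P (fun k w => (\1_A w * \1_(stay N%:R t) w * (Z w + zsum (phi (k + N)%N)%:R (phi (k + N)%N) w)) ^+ q.*2) _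
 (fun k => (z + ((q.*2.-1)%:R * qsum (phi (k + N)%N) + k.+1%:R^-1)) ^+ q * Gam)) => //.
- move=> k; apply: mfunX; apply: mfunM; first exact: mfunM.
 exact: (mfunD mZO (mzsum _ _)).
- apply: mfunX; apply: mfunM; first exact: mfunM.
 exact: (mfunD mZO mI).
- apply: filterS ae => w h; apply: cvgX; apply: cvgM; first exact: cvg_cst.
 apply: cvgD; first exact: cvg_cst. by rewrite (cvg_shiftn N (fun k => zsum (phi k)%:R (phi k) w)).
- move=> k; apply: le_trans (zmom (phi (k + N)%N) q0 z0 _ G0 hZ hY); last by rewrite invr_gt0.
 apply: ge0_le_integral => //.
 + by move=> w _; rewrite lee_fin.
 + apply/mEFinP; apply: mfunX; apply: mfunM; first exact: mfunM. exact: (mfunD mZO (mzsum _ _)).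
 + apply/mEFinP; apply: mfunX; apply: mfunM => //. exact: (mfunD mZO (mzsum _ _)).
 + move=> w _; rewrite lee_fin. have [hw|hw] := pselect (stay N%:R t w); last first. by rewrite [\1_(stay _ _) w]indicE memNset// mulr0 mul0r expr0n double_eq0 gtn_eqF.
  (* On [stay N t] any cut-off at a level at least [N] is inactive; shifting the index by [N]
     ensures such a level. *)
  rewrite [\1_(stay _ _) w]indicE mem_set// mulr1. suff -> : zsum (phi (k + N)%N)%:R (phi (k + N)%N) w = zsum N%:R (phi (k + N)%N) w by []. apply: eq_bigr => i _; congr (_ * _); congr (_ * _).
  have h1 : stay N%:R (tau (phi (k + N)%N) i) w by apply: (stay_le _ hw); rewrite dtau_le// ltnW. rewrite !indicE !mem_set// => v hv; apply: le_trans (h1 v hv) _.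
  by rewrite ler_nat (leq_trans _ (hphi _))// leq_addl.
- exact: bound_cvg.
Qed.

Definition sqmom (u : R) : R := fine (\int[P]_w ((\1_A w * Y (Num.max 0 u) w) ^+ 2)%:E)%E.

Lemma sqmom_measurable : mfunT sqmom.
Proof.
pose f (z : R * Omega) := ((\1_A z.2 * Y (Num.max 0 z.1) z.2) ^+ 2)%:E.
have mf : mfunT f.
 apply/mEFinP; apply: mfunX; apply: mfunM. exact: (mcompT mAO measurable_snd). exact: (mcompT (joint_measurable hF cY aY) (measurable_fun_pair measurable_snd measurable_fst)).
have f0 z : (0 <= f z)%E by rewrite lee_fin sqr_ge0.
have := @mfubiniF _ _ _ _ _ P f mf f0.
by move=> h; apply: (mcompT _ h).
Qed.

(** Moments of order [2 q > 2], uniform along the approximation, allow the limit in the squares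
    through [vitali_sqr]; the discrete quadratic sums converge by [riemann_sum]. *)
Lemma ito_isometry (q : nat) (z Gam : R) : (1 < q)%N -> 0 < z -> 0 <= Gam ->
 (\int[P]_w ((\1_A w * Z w) ^+ q.*2)%:E <= (z ^+ q * Gam)%:E)%E ->
 (forall u, 0 <= u <= t -> (\int[P]_w ((\1_A w * Y u w) ^+ q.*2)%:E <= Gam%:E)%E) ->
 (\int[P]_w ((\1_A w * (Z w + I w)) ^+ 2)%:E =
  \int[P]_w ((\1_A w * Z w) ^+ 2)%:E + (\int[mu]_(u in `[0, t]) (psi u ^+ 2 * sqmom u))%R%:E)%E.
Proof.
move=> q1 z0 G0 hZ hY; have q0 : (0 < q)%N by exact: ltnW.
have [phi hphi ae] := phi_ex.
have ev (x : R) := expr_double_ge0 x q.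
have mst N u : 0 <= u -> mfunT (\1_(stay N u) : Omega -> R).
 by move=> u0; exact: (mF_meas hF u0 (stay_mF hF cG aG N u0)).
have mYO u : 0 <= u -> mfunT (Y u) by move=> u0; exact: (mF_meas hF u0 (aY u0)).
have mAYs N u : 0 <= u -> mfunT (fun w => \1_A w * \1_(stay N u) w * Y u w).
 by move=> u0; apply: mfunM; [apply: mfunM => //; exact: mst|exact: mYO].
have hYs N u : 0 <= u <= t -> (\int[P]_w ((\1_A w * \1_(stay N u) w * Y u w) ^+ q.*2)%:E <= Gam%:E)%E.
 move=> u0; apply: le_trans (hY u u0); have /andP[u00 _] := u0; apply: ge0_le_integral => //.
 - by move=> w _; rewrite lee_fin.
 - by apply/mEFinP; apply: mfunX; exact: mAYs.
 - by apply/mEFinP; apply: mfunX; apply: mfunM => //; exact: mYO.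
 - move=> w _; rewrite lee_fin mulrAC exprMn ler_piMr//.
pose B k := (z + ((q.*2.-1)%:R * qsum (phi (k + 0)%N) + k.+1%:R^-1)) ^+ q * Gam.
have cB := @bound_cvg phi q z Gam 0%N hphi.
have [C hC] : exists C : R, forall k, B k <= C.
 have [M [_ hM]] := cvg_seq_bounded (cvgP _ cB). exists (M + 1) => k; apply: le_trans (ler_norm _) _. by apply: hM => //; rewrite ltrDl.
pose X k w := \1_A w * (Z w + zsum (phi k)%:R (phi k) w).
have mX k : mfunT (X k) by exact: (mfunM mAO (mfunD mZO (mzsum _ _))).
have mL : mfunT (fun w => \1_A w * (Z w + I w)) by exact: (mfunM mAO (mfunD mZO mI)).
have XL : {ae P, forall w, X k w @[k --> \oo] --> \1_A w * (Z w + I w)}.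
 apply: filterS ae => w h; apply: cvgM; first exact: cvg_cst. by apply: cvgD => //; exact: cvg_cst.
have XC k : (\int[P]_w (X k w ^+ q.*2)%:E <= C%:E)%E.
 apply: (@le_trans _ _ (B k)%:E); last by rewrite lee_fin. rewrite /B addn0; apply: (zmom (phi k) q0 z0 _ G0 hZ (hYs (phi k)%:R)). by rewrite invr_gt0.
have [_ v2] := vitali_sqr q1 mX mL XL XC.
have C1 : 0 <= 1 + Gam by rewrite addr_ge0.
pose y_ (k : nat) (u : R) := fine (\int[P]_w ((\1_A w * \1_(stay k%:R u) w * Y u w) ^+ 2)%:E)%E.
have le2 (U : Omega -> R) : mfunT U -> (\int[P]_w (U w ^+ q.*2)%:E <= Gam%:E)%E ->
  (\int[P]_w (U w ^+ 2)%:E <= (1 + Gam)%:E)%E. move=> mU hU; apply: (@le_trans _ _ (\int[P]_w (cst 1%E w + (U w ^+ q.*2)%:E))%E). apply: ge0_le_integral => //.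
  - by move=> w _; exact: lee_sqr0.
  - by apply/mEFinP; exact: mfunX.
  - apply: emeasurable_funD => //; apply/mEFinP; exact: mfunX.
  - by move=> w _; rewrite -EFinD lee_fin pow_sqr_le1. rewrite ge0_integralD//; last 2 first.
 - by move=> w _; rewrite lee_fin.
 - by apply/mEFinP; exact: mfunX. by rewrite integral_cst//; have /= -> := @probability_setT _ _ _ P; rewrite mule1 EFinD leeD2l.
have y_b k u : 0 <= u <= t -> 0 <= y_ k u <= 1 + Gam.
 move=> u0; have /andP[u00 _] := u0. have := le2 _ (mAYs k%:R u u00) (hYs k%:R u u0).
 have h0 : (0 <= \int[P]_w ((\1_A w * \1_(stay k%:R u) w * Y u w) ^+ 2)%:E)%E by apply: integral_ge0 => w _; exact: lee_sqr0.
 move=> h; have hf := le_lt_trans h (ltry _). by rewrite fine_ge0//= -lee_fin fineK// ge0_fin_numE.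
have y_c u : 0 < u < t -> u != s -> forall x : nat -> R, (forall k, 0 <= x k < u) -> x k @[k --> \oo] --> u ->
  y_ k (x k) @[k --> \oo] --> sqmom u. move=> /andP[u0 ut] us x x0 xu. have xk0 k : 0 <= x k by have /andP[] := x0 k.
 have xkt k : 0 <= x k <= t by have /andP[h1 h2] := x0 k; rewrite h1 (ltW (lt_trans h2 ut)). have mYu : mfunT (fun w => \1_A w * Y (Num.max 0 u) w).
  by apply: mfunM => //; rewrite max_r ?(ltW u0)//; apply: mYO; exact: ltW. have ca : {ae P, forall w, \1_A w * \1_(stay k%:R (x k)) w * Y (x k) w @[k --> \oo] --> \1_A w * Y (Num.max 0 u) w}.
  apply: aeW => w; have [N0 hN] := stay_ev cG w t0. have Yx : Y (Num.max 0 (x k)) w @[k --> \oo] --> Y (Num.max 0 u) w. exact: (cvg_comp _ _ xu (@max0_continuous _ _ (@cY w) u)).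
  have H : \1_A w * Y (Num.max 0 (x k)) w @[k --> \oo] --> \1_A w * Y (Num.max 0 u) w. by apply: cvgM => //; exact: cvg_cst. apply: cvg_trans H; apply: near_eq_cvg; near=> k.
  rewrite (max_r (xk0 k)) [\1_(stay _ _) w]indicE mem_set ?mulr1//. apply: (@stay_le _ _ _ _ _ t); first by have /andP[] := xkt k. by apply: hN; near: k; exact: nbhs_infty_ge.
 have [h1 h2] := vitali_sqr q1 (fun k => mAYs k%:R (x k) (xk0 k)) mYu ca (fun k => hYs k%:R (x k) (xkt k)).
 apply: fine_cvg; rewrite fineK//. rewrite ge0_fin_numE; last by apply: integral_ge0 => w _; exact: lee_sqr0. exact: (le_lt_trans (le2 _ mYu h1) (ltry _)).
have rs := riemann_sum s0 st mpsi ig cpsi gpsi sqmom_measurable y_b y_c.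
have fZ : (\int[P]_w ((\1_A w * Z w) ^+ 2)%:E)%E \is a fin_num.
 rewrite ge0_fin_numE; last by apply: integral_ge0 => w _; exact: lee_sqr0. apply: (@le_lt_trans _ _ (\int[P]_w (cst 1%E w + ((\1_A w * Z w) ^+ q.*2)%:E))%E).
  have mAZ' : mfunT (fun w => \1_A w * Z w) by exact: mfunM. apply: ge0_le_integral => //.
  - by move=> w _; exact: lee_sqr0.
  - by apply/mEFinP; exact: mfunX.
  - apply: emeasurable_funD => //; apply/mEFinP; exact: mfunX.
  - by move=> w _; rewrite -EFinD lee_fin pow_sqr_le1. rewrite ge0_integralD//; last 2 first.
 - by move=> w _; rewrite lee_fin.
 - by apply/mEFinP; apply: mfunX; exact: mfunM. rewrite integral_cst//; have /= -> := @probability_setT _ _ _ P; rewrite mule1.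
 by apply: (@le_lt_trans _ _ (1 + (z ^+ q * Gam)%:E)%E); [rewrite leeD2l|rewrite -EFinD ltry].
have E k : (\int[P]_w (X k w ^+ 2)%:E = (fine (\int[P]_w ((\1_A w * Z w) ^+ 2)%:E) +
  \sum_(i < dn (phi k)) (tau (phi k) i.+1 - tau (phi k) i) * (psi (tau (phi k) i) ^+ 2 * y_ (phi k) (tau (phi k) i)))%:E)%E. rewrite EFinD fineK// /X; under eq_integral do rewrite gridE.
 rewrite (grid_isometry hF hW (dtau_ge0 s0 st _) (dtauS s0 st _) (@mAZ _) (@mAz _ _)). have dp i : 0 <= tau (phi k) i.+1 - tau (phi k) i by rewrite subr_ge0 dtauS.
 have mAzO i : mfunT (fun w => (tau (phi k) i.+1 - tau (phi k) i) * (\1_A w * zeta (phi k)%:R (tau (phi k) i) w) ^+ 2).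
  by apply: mfunM => //; apply: mfunX; exact: (mF_meas hF (dtau_ge0 s0 st _ i) (@mAz _ _ i)). under eq_integral do rewrite EFinD -sumEFin. rewrite ge0_integralD//; last 4 first.
 - by move=> w _; exact: lee_sqr0.
 - by apply/mEFinP; apply: mfunX; exact: mfunM.
 - by move=> w _; apply: sume_ge0 => i _; rewrite lee_fin mulr_ge0// sqr_ge0.
 - by apply: emeasurable_sum => i; apply/mEFinP; exact: mAzO. congr (_ + _)%E; rewrite ge0_integral_sum//; last 2 first.
 - by move=> i; apply/mEFinP; exact: mAzO.
 - by move=> i w _; rewrite lee_fin mulr_ge0// sqr_ge0. rewrite -sumEFin; apply: eq_bigr => i _. have tk : 0 <= tau (phi k) i <= t by rewrite dtau_ge0//= dtau_le// ltnW. have /andP[tk0 _] := tk.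
 rewrite (eq_integral (fun w => ((tau (phi k) i.+1 - tau (phi k) i) * psi (tau (phi k) i) ^+ 2)%:E * ((\1_A w * \1_(stay (phi k)%:R (tau (phi k) i)) w * Y (tau (phi k) i) w) ^+ 2)%:E)%E); last first.
  by move=> w _; rewrite -EFinM /zeta; congr EFin; ring. rewrite ge0_integralZl_EFin; first last.
 - by rewrite mulr_ge0// sqr_ge0.
 - by apply/mEFinP; apply: mfunX; exact: mAYs.
 - by move=> w _; exact: lee_sqr0.
 - by []. rewrite [in RHS]mulrA [RHS]EFinM /y_ fineK//. rewrite ge0_fin_numE; last by apply: integral_ge0 => w _; exact: lee_sqr0. exact: (le_lt_trans (le2 _ (mAYs _ _ tk0) (hYs _ _ tk)) (ltry _)).
have c1 : (\int[P]_w (X k w ^+ 2)%:E)%E @[k --> \oo] --> (fine (\int[P]_w ((\1_A w * Z w) ^+ 2)%:E)%E + \int[mu]_(u in `[0, t]) (psi u ^+ 2 * sqmom u))%:E.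
 under eq_fun do rewrite E. apply: cvg_EFin; first exact: nearW. apply: cvgD; first exact: cvg_cst.
 have := @phi_oo phi 0%N hphi. have -> : (fun k => phi (k + 0)%N) = phi by apply/funext => k; rewrite addn0. by move=> h; exact: (cvg_comp _ _ h rs).
by rewrite -(cvg_lim _ v2)// (cvg_lim _ c1)// EFinD fineK.
Unshelve. all: end_near. Qed.
End ito_moments.

(** From any finite bound [L], however bad, [n] applications of the step give [max (th ^ n L) g].
    The conclusion forgets [L]: this is how bounds become independent of the localisation. *)
Lemma sup_contract (R : realType) (T : Type) (Q : T -> Prop) (a : T -> \bar R) (th g L : R) :
 0 <= th < 1 -> 0 < g -> (forall u, Q u -> (a u <= L%:E)%E) ->
 (forall x, g <= x -> (forall u, Q u -> (a u <= x%:E)%E) -> forall u, Q u -> (a u <= (th * x)%:E)%E) ->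
 forall u, Q u -> (a u <= g%:E)%E.
Proof.
move=> /andP[th0 th1] g0 hL step.
have it n : forall u, Q u -> (a u <= (Num.max (th ^+ n * L) g)%:E)%E.
 elim: n => [|n IH] u Qu; first by apply: le_trans (hL u Qu) _; rewrite lee_fin expr0 mul1r le_max lexx. apply: le_trans (step _ _ IH u Qu) _; first by rewrite le_max lexx orbT.
 rewrite lee_fin /Num.max exprS; case: ifP => h; last by rewrite le_max mulrA lexx. by rewrite le_max ler_piMl ?orbT// ltW.
have cv : th ^+ n * L @[n --> \oo] --> 0.
 by rewrite -(mul0r L); apply: cvgM; [apply: cvg_expr; rewrite ger0_norm|exact: cvg_cst].
have [n _ hn] : \forall n \near \oo, th ^+ n * L < g by apply: (cvgr_lt _ cv).
move=> u Qu; apply: le_trans (it n u Qu) _; rewrite lee_fin ge_max lexx andbT ltW//.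
by apply: hn => /=.
Qed.

Section cvg0.
Context d (Omega : measurableType d) (R : realType) (P : probability Omega R).
Lemma cvg0_lin (U V : nat -> Omega -> R) (I J : Omega -> R) (x y : R) :
 (forall k, mfunT (U k)) -> (forall k, mfunT (V k)) ->
 mfunT I -> mfunT J ->
 cvg0_in_prob P (fun k w => `|U k w - I w|%:E) -> cvg0_in_prob P (fun k w => `|V k w - J w|%:E) ->
 cvg0_in_prob P (fun k w => `|(x * U k w + y * V k w) - (x * I w + y * J w)|%:E).
Proof.
move=> mU mV mI mJ hU hV.
have mn (f : Omega -> R) : mfunT f -> mfunT (fun w => `|f w|%:E).
 by move=> mf; apply/mEFinP; exact: mcompT.
apply: (cvg0_in_prob_le _ _ _ _ hU hV) => [k|k|k|e e0].
- apply: mn; apply: mfunB; apply: mfunD; exact: mfunM.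
- by apply: mn; exact: mfunB.
- by apply: mn; exact: mfunB.
pose c := `|x| + `|y| + 1; have c0 : 0 < c by rewrite ltr_wpDl// addr_ge0.
exists (e / (2 * c)); first by rewrite divr_gt0// mulr_gt0.
move=> k w; rewrite !lee_fin => h.
have [h1|h1] := leP (e / (2 * c)) `|U k w - I w|; [by left|right].
rewrite leNgt; apply/negP => h2; move: h; apply/negP; rewrite -ltNge.
have -> : x * U k w + y * V k w - (x * I w + y * J w) = x * (U k w - I w) + y * (V k w - J w) by ring.
apply: le_lt_trans (ler_normD _ _) _; rewrite !normrM.
apply: (@le_lt_trans _ _ (`|x| * (e / (2 * c)) + `|y| * (e / (2 * c)))).
 by apply: lerD; apply: ler_wpM2l => //; exact: ltW.
have s0 : 0 <= `|x| + `|y| by rewrite addr_ge0.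
rewrite -mulrDl mulrA ltr_pdivrMr ?mulr_gt0// /c.
have := mulr_ge0 s0 (ltW e0); move: e0; lra.
Qed.

Lemma cvg0_ae (U : nat -> Omega -> R) (I J : Omega -> R) :
 (forall k, mfunT (U k)) -> mfunT I -> mfunT J ->
 {ae P, forall w, J w = I w} ->
 cvg0_in_prob P (fun k w => `|U k w - I w|%:E) -> cvg0_in_prob P (fun k w => `|U k w - J w|%:E).
Proof.
move=> mU mI mJ ae hU.
have h0 : cvg0_in_prob P (fun k w => `|cst 0 w - (J w - I w)|%:E).
 move=> e e0; rewrite (_ : (fun n => _) = cst 0%E); first exact: cvg_cst. apply/funext => n /=; apply/negligibleP; last first.
  apply: negligibleS ae => w /= h; rewrite /= => E; move: h; rewrite E subrr subr0 normr0 lee_fin. by apply/negP; rewrite -ltNge. apply: mge_set; apply/mEFinP; apply: mcompT => //.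
 by apply: mfunB => //; exact: mfunB.
have := @cvg0_lin U (fun _ => cst 0) I (fun w => J w - I w) 1 1 mU (fun _ => mcst _) mI (mfunB mJ mI) hU h0.
rewrite (_ : (fun k w => _) = (fun k w => `|U k w - J w|%:E))//.
by apply/funext => k; apply/funext => w; congr (`|_|%:E) => /=; ring.
Qed.
End cvg0.

(** * Volterra processes driven by a Brownian motion *)

Section integral_bounds.
Context d (Omega : measurableType d) (R : realType) (P : probability Omega R).
Lemma int_lin_le (U U2 V : Omega -> R) (c1 c2 x x2 : R) :
 mfunT U -> mfunT U2 -> mfunT V ->
 (forall w, 0 <= U w) -> (forall w, 0 <= U2 w) -> (forall w, 0 <= V w) -> 0 <= c1 -> 0 <= c2 ->
 (forall w, V w <= c1 * U w + c2 * U2 w) -> (\int[P]_w (U w)%:E <= x%:E)%E -> (\int[P]_w (U2 w)%:E <= x2%:E)%E ->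
 (\int[P]_w (V w)%:E <= (c1 * x + c2 * x2)%:E)%E.
Proof.
move=> mU mU2 mV U0 U20 V0 c10 c20 h hx hx2.
have mc (c : R) (f : Omega -> R) : mfunT f -> mfunT (fun w => (c * f w)%:E).
 by move=> mf; apply/mEFinP; exact: mfunM.
apply: (@le_trans _ _ (\int[P]_w ((c1 * U w)%:E + (c2 * U2 w)%:E))%E).
 apply: ge0_le_integral => //.
 - by move=> w _; rewrite lee_fin.
 - exact/mEFinP.
 - by apply: emeasurable_funD; exact: mc.
 - by move=> w _; rewrite -EFinD lee_fin.
have aux (c y : R) (f : Omega -> R) : mfunT f -> (forall w, 0 <= f w) -> 0 <= c ->
  (\int[P]_w (f w)%:E <= y%:E)%E -> (\int[P]_w (c * f w)%:E <= (c * y)%:E)%E. move=> mf f0 c0 hy; under eq_integral do rewrite EFinM.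
 rewrite ge0_integralZl_EFin//; [|by move=> w _; rewrite lee_fin|exact/mEFinP]. by rewrite EFinM; apply: lee_wpmul2l; rewrite ?lee_fin.
rewrite ge0_integralD//; [|by move=> w _; rewrite lee_fin mulr_ge0|exact: mc|by move=> w _; rewrite lee_fin mulr_ge0|exact: mc].
by rewrite EFinD; apply: leeD; exact: aux.
Qed.

Lemma int_cst_le (x : R) : (\int[P]_w x%:E)%E = x%:E.
Proof. by rewrite integral_cst//; have /= -> := @probability_setT _ _ _ P; rewrite mule1. Qed.

Lemma int_aff_le (U V : Omega -> R) (c1 c2 x : R) :
 mfunT U -> mfunT V -> (forall w, 0 <= U w) -> (forall w, 0 <= V w) -> 0 <= c1 -> 0 <= c2 ->
 (forall w, V w <= c1 * U w + c2) -> (\int[P]_w (U w)%:E <= x%:E)%E -> (\int[P]_w (V w)%:E <= (c1 * x + c2)%:E)%E.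
Proof.
move=> mU mV U0 V0 c10 c20 h hx; rewrite -[X in (_ + X)%:E]mulr1.
apply: (@int_lin_le U (cst 1) V) => //; first by move=> w; rewrite mulr1.
by rewrite int_cst_le.
Qed.

Lemma int_le (U V : Omega -> R) (x : R) :
 mfunT U -> mfunT V -> (forall w, 0 <= V w) ->
 (forall w, V w <= U w) -> (\int[P]_w (U w)%:E <= x%:E)%E -> (\int[P]_w (V w)%:E <= x%:E)%E.
Proof.
move=> mU mV V0 h hx; rewrite -[x]mul1r -[1 * x]addr0.
by apply: (@int_aff_le U V) => // w; [exact: le_trans (h w)|rewrite mul1r addr0].
Qed.

Definition trunc (B : set Omega) (h : Omega -> R) (n : nat) : set Omega := B `&` [set w | h w <= n%:R].

Lemma cvg_trunc (B : set Omega) (h U : Omega -> R) : mfunT (\1_B : Omega -> R) ->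
 (forall n, mfunT (\1_(trunc B h n) : Omega -> R)) -> mfunT U ->
 (\int[P]_w ((\1_(trunc B h n) w * U w) ^+ 2)%:E @[n --> \oo] --> \int[P]_w ((\1_B w * U w) ^+ 2)%:E)%E.
Proof.
move=> mB mT mU.
have mg n : mfunT (fun w => ((\1_(trunc B h n) w * U w) ^+ 2)%:E).
 by apply/mEFinP; apply: mfunX; exact: mfunM.
have nd w : {homo (fun n => ((\1_(trunc B h n) w * U w) ^+ 2)%:E) : n n' / (n <= n')%N >-> (n <= n')%E}.
 move=> n n' nn'; rewrite lee_fin !exprMn; apply: ler_wpM2r; first exact: sqr_ge0. have sub : trunc B h n w -> trunc B h n' w by move=> -[hB hn]; split=> //=; apply: le_trans hn _; rewrite ler_nat.
 rewrite !indicE; case: (boolP (w \in trunc B h n)) => [/set_mem /sub/mem_set ->//|_]. by rewrite expr0n/= sqr_ge0.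
have n0 n w : (0 <= ((\1_(trunc B h n) w * U w) ^+ 2)%:E)%E by rewrite lee_fin sqr_ge0.
have := @cvg_monotone_convergence _ _ _ P setT measurableT _ mg (fun n w _ => n0 n w) (fun w _ => nd w).
rewrite (_ : (\int[P]_(x in setT) _)%E = (\int[P]_w ((\1_B w * U w) ^+ 2)%:E)%E)//.
apply: eq_integral => w _; apply/cvg_lim => //.
have H : ((\1_B w * U w) ^+ 2)%:E @[n --> \oo] --> ((\1_B w * U w) ^+ 2)%:E by exact: cvg_cst.
apply: cvg_trans H; apply: near_eq_cvg; near=> n.
congr ((_ * _) ^+ 2)%:E; rewrite !indicE; congr (_%:R); congr nat_of_bool.
apply/idP/idP => /set_mem hw; apply/mem_set; last by case: hw.
split=> //=; apply: le_trans (ler_norm _) _; near: n; exact: nbhs_infty_ger.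
Unshelve. all: end_near. Qed.
End integral_bounds.

Lemma indic_sqr_le1 (T : Type) (R : realType) (A : set T) w : 0 <= (\1_A w : R) <= 1.
Proof. by rewrite indicE; case: (_ \in _); rewrite ?ler01 ?lexx. Qed.

(** * Moment bounds for a solution or for a difference of two solutions *)

Section volterra_process.
Context d (Omega : measurableType d) (R : realType) (P : probability Omega R).
Variables (F : R -> set (set Omega)) (W : R -> Omega -> R).
Hypotheses (hF : usual_conditions P F) (hW : is_brownian P F W).
Local Notation mF := (mF F).
Notation mu := (leb R).
Variables (Y G D : R -> Omega -> R).
Hypotheses (cY : cpath Y) (aY : forall u, 0 <= u -> mF u (Y u)).
Hypotheses (cG : cpath G) (aG : forall u, 0 <= u -> mF u (G u)) (aD : forall u, 0 <= u -> mF u (D u)) (YG : forall N : R, exists L : R, forall u w, `|G u w| <= N -> `|Y u w| <= L).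
Variables (f v : R -> R) (b M cc k C : R).
Hypotheses (sf : suppos f) (f0 : forall x, 0 <= f x) (nf : forall u v, 0 < u -> u <= v -> f v <= f u).
Hypotheses (cf : forall t : R, 0 < t -> {for t, continuous f}) (mf : mfunT f) (f2 : L1 (fun x => f x ^+ 2)).
Hypotheses (cv : continuous v) (vM : forall x, `|v x| <= M).
Hypotheses (k0 : 0 < k) (C0 : 0 <= C) (YD : forall u w, 0 <= u -> Y u w ^+ 2 <= k * D u w ^+ 2 + C).

(** With [b * be] and [b * ga] as coefficients, the kernel of [be J t + ga J s], where the second
    term is 0 from time [s] on. Treating two times together puts increments and covariances under
    the same isometry. *)
Definition vpsi (be ga s t u : R) : R := (be * f (t - u) + ga * f (s - u)) * v u.

Hypothesis hcc : forall t, 0 <= t -> \int[mu]_(u in `[0, t]) (vpsi b 0 t t u ^+ 2) <= cc.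
Variables (X0 : Omega -> R) (ph : R -> R) (m Ph : R).
Hypotheses (aX0 : mF 0 X0) (phM : forall t, 0 <= t -> `|ph t| <= Ph).
Hypothesis hI : forall T, 0 <= T -> exists I : Omega -> R,
 [/\ mfunT I, {ae P, forall w, D T w = X0 w * ph T + m + b * I w} &
   forall be ga s t, 0 <= s -> s <= t -> (T = t /\ be = 1 /\ ga = 0) \/ (T = s /\ be = 0 /\ ga = 1) ->
   cvg0_in_prob P (fun n w => `|zsum W Y G s t (vpsi be ga s t) n%:R n w - I w|%:E)].
Definition vnoise (t : R) (w : Omega) : R := D t w - (X0 w * ph t + m).
Local Notation J := vnoise.

Let M0 : 0 <= M. Proof. exact: le_trans (normr_ge0 _) (vM 0). Qed.
Let mf_t t : mfunT (fun u : R => f (t - u)). Proof. exact: mreflect. Qed.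
Let mv : mfunT v. Proof. exact: cmfun. Qed.

Lemma vpsi_measurable be ga s t : mfunT (vpsi be ga s t).
Proof.
apply: mfunM => //.
by apply: mfunD; exact: mfunM.
Qed.

Lemma vpsi_continuous be ga s t u : u < t -> u != s -> {for u, continuous (vpsi be ga s t)}.
Proof.
move=> ut us.
have aux (x y : R) : u != x -> {for u, continuous (fun u => y * f (x - u))}.
 rewrite neq_lt => /orP[h|h]. have xu : 0 < x - u by rewrite subr_gt0. apply: (@cvgM _ _ _ _ (cst y)); first exact: cvg_cst.
  apply: (@cvg_comp _ _ _ (fun z : R => x - z) f _ (nbhs (x - u))); last exact: cf. by apply: cvgB; [exact: cvg_cst|exact: cvg_id]. have E : {near u, (fun z : R => y * f (x - z)) =1 cst 0}.
  near=> z; rewrite /= sf ?mulr0// subr_le0; near: z. by exists (u - x) => /=; [rewrite subr_gt0|move=> z /=; rewrite ltr_distlC => /andP[h1 _]; apply: ltW; move: h1; lra].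
 have H : cst (0 : R) z @[z --> u] --> (0 : R) by exact: cvg_cst. have E0 : y * f (x - u) = 0 by rewrite sf ?mulr0// subr_le0 ltW. change (y * f (x - z) @[z --> u] --> y * f (x - u)); rewrite E0.
 by apply: cvg_trans H; apply: near_eq_cvg; apply: filterS E => z /= ->.
apply: (@cvgM _ _ _ _ (fun u => (be * f (t - u) + ga * f (s - u)))); last exact: cv.
by apply: (@cvgD _ _ _ _ _ (fun u => be * f (t - u)) (fun u => ga * f (s - u))); apply: aux => //; rewrite lt_eqF.
Unshelve. all: end_near. Qed.

Definition venv (be ga s t u : R) : R := (`|be| * f (t - u) + `|ga| * f (s - u)) * M.

Lemma venv_L1 be ga s t : L1 (fun u => venv be ga s t u ^+ 2).
Proof.
apply: (@L1_le _ _ (fun u => 2 * (`|be| * M) ^+ 2 * f (t - u) ^+ 2 + 2 * (`|ga| * M) ^+ 2 * f (s - u) ^+ 2)).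
- apply: mfunX; apply: mfunM => //.
 by apply: mfunD; exact: mfunM.
- by apply: L1D; apply: L1Z; exact: (@L1_reflect _ (fun x => f x ^+ 2)).
- move=> u; rewrite ger0_norm ?sqr_ge0// /venv.
 have := sqr_ge0 (`|be| * M * f (t - u) - `|ga| * M * f (s - u)); rewrite -subr_ge0; move=> h; rewrite -subr_ge0. by apply: le_trans h _; apply: eq_ler; ring.
Qed.

(** As [f] is nonincreasing, [f (t - x)] grows with [x] up to its singularity at [t]: the value at
    an earlier point [x] is controlled by the one at [u], provided [s] does not separate them. *)
Lemma vpsi_env be ga s t x u : 0 <= x <= u -> 0 < u < t -> u != s -> (s < u -> s <= x) -> `|vpsi be ga s t x| <= venv be ga s t u.
Proof.
move=> /andP[x0 xu] /andP[u0 ut] us hs; rewrite normrM.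
have h1 : f (t - x) <= f (t - u) by apply: nf; [rewrite subr_gt0|rewrite lerB].
have h2 : f (s - x) <= f (s - u).
 move: us; rewrite neq_lt => /orP[h|h]; first by apply: nf; [rewrite subr_gt0|rewrite lerB]. by rewrite [f (s - x)]sf// subr_le0; exact: hs.
apply: ler_pM => //.
apply: le_trans (ler_normD _ _) _; rewrite !normrM !(ger0_norm (f0 _)).
by apply: lerD; apply: ler_wpM2l.
Qed.

Lemma zsum_measurable be ga s t N n : 0 <= s -> s <= t -> mfunT (zsum W Y G s t (vpsi be ga s t) N n).
Proof.
move=> s0 st; apply: msum => i; apply: mfunM.
 exact: (mF_meas hF (dtau_ge0 s0 st n i) (zeta_mF hF aY cG aG (vpsi be ga s t) N (dtau_ge0 s0 st n i))).
by apply: mfunB; exact: (mF_meas hF (dtau_ge0 s0 st n _) (W_mF hF hW (dtau_ge0 s0 st n _))).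
Qed.

Lemma vnoise_mF t : 0 <= t -> mF t (J t).
Proof.
move=> t0; apply: mfunB; first exact: aD.
apply: mfunD => //; apply: mfunM => //; exact: (mF_mono hF (lexx 0) t0 aX0).
Qed.

Lemma vnoise_measurable t : 0 <= t -> mfunT (J t).
Proof. by move=> t0; exact: (mF_meas hF t0 (vnoise_mF t0)). Qed.

Lemma vzsum_ito (be ga s t T : R) I H j : 0 <= s -> s <= t -> (T = t /\ be = 1 /\ ga = 0) \/ (T = s /\ be = 0 /\ ga = 1) ->
 is_ito_integral P F W T H I ->
 (forall u w, 0 <= u <= T -> H u w = (if u == T then j else f (T - u) * v u) * Y u w) ->
 cvg0_in_prob P (fun n w => `|zsum W Y G s t (vpsi be ga s t) n%:R n w - I w|%:E).
Proof.
move=> s0 st hT hi hH.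
pose c (u : R) := if u == T then j else f (T - u) * v u.
have mc : mfunT c.
 apply: mfun_ifT; [|exact: mcst|by apply: mfunM]. by apply: measurable_fun_eqr => //; exact: measurable_id.
have ps u : vpsi be ga s t u = f (T - u) * v u.
 by rewrite /vpsi; case: hT => -[-> [-> ->]]; ring.
apply: (zsum_ito hF hW cY aY cG aG YG s0 st (vpsi_measurable be ga s t) (venv_L1 be ga s t) _ (@vpsi_env be ga s t) _ _ mc _ hi).
- by move=> u /andP[_ ut] us; exact: vpsi_continuous.
- case: hT => -[-> h]; [by left|right; split=> // x sx].
 by rewrite /vpsi; case: h => -> ->; rewrite mul0r add0r mul1r sf ?mul0r// subr_le0.
- by move=> u /andP[_ uT]; rewrite /c lt_eqF// ps.
- by move=> u w uT; rewrite hH.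
Qed.

Lemma vnoise_zsum (be ga s t : R) : 0 <= s -> s <= t ->
 cvg0_in_prob P (fun n w => `|zsum W Y G s t (vpsi (b * be) (b * ga) s t) n%:R n w - (be * J t w + ga * J s w)|%:E).
Proof.
move=> s0 st; have t0 : 0 <= t by exact: le_trans st.
have [I [mI ae hi]] := hI t0; have [I' [mI' ae' hi']] := hI s0.
have h1 := hi 1 0 s t s0 st (or_introl (conj erefl (conj erefl erefl))).
have h2 := hi' 0 1 s t s0 st (or_intror (conj erefl (conj erefl erefl))).
have := cvg0_lin (b * be) (b * ga) (fun n => zsum_measurable 1 0 n%:R n s0 st) (fun n => zsum_measurable 0 1 n%:R n s0 st) mI mI' h1 h2.
rewrite (_ : (fun k w => _) = (fun n w => `|zsum W Y G s t (vpsi (b * be) (b * ga) s t) n%:R n w - (b * be * I w + b * ga * I' w)|%:E)); last first.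
 apply/funext => n; apply/funext => w; congr (`|_ - _|%:E); rewrite /zsum !mulr_sumr -big_split/=; apply: eq_bigr => i _. by rewrite /zeta /vpsi; ring.
apply: cvg0_ae.
- by move=> n; exact: zsum_measurable.
- by apply: mfunD; exact: mfunM.
- by apply: mfunD; apply: mfunM => //; exact: vnoise_measurable.
- by apply: filterS2 ae ae' => w E E'; rewrite /J E E'; ring.
Qed.

Local Notation stay := (stay G).
Definition vstart (t : R) (w : Omega) : R := X0 w * ph t + m.

Lemma vstart_mF t : mF 0 (vstart t).
Proof. by apply: mfunD => //; exact: mfunM. Qed.

Lemma vstartJ t w : D t w = vstart t w + J t w.
Proof. by rewrite /vnoise /vstart addrC subrK. Qed.

Variable q : nat.
Hypotheses (q1 : (1 < q)%N) (hcq : k * ((q.*2.-1)%:R * cc) <= 9 / 16).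

Let ev (x : R) := expr_double_ge0 x q.
Let cc0 : 0 <= cc.
Proof. by apply: le_trans (hcc (lexx 0)); apply: Rintegral_ge0 => // u _; exact: sqr_ge0. Qed.

Section trunc.
Variables (A : set Omega) (K : R).
Hypotheses (mA : mF 0 (\1_A : Omega -> R)) (AK : forall w, A w -> `|X0 w| <= K).
Let mAO : mfunT (\1_A : Omega -> R). Proof. exact: (mF_meas hF (lexx 0) mA). Qed.
Let mYO u : 0 <= u -> mfunT (Y u). Proof. by move=> u0; exact: (mF_meas hF u0 (aY u0)). Qed.
Let mDO u : 0 <= u -> mfunT (D u). Proof. by move=> u0; exact: (mF_meas hF u0 (aD u0)). Qed.
Let msO N u : 0 <= u -> mfunT (\1_(stay N u) : Omega -> R).
Proof. by move=> u0; exact: (mF_meas hF u0 (stay_mF hF cG aG N u0)). Qed.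

Lemma vstart_bnd t w : 0 <= t -> `|\1_A w * vstart t w| <= `|K| * Ph + `|m|.
Proof.
move=> t0; have Ph0 : 0 <= Ph by exact: le_trans (phM t0).
rewrite indicE; case: (boolP (w \in A)) => [/set_mem wA|_]; last by rewrite mul0r normr0 addr_ge0// mulr_ge0.
rewrite mul1r; apply: le_trans (ler_normD _ _) _; rewrite lerD2r normrM ler_pM//; last exact: phM.
by apply: le_trans (AK wA) _; exact: ler_norm.
Qed.

(** One round of the contraction: [Y ^ 2 <= k D ^ 2 + C], and [ito_moment] bounds [D] at time [t] by
    the bound on [Y] up to [t]. Convexity with weights [a] and [b'] produces the factor
    [(a + b') ^ q]. *)
Let step (N z Gam a b' : R) (n : nat) t : 0 <= t -> N = n%:R -> 0 < z -> 0 < a -> 0 < b' -> 0 <= Gam ->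
 k * (z + (q.*2.-1)%:R * cc) <= a -> (C / b') ^+ q <= Gam ->
 (\int[P]_w ((\1_A w * vstart t w) ^+ q.*2)%:E <= (z ^+ q * Gam)%:E)%E ->
 (forall u, 0 <= u <= t -> (\int[P]_w ((\1_A w * \1_(stay N u) w * Y u w) ^+ q.*2)%:E <= Gam%:E)%E) ->
 (\int[P]_w ((\1_A w * \1_(stay N t) w * Y t w) ^+ q.*2)%:E <= ((a + b') ^+ q * Gam)%:E)%E.
Proof.
move=> t0 -> z0 a0 b0 G0 ha hb hz hY.
have mI : mfunT (fun w => 1 * J t w + 0 * J t w) by apply: mfunD; apply: mfunM => //; exact: vnoise_measurable.
have := ito_moment hF hW aY cG aG t0 (lexx t) (vpsi_measurable (b * 1) (b * 0) t t) (venv_L1 (b * 1) (b * 0) t t)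
 _ (@vpsi_env (b * 1) (b * 0) t t) mI (vstart_mF t) mA (vnoise_zsum 1 0 t0 (lexx t)) (ltnW q1) z0 G0 hz hY.
have h0 (u : R) : 0 < u < t -> u != t -> {for u, continuous (vpsi (b * 1) (b * 0) t t)}.
 by move=> /andP[_ ut] us; exact: vpsi_continuous.
move=> /(_ h0); rewrite mulr1 mulr0 => hD.
have {}hD : (\int[P]_w ((\1_A w * \1_(stay n%:R t) w * D t w) ^+ q.*2)%:E <= ((z + (q.*2.-1)%:R * cc) ^+ q * Gam)%:E)%E.
 rewrite (eq_integral (fun w => ((\1_A w * \1_(stay n%:R t) w * (vstart t w + (1 * J t w + 0 * J t w))) ^+ q.*2)%:E)); last first. by move=> w _; rewrite vstartJ mul1r mul0r addr0.
 apply: le_trans hD _; rewrite lee_fin; apply: ler_wpM2r => //; apply: lerXn2r; rewrite ?nnegrE.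
 - by rewrite addr_ge0 ?(ltW z0)// mulr_ge0//; apply: Rintegral_ge0 => // u _; exact: sqr_ge0.
 - by rewrite addr_ge0 ?(ltW z0)// mulr_ge0.
 - by rewrite lerD2l; apply: ler_wpM2l => //; exact: hcc.
have ab0 : 0 < a + b' by exact: addr_gt0.
apply: le_trans (@int_aff_le _ _ _ P (fun w => (\1_A w * \1_(stay n%:R t) w * D t w) ^+ q.*2) _
 ((a + b') ^+ q * (a / (a + b')) * (k / a) ^+ q) ((a + b') ^+ q * (b' / (a + b') * (C / b') ^+ q)) _ _ _ _ _ _ _ _ hD) _ => //.
- by apply: mfunX; apply: mfunM; [apply: mfunM => //; exact: msO|exact: mDO].
- by apply: mfunX; apply: mfunM; [apply: mfunM => //; exact: msO|exact: mYO].
- by rewrite !mulr_ge0 ?exprn_ge0 ?invr_ge0 ?divr_ge0// ltW.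
- by rewrite !mulr_ge0 ?exprn_ge0 ?invr_ge0 ?divr_ge0// ltW.
- move=> w; set e := \1_A w * \1_(stay n%:R t) w.
 have e1 : 0 <= e ^+ 2 <= 1. rewrite sqr_ge0/= expr_le1//; last by rewrite mulr_ge0. by apply: mulr_ile1 => //; have /andP[_] := indic_sqr_le1 R A w; have /andP[_] := indic_sqr_le1 R (stay n%:R t) w.
 have h1 : (e * Y t w) ^+ 2 <= k * (e * D t w) ^+ 2 + C. have /andP[e0 e1'] := e1; rewrite ![(e * _) ^+ 2]exprMn.
  apply: le_trans (ler_wpM2l e0 (YD w t0)) _; rewrite mulrDr mulrCA lerD2l. exact: ler_piMl. rewrite -!mul2n !exprM. apply: (@le_trans _ _ ((k * (e * D t w) ^+ 2 + C) ^+ q)).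
  by apply: lerXn2r; rewrite ?nnegrE ?sqr_ge0// addr_ge0// mulr_ge0 ?sqr_ge0 ?ltW. apply: le_trans (pow_add_le q a0 b0 _ C0) _; first by rewrite mulr_ge0 ?sqr_ge0 ?ltW.
 have -> : (k * (e * D t w) ^+ 2 / a) ^+ q = (k / a) ^+ q * ((e * D t w) ^+ 2) ^+ q by rewrite -exprMn mulrAC. by apply: eq_ler; ring.
rewrite lee_fin.
have -> : (a + b') ^+ q * Gam = (a + b') ^+ q * (a / (a + b') * Gam + b' / (a + b') * Gam).
 by rewrite -mulrDl -mulrDl divff ?mul1r// gt_eqF.
rewrite -!mulrA -!mulrDr; apply: ler_wpM2l; first by rewrite exprn_ge0// ltW.
apply: lerD; last by rewrite !mulrA; apply: ler_wpM2l => //; rewrite divr_ge0// ltW.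
rewrite !mulrA; rewrite -!mulrA; apply: ler_wpM2l; first exact: ltW.
apply: ler_wpM2l; first by rewrite invr_ge0 ltW.
rewrite mulrA -exprMn; apply: ler_piMl => //; apply: exprn_ile1.
 have zz : 0 <= z + (q.*2.-1)%:R * cc by apply: addr_ge0; [exact: ltW|exact: mulr_ge0]. by apply: mulr_ge0 zz; apply: divr_ge0; exact: ltW.
by rewrite mulrAC ler_pdivrMr// mul1r.
Qed.

(** On [stay N] the bound from [YG] starts the iteration. The bound [g] reached depends neither on
    [N] nor on the horizon, so Fatou's lemma lets [N] grow. *)
Lemma trunc_moment : exists2 Gam : R, 0 <= Gam & forall u, 0 <= u -> (\int[P]_w ((\1_A w * Y u w) ^+ q.*2)%:E <= Gam%:E)%E.
Proof.
(* [k z = 1 / 16], so [k (z + (2 q - 1) cc) <= 1 / 16 + 9 / 16 = 5 / 8]; with [1 / 4] left for the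
   constant [C], the factor is [7 / 8 < 1]. *)
pose z := (16 * k)^-1; have z0 : 0 < z by rewrite invr_gt0 mulr_gt0.
pose Kz := `|K| * Ph + `|m|.
have Ph0 : 0 <= Ph by exact: le_trans (phM (lexx 0)).
have Kz0 : 0 <= Kz by rewrite addr_ge0// mulr_ge0.
(* The first term absorbs the constant [C], the second the bounded start, and 1 makes [g]
   positive. *)
pose g := (C / 4^-1) ^+ q + (Kz ^+ 2 / z) ^+ q + 1.
have C40 : 0 <= (C / 4^-1) ^+ q by rewrite exprn_ge0// divr_ge0.
have Kzz0 : 0 <= (Kz ^+ 2 / z) ^+ q by rewrite exprn_ge0// divr_ge0 ?sqr_ge0// ltW.
have g0 : 0 < g by rewrite ltr_wpDl// addr_ge0.
have hz t : 0 <= t -> (\int[P]_w ((\1_A w * vstart t w) ^+ q.*2)%:E <= (z ^+ q * g)%:E)%E.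
 move=> t0; apply: (@le_trans _ _ (0 * 0 + Kz ^+ q.*2)%:E). apply: (@int_aff_le _ _ _ P (cst 0)) => //.
  - by apply: mfunX; apply: mfunM => //; exact: (mF_meas hF (lexx 0) (vstart_mF t)).
  - move=> w; rewrite mul0r add0r -[in leLHS](ger0_norm (ev _)) normrX. by apply: lerXn2r; rewrite ?nnegrE//; exact: vstart_bnd.
  - by rewrite integral0. rewrite lee_fin mul0r add0r -mul2n exprM -ler_pdivrMl ?exprn_gt0// mulrC -expr_div_n. by rewrite /g -addrA addrCA lerDl addr_ge0.
have cl (n : nat) T u : 0 <= u <= T -> (\int[P]_w ((\1_A w * \1_(stay n%:R u) w * Y u w) ^+ q.*2)%:E <= g%:E)%E.
 have [L hL] := YG n%:R. apply: (@sup_contract R R (fun u => 0 <= u <= T) (fun u => (\int[P]_w ((\1_A w * \1_(stay n%:R u) w * Y u w) ^+ q.*2)%:E)%E) ((5/8 + 4^-1) ^+ q) g (`|L| ^+ q.*2)) => //.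
 - rewrite exprn_ge0 ?addr_ge0//= exprn_ilt1 ?addr_ge0// -?lt0n ?(ltnW q1)//; lra.
 - move=> {}u /andP[u0 _]. rewrite -[`|L| ^+ _]add0r -[X in (X + _)%:E](mul0r (0:R)). apply: (@int_aff_le _ _ _ P (cst 0)) => //.
  + by apply: mfunX; apply: mfunM; [apply: mfunM => //; exact: msO|exact: mYO].
  + move=> w; rewrite mul0r add0r -[in leLHS](ger0_norm (ev _)) normrX. apply: lerXn2r; rewrite ?nnegrE//; rewrite !indicE.
   case: (boolP (w \in stay _ _)) => [/set_mem h|_]; last by rewrite mulr0 mul0r normr0.
   rewrite mulr1 normrM; apply: le_trans (_ : `|Y u w| <= _); last by apply: le_trans (ler_norm L); apply: hL; apply: h; rewrite u0 lexx. by case: (_ \in _); rewrite ?normr1 ?normr0 ?mul1r ?mul0r.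
  + by rewrite integral0.
 - move=> x gx hx t /andP[t0 tT]. have s1 : 0 <= x by exact: le_trans (ltW g0) gx. have s2 : k * (z + (q.*2.-1)%:R * cc) <= 5 / 8.
   rewrite mulrDr; have -> : k * z = 16^-1 by rewrite /z invfM mulrCA divff ?mulr1// gt_eqF. by move: hcq; lra. have s3 : (C / 4^-1) ^+ q <= x by apply: le_trans gx; rewrite /g -addrA lerDl addr_ge0.
  have s4 : (\int[P]_w ((\1_A w * vstart t w) ^+ q.*2)%:E <= (z ^+ q * x)%:E)%E. by apply: le_trans (hz t t0) _; rewrite lee_fin; apply: ler_wpM2l => //; rewrite exprn_ge0// ltW.
  have s5 : 0 < 5 / 8 :> R by lra. have s6 : 0 < 4^-1 :> R by lra. apply: (@step n%:R z x (5/8) 4^-1 n t t0 erefl z0 s5 s6 s1 s2 s3 s4) => u' /andP[u0 ut]. by apply: hx; rewrite u0 (le_trans ut).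
exists g; first exact: ltW.
move=> u u0.
apply: (@fatou_le _ _ _ P (fun n w => (\1_A w * \1_(stay n%:R u) w * Y u w) ^+ q.*2) _ (fun=> g)) => //.
- by move=> n; apply: mfunX; apply: mfunM; [apply: mfunM => //; exact: msO|exact: mYO].
- by apply: mfunX; apply: mfunM => //; exact: mYO.
- apply: aeW => w; have [N0 hN] := stay_ev cG w u0.
 have H : (\1_A w * Y u w) ^+ q.*2 @[n --> \oo] --> (\1_A w * Y u w) ^+ q.*2 by exact: cvg_cst. apply: cvg_trans H; apply: near_eq_cvg; near=> n. rewrite [\1_(stay _ _) w]indicE mem_set ?mulr1//.
 by apply: hN; near: n; exact: nbhs_infty_ge.
- by move=> n; apply: (cl n u); rewrite u0 lexx.
- exact: cvg_cst.
Unshelve. all: end_near. Qed.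

Let stay_moment Gam N u : 0 <= u -> (\int[P]_w ((\1_A w * Y u w) ^+ q.*2)%:E <= Gam%:E)%E ->
 (\int[P]_w ((\1_A w * \1_(stay N u) w * Y u w) ^+ q.*2)%:E <= Gam%:E)%E.
Proof.
move=> u0; apply: int_le => //.
- by apply: mfunX; apply: mfunM => //; exact: mYO.
- by apply: mfunX; apply: mfunM; [apply: mfunM => //; exact: msO|exact: mYO].
move=> w; rewrite mulrAC exprMn ler_piMr//.
Qed.

Let mcomb be ga s t : 0 <= s -> s <= t -> mfunT (fun w => be * J t w + ga * J s w).
Proof.
move=> s0 st; have t0 : 0 <= t by exact: le_trans st.
by apply: mfunD; apply: mfunM => //; exact: vnoise_measurable.
Qed.

Let cpsi be ga s t u : 0 < u < t -> u != s -> {for u, continuous (vpsi be ga s t)}.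
Proof. by move=> /andP[_ ut] us; exact: vpsi_continuous. Qed.

Lemma comb_moment (Z' : Omega -> R) (be ga s t z Gam : R) : mF 0 Z' -> 0 <= s -> s <= t -> 0 < z -> 0 <= Gam ->
 (\int[P]_w ((\1_A w * Z' w) ^+ q.*2)%:E <= (z ^+ q * Gam)%:E)%E ->
 (forall u, 0 <= u -> (\int[P]_w ((\1_A w * Y u w) ^+ q.*2)%:E <= Gam%:E)%E) ->
 (\int[P]_w ((\1_A w * (Z' w + (be * J t w + ga * J s w))) ^+ q.*2)%:E <=
  ((z + (q.*2.-1)%:R * \int[mu]_(u in `[0, t]) (vpsi (b * be) (b * ga) s t u ^+ 2)) ^+ q * Gam)%:E)%E.
Proof.
move=> mZ s0 st z0 G0 hZ hY; have t0 : 0 <= t by exact: le_trans st.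
have mZ' : mfunT Z' by exact: (mF_meas hF (lexx 0) mZ).
have mU : mfunT (fun w => Z' w + (be * J t w + ga * J s w)) by exact: (mfunD mZ' (mcomb be ga s0 st)).
apply: (@fatou_le _ _ _ P (fun n w => (\1_A w * \1_(stay n%:R t) w * (Z' w + (be * J t w + ga * J s w))) ^+ q.*2) _
 (fun=> (z + (q.*2.-1)%:R * \int[mu]_(u in `[0, t]) (vpsi (b * be) (b * ga) s t u ^+ 2)) ^+ q * Gam)) => //.
- by move=> n; apply: mfunX; apply: mfunM => //; apply: mfunM => //; exact: msO.
- by apply: mfunX; apply: mfunM.
- apply: aeW => w; have [N0 hN] := stay_ev cG w t0.
 have H : (\1_A w * (Z' w + (be * J t w + ga * J s w))) ^+ q.*2 @[n --> \oo] --> (\1_A w * (Z' w + (be * J t w + ga * J s w))) ^+ q.*2 by exact: cvg_cst.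
 apply: cvg_trans H; apply: near_eq_cvg; near=> n. rewrite [\1_(stay _ _) w]indicE mem_set ?mulr1//. by apply: hN; near: n; exact: nbhs_infty_ge.
- move=> n; apply: (ito_moment hF hW aY cG aG s0 st (vpsi_measurable _ _ s t) (venv_L1 _ _ s t)
  (@cpsi (b * be) (b * ga) s t) (@vpsi_env _ _ s t) (mcomb be ga s0 st) mZ mA (vnoise_zsum be ga s0 st) (ltnW q1) z0 G0 hZ). by move=> u /andP[u0 _]; apply: stay_moment => //; exact: hY.
- exact: cvg_cst.
Unshelve. all: end_near. Qed.

Lemma trunc_isom (Z' : Omega -> R) (K' be ga s t : R) : mF 0 Z' -> (forall w, A w -> `|Z' w| <= K') -> 0 <= s -> s <= t ->
 (\int[P]_w ((\1_A w * (Z' w + (be * J t w + ga * J s w))) ^+ 2)%:E =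
  \int[P]_w ((\1_A w * Z' w) ^+ 2)%:E + (\int[mu]_(u in `[0, t]) (vpsi (b * be) (b * ga) s t u ^+ 2 * sqmom P Y A u))%R%:E)%E.
Proof.
move=> mZ ZK s0 st; have [Gam G0 hG] := trunc_moment.
have mZ' : mfunT Z' by exact: (mF_meas hF (lexx 0) mZ).
have K0 : 0 <= `|K'| ^+ q.*2 by [].
apply: (@ito_isometry _ _ _ _ _ _ hF hW _ _ cY aY cG aG _ _ _ _ s0 st (vpsi_measurable _ _ s t) (venv_L1 _ _ s t)
  (@cpsi (b * be) (b * ga) s t) (@vpsi_env _ _ s t) _ _ _ (mcomb be ga s0 st) mZ mA (vnoise_zsum be ga s0 st) q 1 (Gam + `|K'| ^+ q.*2) q1) => //.
- exact: addr_ge0.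
- apply: (@le_trans _ _ (0 * 0 + (Gam + `|K'| ^+ q.*2))%:E); last by rewrite mul0r add0r expr1n mul1r.
 apply: (@int_aff_le _ _ _ P (cst 0)) => //.
 + by apply: mfunX; apply: mfunM.
 + exact: addr_ge0.
 + move=> w; rewrite mul0r add0r -[in leLHS](ger0_norm (ev _)) normrX. apply: ler_wpDl => //; apply: lerXn2r; rewrite ?nnegrE//; rewrite indicE.
  case: (boolP (w \in A)) => [/set_mem wA|_]; last by rewrite mul0r normr0. by rewrite mul1r; apply: le_trans (ZK _ wA) _; exact: ler_norm.
 + by rewrite integral0.
- by move=> u /andP[u0 _]; apply: le_trans (hG u u0) _; rewrite lee_fin lerDl.
Qed.
End trunc.

Let mDO u : 0 <= u -> mfunT (D u). Proof. by move=> u0; exact: (mF_meas hF u0 (aD u0)). Qed.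
Let mYO u : 0 <= u -> mfunT (Y u). Proof. by move=> u0; exact: (mF_meas hF u0 (aY u0)). Qed.
Let mO0 (U : Omega -> R) : mF 0 U -> mfunT U. Proof. by move=> mU; exact: (mF_meas hF (lexx 0) mU). Qed.

Lemma sqmom_fin A x u : 0 <= x -> (forall u, 0 <= u -> (\int[P]_w ((\1_A w * Y u w) ^+ 2)%:E <= x%:E)%E) ->
 (\int[P]_w ((\1_A w * Y (Num.max 0 u) w) ^+ 2)%:E)%E \is a fin_num.
Proof.
move=> x0 h; rewrite ge0_fin_numE; last by apply: integral_ge0 => w _; exact: lee_sqr0.
by apply: le_lt_trans (h _ _) (ltry _); rewrite le_max lexx.
Qed.

Lemma sqmom_le A x u : 0 <= x -> (forall u, 0 <= u -> (\int[P]_w ((\1_A w * Y u w) ^+ 2)%:E <= x%:E)%E) ->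
 0 <= sqmom P Y A u <= x.
Proof.
move=> x0 h; rewrite /sqmom fine_ge0/=; last by apply: integral_ge0 => w _; exact: lee_sqr0.
by rewrite -lee_fin fineK ?(sqmom_fin _ x0)//; apply: h; rewrite le_max lexx.
Qed.

Lemma vpsi2_L1 be ga s t : L1 (fun u => vpsi be ga s t u ^+ 2).
Proof.
apply: (@L1_le _ _ (fun u => venv be ga s t u ^+ 2)); last 1 first.
- move=> u; rewrite normrX; apply: lerXn2r; rewrite ?nnegrE//.
  by rewrite mulr_ge0// addr_ge0// mulr_ge0. rewrite normrM; apply: ler_pM => //; apply: le_trans (ler_normD _ _) _. by rewrite !normrM !(ger0_norm (f0 _)).
- by apply: mfunX; exact: vpsi_measurable.
- exact: venv_L1.
Qed.

Lemma vquad_L1 A x be ga s t : mF 0 (\1_A : Omega -> R) -> 0 <= x ->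
 (forall u, 0 <= u -> (\int[P]_w ((\1_A w * Y u w) ^+ 2)%:E <= x%:E)%E) ->
 L1 (fun u => vpsi be ga s t u ^+ 2 * sqmom P Y A u).
Proof.
move=> mA x0 h; apply: L1_bddM; first exact: vpsi2_L1.
split; first exact: (sqmom_measurable hF cY aY mA).
by exists x => u; have /andP[h1 h2] := sqmom_le u x0 h; rewrite ger0_norm.
Qed.

Lemma vquad_le A x be ga s t : mF 0 (\1_A : Omega -> R) -> 0 <= x ->
 (forall u, 0 <= u -> (\int[P]_w ((\1_A w * Y u w) ^+ 2)%:E <= x%:E)%E) ->
 \int[mu]_(u in `[0, t]) (vpsi be ga s t u ^+ 2 * sqmom P Y A u) <= (\int[mu]_(u in `[0, t]) (vpsi be ga s t u ^+ 2)) * x.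
Proof.
move=> mA x0 h.
have sub (g : R -> R) : L1 g -> mu.-integrable `[0, t] (EFin \o g).
 by move=> ig; apply: (integrableS measurableT _ _ ig).
rewrite -RintegralZr//; last by apply: sub; exact: vpsi2_L1.
apply: le_Rintegral => //; first by apply: sub; exact: (vquad_L1 _ _ _ _ mA x0 h).
 apply: (sub (fun u => vpsi be ga s t u ^+ 2 * x)). by rewrite (_ : (fun u => _) = (fun u => x * vpsi be ga s t u ^+ 2)); [apply: L1Z; exact: vpsi2_L1|apply/funext => u; rewrite mulrC].
by move=> u _; apply: ler_wpM2l; [exact: sqr_ge0|have /andP[] := sqmom_le u x0 h].
Qed.

Let mtrunc B (h : Omega -> R) n : mF 0 (\1_B : Omega -> R) -> mF 0 h -> mF 0 (\1_(trunc B h n) : Omega -> R).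
Proof.
move=> mB mh.
rewrite (_ : \1_(trunc B h n) = fun w => \1_B w * (h w <= n%:R)%R%:R).
 apply: mfunM => //. have mp : mfunT (fun x : R => ((x <= n%:R)%R%:R : R)). exact: measurable_le01. exact: (mcompT mp mh).
apply/funext => w; rewrite !indicE /trunc in_setI -natrM mulnb; congr (_ && _)%:R.
by apply/idP/idP => [/set_mem|h1]; [|apply/mem_set].
Qed.

(** A bound linear in the second moment of the start on [B] and in the mass of [B], hence small on
    tail events. On the truncations of [B], [trunc_moment] supplies the finite bound that starts the
    iteration. *)
Lemma y_bound B zB pB : mF 0 (\1_B : Omega -> R) -> 0 <= zB -> 0 <= pB ->
 (\int[P]_w (\1_B w)%:E <= pB%:E)%E ->
 (forall t, 0 <= t -> (\int[P]_w ((\1_B w * vstart t w) ^+ 2)%:E <= zB%:E)%E) ->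
 forall u, 0 <= u -> (\int[P]_w ((\1_B w * Y u w) ^+ 2)%:E <= (4 * (k * zB + C * pB))%:E)%E.
Proof.
move=> mB z0 p0 hp hz.
pose h w := `|X0 w|; have mh : mF 0 h by exact: mcompT.
have mBO := mO0 mB.
have S0 : 0 <= k * zB + C * pB by rewrite addr_ge0// mulr_ge0// ltW.
have sub n w : trunc B h n w -> B w by case.
have le1 n w : \1_(trunc B h n) w <= \1_B w :> R.
 by rewrite !indicE ler_nat leq_b1 || rewrite !indicE; case: (boolP (w \in trunc B h n)) => [/set_mem/sub/mem_set ->|].
have kcc : k * cc <= 9 / 16.
 apply: le_trans hcq; rewrite mulrCA ler_peMl ?mulr_ge0 ?(ltW k0)//. by rewrite ler1n -subn1 subn_gt0 -addnn; move: q1; case: (q) => [|[|n]] //= _; rewrite addSn addnS.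
have claim (e : R) n : 0 < e -> forall u, 0 <= u -> (\int[P]_w ((\1_(trunc B h n) w * Y u w) ^+ 2)%:E <= (4 * (k * zB + C * pB) + e)%:E)%E.
 move=> e0; set A := trunc B h n. have mA : mF 0 (\1_A : Omega -> R) by exact: mtrunc. have AK w : A w -> `|X0 w| <= n%:R by case. have [Gam G0 hG] := trunc_moment mA AK.
 (* [9 / 16] comes from [k cc], and [k zB + C pB] is at most a quarter of the target, whence
    [13 / 16]. The slack [e] makes the target positive. *)
 apply: (@sup_contract R R (fun u => 0 <= u) (fun u => (\int[P]_w ((\1_A w * Y u w) ^+ 2)%:E)%E) (13/16) _ (1 * Gam + 1)) => //.
 - by apply/andP; split; lra.
 - by rewrite ltr_wpDl// mulr_ge0.
 - move=> u u0; apply: int_aff_le (hG u u0) => //.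
  + by apply: mfunX; apply: mfunM; [exact: mO0|exact: mYO].
  + by apply: mfunX; apply: mfunM; [exact: mO0|exact: mYO].
  + by move=> w; exact: sqr_ge0.
  + by move=> w; rewrite mul1r addrC pow_sqr_le1// ltnW. move=> x gx hx t t0. have x0 : 0 <= x by apply: le_trans gx; rewrite addr_ge0 ?(ltW e0)// mulr_ge0.
 have hD : (\int[P]_w ((\1_A w * D t w) ^+ 2)%:E <= (zB + cc * x)%:E)%E. rewrite (eq_integral (fun w => ((\1_A w * (vstart t w + (1 * J t w + 0 * J t w))) ^+ 2)%:E)); last first.
   by move=> w _; rewrite vstartJ mul1r mul0r addr0. have bs w : A w -> `|vstart t w| <= `|n%:R : R| * Ph + `|m|. by move=> Aw; have := vstart_bnd AK w t0; rewrite indicE mem_set// mul1r.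
  rewrite (trunc_isom mA AK 1 0 (vstart_mF t) bs t0 (lexx t)) EFinD. apply: leeD. apply: int_le (hz t t0).
   + by apply: mfunX; apply: mfunM => //; exact: mO0 (vstart_mF t).
   + by apply: mfunX; apply: mfunM; [exact: mO0|exact: mO0 (vstart_mF t)].
   + by move=> w; exact: sqr_ge0.
   + move=> w; rewrite !exprMn; apply: ler_wpM2r; first exact: sqr_ge0. by apply: lerXn2r; rewrite ?nnegrE; [have /andP[] := indic_sqr_le1 R A w|have /andP[] := indic_sqr_le1 R B w|exact: le1].
  rewrite lee_fin; apply: le_trans (vquad_le _ _ _ _ mA x0 hx) _; rewrite mulr1 mulr0. by apply: ler_wpM2r => //; exact: hcc. have hA : (\int[P]_w (\1_A w)%:E <= pB%:E)%E.
  have mAO := mO0 mA; apply: (@int_le _ _ _ P (\1_B) (\1_A)) => // w; exact: le1. apply: (@le_trans _ _ (k * (zB + cc * x) + C * pB)%:E). apply: (int_lin_le _ _ _ _ _ _ _ _ _ hD hA) => //.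
  - by apply: mfunX; apply: mfunM; [exact: mO0|exact: mDO].
  - exact: mO0.
  - by apply: mfunX; apply: mfunM; [exact: mO0|exact: mYO].
  - by move=> w; exact: sqr_ge0.
  - by move=> w; exact: sqr_ge0.
  - exact: ltW.
  - move=> w; rewrite !exprMn indicE; case: (w \in A); last by rewrite expr0n/= !mul0r !mulr0 addr0. by rewrite expr1n !mul1r mulr1; exact: YD.
 rewrite lee_fin; have := ler_wpM2r x0 kcc; move: gx; rewrite mulrDr; have := e0; lra.
move=> u u0; apply/lee_addgt0Pr => e e0.
apply: (@fatou_le _ _ _ P (fun n w => (\1_(trunc B h n) w * Y u w) ^+ 2) _ (fun=> 4 * (k * zB + C * pB) + e)) => //.
- by move=> n; apply: mfunX; apply: mfunM; [exact: mO0 (mtrunc n mB mh)|exact: mYO].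
- by move=> n w; exact: sqr_ge0.
- by apply: mfunX; apply: mfunM => //; exact: mYO.
- by move=> w; exact: sqr_ge0.
- apply: aeW => w.
 have H : (\1_B w * Y u w) ^+ 2 @[n --> \oo] --> (\1_B w * Y u w) ^+ 2 by exact: cvg_cst. apply: cvg_trans H; apply: near_eq_cvg; near=> n.
 congr ((_ * _) ^+ 2); rewrite !indicE; congr (_%:R); congr nat_of_bool. apply/idP/idP => /set_mem hw; apply/mem_set; last by case: hw. split=> //=; near: n; exact: nbhs_infty_ger.
- by move=> n; apply: claim.
- exact: cvg_cst.
Unshelve. all: end_near. Qed.

(** The truncation of [X0] and [Z'] is removed by monotone convergence in the expectations and
    dominated convergence in the time integral. *)
Lemma isom_full B (Z' : Omega -> R) (x be ga s t : R) : mF 0 (\1_B : Omega -> R) -> mF 0 Z' -> 0 <= x ->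
 (forall u, 0 <= u -> (\int[P]_w ((\1_B w * Y u w) ^+ 2)%:E <= x%:E)%E) -> 0 <= s -> s <= t ->
 (\int[P]_w ((\1_B w * (Z' w + (be * J t w + ga * J s w))) ^+ 2)%:E =
  \int[P]_w ((\1_B w * Z' w) ^+ 2)%:E + (\int[mu]_(u in `[0, t]) (vpsi (b * be) (b * ga) s t u ^+ 2 * sqmom P Y B u))%R%:E)%E.
Proof.
move=> mB mZ x0 hx s0 st; have t0 : 0 <= t by exact: le_trans st.
pose h w := `|X0 w| + `|Z' w|.
have mh : mF 0 h by apply: mfunD; exact: mcompT.
have mBO := mO0 mB; have mZO := mO0 mZ.
have mU : mfunT (fun w => Z' w + (be * J t w + ga * J s w)).
 by apply: mfunD => //; apply: mfunD; apply: mfunM => //; exact: vnoise_measurable.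
have mTO n := mO0 (mtrunc n mB mh).
have c1 := @cvg_trunc _ _ _ P _ _ _ mBO mTO mU; have c2 := @cvg_trunc _ _ _ P _ _ _ mBO mTO mZO.
have hxn n u : 0 <= u -> (\int[P]_w ((\1_(trunc B h n) w * Y u w) ^+ 2)%:E <= x%:E)%E.
 move=> u0; apply: int_le (hx u u0).
 - by apply: mfunX; apply: mfunM => //; exact: mYO.
 - by apply: mfunX; apply: mfunM => //; exact: mYO.
 - by move=> w; exact: sqr_ge0.
 - move=> w; rewrite !exprMn; apply: ler_wpM2r; first exact: sqr_ge0. rewrite !indicE; case: (boolP (w \in trunc B h n)) => [/set_mem[/mem_set ->]//|_]. by rewrite expr0n sqr_ge0.
pose psi u := vpsi (b * be) (b * ga) s t u.
have c3 : \int[mu]_(u in `[0, t]) (psi u ^+ 2 * sqmom P Y (trunc B h n) u) @[n --> \oo] --> \int[mu]_(u in `[0, t]) (psi u ^+ 2 * sqmom P Y B u).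
 apply: fine_cvg; rewrite fineK; last first. apply: integrable_fin_num => //; apply: (integrableS measurableT) => //. exact: (vquad_L1 _ _ _ _ mB x0 hx).
 apply: (@dominated_cvg _ _ _ mu `[0, t]%classic _ (fun n u => (psi u ^+ 2 * sqmom P Y (trunc B h n) u)%:E) _ (fun u => (psi u ^+ 2 * x)%:E)) => //.
 - move=> n; apply: mfunTS; apply/mEFinP; apply: mfunM. by apply: mfunX; exact: vpsi_measurable. exact: (sqmom_measurable hF cY aY (mtrunc n mB mh)).
 - move=> u _; apply: cvg_EFin; first exact: nearW. apply: cvgM; first exact: cvg_cst. apply: fine_cvg; rewrite fineK ?(sqmom_fin _ x0)//. by apply: cvg_trunc => //; apply: mYO; rewrite le_max lexx.
 - apply: (integrableS measurableT) => //. apply: (_ : L1 (fun u => psi u ^+ 2 * x)).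
  by rewrite (_ : (fun u => _) = (fun u => x * psi u ^+ 2)); [apply: L1Z; exact: vpsi2_L1|apply/funext => u; rewrite mulrC].
 - move=> n u _; rewrite lee_fin; have /andP[h1 h2] := sqmom_le u x0 (hxn n). by rewrite ger0_norm ?(mulr_ge0 (sqr_ge0 _) h1)//; apply: ler_wpM2l => //; exact: sqr_ge0.
have Bx n w : trunc B h n w -> `|X0 w| <= n%:R by case=> _; apply: le_trans; rewrite lerDl.
have Bz n w : trunc B h n w -> `|Z' w| <= n%:R by case=> _; apply: le_trans; rewrite lerDr.
have E n := trunc_isom (mtrunc n mB mh) (@Bx n) be ga mZ (@Bz n) s0 st.
rewrite -(cvg_lim _ c1)//; apply/cvg_lim => //.
under eq_fun do rewrite E.
apply: cvgeD => //; first by rewrite fin_num_adde_defl.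
by apply: cvg_EFin => //; exact: nearW.
Qed.
End volterra_process.

(** * Moments of the solutions *)

Lemma polar_solve (R : realFieldType) (A B D x y : R) : 1 ^+ 2 * A + 2 * 1 * 1 * B + 1 ^+ 2 * D = x ->
 1 ^+ 2 * A + 2 * 1 * -1 * B + (-1) ^+ 2 * D = y -> B = 4^-1 * (x - y).
Proof. by move=> <- <-; field. Qed.

Section square_integrable.
Context d (Omega : measurableType d) (R : realType) (P : probability Omega R).
Definition L2 (U : Omega -> R) := mfunT U /\ P.-integrable setT (EFin \o (fun w => U w ^+ 2)).

Lemma L2_le (U : Omega -> R) (x : R) : mfunT U -> (\int[P]_w (U w ^+ 2)%:E <= x%:E)%E -> L2 U.
Proof.
move=> mU h; split=> //; apply/integrableP; split; first by apply/mEFinP; exact: mfunX.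
rewrite (eq_integral (fun w => (U w ^+ 2)%:E)); first exact: le_lt_trans h (ltry _).
by move=> w _ /=; rewrite ger0_norm// sqr_ge0.
Qed.

Lemma L2_Rint (U : Omega -> R) : L2 U -> (\int[P]_w (U w ^+ 2)%:E = (\int[P]_w (U w ^+ 2))%:E)%E.
Proof. by move=> [mU iU]; rewrite /Rintegral fineK//; exact: integrable_fin_num iU. Qed.

Lemma L2M (U V : Omega -> R) : L2 U -> L2 V -> P.-integrable setT (EFin \o (fun w => U w * V w)).
Proof.
move=> [mU iU] [mV iV]; have := integrableD measurableT iU iV; apply: le_integrable => //.
 by apply/mEFinP; exact: mfunM.
move=> w _ /=; rewrite lee_fin normrM [leRHS]ger0_norm ?addr_ge0 ?sqr_ge0//.
have := sqr_ge0 (`|U w| - `|V w|); rewrite sqrrB !real_normK ?num_real//.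
have := sqr_ge0 (U w); have := sqr_ge0 (V w); move: (`|U w| * `|V w|) => z; lra.
Qed.

Lemma L2_lin (a b : R) (U V : Omega -> R) : L2 U -> L2 V -> L2 (fun w => a * U w + b * V w).
Proof.
move=> hU hV; have [mU iU] := hU; have [mV iV] := hV; split; first by apply: mfunD; exact: mfunM.
have iUV := L2M hU hV.
have Z x (U' : Omega -> R) : P.-integrable setT (EFin \o U') -> P.-integrable setT (EFin \o (fun w => x * U' w)).
 by move=> iU'; exact: (@integrableZl _ _ _ P _ measurableT x (EFin \o U') iU').
have := integrableD measurableT (integrableD measurableT (Z (a ^+ 2) _ iU) (Z (2 * a * b) _ iUV)) (Z (b ^+ 2) _ iV).
by apply: eq_integrable => // w _ /=; rewrite -!EFinD; congr EFin; ring.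
Qed.

Lemma L2_cst (c : R) : L2 (cst c).
Proof. by apply: (@L2_le _ (c ^+ 2)) => //=; rewrite int_cst_le. Qed.

Lemma L2_int (U : Omega -> R) : L2 U -> P.-integrable setT (EFin \o U).
Proof.
by move=> hU; have := L2M hU (L2_cst 1); apply: eq_integrable => // w _ /=; rewrite mulr1.
Qed.

Lemma L2_sqrD (a b : R) (U V : Omega -> R) : L2 U -> L2 V ->
 \int[P]_w ((a * U w + b * V w) ^+ 2) = a ^+ 2 * \int[P]_w (U w ^+ 2) + 2 * a * b * \int[P]_w (U w * V w) + b ^+ 2 * \int[P]_w (V w ^+ 2).
Proof.
move=> hU hV; have [mU iU] := hU; have [mV iV] := hV; have iUV := L2M hU hV.
have Z x (U' : Omega -> R) : P.-integrable setT (EFin \o U') -> P.-integrable setT (EFin \o (fun w => x * U' w)).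
 by move=> iU'; exact: (@integrableZl _ _ _ P _ measurableT x (EFin \o U') iU').
rewrite -!RintegralZl// -!RintegralD//; first last.
- exact: (Z _ (fun w => U w * V w)).
- exact: (Z _ (fun w => U w ^+ 2)).
- exact: (Z _ (fun w => V w ^+ 2)).
- exact: (integrableD measurableT (Z _ (fun w => U w ^+ 2) iU) (Z _ (fun w => U w * V w) iUV)).
by apply: eq_Rintegral => w _; ring.
Qed.

Lemma L2_ip_lin (a b : R) (U V T : Omega -> R) : L2 U -> L2 V -> L2 T ->
 \int[P]_w ((a * U w + b * V w) * T w) = a * \int[P]_w (U w * T w) + b * \int[P]_w (V w * T w).
Proof.
move=> hU hV hT; have iU := L2M hU hT; have iV := L2M hV hT.
rewrite -!RintegralZl// -RintegralD//; first last.
- exact: (@integrableZl _ _ _ P _ measurableT b (EFin \o (fun w => V w * T w)) iV).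
- exact: (@integrableZl _ _ _ P _ measurableT a (EFin \o (fun w => U w * T w)) iU).
by apply: eq_Rintegral => w _; ring.
Qed.

Lemma L2_ipC (U V : Omega -> R) : \int[P]_w (U w * V w) = \int[P]_w (V w * U w).
Proof. by apply: eq_Rintegral => w _; exact: mulrC. Qed.
End square_integrable.

(** * The diffusion coefficient *)

Section diffusion.
Variables (R : realType) (k0 k1 k2 : R).
Hypotheses (hk0 : 0 <= k0) (hk2 : 0 < k2) (hk1 : k1 ^+ 2 <= 4 * k2 * k0).
Notation sg := (diffusion_coef k0 k1 k2).
Lemma diffusion_sqr x : sg x ^+ 2 = k0 + k1 * x + k2 * x ^+ 2.
Proof.
rewrite sqr_sqrtr//.
have : 0 <= 4 * k2 * (k0 + k1 * x + k2 * x ^+ 2).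
 have -> : 4 * k2 * (k0 + k1 * x + k2 * x ^+ 2) = (2 * k2 * x + k1) ^+ 2 + (4 * k2 * k0 - k1 ^+ 2) by ring. by rewrite addr_ge0 ?sqr_ge0// subr_ge0.
by rewrite pmulr_rge0// mulr_gt0.
Qed.

Definition diffusion_cst : R := k0 + k1 ^+ 2 / (2 * k2).

Lemma diffusion_cst_ge0 : 0 <= diffusion_cst.
Proof. by rewrite addr_ge0// divr_ge0 ?sqr_ge0// mulr_ge0// ltW. Qed.

(** Young's inequality on [k1 x]. The factor [3 / 2] is affordable: with [mom_order_le],
    [3 / 2 * 3 / 8 = 9 / 16 < 1]. *)
Lemma diffusion_le x : sg x ^+ 2 <= 3 / 2 * k2 * x ^+ 2 + diffusion_cst.
Proof.
rewrite diffusion_sqr /diffusion_cst -subr_ge0.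
have -> : 3 / 2 * k2 * x ^+ 2 + (k0 + k1 ^+ 2 / (2 * k2)) - (k0 + k1 * x + k2 * x ^+ 2) = (k2 * x - k1) ^+ 2 / (2 * k2).
 by field; rewrite gt_eqF.
by rewrite divr_ge0 ?sqr_ge0// mulr_ge0// ltW.
Qed.

Lemma diffusion_bnd N : exists L : R, forall x, `|x| <= N -> `|sg x| <= L.
Proof.
exists (1 + (3 / 2 * k2 * `|N| ^+ 2 + diffusion_cst)) => x h.
have h1 : `|sg x| <= 1 + sg x ^+ 2.
 by have := sqr_ge0 (`|sg x| - 1); rewrite sqrrB real_normK ?num_real//; have := normr_ge0 (sg x); lra.
apply: le_trans h1 _; rewrite lerD2l; apply: le_trans (diffusion_le _) _; rewrite lerD2r.
apply: ler_wpM2l; first by rewrite !mulr_ge0// ltW.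
rewrite -[leLHS]real_normK ?num_real//; apply: lerXn2r; rewrite ?nnegrE//.
by apply: le_trans h _; exact: ler_norm.
Qed.

(** [B] is the polar form of the nonnegative quadratic form behind [sg ^ 2], and [B <= sg x * sg y]
    its Cauchy-Schwarz inequality, the squares differing by [(4 k2 k0 - k1 ^ 2) / 4 * (x - y) ^ 2].
    The constant [k2] lets [c k2] be the contraction factor of the coupling. *)
Lemma diffusion_lip x y : (sg x - sg y) ^+ 2 <= k2 * (x - y) ^+ 2.
Proof.
pose B := k0 + k1 * (x + y) / 2 + k2 * x * y.
have sp : 0 <= sg x * sg y by rewrite mulr_ge0// sqrtr_ge0.
have h : B <= sg x * sg y.
 apply: le_trans (ler_norm _) _; rewrite -(ger0_norm sp) -ler_sqr ?nnegrE// !real_normK ?num_real//. rewrite exprMn !diffusion_sqr -subr_ge0.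
 have -> : (k0 + k1 * x + k2 * x ^+ 2) * (k0 + k1 * y + k2 * y ^+ 2) - B ^+ 2 = (4 * k2 * k0 - k1 ^+ 2) / 4 * (x - y) ^+ 2. by rewrite /B; field. by rewrite mulr_ge0 ?sqr_ge0// divr_ge0// subr_ge0.
rewrite sqrrB !diffusion_sqr; move: h; rewrite /B; lra.
Qed.

Lemma diff_continuous : continuous sg.
Proof.
move=> x; apply: continuous_comp; last exact: sqrt_continuous.
apply: (@cvgD _ _ _ _ _ (fun z => k0 + k1 * z) (fun z => k2 * z ^+ 2)).
 by apply: cvgD; [exact: cvg_cst|apply: cvgM; [exact: cvg_cst|exact: cvg_id]].
by apply: cvgM; [exact: cvg_cst|exact: exprn_continuous].
Qed.
End diffusion.

Lemma within_continuousB (R : realType) (A : set R) (g h : R -> R) :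
 {within A, continuous g} -> {within A, continuous h} -> {within A, continuous (fun u => g u - h u)}.
Proof. by move=> cg ch x; apply: cvgB; [exact: cg|exact: ch]. Qed.

Lemma within_continuous_normD (R : realType) (A : set R) (g h : R -> R) :
 {within A, continuous g} -> {within A, continuous h} -> {within A, continuous (fun u => `|g u| + `|h u|)}.
Proof. by move=> cg ch x; apply: cvgD; apply: cvg_norm; [exact: cg|exact: ch]. Qed.

Lemma Rintegral_reflect (R : realType) (g : R -> R) (s : R) : mfunT g ->
 \int[lebesgue_measure]_x g (s - x) = \int[lebesgue_measure]_x g x.
Proof.
move=> mg; rewrite /Rintegral; congr fine.
by rewrite (@integral_reflect _ s (fun x => (g x)%:E))//; apply/mEFinP.
Qed.

Lemma Rint_sub_le (R : realType) (h : R -> R) (A : set R) : L1 h -> measurable (A : set (measurableTypeR R)) -> (forall x, 0 <= h x) ->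
 \int[lebesgue_measure]_(x in A) h x <= \int[lebesgue_measure]_x h x.
Proof.
move=> ih mA h0; apply: fine_le.
- exact: (integrable_fin_num mA (integrableS measurableT mA (@subsetT _ _) ih)).
- exact: integrable_fin_num ih.
apply: ge0_subset_integral => //; first by have [] := integrableP _ _ _ ih.
by move=> x _; rewrite lee_fin.
Qed.

Lemma ler_powR_le1 (R : realType) (h p r : R) : 0 < h <= 1 -> r <= p -> h `^ p <= h `^ r.
Proof.
move=> /andP[h0 h1] rp; rewrite /powR gt_eqF// ler_expR; apply: ler_wnM2r => //.
by rewrite -ln1 ler_ln ?posrE.
Qed.

Lemma RintZl_L1 (R : realType) (r : R) (g : R -> R) : L1 g -> \int[leb R]_x (r * g x) = r * \int[leb R]_x g x.
Proof. by move=> ig; rewrite RintegralZl. Qed.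

(** * Solutions of (E): constants and reduction to Volterra processes *)

Section solution.
Context d (Omega : measurableType d) (R : realType) (P : probability Omega R).
Variables (F : R -> set (set Omega)) (W : R -> Omega -> R).
Hypotheses (hF : usual_conditions P F) (hW : is_brownian P F W).
Local Notation mF := (mF F).
Notation mu := (leb R).
Variables (alpha rho lambda : R) (Rl : R -> R).
Hypotheses (alpha1 : 2^-1 < alpha) (alpha2 : alpha < 1) (rho0 : 0 < rho) (lambda0 : 0 < lambda) (hRl : is_resolvent (gamma_kernel alpha rho) lambda Rl).
Variables (m0 c Mv : R) (drift vs : R -> R).
Hypothesis cdrift : {within `[0, +oo[, continuous drift}.
Hypotheses (cvs : {within `[0, +oo[, continuous vs}) (Mvs : forall t, 0 <= t -> `|vs t| <= Mv) (hM : scaling_equation lambda m0 c (resolvent_density Rl) drift vs).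
Variables (k0 k1 k2 : R).
Hypotheses (hk0 : 0 <= k0) (hk2 : 0 < k2) (hk1 : k1 ^+ 2 <= 4 * k2 * k0).
Hypotheses (c0 : 0 < c) (hc : c < (2 * alpha - 1) / (8 * k2)).
Local Notation sg := (diffusion_coef k0 k1 k2).
Local Notation f := (resf Rl).
Local Notation Cs := (diffusion_cst k0 k1 k2).

Definition vext (u : R) : R := vs (Num.max 0 u).
Local Notation v := vext.
Local Notation b := (lambda^-1).
Definition phi (t : R) : R := 1 - volterra_conv (resolvent_density Rl) drift t / (lambda * m0).
(** The least integer [q] with [q (2 alpha - 1) > 1]: the moments of order [2 q] of increments are
    of order [h ^ (q (2 alpha - 1))], and Kolmogorov's criterion asks for an exponent above 1. *)
Definition mom_order : nat := (Num.truncn (2 * alpha - 1)^-1).+1.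
Local Notation q := mom_order.

Let a21 : 0 < 2 * alpha - 1. Proof. by move: alpha1; lra. Qed.

Lemma mom_order_gt1 : (1 < q)%N.
Proof.
rewrite ltnS truncn_gt_nat -[X in X <= _]invr1 lef_pV2 ?posrE//; move: alpha2; lra.
Qed.

Lemma mom_order_gt : 1 < q%:R * (2 * alpha - 1).
Proof.
rewrite -ltr_pdivrMr// mul1r.
by have /andP[_] : (q.-1)%:R <= (2 * alpha - 1)^-1 < q%:R by apply: truncn_itv; rewrite invr_ge0 ltW.
Qed.

(** [q - 1 <= 1 / (2 alpha - 1)] and [c k2 < (2 alpha - 1) / 8] give [2 (q - 1) c k2 <= 2 / 8], and
    [c k2 <= 1 / 8] remains. *)
Lemma mom_order_le : c * k2 * (q.*2.-1)%:R <= 3 / 8.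
Proof.
have /andP[h _] : (q.-1)%:R <= (2 * alpha - 1)^-1 < q%:R by apply: truncn_itv; rewrite invr_ge0 ltW.
have E : (q.*2.-1)%:R = 2 * (q.-1)%:R + 1 :> R.
 have -> : q.*2.-1 = (2 * q.-1).+1 by rewrite doubleS /= mul2n. by rewrite -natr1 natrM.
have ck : c * k2 < (2 * alpha - 1) / 8.
 by rewrite -ltr_pdivlMr// -mulrA -invfM.
have h2 : (2 * alpha - 1) * (q.-1)%:R <= 1.
 by apply: le_trans (ler_wpM2l (ltW a21) h) _; rewrite divff// gt_eqF.
have q0 : 0 <= (q.-1)%:R :> R by [].
have h3 := ler_wpM2r q0 (ltW ck).
by rewrite E; move: alpha2 ck h2 h3; lra.
Qed.

Let fm := resf_measurable alpha1 alpha2 rho0 hRl.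
Let f0 := resf_ge0 alpha1 alpha2 rho0 lambda0 hRl.
Let f2 := resf2_L1 alpha1 alpha2 rho0 lambda0 hRl.
Let f1 := resf_L1 alpha1 alpha2 rho0 lambda0 hRl.
Let fs : suppos f := @resf_supp R Rl.
Let fn := resf_nincr alpha1 alpha2 rho0 lambda0 hRl.
Let fc := @resf_continuous _ _ _ _ _ alpha1 alpha2 rho0 hRl.

Lemma vext_continuous : continuous v.
Proof. exact: max0_continuous. Qed.
Let cv := vext_continuous.

Lemma vext_bound x : `|v x| <= Mv.
Proof. by apply: Mvs; rewrite le_max lexx. Qed.
Let vM := vext_bound.

Let ppart_eq (g h : R -> R) : (forall x, 0 < x -> g x = h x) -> ppart g = ppart h.
Proof. by move=> gh; apply/funext => x; rewrite /ppart; case: ifP => // /gh. Qed.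

(** This is (M) divided by [lambda ^ 2]; the values at time 0 do not affect the integrals. It forces
    [|phi| <= 1]. *)
Lemma phi_quad t : 0 <= t -> \int[mu]_(u in `[0, t]) (vpsi f v b 0 t t u ^+ 2) = c * (1 - phi t ^+ 2).
Proof.
move=> t0.
have mv : mfunT v by exact: cmfun.
have E1 : ppart (fun s => resolvent_density Rl s ^+ 2) = (fun s => f s ^+ 2).
 by apply/funext => x; rewrite /resf /ppart; case: ifP => //; rewrite expr0n.
have E2 : ppart (fun s => vs s ^+ 2) = ppart (fun s => v s ^+ 2).
 by apply: ppart_eq => x x0; rewrite /vext max_r// ltW.
have mv2 : mfunT (ppart (fun s => v s ^+ 2)).
 apply: mfun_ifT; [by apply: measurable_fun_ltr|exact: mfunX|exact: mcst].
have mf2 : mfunT (fun s => f s ^+ 2) by exact: mfunX.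
have E3 : volterra_conv (fun s => resolvent_density Rl s ^+ 2) (fun s => vs s ^+ 2) t =
  volterra_conv (fun s => f s ^+ 2) (fun s => v s ^+ 2) t. rewrite (volterra_rconv t0) ?E1 ?E2// (volterra_rconv t0)//; last first.
  by rewrite (_ : ppart _ = (fun s => f s ^+ 2))// -E1; apply/funext => x; rewrite /resf /ppart; case: ifP => // ->.
 by congr (rconv _ _ t); rewrite -E1; apply/funext => x; rewrite /resf /ppart; case: ifP => // ->.
have l0 : lambda != 0 by rewrite gt_eqF.
have := hM t0; rewrite E3 -/(phi t) => h.
apply: (@mulfI _ (lambda ^+ 2)); first by rewrite expf_neq0.
rewrite mulrA [_ * c]mulrC h /volterra_conv -RintegralZl//; last first.
 by apply: (integrableS measurableT) => //; apply: (@vpsi2_L1 _ _ _ Mv) => //.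
by apply: eq_Rintegral => u _; rewrite /vpsi; field.
Qed.

Lemma phi_le1 t : 0 <= t -> phi t ^+ 2 <= 1.
Proof.
move=> t0; have : 0 <= c * (1 - phi t ^+ 2).
 by rewrite -phi_quad//; apply: Rintegral_ge0 => // u _; exact: sqr_ge0.
by rewrite pmulr_rge0// subr_ge0.
Qed.

Lemma phi_norm_le1 t : 0 <= t -> `|phi t| <= 1.
Proof. by move=> t0; rewrite -(@ler_pXn2r _ 2)// ?nnegrE// real_normK ?num_real// expr1n; exact: phi_le1. Qed.

Let sgc := @diff_continuous _ k0 k1 k2.

Lemma diffusion_path (X : R -> Omega -> R) : (cpath X) ->
 forall w, {within `[0, +oo[, continuous ((fun u w => sg (X u w))^~ w)}.
Proof. by move=> cX w x; apply: (@cvg_comp _ _ _ _ sg _ _ _ (cX w x)); exact: sgc. Qed.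

Lemma diffusion_mF (X : R -> Omega -> R) : (forall u, 0 <= u -> mF u (X u)) -> forall u, 0 <= u -> mF u (fun w => sg (X u w)).
Proof.
move=> aX u u0; apply: (@mcompT _ _ _ _ _ _ sg); last exact: aX.
by apply: cmfun; exact: sgc.
Qed.

Lemma solution_ito X0 X T : is_solution P F W lambda m0 (resolvent_density Rl) drift vs sg X0 X -> 0 <= T ->
 exists I : Omega -> R,
 [/\ mfunT I, {ae P, forall w, X T w = (X0 w - m0) * phi T + m0 + b * I w} &
   forall G : R -> Omega -> R, (cpath G) -> (forall u, 0 <= u -> mF u (G u)) ->
   (forall N : R, exists L : R, forall u w, `|G u w| <= N -> `|sg (X u w)| <= L) ->
   forall be ga s t, 0 <= s -> s <= t -> (T = t /\ be = 1 /\ ga = 0) \/ (T = s /\ be = 0 /\ ga = 1) ->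
   cvg0_in_prob P (fun n w => `|zsum W (fun u w => sg (X u w)) G s t (vpsi f v be ga s t) n%:R n w - I w|%:E)].
Proof.
move=> [aX cX hX] T0; have [I [hI ae]] := hX T T0.
have aX' u : 0 <= u -> mF u (X u) by move=> u0; apply/(meas_wrtP hF) => //; exact: aX.
exists I; split.
- by have [h _] := hI; apply: (mF_meas hF T0); apply/(meas_wrtP hF).
- apply: filterS ae => w ->; congr (_ + _); rewrite /phi.
 by rewrite mulrBr mulr1 mulrAC [X in _ - X + _]mulrA; ring.
move=> G cG aG YG be ga s t s0 st hT.
(* [j] is the value of the kernel at [u = T], where [resolvent_density Rl] and [resf] may differ. *)
apply: (vzsum_ito hF hW (diffusion_path cX) (diffusion_mF aX') cG aG YG fs f0 fn fc fm f2 cv vM s0 st hT hI (j := resolvent_density Rl 0 * vs T)).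
move=> u w /andP[u0 uT]; case: eqP => [->|/eqP uT']; first by rewrite subrr.
by rewrite /vext max_r// /resf /ppart subr_gt0 lt_neqAle uT' uT.
Qed.

(** * The solution with stationary mean and variance *)

Section stationary.
Variables (X0 : Omega -> R) (X : R -> Omega -> R) (v0 : R).
Hypotheses (aX0 : meas_wrt (F 0) X0) (hE : ('E_P[X0] = m0%:E)%E) (hV : ('V_P[X0] = v0%:E)%E) (hv0 : v0 = c * sg m0 ^+ 2 / (1 - c * k2)).
Hypothesis hX : is_solution P F W lambda m0 (resolvent_density Rl) drift vs sg X0 X.
Local Notation Y := (fun u w => sg (X u w)).
Definition centred (w : Omega) : R := X0 w - m0.
Local Notation U0 := centred.
Local Notation J := (vnoise X U0 phi m0).
Local Notation y := (sqmom P Y setT).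
Local Notation psi := (vpsi f v).

Let ck : c * k2 <= 1 / 8.
Proof.
have : c * (8 * k2) < 2 * alpha - 1 by rewrite -ltr_pdivlMr// mulr_gt0.
by move: alpha2; lra.
Qed.

Let aX u : 0 <= u -> mF u (X u).
Proof. by have [h _ _] := hX; move=> u0; apply/(meas_wrtP hF) => //; exact: h. Qed.
Let cX w : {within `[0, +oo[, continuous (X^~ w)}. Proof. by have [_ h _] := hX. Qed.
Let mX u : 0 <= u -> mfunT (X u).
Proof. by move=> u0; exact: (mF_meas hF u0 (aX u0)). Qed.
Let mY u : 0 <= u -> mfunT (Y u).
Proof. by move=> u0; exact: (mF_meas hF u0 (diffusion_mF aX u0)). Qed.

Lemma centred_mF : mF 0 U0.
Proof. by apply: mfunB => //; apply/(meas_wrtP hF). Qed.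
Let mU0 : mfunT U0. Proof. exact: (mF_meas hF (lexx 0) centred_mF). Qed.

Let YX (N : R) : exists L : R, forall u w, `|X u w| <= N -> `|Y u w| <= L.
Proof. by have [L hL] := diffusion_bnd hk2 hk1 N; exists L => u w; exact: hL. Qed.

Let hcc t : 0 <= t -> \int[mu]_(u in `[0, t]) (psi b 0 t t u ^+ 2) <= c.
Proof. by move=> t0; rewrite phi_quad// ger_pMr// lerBlDr lerDl sqr_ge0. Qed.

Let k32 : 0 < 3 / 2 * k2. Proof. by rewrite mulr_gt0// divr_gt0. Qed.
Let hcq : 3 / 2 * k2 * ((q.*2.-1)%:R * c) <= 9 / 16.
Proof. by have := mom_order_le; move: (q.*2.-1)%:R => n; lra. Qed.
Let YD u w : 0 <= u -> Y u w ^+ 2 <= 3 / 2 * k2 * X u w ^+ 2 + Cs.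
Proof. by move=> _; exact: diffusion_le. Qed.

Let hI T : 0 <= T -> exists I : Omega -> R,
 [/\ mfunT I, {ae P, forall w, X T w = U0 w * phi T + m0 + b * I w} &
   forall be ga s t, 0 <= s -> s <= t -> (T = t /\ be = 1 /\ ga = 0) \/ (T = s /\ be = 0 /\ ga = 1) ->
   cvg0_in_prob P (fun n w => `|zsum W Y X s t (psi be ga s t) n%:R n w - I w|%:E)].
Proof.
move=> T0; have [I [h1 h2 h3]] := solution_ito hX T0; exists I; split => //.
exact: (h3 X cX aX YX).
Qed.

Let C0 := diffusion_cst_ge0 k1 hk0 hk2.
Let yb := y_bound hF hW (diffusion_path cX) (diffusion_mF aX) cX aX aX YX fs f0 fn fc fm f2 cv vM k32 C0 YD hcc
 centred_mF phi_norm_le1 hI mom_order_gt1 hcq.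
Let iso := isom_full hF hW (diffusion_path cX) (diffusion_mF aX) cX aX aX YX fs f0 fn fc fm f2 cv vM k32 C0 YD hcc
 centred_mF phi_norm_le1 hI mom_order_gt1 hcq.

Lemma centred_sqr : (\int[P]_w (U0 w ^+ 2)%:E = v0%:E)%E.
Proof. by rewrite -hV /variance covariance.unlock hE unlock. Qed.

Lemma centred_L2 : L2 P U0.
Proof. by apply: (@L2_le _ _ _ _ _ v0) => //; rewrite centred_sqr. Qed.

Lemma centred_mean : \int[P]_w U0 w = 0.
Proof.
have hX0 : P.-integrable setT (EFin \o X0).
 have := integrableD measurableT (L2_int centred_L2) (L2_int (L2_cst P m0)). by apply: eq_integrable => // w _ /=; rewrite /centred -EFinD subrK.
have h : \int[P]_w X0 w = m0 by move: hE; rewrite unlock /Rintegral => ->.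
rewrite /centred RintegralB//; last exact: (L2_int (L2_cst P m0)).
by rewrite h /Rintegral (int_cst_le P m0) subrr.
Qed.

Lemma solution_bound B (zB pB : R) : mF 0 (\1_B : Omega -> R) -> 0 <= zB -> 0 <= pB ->
 (\int[P]_w ((\1_B w * U0 w) ^+ 2)%:E <= zB%:E)%E -> (\int[P]_w (\1_B w)%:E <= pB%:E)%E ->
 forall u, 0 <= u -> (\int[P]_w ((\1_B w * Y u w) ^+ 2)%:E <=
  (4 * (3 / 2 * k2 * (2 * zB + 2 * m0 ^+ 2 * pB) + Cs * pB))%:E)%E.
Proof.
move=> mB z0 p0 hz hp; apply: yb => //.
 by apply: addr_ge0; [exact: mulr_ge0|apply: mulr_ge0 => //; apply: mulr_ge0 => //; exact: sqr_ge0].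
have mBO : mfunT (\1_B : Omega -> R) := mF_meas hF (lexx 0) mB.
move=> t t0; apply: (int_lin_le _ _ _ _ _ _ _ _ _ hz hp) => //.
- by apply: mfunX; exact: mfunM.
- apply: mfunX; apply: mfunM => //.
 by apply: mfunD => //; exact: mfunM.
- by move=> w; exact: sqr_ge0.
- by move=> w; exact: sqr_ge0.
- by rewrite mulr_ge0// sqr_ge0.
- move=> w; rewrite /vstart indicE; case: (w \in B); last by rewrite !mul0r expr0n/= !mulr0 addr0.
 rewrite !mul1r mulr1. have h1 := ler_wpM2l (sqr_ge0 (U0 w)) (phi_le1 t0). by have := sqr_ge0 (U0 w * phi t - m0); rewrite sqrrB sqrrD exprMn; lra.
Qed.

Let mT : mF 0 (\1_(setT : set Omega) : Omega -> R).
Proof. by rewrite indicT; exact: mcst. Qed.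

Let v00 : 0 <= v0.
Proof. by rewrite -lee_fin -centred_sqr; apply: integral_ge0 => w _; exact: lee_sqr0. Qed.

Let xT := 4 * (3 / 2 * k2 * (2 * v0 + 2 * m0 ^+ 2 * 1) + Cs * 1).
Let xT0 : 0 <= xT.
Proof.
rewrite /xT !mulr1; apply: mulr_ge0 => //; apply: addr_ge0 => //; apply: mulr_ge0; first exact: ltW.
by apply: addr_ge0; [exact: mulr_ge0|apply: mulr_ge0 => //; exact: sqr_ge0].
Qed.

Let hy u : 0 <= u -> (\int[P]_w ((\1_setT w * Y u w) ^+ 2)%:E <= xT%:E)%E.
Proof.
apply: solution_bound => //.
- by under eq_integral do rewrite indicT mul1r; rewrite centred_sqr.
- by rewrite indicT int_cst_le.
Qed.

Let Y2 u : 0 <= u -> L2 P (Y u).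
Proof.
move=> u0; apply: (@L2_le _ _ _ _ _ xT); first exact: mY.
by have := hy u0; under eq_integral do rewrite indicT mul1r.
Qed.

Let yE u : 0 <= u -> y u = \int[P]_w (Y u w ^+ 2).
Proof. by move=> u0; rewrite /sqmom max_r// /Rintegral; congr fine; apply: eq_integral => w _; rewrite indicT mul1r. Qed.

Let isoT (Z : Omega -> R) (be ga s t : R) : mF 0 Z -> 0 <= s -> s <= t ->
 (\int[P]_w ((Z w + (be * J t w + ga * J s w)) ^+ 2)%:E =
  \int[P]_w (Z w ^+ 2)%:E + (\int[mu]_(u in `[0, t]) (psi (b * be) (b * ga) s t u ^+ 2 * y u))%R%:E)%E.
Proof.
move=> mZ s0 st; have := iso be ga mT mZ xT0 hy s0 st.
by under eq_integral do rewrite indicT mul1r; under [X in _ = (X + _)%E -> _]eq_integral do rewrite indicT mul1r.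
Qed.

Let mJ t : 0 <= t -> mfunT (J t).
Proof. by move=> t0; apply: (vnoise_measurable hF aX phi m0 centred_mF t0). Qed.

Let isoJ (be ga s t : R) : 0 <= s -> s <= t ->
 (\int[P]_w ((be * J t w + ga * J s w) ^+ 2)%:E = (\int[mu]_(u in `[0, t]) (psi (b * be) (b * ga) s t u ^+ 2 * y u))%R%:E)%E.
Proof.
move=> s0 st; have m0' : mF 0 (cst 0 : Omega -> R) by exact: mcst.
have := @isoT (cst 0) be ga s t m0' s0 st.
under eq_integral do rewrite add0r.
by under [X in _ = (X + _)%E -> _]eq_integral do rewrite expr0n; rewrite integral0 add0e.
Qed.

Lemma noise_L2 t : 0 <= t -> L2 P (J t).
Proof.
move=> t0; have h := @isoJ 1 0 t t t0 (lexx t).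
have {}h : (\int[P]_w (J t w ^+ 2)%:E = (\int[mu]_(u in `[0, t]) (psi (b * 1) (b * 0) t t u ^+ 2 * y u))%R%:E)%E.
 by rewrite -h; apply: eq_integral => w _; rewrite mul1r mul0r addr0.
by apply: (L2_le (mJ t0)); rewrite h.
Qed.

(** Orthogonality is read off the isometry: the second moment of [Z + J t] is the sum of the two
    second moments, so the cross term vanishes. With [Z = 1] the noise is centred. *)
Let ZJ (Z : Omega -> R) t : mF 0 Z -> L2 P Z -> 0 <= t -> \int[P]_w (Z w * J t w) = 0.
Proof.
move=> mZ Z2 t0; have J2 := noise_L2 t0.
have E1 := @isoT Z 1 0 t t mZ t0 (lexx t).
have E2 := @isoJ 1 0 t t t0 (lexx t).
have E3 : \int[P]_w ((1 * Z w + 1 * J t w) ^+ 2) = \int[P]_w (Z w ^+ 2) + \int[P]_w (J t w ^+ 2).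
 apply: EFin_inj; rewrite -(L2_Rint (L2_lin 1 1 Z2 J2)) EFinD -(L2_Rint Z2) -(L2_Rint J2). have -> : (\int[P]_w (J t w ^+ 2)%:E = (\int[mu]_(u in `[0, t]) (psi (b * 1) (b * 0) t t u ^+ 2 * y u))%R%:E)%E.
  by rewrite -E2; apply: eq_integral => w _; rewrite mul1r mul0r addr0. by rewrite -E1; apply: eq_integral => w _; rewrite !mul1r mul0r addr0.
by move: E3; rewrite (L2_sqrD 1 1 Z2 J2) !expr1n !mul1r; lra.
Qed.

Lemma noise_mean t : 0 <= t -> \int[P]_w J t w = 0.
Proof.
move=> t0; have m1 : mF 0 (cst 1 : Omega -> R) by exact: mcst.
rewrite -(ZJ m1 (L2_cst P 1) t0).
by apply: eq_Rintegral => w _; rewrite mul1r.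
Qed.

Let psiyL be ga s t : L1 (fun u => psi be ga s t u ^+ 2 * y u).
Proof. exact: (vquad_L1 hF (diffusion_path cX) (diffusion_mF aX) f0 fm f2 cv vM _ _ _ _ mT xT0 hy). Qed.

Let psiy_L1 be ga s t : mu.-integrable `[0, t] (EFin \o (fun u => psi be ga s t u ^+ 2 * y u)).
Proof. by apply: (integrableS measurableT) => //; exact: psiyL. Qed.

(** Polarisation of the isometry, with coefficients [1, 1] and [1, -1]. *)
Lemma noise_cov_y s t : 0 <= s -> s <= t ->
 \int[P]_w (J s w * J t w) = \int[mu]_(u in `[0, t]) (b ^+ 2 * (f (t - u) * f (s - u)) * v u ^+ 2 * y u).
Proof.
move=> s0 st; have t0 : 0 <= t by exact: le_trans st.
have Js := noise_L2 s0; have Jt := noise_L2 t0.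
have E (be ga : R) : be ^+ 2 * \int[P]_w (J t w ^+ 2) + 2 * be * ga * \int[P]_w (J t w * J s w) + ga ^+ 2 * \int[P]_w (J s w ^+ 2) =
  \int[mu]_(u in `[0, t]) (psi (b * be) (b * ga) s t u ^+ 2 * y u). rewrite -(L2_sqrD be ga Jt Js); apply: EFin_inj; rewrite -(isoJ be ga s0 st). by rewrite (L2_Rint (L2_lin be ga Jt Js)).
have E11 := E 1 1; have E10 := E 1 (-1).
have -> : \int[P]_w (J s w * J t w) = \int[P]_w (J t w * J s w) by apply: eq_Rintegral => w _; exact: mulrC.
rewrite (polar_solve E11 E10).
rewrite -RintegralB//.
rewrite -RintegralZl//; last first.
 apply: (integrableS measurableT) => //. exact: (L1B (psiyL (b * 1) (b * 1) s t) (psiyL (b * 1) (b * -1) s t)).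
by apply: eq_Rintegral => u _; rewrite /vpsi; field; rewrite gt_eqF.
Qed.

Let vs2 t : L2 P (vstart U0 phi m0 t).
Proof.
have := L2_lin (phi t) 1 centred_L2 (L2_cst P m0).
by rewrite /vstart; under [X in L2 P X -> _]eq_fun do rewrite mul1r mulrC.
Qed.

Let Xsplit t w : X t w = vstart U0 phi m0 t w + J t w.
Proof. exact: vstartJ. Qed.

Lemma solution_L2 t : 0 <= t -> L2 P (X t).
Proof.
move=> t0; have := L2_lin 1 1 (vs2 t) (noise_L2 t0).
by rewrite (_ : (fun w => _) = X t)//; apply/funext => w; rewrite !mul1r -Xsplit.
Qed.

Lemma solution_mean t : 0 <= t -> \int[P]_w X t w = m0.
Proof.
move=> t0; under eq_Rintegral do rewrite Xsplit.
rewrite RintegralD//; [|exact: L2_int (vs2 t)|exact: L2_int (noise_L2 t0)].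
rewrite noise_mean// addr0 /vstart RintegralD//; last 2 first.
- exact: (L2_int (L2_lin (phi t) 0 centred_L2 (L2_cst P 0))) || (have := L2_int (L2_lin (phi t) 0 centred_L2 (L2_cst P 0)); by apply: eq_integrable => // w _ /=; rewrite mul0r addr0 mulrC).
- exact: L2_int (L2_cst P m0).
rewrite RintegralZr//; last exact: L2_int centred_L2.
by rewrite centred_mean mul0r add0r /Rintegral (int_cst_le P m0).
Qed.

Let vs_sqr t : \int[P]_w (vstart U0 phi m0 t w ^+ 2) = v0 * phi t ^+ 2 + m0 ^+ 2.
Proof.
have E := L2_sqrD (phi t) 1 centred_L2 (L2_cst P m0).
have -> : \int[P]_w (vstart U0 phi m0 t w ^+ 2) = \int[P]_w ((phi t * U0 w + 1 * cst m0 w) ^+ 2).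
 by apply: eq_Rintegral => w _; rewrite /vstart mul1r [phi t * _]mulrC.
rewrite E RintegralZr ?centred_mean; [|exact: measurableT|exact: L2_int centred_L2].
have -> : \int[P]_w (U0 w ^+ 2) = v0 by rewrite /Rintegral centred_sqr.
have -> : \int[P]_w (cst m0 w ^+ 2) = m0 ^+ 2 by rewrite /Rintegral /= (int_cst_le P (m0 ^+ 2)).
by rewrite mul0r; ring.
Qed.

Let X_sqr t : 0 <= t -> \int[P]_w (X t w ^+ 2) = v0 * phi t ^+ 2 + m0 ^+ 2 + \int[mu]_(u in `[0, t]) (psi b 0 t t u ^+ 2 * y u).
Proof.
move=> t0; apply: EFin_inj; rewrite -(L2_Rint (solution_L2 t0)) EFinD -(vs_sqr t) -(L2_Rint (vs2 t)).
have := @isoT (vstart U0 phi m0 t) 1 0 t t (vstart_mF phi m0 centred_mF t) t0 (lexx t).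
rewrite mulr1 mulr0 => <-; apply: eq_integral => w _.
by rewrite Xsplit mul1r mul0r addr0.
Qed.

Let yrec t : 0 <= t -> y t = sg m0 ^+ 2 + k2 * (v0 * phi t ^+ 2 + \int[mu]_(u in `[0, t]) (psi b 0 t t u ^+ 2 * y u)).
Proof.
move=> t0; rewrite yE//; under eq_Rintegral do rewrite (diffusion_sqr hk2 hk1).
have iX := L2_int (solution_L2 t0); have [_ iX2] := solution_L2 t0.
have Zi x (U' : Omega -> R) : P.-integrable setT (EFin \o U') -> P.-integrable setT (EFin \o (fun w => x * U' w)).
 by move=> iU'; exact: (@integrableZl _ _ _ P _ measurableT x (EFin \o U') iU').
have ic : P.-integrable setT (EFin \o cst k0) by exact: L2_int (L2_cst P k0).
rewrite RintegralD//; [|exact: (integrableD measurableT ic (Zi k1 _ iX))|exact: (Zi k2 (fun w => X t w ^+ 2))].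
rewrite RintegralD//; last exact: Zi.
rewrite !RintegralZl// solution_mean// X_sqr// [X in X + _ + _](_ : _ = k0); last by rewrite /Rintegral (int_cst_le P k0).
by rewrite (diffusion_sqr hk2 hk1); ring.
Qed.

Let ck1 : 0 < 1 - c * k2. Proof. by move: ck; lra. Qed.
Let ys := sg m0 ^+ 2 / (1 - c * k2).
Let v0ys : v0 = c * ys. Proof. by rewrite hv0 /ys mulrA. Qed.
Let ysE : ys = sg m0 ^+ 2 + k2 * v0.
Proof. by rewrite v0ys /ys; field; rewrite gt_eqF. Qed.

(** By (M) the constant [ys] solves [yrec]: the start contributes [v0 phi ^ 2] and the noise
    [c ys (1 - phi ^ 2)], which add up to [v0 = c ys]. The difference [y - ys] is then contracted by
    [c k2], hence zero. *)
Lemma stationary_y u : y u = ys.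
Proof.
have -> : y u = y (Num.max 0 u) by rewrite /sqmom [Num.max 0 (Num.max 0 u)]max_r// le_max lexx.
have : 0 <= Num.max 0 u by rewrite le_max lexx.
move: (Num.max 0 u) => {}u u0; apply/eqP; rewrite -subr_eq0 -normr_le0; apply/ler_addgt0Pr => e e0; rewrite add0r -lee_fin.
move: u u0; apply: (@sup_contract R R (fun u => 0 <= u) (fun u => `|y u - ys|%:E) (c * k2) e (xT + `|ys|)) => //.
- by rewrite mulr_ge0 ?ltW//=; move: ck; lra.
- move=> u u0; rewrite lee_fin; apply: le_trans (ler_normB _ _) _; rewrite lerD2r.
 by have /andP[h1 h2] := sqmom_le u xT0 hy; rewrite ger0_norm.
move=> x ex hx t t0; have x0 : 0 <= x by exact: le_trans (ltW e0) ex.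
have i1 : mu.-integrable `[0, t] (EFin \o (fun u => psi b 0 t t u ^+ 2)).
 by apply: (integrableS measurableT) => //; apply: (@vpsi2_L1 _ _ _ Mv).
have iZ z : mu.-integrable `[0, t] (EFin \o (fun u => psi b 0 t t u ^+ 2 * z)).
 have := @integrableZl _ _ _ mu _ (mitv _) z _ i1. by apply: eq_integrable => // u _ /=; rewrite -EFinM mulrC.
have -> : y t - ys = k2 * \int[mu]_(u in `[0, t]) (psi b 0 t t u ^+ 2 * y u - psi b 0 t t u ^+ 2 * ys).
 rewrite RintegralB//. rewrite RintegralZr// phi_quad// yrec// {1}ysE; move: (\int[mu]_(u in _) _) (phi t ^+ 2) => I p; rewrite {1 2}v0ys; ring.
rewrite normrM (gtr0_norm hk2) lee_fin [c * k2]mulrC -mulrA; apply: ler_wpM2l; first exact: ltW.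
have iB : mu.-integrable `[0, t] (EFin \o (fun u => psi b 0 t t u ^+ 2 * y u - psi b 0 t t u ^+ 2 * ys)).
 apply: (integrableS measurableT) => //; apply: (L1B (psiyL b 0 t t)). rewrite (_ : (fun u => _) = (fun u => ys * psi b 0 t t u ^+ 2)); last by apply/funext => u; rewrite mulrC.
 by apply: L1Z; apply: (@vpsi2_L1 _ _ _ Mv).
apply: le_trans (le_normr_Rintegral _ iB) _ => //.
apply: (@le_trans _ _ (\int[mu]_(u in `[0, t]) (psi b 0 t t u ^+ 2 * x))).
 apply: le_Rintegral => //; first exact: integrable_norm iB. move=> u _; rewrite -mulrBr normrM ger0_norm ?sqr_ge0//; apply: ler_wpM2l; first exact: sqr_ge0.
 have -> : y u = y (Num.max 0 u) by rewrite /sqmom [Num.max 0 (Num.max 0 u)]max_r// le_max lexx. by rewrite -lee_fin; apply: hx; rewrite le_max lexx.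
by rewrite RintegralZr//; apply: ler_wpM2r => //; exact: hcc.
Qed.

Lemma stationary_sigma t : 0 <= t -> (\int[P]_w (sg (X t w) ^+ 2)%:E = (sg m0 ^+ 2 / (1 - c * k2))%:E)%E.
Proof. by move=> t0; rewrite -/ys -(stationary_y t) yE//; exact: L2_Rint (Y2 t0). Qed.

Lemma stationary_sqr t : 0 <= t -> \int[P]_w (X t w ^+ 2) = v0 + m0 ^+ 2.
Proof.
move=> t0; rewrite X_sqr//; under eq_Rintegral do rewrite stationary_y.
rewrite RintegralZr//; last by apply: (integrableS measurableT) => //; apply: (@vpsi2_L1 _ _ _ Mv).
by rewrite phi_quad// v0ys; ring.
Qed.

Lemma stationary_cov s t : 0 <= s -> s <= t ->
 \int[P]_w (X s w * X t w) = m0 ^+ 2 + v0 * phi s * phi t +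
  v0 / (c * lambda ^+ 2) * \int[mu]_(u in `[0, t]) (f (t - u) * f (s - u) * v u ^+ 2).
Proof.
move=> s0 st; have t0 : 0 <= t by exact: le_trans st.
have Js := noise_L2 s0; have Jt := noise_L2 t0.
have c1 := L2_cst P m0.
have aux2 (x z r k : R) : x * z * r * k = x * k * (z * r) by ring.
have aux (x z r m : R) : x * (z * r) + 1 * m ^+ 2 = m ^+ 2 + r * z * x by ring.
have E u w : vstart U0 phi m0 u w = phi u * U0 w + 1 * cst m0 w by rewrite /vstart mul1r [phi u * _]mulrC.
have X2 := solution_L2 t0.
have E1 : \int[P]_w (X s w * X t w) = \int[P]_w (X t w * vstart U0 phi m0 s w) + \int[P]_w (X t w * J s w).
 have := L2_ip_lin 1 1 (vs2 s) Js X2; rewrite !mul1r. rewrite (_ : \int[P]_w ((1 * vstart U0 phi m0 s w + 1 * J s w) * X t w) = \int[P]_w (X s w * X t w)).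
  by move=> ->; congr (_ + _); exact: L2_ipC. by apply: eq_Rintegral => w _; rewrite !mul1r -Xsplit.
have E2 T : L2 P T -> \int[P]_w (X t w * T w) = \int[P]_w (vstart U0 phi m0 t w * T w) + \int[P]_w (J t w * T w).
 move=> hT; have := L2_ip_lin 1 1 (vs2 t) Jt hT; rewrite !mul1r => <-. by apply: eq_Rintegral => w _; rewrite !mul1r -Xsplit.
rewrite E1 !E2//.
have z1 : \int[P]_w (J t w * vstart U0 phi m0 s w) = 0.
 by rewrite L2_ipC; exact: (ZJ (vstart_mF phi m0 centred_mF s) (vs2 s) t0).
have z2 := ZJ (vstart_mF phi m0 centred_mF t) (vs2 t) s0.
have z3 : \int[P]_w (vstart U0 phi m0 t w * vstart U0 phi m0 s w) = m0 ^+ 2 + v0 * phi s * phi t.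
 have -> : \int[P]_w (vstart U0 phi m0 t w * vstart U0 phi m0 s w) = \int[P]_w ((phi t * U0 w + 1 * cst m0 w) * vstart U0 phi m0 s w).
  by apply: eq_Rintegral => w _; rewrite E. rewrite (L2_ip_lin _ _ centred_L2 c1 (vs2 s)). have A1 : \int[P]_w (U0 w * vstart U0 phi m0 s w) = phi s * v0.
  rewrite L2_ipC; have -> : \int[P]_w (vstart U0 phi m0 s w * U0 w) = \int[P]_w ((phi s * U0 w + 1 * cst m0 w) * U0 w). by apply: eq_Rintegral => w _; rewrite E.
  rewrite (L2_ip_lin _ _ centred_L2 c1 centred_L2) [X in _ + 1 * X](_ : _ = 0) ?mulr0 ?addr0. by congr (_ * _); rewrite /Rintegral -[v0]/(fine v0%:E) -centred_sqr.
  by rewrite /= RintegralZl ?centred_mean ?mulr0//; exact: L2_int centred_L2. have A2 : \int[P]_w (cst m0 w * vstart U0 phi m0 s w) = m0 ^+ 2.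
  rewrite L2_ipC; have -> : \int[P]_w (vstart U0 phi m0 s w * cst m0 w) = \int[P]_w ((phi s * U0 w + 1 * cst m0 w) * cst m0 w). by apply: eq_Rintegral => w _; rewrite E.
  rewrite (L2_ip_lin _ _ centred_L2 c1 c1) /= RintegralZr ?centred_mean//; last exact: L2_int centred_L2.
  by rewrite /Rintegral (int_cst_le P (m0 * m0)) /= mul0r mulr0 add0r mul1r expr2. by rewrite A1 A2; exact: aux.
rewrite z1 z2 z3 add0r addr0; congr (_ + _).
rewrite L2_ipC noise_cov_y//; under eq_Rintegral do rewrite stationary_y.
rewrite -RintegralZl//; last first.
 apply: (integrableS measurableT) => //. apply: (_ : L1 (fun u => f (t - u) * f (s - u) * v u ^+ 2)). rewrite (_ : (fun u => _) = (fun u => 4^-1 * (psi 1 1 s t u ^+ 2 - psi 1 (-1) s t u ^+ 2))).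
  by apply: L1Z; apply: L1B; apply: (@vpsi2_L1 _ _ _ Mv). by apply/funext => u; rewrite /vpsi; field.
have h : v0 / (c * lambda ^+ 2) = b ^+ 2 * ys by rewrite v0ys; field; rewrite !gt_eqF.
rewrite h; apply: eq_Rintegral => u _; exact: aux2.
Qed.

(** On these events of [F 0] the start is bounded, hence has moments of order [2 q]; the complements
    are controlled in L2. *)
Definition init_set (n : nat) : set Omega := trunc setT (fun w => `|U0 w|) n.
Local Notation A := init_set.

Lemma init_set_mF n : mF 0 (\1_(A n) : Omega -> R).
Proof.
rewrite (_ : \1_(A n) = fun w => (`|U0 w| <= n%:R)%R%:R).
 have mh : mF 0 (fun w => `|U0 w|) by apply: mcompT => //; exact: centred_mF. exact: (mcompT (measurable_le01 n%:R) mh).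
apply/funext => w; rewrite indicE; congr (_%:R); congr nat_of_bool.
by apply/idP/idP => [/set_mem[]//|h]; apply/mem_set.
Qed.

Let mC n : mF 0 (\1_(~` A n) : Omega -> R).
Proof.
rewrite (_ : \1_(~` A n) = fun w => 1 - \1_(A n) w); first by apply: mfunB => //; exact: init_set_mF.
by apply/funext => w; rewrite !indicE in_setC; case: (w \in A n); rewrite ?subrr ?subr0.
Qed.

Lemma init_set_tail (U : Omega -> R) (e : R) : L2 P U -> 0 < e ->
 \forall n \near \oo, (\int[P]_w ((\1_(~` A n) w * U w) ^+ 2)%:E <= e%:E)%E.
Proof.
move=> hU e0; have [mU iU] := hU.
have mAn n := mF_meas hF (lexx 0) (init_set_mF n).
have mT' := mF_meas hF (lexx 0) mT.
have cT := @cvg_trunc _ _ _ P setT (fun w => `|U0 w|) U mT' mAn mU.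
have E0 : (\int[P]_w ((\1_setT w * U w) ^+ 2)%:E = (\int[P]_w (U w ^+ 2))%:E)%E.
 by rewrite -(L2_Rint hU); apply: eq_integral => w _; rewrite indicT mul1r.
rewrite E0 in cT.
pose a n := (\int[P]_w ((\1_(A n) w * U w) ^+ 2)%:E)%E.
have En n : (\int[P]_w ((\1_(~` A n) w * U w) ^+ 2)%:E + a n = (\int[P]_w (U w ^+ 2))%:E)%E.
 rewrite /a -ge0_integralD//; first last.
 - by apply/mEFinP; apply: mfunX; exact: mfunM.
 - by move=> w _; exact: lee_sqr0.
 - by apply/mEFinP; apply: mfunX; apply: mfunM => //; exact: (mF_meas hF (lexx 0) (mC n)).
 - by move=> w _; exact: lee_sqr0. rewrite -(L2_Rint hU); apply: eq_integral => w _; rewrite -EFinD; congr EFin.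
 by rewrite !indicE in_setC; case: (w \in A n); rewrite /= !mul1r !mul0r expr0n/= ?addr0 ?add0r.
have fa n : a n \is a fin_num.
 rewrite ge0_fin_numE; last by apply: integral_ge0 => w _; exact: lee_sqr0. apply: le_lt_trans (ltry (\int[P]_w (U w ^+ 2))); rewrite -(En n) leeDr//. by apply: integral_ge0 => w _; exact: lee_sqr0.
have c' : fine (a n) @[n --> \oo] --> \int[P]_w (U w ^+ 2) by apply: fine_cvg.
have h : \forall n \near \oo, \int[P]_w (U w ^+ 2) - e < fine (a n).
 by apply: (cvgr_gt _ c'); rewrite ltrBlDr ltrDl.
apply: filterS h => n h; have := En n; rewrite -(fineK (fa n)) => E.
have -> : (\int[P]_w ((\1_(~` A n) w * U w) ^+ 2)%:E = (\int[P]_w (U w ^+ 2) - fine (a n))%:E)%E.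
 by rewrite EFinB -E addeK.
by rewrite lee_fin lerBlDr -lerBlDl ltW.
Qed.

Let AK n w : A n w -> `|U0 w| <= n%:R. Proof. by case. Qed.

Let tm n := trunc_moment hF hW (diffusion_mF aX) cX aX aX YX fs f0 fn fc fm f2 cv vM k32 C0 YD hcc
 centred_mF phi_norm_le1 hI mom_order_gt1 hcq (init_set_mF n) (@AK n).
Let cm n := comb_moment hF hW (diffusion_mF aX) cX aX aX fs f0 fn fc fm f2 cv vM
 centred_mF hI mom_order_gt1 (init_set_mF n).
Let ev (x : R) := expr_double_ge0 x q.

Let bnd_moment (V : Omega -> R) (K : R) : mfunT V -> (forall w, `|V w| <= K) -> (\int[P]_w (V w ^+ q.*2)%:E <= (K ^+ q.*2)%:E)%E.
Proof.
move=> mV h; rewrite -[X in (_ <= X)%E](int_cst_le P); apply: ge0_le_integral => //.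
- by move=> w _; rewrite lee_fin.
- by apply/mEFinP; exact: mfunX.
- move=> w _; rewrite lee_fin -[leLHS]ger0_norm// normrX; apply: lerXn2r; rewrite ?nnegrE//.
 exact: le_trans (normr_ge0 _) (h w).
Qed.

Lemma solution_moment n : exists C : R, forall t, 0 <= t -> (\int[P]_w ((\1_(A n) w * X t w) ^+ q.*2)%:E <= C%:E)%E.
Proof.
have [Gam G0 hG] := tm n.
pose K := `|n%:R : R| * 1 + `|m0|.
have K0 : 0 <= K by rewrite addr_ge0// mulr_ge0.
exists ((1 + (q.*2.-1)%:R * c) ^+ q * (Gam + K ^+ q.*2)) => t t0.
have G1 : 0 <= Gam + K ^+ q.*2 by rewrite addr_ge0.
have h1 : (\int[P]_w ((\1_(A n) w * vstart U0 phi m0 t w) ^+ q.*2)%:E <= (1 ^+ q * (Gam + K ^+ q.*2))%:E)%E.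
 apply: (@le_trans _ _ (K ^+ q.*2)%:E); last by rewrite expr1n mul1r lee_fin lerDr. apply: bnd_moment. apply: mfunM; first exact: (mF_meas hF (lexx 0) (init_set_mF n)).
  exact: (mF_meas hF (lexx 0) (vstart_mF phi m0 centred_mF t)). by move=> w; exact: (vstart_bnd m0 phi_norm_le1 (@AK n) w t0).
have h2 u : 0 <= u -> (\int[P]_w ((\1_(A n) w * Y u w) ^+ q.*2)%:E <= (Gam + K ^+ q.*2)%:E)%E.
 by move=> u0; apply: le_trans (hG u u0) _; rewrite lee_fin lerDl.
have := @cm n _ 1 0 _ _ _ _ (vstart_mF phi m0 centred_mF t) t0 (lexx t) ltr01 G1 h1 h2.
rewrite mulr1 mulr0 (eq_integral (fun w => ((\1_(A n) w * X t w) ^+ q.*2)%:E)); last first.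
 by move=> w _; rewrite mul1r mul0r addr0 -Xsplit.
move=> /le_trans; apply; rewrite lee_fin; apply: ler_wpM2r => //; apply: lerXn2r; rewrite ?nnegrE.
- by rewrite addr_ge0// mulr_ge0//; apply: Rintegral_ge0 => // u _; exact: sqr_ge0.
- by rewrite addr_ge0// mulr_ge0// ltW.
- by rewrite lerD2l; apply: ler_wpM2l => //; exact: hcc.
Qed.

(** All the bounds are linear in the second moment of the start on the complement and in its mass,
    both made at most [z]; [S] collects the coefficients. *)
Lemma solution_tail (e : R) : 0 < e -> exists n, forall t, 0 <= t -> (\int[P]_w ((\1_(~` A n) w * X t w) ^+ 2)%:E <= e%:E)%E.
Proof.
move=> e0.
pose L (z : R) := 2 * z + 2 * m0 ^+ 2 * z + c * (4 * (3 / 2 * k2 * (2 * z + 2 * m0 ^+ 2 * z) + Cs * z)).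
pose S := 2 + 2 * m0 ^+ 2 + c * (4 * (3 / 2 * k2 * (2 + 2 * m0 ^+ 2) + Cs)).
have LE z : L z = S * z by rewrite /L /S; ring.
have S0 : 0 < S.
 rewrite /S -addrA ltr_pwDl// addr_ge0//; first by rewrite mulr_ge0// sqr_ge0. apply: mulr_ge0; first exact: ltW. apply: mulr_ge0 => //; apply: addr_ge0 => //; apply: mulr_ge0; first exact: ltW.
 by rewrite addr_ge0// mulr_ge0// sqr_ge0.
pose z := e / S; have z0 : 0 < z by rewrite divr_gt0.
have [n _ hn] := filterI (init_set_tail centred_L2 z0) (init_set_tail (L2_cst P 1) z0).
have [hU h1] := hn n (leqnn n).
exists n => t t0; set B := ~` A n in hU h1 *.
have mB : mF 0 (\1_B : Omega -> R) := mC n.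
have hp : (\int[P]_w (\1_B w)%:E <= z%:E)%E.
 apply: le_trans h1; apply: eq_ler; apply: eq_integral => w _. by rewrite mulr1 indicE; case: (w \in B); rewrite ?expr1n ?expr0n.
have hY := solution_bound mB (ltW z0) (ltW z0) hU hp.
set xB := 4 * _ in hY.
have xB0 : 0 <= xB.
 by rewrite -lee_fin; apply: le_trans (hY 0 (lexx 0)); apply: integral_ge0 => w _; exact: lee_sqr0.
have := iso 1 0 mB (vstart_mF phi m0 centred_mF t) xB0 hY t0 (lexx t).
rewrite mulr1 mulr0 (eq_integral (fun w => ((\1_B w * X t w) ^+ 2)%:E)); last first.
 by move=> w _; rewrite mul1r mul0r addr0 -Xsplit.
move=> ->.
have -> : e = 2 * z + 2 * m0 ^+ 2 * z + c * xB by rewrite -/(L z) LE /z mulrC divfK// gt_eqF.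
rewrite [in leRHS]EFinD; apply: leeD.
 have mBO : mfunT (\1_B : Omega -> R) := mF_meas hF (lexx 0) mB. apply: (int_lin_le _ _ _ _ _ _ _ _ _ hU hp) => //.
 - by apply: mfunX; exact: mfunM.
 - by apply: mfunX; apply: mfunM => //; exact: (mF_meas hF (lexx 0) (vstart_mF phi m0 centred_mF t)).
 - by move=> w; exact: sqr_ge0.
 - by move=> w; exact: sqr_ge0.
 - by rewrite mulr_ge0// sqr_ge0.
 - move=> w; rewrite /vstart indicE; case: (w \in B); last by rewrite !mul0r expr0n/= !mulr0 addr0. rewrite !mul1r mulr1. have h2 := ler_wpM2l (sqr_ge0 (U0 w)) (phi_le1 t0).
  by have := sqr_ge0 (U0 w * phi t - m0); rewrite sqrrB sqrrD exprMn; lra.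
rewrite lee_fin; apply: le_trans (vquad_le hF (diffusion_path cX) (diffusion_mF aX) f0 fm f2 cv vM _ _ _ _ mB xB0 hY) _.
by apply: ler_wpM2r => //; exact: hcc.
Qed.

Definition clip (N x : R) : R := Num.max (- N) (Num.min x N).

(** Uniform integrability of [X t ^ 2], as an L2 distance to a bounded variable. Off [A n] the tail
    bound suffices; on [A n], where [|X t| > N >= 1], [X t ^ 2] is at most its power of order [q]
    divided by [N ^ 2]. *)
Lemma clip_ui (e : R) : 0 < e -> exists2 N : R, 0 < N & forall t, 0 <= t -> (\int[P]_w ((X t w - clip N (X t w)) ^+ 2)%:E <= e%:E)%E.
Proof.
move=> e0; have e2 : 0 < e / 2 by rewrite divr_gt0.
have [n hn] := solution_tail e2; have [C hC] := solution_moment n.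
pose N2 := 1 + 2 * `|C| / e; have N20 : 1 <= N2 by rewrite lerDl divr_ge0 ?(ltW e0)// mulr_ge0.
have N2p : 0 < N2 by exact: lt_le_trans N20.
pose N := Num.sqrt N2; have N0 : 0 < N by rewrite sqrtr_gt0.
have NN : N ^+ 2 = N2 by rewrite sqr_sqrtr// ltW.
exists N => // t t0.
have mX' := mX t0.
apply: (@le_trans _ _ (1 * (e / 2) + N2^-1 * `|C|)%:E); last first.
 rewrite lee_fin mul1r [leRHS]splitr lerD2l mulrC ler_pdivrMr// /N2 mulrDr mulr1. have -> : e / 2 * (2 * `|C| / e) = `|C| by field; rewrite gt_eqF. by rewrite lerDr ltW.
have hC' : (\int[P]_w ((\1_(A n) w * X t w) ^+ q.*2)%:E <= `|C|%:E)%E.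
 by apply: le_trans (hC t t0) _; rewrite lee_fin ler_norm.
apply: (int_lin_le _ _ _ _ _ _ _ _ _ (hn t t0) hC') => //.
- by apply: mfunX; apply: mfunM => //; exact: (mF_meas hF (lexx 0) (mC n)).
- by apply: mfunX; apply: mfunM => //; exact: (mF_meas hF (lexx 0) (init_set_mF n)).
- apply: mfunX; apply: mfunB => //; rewrite /clip.
 by apply: measurable_maxr => //; exact: measurable_minr.
- by move=> w; exact: sqr_ge0.
- by move=> w; exact: sqr_ge0.
- by rewrite invr_ge0 ltW.
move=> w; rewrite mul1r; set x := X t w.
have hx : (x - clip N x) ^+ 2 <= x ^+ 2.
 rewrite /clip; case: (lerP x N) => h1; case: (lerP (- N) _) => h2; move: N0; rewrite -!/x; nra.
rewrite !indicE in_setC; case: (boolP (w \in A n)) => _ /=; last first.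
 have -> : (0 * x) ^+ q.*2 = 0 by rewrite mul0r expr0n double_eq0. by rewrite mul1r mulr0 addr0.
rewrite mul0r expr0n/= add0r mul1r.
have [h|h] := leP `|x| N.
 have -> : clip N x = x by rewrite /clip (min_l (le_trans (ler_norm x) h)) max_r// lerNl (le_trans _ h)// -normrN ler_norm. by rewrite subrr expr0n/= mulr_ge0// invr_ge0 ltW.
apply: le_trans hx _; rewrite ler_pdivlMl// -NN.
have x2 : N2 <= x ^+ 2 by rewrite -NN -[x ^+ 2]real_normK ?num_real//; apply: lerXn2r; rewrite ?nnegrE// ltW.
have Ex : x ^+ q.*2 = (x ^+ 2) ^+ q.-1 * x ^+ 2 by rewrite -mul2n exprM -exprSr.
rewrite NN Ex; apply: ler_wpM2r; first exact: sqr_ge0.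
have N2x := le_trans N20 x2.
apply: (le_trans x2); rewrite -[leLHS]expr1; apply: ler_weXn2l => //.
by have := mom_order_gt1; case: (q) => [|[|k]].
Qed.

Lemma phi_increment (Md s h : R) : bddm (ppart drift) -> (forall x, `|ppart drift x| <= Md) -> 0 <= Md -> 0 <= s -> 0 < h ->
 `|phi (s + h) - phi s| <= 2 * Md * (lambda * gamC alpha * (h `^ alpha / alpha)) / `|lambda * m0|.
Proof.
move=> bd hMd Md0 s0 h0.
have a0 : 0 < alpha by move: alpha1; apply: lt_trans; rewrite invr_gt0.
have md := mppart cdrift.
rewrite /phi (volterra_rconv _ fm md) ?(volterra_rconv _ fm md) ?addr_ge0 ?(ltW h0)//.
set A1 := rconv _ _ (s + h); set A2 := rconv _ _ s.
have -> : 1 - A1 / (lambda * m0) - (1 - A2 / (lambda * m0)) = (A2 - A1) / (lambda * m0) by ring.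
rewrite normrM normfV.
apply: ler_wpM2r; first by rewrite invr_ge0.
rewrite distrC; apply: le_trans (rconv_shift s f1 fs f0 fn bd hMd Md0 h0) _.
by apply: ler_wpM2l; [rewrite mulr_ge0|exact: (resf_small alpha1 alpha2 rho0 lambda0 hRl h0)].
Qed.

Lemma solution_increment_aux (u p1 p2 x1 x2 m : R) :
 u * (p1 - p2) + (1 * (x1 - (u * p1 + m)) + -1 * (x2 - (u * p2 + m))) = x1 - x2.
Proof. ring. Qed.

(** The start contributes the increment of [phi], of order [h ^ alpha <= h ^ (alpha - 1 / 2)]; the
    noise contributes the squared increment of the kernel, whose integral is of order
    [h ^ (2 alpha - 1)] by [nincr_shift2]. *)
Lemma solution_increment (n : nat) : bddm (ppart drift) -> exists2 C : R, 0 <= C & forall s h, 0 <= s -> 0 < h <= 1 ->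
 (\int[P]_w ((\1_(A n) w * (X (s + h) w - X s w)) ^+ q.*2)%:E <= (C * (h `^ (2 * alpha - 1)) ^+ q)%:E)%E.
Proof.
move=> bd; have [_ [Md hMd]] := bd.
have Md0 : 0 <= Md by exact: le_trans (hMd 0).
have [Gam G0 hG] := tm n.
have a0 : 0 < alpha by move: alpha1; apply: lt_trans; rewrite invr_gt0.
pose Kp := 2 * Md * (lambda * gamC alpha / alpha) / `|lambda * m0|.
have Kp0 : 0 <= Kp.
 apply: divr_ge0 => //; apply: mulr_ge0; first exact: mulr_ge0. apply: divr_ge0; last exact: ltW. by apply: mulr_ge0; [exact: ltW|exact: gamC_ge0].
pose L := n%:R * Kp.
pose K2 := (b * Mv) ^+ 2 * (2 * ((lambda * gamC alpha) ^+ 2 / (2 * alpha - 1))).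
have K20 : 0 <= K2 by rewrite mulr_ge0 ?sqr_ge0// mulr_ge0// divr_ge0 ?sqr_ge0// ltW.
pose GG := Gam + (L ^+ 2) ^+ q.
have GG0 : 0 <= GG by rewrite addr_ge0// exprn_ge0// sqr_ge0.
exists ((1 + (q.*2.-1)%:R * K2) ^+ q * GG); first by rewrite mulr_ge0// exprn_ge0// addr_ge0// mulr_ge0.
move=> s h s0 /andP[h0 h1].
have sh0 : 0 <= s + h by rewrite addr_ge0// ltW.
have ssh : s <= s + h by rewrite lerDl ltW.
set z := h `^ (2 * alpha - 1); have z0 : 0 < z by rewrite powR_gt0.
pose Z w := U0 w * (phi (s + h) - phi s).
have mZ : mF 0 Z by apply: mfunM => //; exact: centred_mF.
have hph : (phi (s + h) - phi s) ^+ 2 <= Kp ^+ 2 * z.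
 have hp := phi_increment bd hMd Md0 s0 h0. rewrite -[leLHS]real_normK ?num_real//. apply: (@le_trans _ _ ((Kp * h `^ alpha) ^+ 2)). have K1 : 0 <= Kp * h `^ alpha by rewrite mulr_ge0// powR_ge0.
  apply: lerXn2r; rewrite ?nnegrE//; apply: (le_trans hp). by apply: eq_ler; rewrite /Kp; ring. rewrite exprMn; apply: ler_wpM2l; first exact: sqr_ge0.
 rewrite /z -powR_mulrn ?powR_ge0// -powRrM; apply: ler_powR_le1 => //; first by rewrite h0 h1. by rewrite mulrC; lra.
have hZ : (\int[P]_w ((\1_(A n) w * Z w) ^+ q.*2)%:E <= (z ^+ q * GG)%:E)%E.
 apply: (@le_trans _ _ ((L * Num.sqrt z) ^+ q.*2)%:E); last first. have -> : (L * Num.sqrt z) ^+ q.*2 = z ^+ q * (L ^+ 2) ^+ q.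
   by rewrite -mul2n exprM [(L * _) ^+ 2]exprMn sqr_sqrtr ?(ltW z0)// exprMn mulrC. rewrite lee_fin; apply: ler_wpM2l; first by rewrite exprn_ge0// ltW. by rewrite /GG lerDr. apply: bnd_moment.
  by apply: mfunM; [exact: (mF_meas hF (lexx 0) (init_set_mF n))|exact: (mF_meas hF (lexx 0) mZ)].
 have hd : `|phi (s + h) - phi s| <= Kp * Num.sqrt z. have K1 : 0 <= Kp * Num.sqrt z by rewrite mulr_ge0// sqrtr_ge0.
  rewrite -ler_sqr ?nnegrE// real_normK ?num_real//. by rewrite exprMn sqr_sqrtr ?(ltW z0). move=> w; rewrite indicE; case: (boolP (w \in A n)) => [/set_mem wA|_]; last first. have sz := sqrtr_ge0 z.
  by rewrite mul0r normr0 /L; apply: mulr_ge0 => //; exact: mulr_ge0. rewrite mul1r /Z normrM /L -mulrA; apply: ler_pM => //; exact: (AK wA).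
have h2 u : 0 <= u -> (\int[P]_w ((\1_(A n) w * Y u w) ^+ q.*2)%:E <= GG%:E)%E.
 by move=> u0; apply: le_trans (hG u u0) _; rewrite lee_fin lerDl exprn_ge0// sqr_ge0.
have := @cm n _ 1 (-1) _ _ _ _ mZ s0 ssh z0 GG0 hZ h2.
rewrite (eq_integral (fun w => ((\1_(A n) w * (X (s + h) w - X s w)) ^+ q.*2)%:E)); last first.
 by move=> w _; rewrite /Z /vnoise; congr ((_ * _) ^+ _)%:E; exact: solution_increment_aux.
move=> /le_trans; apply; rewrite lee_fin.
have hq : \int[mu]_(u in `[0, s + h]) (psi (b * 1) (b * -1) s (s + h) u ^+ 2) <= K2 * z.
 have [i2 n2] := nincr_shift2 f2 fs fm f0 fn h0. pose g x := (f (x + h) - f x) ^+ 2. have ig : L1 g by []. have igs : L1 (fun u => (b * Mv) ^+ 2 * g (s - u)) by apply: L1Z; exact: L1_reflect.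
 have ip : L1 (fun u => psi (b * 1) (b * -1) s (s + h) u ^+ 2) by apply: (@vpsi2_L1 _ _ _ Mv). apply: le_trans (Rint_sub_le ip _ (fun x => sqr_ge0 _)) _ => //. apply: le_trans (Rint_le_L1 ip igs _) _.
  move=> u; rewrite /vpsi /g. have -> : (b * 1 * f (s + h - u) + b * -1 * f (s - u)) * v u = b * v u * (f (s - u + h) - f (s - u)). rewrite addrAC; move: (f _) (f (s - u)) (v u) => x y z1; ring.
  rewrite exprMn; apply: ler_wpM2r; first exact: sqr_ge0. rewrite !exprMn; apply: ler_wpM2l; first exact: sqr_ge0.
  by rewrite -[leLHS]real_normK ?num_real//; apply: lerXn2r; rewrite ?nnegrE//; exact: le_trans (vM u).
 rewrite RintZl_L1; last exact: L1_reflect. rewrite /K2 -[leRHS]mulrA; apply: ler_wpM2l; first exact: sqr_ge0.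
 have -> : \int[mu]_x g (s - x) = \int[mu]_x g x. by apply: Rintegral_reflect; exact: L1_mfun ig. apply: le_trans n2 _; rewrite -[leRHS]mulrA; apply: ler_wpM2l => //.
 apply: le_trans (resf2_small alpha1 alpha2 rho0 lambda0 hRl h0) _; rewrite -/z; have aux (x y t : R) : x * (t / y) <= x / y * t by rewrite -mulrA [_ / y]mulrC; exact: lexx. exact: aux.
rewrite -mulrA [GG * _]mulrC mulrA -exprMn; apply: ler_wpM2r => //; apply: lerXn2r; rewrite ?nnegrE.
- by rewrite addr_ge0 ?(ltW z0)// mulr_ge0//; apply: Rintegral_ge0 => // u _; exact: sqr_ge0.
- by rewrite mulr_ge0 ?(ltW z0)// addr_ge0// mulr_ge0.
- rewrite mulrDl mul1r lerD2l -mulrA; apply: ler_wpM2l => //; exact: hq.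
Qed.
End stationary.

Lemma drift_bddm (mu_inf : R) : drift t @[t --> +oo] --> mu_inf -> bddm (ppart drift).
Proof.
move=> hd; split; first exact: mppart.
have h1 : \forall t \near +oo, `|drift t| <= `|mu_inf| + 1.
 have := @cvgr_norm_le _ _ _ _ _ _ _ hd (`|mu_inf| + 1); apply; exact: ltr_pwDr.
have [T [_ hT]] := h1.
pose T' := Num.max 0 (T + 1); have T0 : 0 <= T' by rewrite le_max lexx.
have cn : {within `[0, T'], continuous (fun t : R => `|drift (Num.max 0 t)|)}.
 apply: continuous_subspaceT => t. by apply: continuous_comp; [exact: max0_continuous|exact: norm_continuous].
have [m _ hm] := EVT_max T0 cn.
exists (Num.max (`|drift (Num.max 0 m)|) (`|mu_inf| + 1)) => t; rewrite /ppart; case: ifP => t0; last first.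
 by rewrite normr0 le_max normr_ge0.
rewrite le_max; have [tT|Tt] := leP t T'.
 by have := hm t; rewrite in_itv/= (ltW t0) tT (max_r (ltW t0)) => /(_ isT) ->.
apply/orP; right; apply: hT; apply: lt_trans Tt; rewrite /T' lt_max ltrDl ltr01 orbT//.
Qed.

Lemma phi_cvg (mu_inf : R) : drift t @[t --> +oo] --> mu_inf ->
 phi t @[t --> +oo] --> 1 - mu_inf * (\int[mu]_x f x) / (lambda * m0).
Proof.
move=> hd; have bd := drift_bddm hd.
have h1 : ppart drift t @[t --> +oo] --> mu_inf.
 apply: cvg_trans hd; apply: near_eq_cvg; near=> t. by rewrite /ppart ifT//; near: t; exact: nbhs_pinfty_gt.
have h2 := rconv_cvg f1 bd h1.
apply: cvgB; first exact: cvg_cst.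
apply: cvgM; last exact: cvg_cst.
apply: cvg_trans h2; apply: near_eq_cvg; near=> t.
have t0 : 0 <= t by near: t; exact: nbhs_pinfty_ge.
by rewrite (volterra_rconv t0)//; exact: mppart.
Unshelve. all: end_near. Qed.

(** * Coupling of two solutions *)

Section coupling.
Variables (X0 X0' : Omega -> R) (X X' : R -> Omega -> R) (mu_inf : R).
Hypotheses (aX0 : meas_wrt (F 0) X0) (aX0' : meas_wrt (F 0) X0').
Hypotheses (hX : is_solution P F W lambda m0 (resolvent_density Rl) drift vs sg X0 X).
Hypotheses (hX' : is_solution P F W lambda m0 (resolvent_density Rl) drift vs sg X0' X') (U2 : L2 P (fun w => X0' w - X0 w)) (phi0 : phi t @[t --> +oo] --> (0 : R)).
Local Notation Y := (fun (u : R) (w : Omega) => (sg (X' u w) - sg (X u w) : R)).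
Local Notation D := (fun (u : R) (w : Omega) => (X' u w - X u w : R)).
Local Notation G := (fun (u : R) (w : Omega) => (`|X u w| + `|X' u w| : R)).
Local Notation U0 := (fun w => X0' w - X0 w).
Local Notation J := (vnoise D U0 phi 0).
Local Notation y := (sqmom P Y setT).
Local Notation psi := (vpsi f v).

Let aX u : 0 <= u -> mF u (X u).
Proof. by have [h _ _] := hX; move=> u0; apply/(meas_wrtP hF) => //; exact: h. Qed.
Let cX w : {within `[0, +oo[, continuous (X^~ w)}. Proof. by have [_ h _] := hX. Qed.
Let aX' u : 0 <= u -> mF u (X' u).
Proof. by have [h _ _] := hX'; move=> u0; apply/(meas_wrtP hF) => //; exact: h. Qed.
Let cX' w : {within `[0, +oo[, continuous (X'^~ w)}. Proof. by have [_ h _] := hX'. Qed.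

Let cY w : {within `[0, +oo[, continuous (Y^~ w)}.
Proof. exact: (within_continuousB (@diffusion_path X' cX' w) (@diffusion_path X cX w)). Qed.
Let aY u : 0 <= u -> mF u (Y u).
Proof. by move=> u0; apply: mfunB; [exact: diffusion_mF|exact: diffusion_mF]. Qed.
Let cG w : {within `[0, +oo[, continuous (G^~ w)}.
Proof. exact: (within_continuous_normD (@cX w) (@cX' w)). Qed.
Let aG u : 0 <= u -> mF u (G u).
Proof. by move=> u0; apply: mfunD; apply: mcompT => //; [exact: aX|exact: aX']. Qed.
Let aD u : 0 <= u -> mF u (D u).
Proof. by move=> u0; apply: mfunB; [exact: aX'|exact: aX]. Qed.
Let mD u : 0 <= u -> mfunT (D u).
Proof. by move=> u0; exact: (mF_meas hF u0 (aD u0)). Qed.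

Let GX (N : R) : exists L : R, forall u w, `|G u w| <= N -> `|sg (X u w)| <= L.
Proof.
have [L hL] := diffusion_bnd hk2 hk1 N; exists L => u w; rewrite ger0_norm ?addr_ge0// => h.
by apply: hL; apply: le_trans h; rewrite lerDl.
Qed.
Let GX' (N : R) : exists L : R, forall u w, `|G u w| <= N -> `|sg (X' u w)| <= L.
Proof.
have [L hL] := diffusion_bnd hk2 hk1 N; exists L => u w; rewrite ger0_norm ?addr_ge0// => h.
by apply: hL; apply: le_trans h; rewrite lerDr.
Qed.
Let YG (N : R) : exists L : R, forall u w, `|G u w| <= N -> `|Y u w| <= L.
Proof.
have [L hL] := GX N; have [L' hL'] := GX' N; exists (L' + L) => u w h.
by apply: le_trans (ler_normB _ _) _; apply: lerD; [exact: hL'|exact: hL].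
Qed.

Let hcc t : 0 <= t -> \int[mu]_(u in `[0, t]) (psi b 0 t t u ^+ 2) <= c.
Proof. by move=> t0; rewrite phi_quad// ger_pMr// lerBlDr lerDl sqr_ge0. Qed.
Let k32 : 0 < 3 / 2 * k2. Proof. by rewrite mulr_gt0// divr_gt0. Qed.
Let hcq : 3 / 2 * k2 * ((q.*2.-1)%:R * c) <= 9 / 16.
Proof. by have := mom_order_le; move: (q.*2.-1)%:R => n; lra. Qed.
Let YD1 u w : Y u w ^+ 2 <= k2 * D u w ^+ 2. Proof. exact: diffusion_lip. Qed.
Let YD u w : 0 <= u -> Y u w ^+ 2 <= 3 / 2 * k2 * D u w ^+ 2 + 0.
Proof.
move=> _; rewrite addr0; apply: le_trans (YD1 u w) _; apply: ler_wpM2r; first exact: sqr_ge0.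
by move: hk2; lra.
Qed.
Let aU : mF 0 U0.
Proof. by apply: mfunB; apply/(meas_wrtP hF). Qed.
Let mU : mfunT U0. Proof. exact: (mF_meas hF (lexx 0) aU). Qed.

Let hI T : 0 <= T -> exists I : Omega -> R,
 [/\ mfunT I, {ae P, forall w, D T w = U0 w * phi T + 0 + b * I w} &
   forall be ga s t, 0 <= s -> s <= t -> (T = t /\ be = 1 /\ ga = 0) \/ (T = s /\ be = 0 /\ ga = 1) ->
   cvg0_in_prob P (fun n w => `|zsum W Y G s t (psi be ga s t) n%:R n w - I w|%:E)].
Proof.
move=> T0; have [I [h1 h2 h3]] := solution_ito hX T0; have [I' [h1' h2' h3']] := solution_ito hX' T0.
exists (fun w => I' w - I w); split.
- exact: mfunB.
- by apply: filterS2 h2 h2' => w -> ->; ring.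
move=> be ga s t s0 st hT.
have e := h3 G cG aG GX be ga s t s0 st hT; have e' := h3' G cG aG GX' be ga s t s0 st hT.
have m1 n : mfunT (zsum W (fun u w => sg (X' u w)) G s t (psi be ga s t) n%:R n).
 exact: (zsum_measurable hF hW (diffusion_mF aX') cG aG).
have m2 n : mfunT (zsum W (fun u w => sg (X u w)) G s t (psi be ga s t) n%:R n).
 exact: (zsum_measurable hF hW (diffusion_mF aX) cG aG).
have := cvg0_lin 1 (-1) m1 m2 h1' h1 e' e.
rewrite (_ : (fun k w => _) = (fun n w => `|zsum W Y G s t (psi be ga s t) n%:R n w - (I' w - I w)|%:E))//.
apply/funext => n; apply/funext => w; rewrite !mulN1r !mul1r; congr (`|_ - _|%:E).
rewrite /zsum -sumrB; apply: eq_bigr => i _; rewrite /zeta.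
by rewrite -mulrBl; congr (_ * _); rewrite mulrBr mulrBl.
Qed.

Let yb := y_bound hF hW cY aY cG aG aD YG fs f0 fn fc fm f2 cv vM k32 (lexx 0) YD hcc
 aU phi_norm_le1 hI mom_order_gt1 hcq.
Let iso := isom_full hF hW cY aY cG aG aD YG fs f0 fn fc fm f2 cv vM k32 (lexx 0) YD hcc
 aU phi_norm_le1 hI mom_order_gt1 hcq.

Let mT : mF 0 (\1_(setT : set Omega) : Omega -> R).
Proof. by rewrite indicT; exact: mcst. Qed.
Let r := \int[P]_w (U0 w ^+ 2).
Let r0 : 0 <= r. Proof. by apply: Rintegral_ge0 => // w _; exact: sqr_ge0. Qed.

Let st2 t : (\int[P]_w (vstart U0 phi 0 t w ^+ 2)%:E = (r * phi t ^+ 2)%:E)%E.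
Proof.
under eq_integral do rewrite /vstart addr0 exprMn mulrC EFinM.
rewrite ge0_integralZl_EFin ?sqr_ge0//; [|by move=> w _; exact: lee_sqr0|by apply/mEFinP; exact: mfunX].
by rewrite (L2_Rint U2) mulrC.
Qed.

Let x := 4 * (3 / 2 * k2 * r + 0 * 1).
Let x0 : 0 <= x. Proof. by rewrite /x mul0r addr0; apply: mulr_ge0 => //; apply: mulr_ge0 => //; exact: ltW. Qed.
Let hy u : 0 <= u -> (\int[P]_w ((\1_setT w * Y u w) ^+ 2)%:E <= x%:E)%E.
Proof.
apply: yb => //; first by rewrite indicT int_cst_le.
move=> t t0; under eq_integral do rewrite indicT mul1r.
by rewrite st2 lee_fin; apply: ler_piMr => //; exact: phi_le1.
Qed.

Let m2 t := \int[P]_w (D t w ^+ 2).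

Let D_sqr t : 0 <= t -> (\int[P]_w (D t w ^+ 2)%:E = (r * phi t ^+ 2 + \int[mu]_(u in `[0, t]) (psi b 0 t t u ^+ 2 * y u))%:E)%E.
Proof.
move=> t0; have mZ : mF 0 (vstart U0 phi 0 t) by exact: vstart_mF.
have := iso 1 0 mT mZ x0 hy t0 (lexx t); rewrite mulr1 mulr0.
under [X in _ = (X + _)%E -> _]eq_integral do rewrite indicT mul1r.
rewrite st2 EFinD => <-; apply: eq_integral => w _.
by rewrite indicT mul1r mul1r mul0r addr0 -vstartJ.
Qed.

Lemma coupling_sqr t : 0 <= t -> (\int[P]_w ((X' t w - X t w) ^+ 2)%:E = (m2 t)%:E)%E.
Proof. by move=> t0; rewrite /m2 /Rintegral D_sqr. Qed.

Let y_le u : 0 <= u -> y u <= k2 * m2 u.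
Proof.
move=> u0; have fin := sqmom_fin u x0 hy.
rewrite -lee_fin /sqmom fineK// max_r// -[X in (_ <= X%:E)%E]addr0.
apply: (@int_aff_le _ _ _ P (fun w => D u w ^+ 2)) => //.
- by apply: mfunX; exact: mD.
- by apply: mfunX; apply: mfunM; [rewrite indicT; exact: mcst|exact: (mF_meas hF u0 (aY u0))].
- by move=> w; exact: sqr_ge0.
- by move=> w; exact: sqr_ge0.
- exact: ltW.
- by move=> w; rewrite indicT mul1r addr0.
- by rewrite coupling_sqr.
Qed.

(** Up to a time [T'] only the crude bound [x] on [y] is available, but its weight, a convolution of
    [f ^ 2] with a function of bounded support to the right, fades as [t] grows; after [T'] the
    total mass [c] of the kernel applies. *)
Let quad_le (z e : R) : 0 <= z -> 0 < e -> (\forall t \near +oo, y t <= z) ->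
 \forall t \near +oo, m2 t <= c * z + e.
Proof.
move=> z0 e0 [T [_ hT]].
pose T' := Num.max 1 (T + 1); have T0 : 0 < T' by rewrite lt_max ltr01.
pose g (u : R) := x * (u <= T')%R%:R.
have bg : bddm g.
 split; first by apply: mfunM => //; exact: measurable_le01. by exists x => u; rewrite /g; case: (u <= T'); rewrite ?mulr1 ?mulr0 ?normr0// ger0_norm.
have g0 : g t @[t --> +oo] --> (0 : R).
 have H : (cst 0 : R -> R) t @[t --> +oo] --> (0 : R) by exact: cvg_cst. apply: cvg_trans H; apply: near_eq_cvg; near=> t.
 have h : T' < t by near: t; apply: nbhs_pinfty_gt; exact: num_real. by rewrite /g leNgt h mulr0.
have cg := rconv_cvg f2 bg g0; rewrite mul0r in cg.
have cp : r * phi t ^+ 2 @[t --> +oo] --> (0 : R).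
 rewrite -(mulr0 r) -[X in r * X](expr0n R 2); apply: cvgM; first exact: cvg_cst. exact: (cvg_comp _ _ phi0 (@exprn_continuous R 2 0)).
have cs : r * phi t ^+ 2 + (b * Mv) ^+ 2 * rconv (fun s => f s ^+ 2) g t @[t --> +oo] --> (0 : R).
 by rewrite -(addr0 0) -[X in _ + X](mulr0 ((b * Mv) ^+ 2)); apply: cvgD => //; apply: cvgM => //; exact: cvg_cst.
have hs : \forall t \near +oo, r * phi t ^+ 2 + (b * Mv) ^+ 2 * rconv (fun s => f s ^+ 2) g t < e by apply: (cvgr_lt _ cs).
near=> t.
have t0 : 0 <= t by near: t; exact: nbhs_pinfty_ge.
have h1 : r * phi t ^+ 2 + (b * Mv) ^+ 2 * rconv (fun s => f s ^+ 2) g t < e by near: t.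
rewrite /m2 /Rintegral D_sqr//=.
apply: (@le_trans _ _ (r * phi t ^+ 2 + (c * z + (b * Mv) ^+ 2 * rconv (fun s => f s ^+ 2) g t))); last first.
 by rewrite addrCA lerD2l ltW.
rewrite lerD2l.
have i0 : L1 (fun u => f (t - u) ^+ 2 * g u) by exact: (rconv_L1_pt t f2 bg).
have i1 : L1 (fun u => psi b 0 t t u ^+ 2) by apply: (@vpsi2_L1 _ _ _ Mv).
have sub (h : R -> R) : L1 h -> mu.-integrable `[0, t] (EFin \o h) by move=> ih; apply: (integrableS measurableT) => //.
have iz : L1 (fun u => psi b 0 t t u ^+ 2 * z).
 by rewrite (_ : (fun u => _) = (fun u => z * psi b 0 t t u ^+ 2)); [exact: L1Z|apply/funext => u; rewrite mulrC].
have iy : L1 (fun u => psi b 0 t t u ^+ 2 * y u) by exact: (vquad_L1 hF cY aY f0 fm f2 cv vM _ _ _ _ mT x0 hy).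
apply: (@le_trans _ _ (\int[mu]_(u in `[0, t]) (psi b 0 t t u ^+ 2 * z + (b * Mv) ^+ 2 * (f (t - u) ^+ 2 * g u)))).
 apply: le_Rintegral => //; [exact: sub|exact: (sub (fun u => _) (L1D iz (L1Z ((b * Mv) ^+ 2) i0)))|]. move=> u; rewrite /= in_itv/= => /andP[u0 ut]. have g0' : 0 <= g u by rewrite /g mulr_ge0.
 have p2 : 0 <= psi b 0 t t u ^+ 2 by exact: sqr_ge0. have [Tu|uT'] := ltP T' u. apply: ler_wpDr; first by apply: mulr_ge0; [exact: sqr_ge0|apply: mulr_ge0 => //; exact: sqr_ge0].
  apply: ler_wpM2l => //; apply: hT; apply: lt_trans Tu; rewrite /T' lt_max ltrDl ltr01 orbT//. apply: ler_wpDl; first exact: mulr_ge0. have hp : psi b 0 t t u ^+ 2 <= (b * Mv) ^+ 2 * f (t - u) ^+ 2.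
  rewrite /vpsi mul0r addr0 !exprMn [leRHS]mulrAC; apply: ler_wpM2l; first by rewrite mulr_ge0// sqr_ge0.
  by rewrite -[leLHS]real_normK ?num_real//; apply: lerXn2r; rewrite ?nnegrE//; exact: le_trans (vM u). rewrite mulrA; apply: ler_pM => //; first by have /andP[] := sqmom_le u x0 hy.
 by rewrite /g uT' mulr1; have /andP[] := sqmom_le u x0 hy.
rewrite RintegralD//; [|exact: sub|exact: (sub (fun u => _) (L1Z ((b * Mv) ^+ 2) i0))].
rewrite RintegralZr//; last exact: sub.
rewrite RintegralZl//; last exact: (sub (fun u => _) i0).
apply: lerD; first by apply: ler_wpM2r => //; exact: hcc.
apply: ler_wpM2l; first exact: sqr_ge0.
apply: (Rint_sub_le i0) => // u; apply: mulr_ge0; first exact: sqr_ge0.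
by rewrite /g mulr_ge0.
Unshelve. all: end_near. Qed.

(** [y <= k2 m2] and [quad_le], with [c k2 <= 1 / 8], halve the asymptotic bound on [y] at each
    round. *)
Lemma coupling_cvg : m2 t @[t --> +oo] --> (0 : R).
Proof.
have ck : c * k2 <= 1 / 8.
 have : c * (8 * k2) < 2 * alpha - 1 by rewrite -ltr_pdivlMr// mulr_gt0. by move: alpha2; lra.
have it n : \forall t \near +oo, y t <= (x + 1) / 2 ^+ n.
 elim: n => [|n IH]. near=> t; rewrite expr0 divr1; have /andP[_ h] := sqmom_le t x0 hy; apply: le_trans h _; rewrite lerDl//. have z0 : 0 < (x + 1) / 2 ^+ n by rewrite divr_gt0 ?exprn_gt0// ltr_wpDl.
 (* With [z] the current bound, [k2 (c z + z / (4 k2)) <= z / 8 + z / 4 <= z / 2]. *)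
 have e0 : 0 < (x + 1) / 2 ^+ n / 4 / k2 by rewrite divr_gt0// divr_gt0. have h := quad_le (ltW z0) e0 IH. near=> t; have t0 : 0 <= t by near: t; exact: nbhs_pinfty_ge. apply: le_trans (y_le t0) _.
 have h1 : m2 t <= c * ((x + 1) / 2 ^+ n) + (x + 1) / 2 ^+ n / 4 / k2 by near: t. apply: le_trans (ler_wpM2l (ltW hk2) h1) _.
 have -> : (x + 1) / 2 ^+ n.+1 = (x + 1) / 2 ^+ n / 2 by rewrite exprSr invfM mulrA. move: ((x + 1) / 2 ^+ n) z0 => z z0. rewrite mulrDr [k2 * (z / 4 / k2)]mulrC divfK ?gt_eqF//.
 have -> : k2 * (c * z) = c * k2 * z by ring. have := ler_wpM2r (ltW z0) ck; lra.
apply/cvgrPdist_le => e e0.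
have cz : (c * ((x + 1) / 2 ^+ n)) @[n --> \oo] --> (0 : R).
 rewrite -(mulr0 c) -[X in _ * X](mulr0 (x + 1)); apply: cvgM; first exact: cvg_cst. apply: cvgM; first exact: cvg_cst. under eq_fun do rewrite -exprVn; apply: cvg_expr.
 by rewrite ger0_norm ?invr_ge0// invf_lt1// ltr1n.
have e2 : 0 < e / 2 by rewrite divr_gt0.
have [n _ hn] : \forall n \near \oo, c * ((x + 1) / 2 ^+ n) < e / 2 by apply: (cvgr_lt _ cz).
have z0 : 0 <= (x + 1) / 2 ^+ n by rewrite divr_ge0 ?exprn_ge0// addr_ge0.
have h := quad_le z0 e2 (it n).
near=> t; have h1 : m2 t <= c * ((x + 1) / 2 ^+ n) + e / 2 by near: t.
have m20 : 0 <= m2 t by apply: Rintegral_ge0 => // w _; exact: sqr_ge0.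
rewrite sub0r normrN ger0_norm//; apply: le_trans h1 _; rewrite [leRHS]splitr lerD2r ltW//; apply: hn; exact: leqnn.
Unshelve. all: end_near. Qed.
End coupling.
End solution.

(** * Kolmogorov's tightness criterion *)

Section chaining.
Variables (R : realType) (g : R -> R) (k m0 : nat) (th : R).
Hypotheses (th0 : 0 < th) (th1 : th < 1) (cg : continuous g).
Hypothesis step : forall m j : nat, (m0 <= m)%N -> (j < 2 ^ m)%N ->
 `|g (k%:R + j.+1%:R / 2 ^+ m) - g (k%:R + j%:R / 2 ^+ m)| <= th ^+ m.

(** [ap x n] is the last dyadic point of level [n], counted from [k], that does not exceed [x]. *)
Let fl (x : R) (n : nat) : nat := Num.truncn ((x - k%:R) * 2 ^+ n).
Let ap (x : R) n : R := k%:R + (fl x n)%:R / 2 ^+ n.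
Let p2 n : 0 < 2 ^+ n :> R. Proof. by rewrite exprn_gt0. Qed.

Let flP x n : k%:R <= x -> (fl x n)%:R <= (x - k%:R) * 2 ^+ n < (fl x n).+1%:R.
Proof. by move=> kx; apply: truncn_itv; rewrite mulr_ge0 ?subr_ge0// ltW. Qed.

Let ap_cvg x : k%:R <= x -> ap x n @[n --> \oo] --> x.
Proof.
move=> kx; apply/cvgrPdist_le => e e0.
have c : 2^-1 ^+ n @[n --> \oo] --> (0 : R).
 by apply: cvg_expr; rewrite ger0_norm ?invr_ge0// invf_lt1// ltr1n.
have [n0 _ hn] : \forall n \near \oo, (2^-1 : R) ^+ n < e by apply: (cvgr_lt _ c).
exists n0 => // n /= nn; have /andP[h1 h2] := flP n kx.
have -> : x - ap x n = ((x - k%:R) * 2 ^+ n - (fl x n)%:R) / 2 ^+ n.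
 by rewrite mulrBl mulfK ?gt_eqF// /ap opprD addrA.
rewrite ger0_norm; last by rewrite divr_ge0 ?(ltW (p2 n))// subr_ge0.
apply: le_trans (ltW (hn n nn)); rewrite exprVn -[leRHS]mul1r; apply: ler_wpM2r; first by rewrite invr_ge0 ltW.
by move: h2; rewrite -[(fl x n).+1%:R]natr1; lra.
Qed.

Let ap_step x n : k%:R <= x <= k.+1%:R -> (m0 <= n)%N -> `|g (ap x n.+1) - g (ap x n)| <= th ^+ n.+1.
Proof.
move=> /andP[kx xk] mn; have /andP[h1 h2] := flP n kx; have /andP[h3 h4] := flP n.+1 kx.
have E : (x - k%:R) * 2 ^+ n.+1 = 2 * ((x - k%:R) * 2 ^+ n) by rewrite exprS; ring.
have a1 : (2 * fl x n < (fl x n.+1).+1)%N.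
 by rewrite -(ltr_nat R) natrM; apply: le_lt_trans h4; rewrite E ler_pM2l.
have a2 : (fl x n.+1 < 2 * (fl x n).+1)%N.
 by rewrite -(ltr_nat R) natrM; apply: le_lt_trans h3 _; rewrite E ltr_pM2l.
have apn : ap x n = k%:R + (2 * fl x n)%:R / 2 ^+ n.+1.
 by rewrite /ap natrM exprS -mulf_div divff ?mul1r// pnatr_eq0.
have [e|e] : fl x n.+1 = (2 * fl x n)%N \/ fl x n.+1 = (2 * fl x n).+1.
 by move: (fl x n) (fl x n.+1) a1 a2; clear => a a'; lia. by rewrite apn /ap e subrr normr0 exprn_ge0// ltW.
rewrite apn /ap e; apply: step; first exact: leq_trans mn _.
rewrite -(ltr_nat R) natrX.
have h5 : (2 * fl x n).+1%:R <= 2 ^+ n.+1 :> R.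
 rewrite -e; apply: le_trans h3 _; apply: ler_piMl; first exact: ltW. by move: xk; rewrite -[k.+1%:R]natr1; lra.
by apply: lt_le_trans h5; rewrite ltr_nat.
Qed.

Let ap_dist x n i : k%:R <= x <= k.+1%:R -> (m0 <= n)%N -> `|g (ap x (n + i)) - g (ap x n)| <= th ^+ n * (1 - th ^+ i) / (1 - th).
Proof.
move=> kx mn; have t1 : 0 < 1 - th by rewrite subr_gt0.
elim: i => [|i IH]; first by rewrite addn0 subrr normr0 expr0 subrr mulr0 mul0r.
rewrite addnS -(subrKA (g (ap x (n + i)))); apply: le_trans (ler_normD _ _) _.
apply: le_trans (lerD (ap_step kx (leq_trans mn (leq_addr i n))) IH) _.
have -> : th ^+ n * (1 - th ^+ i.+1) / (1 - th) = th ^+ (n + i) + th ^+ n * (1 - th ^+ i) / (1 - th).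
 by rewrite exprS exprD; field; rewrite gt_eqF.
by rewrite lerD2r exprS; apply: ler_piMl; [exact: exprn_ge0 (ltW th0)|exact: ltW].
Qed.

Let ap_lim x n : k%:R <= x <= k.+1%:R -> (m0 <= n)%N -> `|g x - g (ap x n)| <= th ^+ n / (1 - th).
Proof.
move=> kx mn; have t1 : 0 < 1 - th by rewrite subr_gt0.
have c : `|g (ap x (i + n)) - g (ap x n)| @[i --> \oo] --> `|g x - g (ap x n)|.
 apply: cvg_norm; apply: cvgB; last exact: cvg_cst. have /andP[kx0 _] := kx. have h := cvg_comp _ _ (ap_cvg kx0) (@cg x). by rewrite (cvg_shiftn n (fun i => g (ap x i))).
apply: (@closed_cvg _ _ _ eventually_filter _ [set z : R | z <= th ^+ n / (1 - th)] _ _ _ c); first exact: closed_le.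
apply: nearW => i /=; rewrite addnC; apply: le_trans (ap_dist i kx mn) _.
apply: ler_wpM2r; first by rewrite invr_ge0 ltW.
have e1 j : 0 <= th ^+ j by exact: exprn_ge0 (ltW th0).
by apply: ler_piMr => //; rewrite gerBl.
Qed.

(** Two geometric tails lead from [x] and [y] to their dyadic approximations of level [n], which are
    equal or adjacent because [|x - y| <= 2 ^ - n]. *)
Lemma chain_modulus n x y : (m0 <= n)%N -> k%:R <= x <= k.+1%:R -> k%:R <= y <= k.+1%:R -> `|x - y| <= (2 ^+ n)^-1 ->
 `|g x - g y| <= th ^+ n * (1 + 2 / (1 - th)).
Proof.
wlog xy : x y / x <= y.
 move=> H; have [h|h] := leP x y; first exact: H. by move=> mn kx ky; rewrite distrC => d; rewrite distrC; apply: H => //; exact: ltW.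
move=> mn kx ky; rewrite distrC ger0_norm ?subr_ge0// => d.
have t1 : 0 < 1 - th by rewrite subr_gt0.
have /andP[kx0 kx1] := kx; have /andP[ky0 ky1] := ky.
have /andP[h1 h2] := flP n kx0; have /andP[h3 h4] := flP n ky0.
have a1 : (fl x n < (fl y n).+1)%N.
 rewrite -(ltr_nat R); apply: le_lt_trans h1 _; apply: le_lt_trans h4; apply: ler_wpM2r; [exact: ltW|move: xy; lra].
have a2 : (fl y n < (fl x n).+2)%N.
 rewrite -(ltr_nat R); apply: le_lt_trans h3 _. have -> : (y - k%:R) * 2 ^+ n = (x - k%:R) * 2 ^+ n + (y - x) * 2 ^+ n by ring.
 have d' : (y - x) * 2 ^+ n <= 1 by rewrite -ler_pdivlMr// mul1r. by move: h2; rewrite -[(fl x n).+2%:R]natr1; lra.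
have mid : `|g (ap x n) - g (ap y n)| <= th ^+ n.
 have [e|e] : fl y n = fl x n \/ fl y n = (fl x n).+1. by move: (fl x n) (fl y n) a1 a2; clear => a a'; lia. by rewrite /ap e subrr normr0 exprn_ge0// ltW.
 rewrite /ap e distrC; apply: step => //; rewrite -(ltr_nat R) natrX. have h5 : (fl x n).+1%:R <= 2 ^+ n :> R.
  rewrite -e; apply: le_trans h3 _; apply: ler_piMl; first exact: ltW. by move: ky1; rewrite -[k.+1%:R]natr1; lra. by apply: lt_le_trans h5; rewrite ltr_nat.
have -> : g x - g y = (g x - g (ap x n)) + (g (ap x n) - g (ap y n)) - (g y - g (ap y n)) by ring.
apply: le_trans (ler_normB _ _) _; apply: le_trans (lerD (ler_normD _ _) (lexx _)) _.
have l1 := ap_lim kx mn; have l2 := ap_lim ky mn.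
have -> : th ^+ n * (1 + 2 / (1 - th)) = th ^+ n / (1 - th) + th ^+ n + th ^+ n / (1 - th) by ring.
by apply: lerD => //; exact: lerD.
Qed.

(** At level [m0] at most [2 ^ m0] links, each of length at most 1, join [k] to the approximation of
    [x]; a geometric tail does the rest. *)
Lemma chain_bound x : k%:R <= x <= k.+1%:R -> `|g x - g k%:R| <= (2 ^ m0)%:R + (1 + 2 / (1 - th)).
Proof.
move=> kx; have t1 : 0 < 1 - th by rewrite subr_gt0.
have st j : (j <= 2 ^ m0)%N -> `|g (k%:R + j%:R / 2 ^+ m0) - g k%:R| <= j%:R.
 elim: j => [|j IH] hj; first by rewrite mul0r addr0 subrr normr0. rewrite -(subrKA (g (k%:R + j%:R / 2 ^+ m0))); apply: le_trans (ler_normD _ _) _.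
 have h1 : th ^+ m0 <= 1 by apply: exprn_ile1; exact: ltW. have h2 := le_trans (step (leqnn _) hj) h1; have h3 := IH (ltnW hj). by rewrite -[leRHS]natr1 [leRHS]addrC; exact: lerD.
have /andP[kx0 kx1] := kx; have /andP[h1 h2] := flP m0 kx0.
have fm : (fl x m0 <= 2 ^ m0)%N.
 rewrite -(ler_nat R) natrX; apply: le_trans h1 _; apply: ler_piMl; first exact: ltW. by move: kx1; rewrite -[k.+1%:R]natr1; lra.
rewrite -(subrKA (g (ap x m0))); apply: le_trans (ler_normD _ _) _; rewrite addrC; apply: lerD.
 by apply: le_trans (st _ fm) _; rewrite ler_nat.
apply: le_trans (ap_lim kx (leqnn _)) _.
apply: (@le_trans _ _ (1 / (1 - th))).
 by apply: ler_wpM2r; [rewrite invr_ge0 ltW|apply: exprn_ile1; exact: ltW].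
have : 0 <= (1 - th)^-1 by rewrite invr_ge0 ltW.
by rewrite mul1r; lra.
Qed.
End chaining.

Lemma ultra_fmap (T U : Type) (h : T -> U) (F : set_system T) : UltraFilter F -> UltraFilter (h @ F).
Proof.
move=> UF; split; first exact: fmap_proper_filter.
move=> G PG sub; apply/seteqP; split => [A GA|A]; last exact: sub.
have [//|FC] := in_ultra_setVsetC (h @^-1` A) UF.
have GC : G (~` A) by exact: sub.
by have := filter_ex (filterI GA GC) => -[x [Ax]]; move/(_ Ax).
Qed.

(** * Compact sets of paths *)

Section compactness.
Variable R : realType.

Lemma half_point_subproof (x : R) : Num.max 0 x \in (`[0, +oo[%classic : set R).
Proof. by apply/mem_set; rewrite /= in_itv/= andbT le_max lexx. Qed.
Definition half_point (x : R) : halfline R := SigSub (half_point_subproof x).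
Local Notation hl := half_point.

Lemma half_point_val (s : halfline R) : hl (set_val s) = s.
Proof.
apply: val_inj => /=; case: s => x hx /=; rewrite max_r//.
by have := set_mem hx; rewrite /= in_itv/= andbT.
Qed.

Lemma half_point_continuous : continuous hl.
Proof.
apply: continuous_comp_initial => x /=.
by apply: (@continuous_max R R (cst 0) id); [exact: cvg_cst|exact: cvg_id].
Qed.

Lemma Cspace_continuous (z : Cspace R) : continuous (fun x => z (hl x)).
Proof.
move=> x; apply: continuous_comp; first exact: half_point_continuous.
exact: cts_fun.
Qed.

(** The candidate compact sets: control at 0, and of the dyadic increments on each [[k, k + 1]] from
    level [M k] on. These are countably many conditions on values at fixed times, suited to union
    bounds. *)
Definition chain_set (N : R) (M : nat -> nat) (th : R) : set (Cspace R) :=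
 [set z | `|z (hl 0)| <= N /\ forall k m j : nat, (M k <= m)%N -> (j < 2 ^ m)%N ->
   `|z (hl (k%:R + j.+1%:R / 2 ^+ m)) - z (hl (k%:R + j%:R / 2 ^+ m))| <= th ^+ m].

Section fixed.
Variables (N th : R) (M : nat -> nat).
Hypotheses (th0 : 0 < th) (th1 : th < 1).
Local Notation C := (chain_set N M th).

Lemma chain_set_modulus (x e : R) : 0 <= x -> 0 < e -> exists2 d : R, 0 < d &
 forall z : Cspace R, C z -> forall y, 0 <= y -> `|y - x| < d -> `|z (hl x) - z (hl y)| <= e.
Proof.
move=> x0 e0; have t1 : 0 < 1 - th by rewrite subr_gt0.
pose c := 1 + 2 / (1 - th); have c0 : 0 < c by rewrite ltr_wpDr// divr_ge0// ltW.
have ct : th ^+ n * c @[n --> \oo] --> (0 : R).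
 by rewrite -(mul0r c); apply: cvgM; [apply: cvg_expr; rewrite ger0_norm// ltW|exact: cvg_cst].
have e2 : 0 < e / 2 by rewrite divr_gt0.
have [n0 _ hn] : \forall n \near \oo, th ^+ n * c < e / 2 by apply: (cvgr_lt _ ct).
pose k := Num.truncn x.
have /andP[kx xk] : k%:R <= x < k.+1%:R by exact: truncn_itv.
(* The level [M k.-1] is included because [y] may lie in the unit interval preceding that of [x]. *)
pose n := (n0 + M k + M k.-1)%N.
have hc : th ^+ n * c < e / 2 by apply: hn => /=; rewrite /n -addnA leq_addr.
exists (Num.min (2 ^+ n)^-1 (Num.min (k.+1%:R - x) 1)).
 by rewrite !lt_min ltr01 invr_gt0 exprn_gt0// subr_gt0 xk.
move=> z [_ hz] y y0; rewrite !lt_min => /and3P[d1 d2 d3].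
have md (i : nat) u v : (M i <= n)%N -> i%:R <= u <= i.+1%:R -> i%:R <= v <= i.+1%:R -> `|u - v| <= (2 ^+ n)^-1 ->
  `|z (hl u) - z (hl v)| <= e / 2. move=> Mi hu hv huv; apply: le_trans (ltW hc). exact: (chain_modulus th0 th1 (@Cspace_continuous z) (hz i) Mi hu hv huv).
have hyk : y <= k.+1%:R by move: d2; rewrite ltr_norml => /andP[_]; lra.
have Mk : (M k <= n)%N by exact: leq_trans (leq_addl n0 (M k)) (leq_addr _ _).
have Mk1 : (M k.-1 <= n)%N by exact: leq_addl.
have [ky|yk] := leP k%:R y.
 apply: le_trans (_ : e / 2 <= _); last by rewrite ler_pdivrMr// ler_pMr// ler1n. by apply: (md k) => //; rewrite ?kx ?ky ?(ltW xk)// distrC ltW.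
have k1 : (0 < k)%N by move: (le_lt_trans y0 yk); rewrite ltr0n.
have kE : k.-1.+1 = k by rewrite prednK.
have kR : k%:R = (k.-1)%:R + 1 :> R by rewrite -{1}kE -natr1.
have yk1 : (k.-1)%:R <= y by move: d3; rewrite ltr_norml => /andP[h _]; move: kx kR h; lra.
have -> : z (hl x) - z (hl y) = (z (hl x) - z (hl k%:R)) + (z (hl k%:R) - z (hl y)) by rewrite subrKA.
apply: le_trans (ler_normD _ _) _; rewrite [leRHS]splitr; apply: lerD.
 apply: (md k) => //; first by rewrite kx ltW. by rewrite lexx ler_nat leqnSn. apply: le_trans (ltW d1); rewrite ger0_norm ?subr_ge0// ler0_norm; move: yk kx; lra.
apply: (md k.-1) => //; rewrite ?kE ?yk1 ?(ltW yk)//.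
 by rewrite ler_nat leq_pred lexx.
apply: le_trans (ltW d1); rewrite ger0_norm ?subr_ge0 ?(ltW yk)// ler0_norm; move: yk kx; lra.
Qed.

Lemma chain_set_bound (x : R) : 0 <= x -> exists B : R, forall z : Cspace R, C z -> `|z (hl x)| <= B.
Proof.
move=> x0; have kb (k : nat) : exists B : R, forall z : Cspace R, C z -> `|z (hl k%:R)| <= B.
 elim: k => [|k [B hB]]; first by exists N => z []. exists ((2 ^ M k)%:R + (1 + 2 / (1 - th)) + B) => z hz. have kk : ((k%:R : R) <= k.+1%:R) && ((k.+1%:R : R) <= k.+1%:R) by rewrite ler_nat leqnSn lexx.
 have := chain_bound th0 th1 (@Cspace_continuous z) (hz.2 k) kk; have := hB z hz. move=> h1 h2; rewrite -[z (hl k.+1%:R)](subrK (z (hl k%:R))). by apply: le_trans (ler_normD _ _) _; exact: lerD.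
pose k := Num.truncn x.
have /andP[kx xk] : k%:R <= x < k.+1%:R by exact: truncn_itv.
have [B hB] := kb k; exists ((2 ^ M k)%:R + (1 + 2 / (1 - th)) + B) => z hz.
have kk : k%:R <= x <= k.+1%:R by rewrite kx ltW.
have := chain_bound th0 th1 (@Cspace_continuous z) (hz.2 k) kk; have := hB z hz.
move=> h1 h2; rewrite -[z (hl x)](subrK (z (hl k%:R))).
by apply: le_trans (ler_normD _ _) _; exact: lerD.
Qed.

Lemma half_val_ge0 (s : halfline R) : 0 <= set_val s.
Proof. by case: s => x hx; have := set_mem hx; rewrite /= in_itv/= andbT. Qed.

Local Notation inc := (fun z : Cspace R => (z : halfline R -> R)).

Lemma chain_set_equicontinuous : equicontinuous (inc @` C) id.
Proof.
move=> s E; rewrite -entourage_ballE => -[e /= e0 he].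
have e2 : 0 < e / 2 by rewrite divr_gt0.
have [d d0 hd] := chain_set_modulus (half_val_ge0 s) e2.
have cval : continuous (set_val : halfline R -> R) by exact: initial_continuous.
have : \forall y \near s, `|set_val y - set_val s| < d.
 by have /cvgrPdist_lt /(_ d d0) := cval s; apply: filterS => y /=; rewrite distrC.
apply: filterS => y hy i [z hz <-]; apply: he => /=.
apply: (@le_lt_trans _ _ (e / 2)); last by rewrite ltr_pdivrMr// ltr_pMr// ltr1n.
by have := hd z hz _ (half_val_ge0 y) hy; rewrite !half_point_val.
Qed.

(** Arzela-Ascoli with ultrafilters: boundedness gives pointwise limits, closedness of the
    conditions keeps them in the set, and equicontinuity upgrades pointwise to compact
    convergence. *)
Lemma chain_set_compact : compact C.
Proof.
rewrite compact_ultra => F UF FC.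
have ev (s : halfline R) : exists l : R, (fun z : Cspace R => z s) @ F --> l.
 have [B hB] := chain_set_bound (half_val_ge0 s). have := @segment_compact R (- B) B; rewrite compact_ultra. move=> /(_ _ (ultra_fmap (fun z : Cspace R => z s) UF)) [|l [_ h]]; last by exists l.
  change (F ((fun z : Cspace R => z s) @^-1` `[- B, B]%classic)). by apply: filterS FC => z hz /=; rewrite in_itv/= -ler_norml; have := hB z hz; rewrite half_point_val.
pose p s := sval (cid (ev s)).
have hp s : (fun z : Cspace R => z s) @ F --> p s by rewrite /p; case: cid.
have lim_le (s s' : halfline R) (e : R) : (forall z, C z -> `|z s - z s'| <= e) -> `|p s - p s'| <= e.
 move=> h; have c : (fun z : Cspace R => `|z s - z s'|) @ F --> `|p s - p s'| by apply: cvg_norm; apply: cvgB; exact: hp.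
 apply: (@closed_cvg _ _ _ _ _ [set x : R | x <= e] _ _ _ c); first exact: closed_le. by apply: filterS FC => z /h.
have cp : continuous p.
 move=> s; have FF : Filter (nbhs s) by exact: nbhs_filter. apply: (iffRL (@cvgrPdist_le _ _ _ (nbhs s) FF p (p s))) => e e0. have [d d0 hd] := chain_set_modulus (half_val_ge0 s) e0.
 have cval : continuous (set_val : halfline R -> R) by exact: initial_continuous. have : \forall y \near s, `|set_val y - set_val s| < d.
  by have /cvgrPdist_lt /(_ d d0) := cval s; apply: filterS => y /=; rewrite distrC. apply: filterS => y hy; apply: lim_le => z hz. by have := hd z hz _ (half_val_ge0 y) hy; rewrite !half_point_val.
pose pz : Cspace R := (mkcts cp : continuousType (halfline R) R).
have Cp : C pz.
 split; last by move=> k m j Mk jm; apply: lim_le => z [_ hz]; exact: hz. have c : (fun z : Cspace R => `|z (hl 0)|) @ F --> `|p (hl 0)| by apply: cvg_norm; exact: hp.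
 apply: (@closed_cvg _ _ _ _ _ [set x : R | x <= N] _ _ _ c); first exact: closed_le. by apply: filterS FC => z [].
exists pz; split => //=.
have hfam : {family compact, inc @ F --> p}.
 apply/pointwise_compact_cvg. apply/near_powerset_filter_fromP; first exact: equicontinuous_subset_id. exists (inc @` C); last exact: chain_set_equicontinuous. change (F (inc @^-1` (inc @` C))).
  by apply: filterS FC => z hz; exists z. by apply/pointwise_cvgP => s; exact: hp.
move=> A /= [_ [[B Bop <-] Bp sBA]].
have : nbhs (p : {family compact, halfline R -> R}) B by rewrite nbhsE; exists B.
move=> /hfam h; change (F (inc @^-1` B)) in h.
by apply: filterS h => z; exact: sBA.
Qed.
End fixed.
End compactness.

(** * From moments of increments to tightness *)

Section tightness.
Context d (Omega : measurableType d) (R : realType) (P : probability Omega R).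

Lemma geometric_union (E : nat -> set Omega) (a r : R) : (forall i, measurable (E i)) -> 0 <= a -> 0 <= r < 1 ->
 (forall i, (P (E i) <= (a * r ^+ i)%:E)%E) -> (P (\bigcup_i E i) <= (a / (1 - r))%:E)%E.
Proof.
move=> mE a0 /andP[r0 r1] hE; have r1' : 0 < 1 - r by rewrite subr_gt0.
apply: (@le_trans _ _ (\sum_(i <oo) P (E i))%E).
 by apply: measure_sigma_subadditive => //; exact: bigcup_measurable.
apply: lime_le; first by apply: is_cvg_nneseries.
apply: nearW => n; apply: (@le_trans _ _ (\sum_(0 <= i < n) (a * r ^+ i)%:E)%E).
 by apply: lee_sum => i _; exact: hE.
rewrite sumEFin lee_fin ler_pdivlMr//.
have -> : (\sum_(0 <= i < n) a * r ^+ i) * (1 - r) = a * (1 - r ^+ n).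
 elim: n => [|n IH]; first by rewrite big_nil expr0 subrr mulr0 mul0r. by rewrite big_nat_recr//= mulrDl IH exprS; ring.
by apply: ler_piMr => //; rewrite gerBl exprn_ge0.
Qed.

Lemma union_bound (n : nat) (E : nat -> set Omega) (x : R) : (forall i, measurable (E i)) -> 
 (forall i, (P (E i) <= x%:E)%E) -> (P (\bigcup_(i in [set i | (i < n)%N]) E i) <= (n%:R * x)%:E)%E.
Proof.
move=> mE hE; apply: (@le_trans _ _ (\sum_(i < n) P (E i))%E).
 apply: content_subadditive => //. by apply: bigcup_measurable. by rewrite bigcup_mkord.
apply: (@le_trans _ _ (\sum_(i < n) x%:E)%E); first by apply: lee_sum.
by rewrite sumEFin sumr_const card_ord mulr_natl.
Qed.

Lemma probU2 (E1 E2 : set Omega) : measurable E1 -> measurable E2 -> (P (E1 `|` E2) <= P E1 + P E2)%E.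
Proof. by move=> m1 m2; exact: measureU2. Qed.

Lemma half_pointE (x : R) : 0 <= x -> set_val (half_point x) = x.
Proof. by move=> x0; change (Num.max 0 x = x); rewrite max_r. Qed.

Variables (X : R -> Omega -> R) (B th : R) (q : nat).
Hypotheses (mX : forall t, 0 <= t -> mfunT (X t)) (cX : cpath X).
Hypotheses (th0 : 0 < th) (th1 : th < 1) (q0 : (0 < q)%N) (hB : forall t, 0 <= t -> (\int[P]_w (X t w ^+ 2)%:E <= B%:E)%E).
Hypothesis hInc : forall e : R, 0 < e -> exists A : set Omega, [/\ measurable A, (P (~` A) <= e%:E)%E &
 exists2 C : R, 0 <= C & forall s m, 0 <= s ->
  (\int[P]_w ((\1_A w * (X (s + (2 ^+ m)^-1) w - X s w)) ^+ q.*2)%:E <= (C * (th ^+ q.*2 ^+ 2 / 2) ^+ m)%:E)%E].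

Lemma shifted_path_val t w s : 0 <= t -> (shifted_path X t w : Cspace R) s = X (t + set_val s) w.
Proof.
move=> t0; rewrite /shifted_path path_ofE//.
have c : continuous (fun s : R => X (Num.max 0 (t + s)) w).
 move=> x; apply: (@continuous_comp _ _ _ (fun s : R => t + s) (fun u => X (Num.max 0 u) w)). by apply: cvgD; [exact: cvg_cst|exact: cvg_id]. exact: (max0_continuous (@cX w)).
have := @continuous_subspaceT _ _ (`[0, +oo[ : set R) _ c.
apply: subspace_eq_continuous => x /set_mem; rewrite /= in_itv/= andbT => x0.
by change (X (Num.max 0 (t + x)) w = X (t + x) w); rewrite max_r// addr_ge0.
Qed.

(** With [r = th ^ (2 q)], Markov's inequality bounds the probability of a large increment at level
    [m] by [C (r / 2) ^ m], and [[k, k + 1]] has [2 ^ m] of them, so the levels sum geometrically.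
    [M k] makes the sum over [k] converge too, uniformly in the shift [t]. *)
Lemma Kolmogorov_tight : C_tight P (shifted_path X).
Proof.
move=> eps eps0.
have e4 : 0 < eps / 4 by rewrite divr_gt0.
have [A [mA hA [C C0 hC]]] := hInc e4.
pose r := th ^+ q.*2.
have q20 : (0 < q.*2)%N by rewrite double_gt0.
have r0 : 0 < r by rewrite exprn_gt0.
have r1 : r < 1 by rewrite exprn_ilt1// ?ltW// -lt0n.
have r1' : 0 < 1 - r by rewrite subr_gt0.
have B0 : 0 <= B.
 by rewrite -lee_fin; apply: le_trans (hB (lexx 0)); apply: integral_ge0 => w _; exact: lee_sqr0.
have [M hM] : exists M : nat -> nat, forall k, C * r ^+ M k / (1 - r) <= eps / 8 * 2^-1 ^+ k.
 have ex k : exists m : nat, C * r ^+ m / (1 - r) <= eps / 8 * 2^-1 ^+ k. have c : C * r ^+ m / (1 - r) @[m --> \oo] --> (0 : R).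
   rewrite -(mul0r (1 - r)^-1) -[X in X * _](mulr0 C); apply: cvgM; last exact: cvg_cst. by apply: cvgM; [exact: cvg_cst|apply: cvg_expr; rewrite ger0_norm// ltW].
  have p0 : 0 < eps / 8 * 2^-1 ^+ k by rewrite mulr_gt0 ?divr_gt0// exprn_gt0// invr_gt0. have [m _ hm] : \forall m \near \oo, C * r ^+ m / (1 - r) < eps / 8 * 2^-1 ^+ k by apply: (cvgr_lt _ c).
  by exists m; apply: ltW; apply: hm => /=. by exists (fun k => sval (cid (ex k))) => k; case: cid.
pose N := Num.sqrt (4 * (B + 1) / eps).
have N2 : N ^+ 2 = 4 * (B + 1) / eps by rewrite sqr_sqrtr// divr_ge0 ?(ltW eps0)// mulr_ge0// addr_ge0.
have N20 : 0 < N ^+ 2 by rewrite N2 divr_gt0// mulr_gt0// ltr_wpDl.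
exists (chain_set N M th); split; first exact: chain_set_compact.
move=> t t0.
pose u k m j : R := t + (k%:R + j%:R / 2 ^+ m).
have u0 k m j : 0 <= u k m j by rewrite !addr_ge0// divr_ge0// exprn_ge0.
have d0 k m j : 0 <= k%:R + j%:R / 2 ^+ m :> R by rewrite !addr_ge0// divr_ge0// exprn_ge0.
have uS k m j : u k m j.+1 = u k m j + (2 ^+ m)^-1 by rewrite /u -natr1; ring.
pose Bd k m j := [set w | th ^+ m < `|X (u k m j.+1) w - X (u k m j) w|].
pose B0' := [set w | N < `|X t w|].
have mgt (g : Omega -> R) (x : R) : mfunT g -> measurable [set w | x < `|g w|].
 move=> mg; rewrite -[X in measurable X]setTI. have mn : mfunT (fun w => `|g w|) by exact: mcompT. rewrite (_ : [set w | x < `|g w|] = (fun w => `|g w|) @^-1` `]x, +oo[%classic); first exact: mn.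
 by apply/seteqP; split => w /=; rewrite in_itv/= andbT.
have mBd k m j : measurable (Bd k m j) by apply: mgt; apply: mfunB; exact: mX.
have mB0 : measurable B0' by apply: mgt; exact: mX.
pose U := \bigcup_k \bigcup_i \bigcup_(j in [set j | (j < 2 ^ (M k + i))%N]) Bd k (M k + i)%N j.
have mU : measurable U.
 by apply: bigcup_measurable => k _; apply: bigcup_measurable => i _; apply: bigcup_measurable => j _; exact: mBd.
have pre : shifted_path X t @^-1` chain_set N M th = ~` (B0' `|` U).
 apply/seteqP; split => w /=. move=> [h1 h2] [h|[k _ [i _ [j /= hj h]]]]. by move: h1; rewrite shifted_path_val// half_pointE// addr0; apply/negP; rewrite -ltNge.
  have := h2 k (M k + i)%N j (leq_addr _ _) hj. rewrite !shifted_path_val// !half_pointE ?d0//. by apply/negP; rewrite -ltNge. move=> h; split.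
  by rewrite shifted_path_val// half_pointE// addr0 leNgt; apply/negP => h1; apply: h; left. move=> k m j Mk jm; rewrite !shifted_path_val// !half_pointE ?d0// leNgt; apply/negP => h1.
 apply: h; right; exists k => //; exists (m - M k)%N => //; exists j; rewrite /= subnKC//.
rewrite pre.
have PB0 : (P B0' <= (eps / 4)%:E)%E.
 have h : ((N ^+ 2)%:E * P B0' <= B%:E)%E. apply: le_trans (hB t0); apply: markov_set => //.
  - by apply/mEFinP; apply: mfunX; exact: mX.
  - by move=> w; rewrite lee_fin sqr_ge0.
  - move=> w /= hw; rewrite lee_fin -[leRHS]real_normK ?num_real//; apply: lerXn2r; rewrite ?nnegrE ?sqrtr_ge0//; exact: ltW.
  - exact: ltW. have fB : P B0' \is a fin_num by exact: fin_num_measure. move: h; rewrite -(fineK fB) -EFinM !lee_fin -ler_pdivlMl// => /le_trans; apply.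
 rewrite N2 invf_div mulrAC ler_pdivrMr ?mulr_gt0 ?ltr_wpDl//. have -> : eps / 4 * (4 * (B + 1)) = eps * (B + 1) by field. by rewrite ler_wpM2l ?(ltW eps0)// lerDl.
have PBd k m j : (P (A `&` Bd k m j) <= (C * (r / 2) ^+ m)%:E)%E.
 have t1 : 0 < (th ^+ m) ^+ q.*2 by rewrite !exprn_gt0. have h : (((th ^+ m) ^+ q.*2)%:E * P (A `&` Bd k m j) <= (C * (r ^+ 2 / 2) ^+ m)%:E)%E.
  apply: le_trans (hC (u k m j) m (u0 _ _ _)); rewrite -uS; apply: markov_set => //.
  - exact: measurableI.
  - apply/mEFinP; apply: mfunX; apply: mfunM; first exact: mindic. by apply: mfunB; exact: mX.
  - by move=> w; rewrite lee_fin -mul2n exprM exprn_ge0// sqr_ge0.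
  - move=> w [hAw hw]; rewrite lee_fin indicE mem_set// mul1r -[leRHS]ger0_norm; last by rewrite -mul2n exprM exprn_ge0// sqr_ge0.
   by rewrite normrX; apply: lerXn2r; rewrite ?nnegrE ?exprn_ge0 ?(ltW th0)//; exact: ltW.
  - exact: ltW. have fB : P (A `&` Bd k m j) \is a fin_num by apply: fin_num_measure; exact: measurableI. move: h; rewrite -(fineK fB) -EFinM !lee_fin -ler_pdivlMl// => /le_trans; apply.
 have -> : (th ^+ m) ^+ q.*2 = r ^+ m by rewrite -!exprM mulnC. have -> : (r ^+ 2 / 2) ^+ m = r ^+ m * (r / 2) ^+ m by rewrite -exprMn; congr (_ ^+ _); ring. by rewrite mulrCA mulKf// gt_eqF// exprn_gt0.
have PU : (P (A `&` U) <= (eps / 4)%:E)%E.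
 have -> : A `&` U = \bigcup_k \bigcup_i \bigcup_(j in [set j | (j < 2 ^ (M k + i))%N]) (A `&` Bd k (M k + i)%N j).
  rewrite setI_bigcupr; apply: eq_bigcupr => k _; rewrite setI_bigcupr; apply: eq_bigcupr => i _. by rewrite setI_bigcupr.
 have mS k i : measurable (\bigcup_(j in [set j | (j < 2 ^ (M k + i))%N]) (A `&` Bd k (M k + i)%N j)). by apply: bigcup_measurable => j _; exact: measurableI.
 have h := @geometric_union _ (eps / 8) 2^-1 (fun k => bigcup_measurable (fun i _ => mS k i)). have E : eps / 8 / (1 - 2^-1) = eps / 4 by field. rewrite -E; apply: h; first by rewrite divr_ge0// ltW.
  by rewrite invr_ge0 ler0n/= invf_lt1// ltr1n. move=> k; apply: (@le_trans _ _ (C * r ^+ M k / (1 - r))%:E); last by rewrite lee_fin.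
 apply: geometric_union => //; first by rewrite mulr_ge0// exprn_ge0// ltW. by rewrite ltW. move=> i; have := @union_bound (2 ^ (M k + i)) (fun j => A `&` Bd k (M k + i)%N j) (C * (r / 2) ^+ (M k + i)).
 move=> /(_ (fun j => measurableI _ _ mA (mBd _ _ j)) (fun j => PBd _ _ j)) /le_trans; apply; rewrite lee_fin. rewrite natrX mulrCA -exprMn mulrCA divff ?mulr1 ?pnatr_eq0// -mulrA -exprD; exact: lexx.
have PT : (P (B0' `|` U) <= eps%:E)%E.
 apply: (@le_trans _ _ (P B0' + (P (~` A) + P (A `&` U)))%E). apply: (le_trans (probU2 mB0 mU)); apply: leeD2l. apply: (@le_trans _ _ (P (~` A `|` (A `&` U)))); last first.
   by apply: probU2; [exact: measurableC|exact: measurableI]. apply: le_measure; rewrite ?inE//. by apply: measurableU; [exact: measurableC|exact: measurableI].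
  by move=> w hw; have [hA'|hA'] := pselect (A w); [right|left]. apply: (@le_trans _ _ ((eps / 4)%:E + ((eps / 4)%:E + (eps / 4)%:E))%E). by apply: leeD => //; exact: leeD.
 by rewrite -!EFinD lee_fin; move: eps0; lra.
rewrite probability_setC; last exact: measurableU.
by rewrite EFinB; apply: leeB.
Qed.
End tightness.

(** * A Tauberian theorem for decreasing kernels *)

Section tauberian_arith.
Variable R : realFieldType.
Implicit Types x y z u v w t : R.
Lemma tau_lip x y z u t w : z <= w -> - z <= x - y -> u - t < y -> u - t - w <= x. Proof. lra. Qed.
Lemma tau_main2 (e k : R) x y z w psi r : x <= y -> z + e * k - x - e * k + y < psi - e * psi + r -> w <= z ->
 w <= (1 - e) * psi + r.
Proof. nra. Qed.
Lemma tau_pos x : 0 <= x -> 0 < 2 * x + 1. Proof. lra. Qed.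
Lemma tau_pos1 x : 0 <= x -> 0 < x + 1. Proof. lra. Qed.
Lemma tau_nE x y : 0 < 2 * y + 1 -> x / (2 * (2 * y + 1)) * (2 * y + 1) = x / 2.
Proof. by move=> h; field; lra. Qed.
Lemma tau_contra (e K ch P n L psi : R) : (L - n - ch) * P <= (1 - e) * psi + (L + n) * (P - (1 - e) * K) + n ->
 n * (2 * P + 1) < (1 - e) * (L * K - psi) - ch * P -> 0 <= n * ((1 - e) * K) -> False.
Proof. nra. Qed.
Lemma tau_half x : 0 < x -> x / 2 < x. Proof. lra. Qed.
Lemma tau_inv x : 0 < x -> x <= 1 -> (1 + x)^-1 <= 1 - x / 2.
Proof. move=> x0 x1; rewrite -div1r ler_pdivrMr; [nra|lra]. Qed.
Lemma tau_e x y z : x <= y -> y <= 1 - z / 2 -> z / 2 <= 1 - x. Proof. lra. Qed.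
Lemma tau_k3 C h (rho D : R) : 0 < C + 1 -> (C + 1) * h * (rho * D / (4 * (C + 1))) = rho * h * D / 4.
Proof. by move=> h1; field; lra. Qed.
Lemma tau_k4 x y D : x / 2 * D <= y -> y <= x * D / 4 -> 0 < x * D -> False. Proof. nra. Qed.
Lemma tau_pair x y e : x <= y + e -> - x <= - y + e -> - e <= y - x /\ y - x <= e.
Proof. by move=> h1 h2; split; lra. Qed.
Lemma tau_mk x e : 0 < x + 1 -> x * e / (x + 1) = x * (e / (x + 1)). Proof. by move=> h; field; lra. Qed.
End tauberian_arith.

Section tauberian.
Variable R : realType.
Notation mu := (leb R).

Definition small_int (g : R -> R) := forall e, 0 < e -> exists2 h0, 0 < h0 &
 forall h, 0 < h < h0 -> \int[mu]_(x in `]0, h]) g x <= e.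

Lemma L1_restrict (g : R -> R) (h : R) : L1 g -> L1 (g \_ `]0, h]).
Proof.
move=> ig; apply: (L1_le _ (integrable_norm ig)).
 by apply/(measurable_restrictT _ _).1 => //; exact: mfunTS (L1_mfun ig).
by move=> x /=; rewrite patchE; case: ifP => _ //; rewrite normr0; exact: normr_ge0.
Qed.

Lemma small_int_le (g1 g2 : R -> R) : L1 g1 -> L1 g2 -> (forall x, g1 x <= g2 x) -> small_int g2 -> small_int g1.
Proof.
move=> i1 i2 le s2 e e0; have [h0 h00 hh] := s2 e e0; exists h0 => // h hlt.
apply: le_trans (hh h hlt); rewrite [leLHS]Rintegral_mkcond [leRHS]Rintegral_mkcond; apply: Rint_le_L1; [exact: L1_restrict|exact: L1_restrict|].
by move=> x; rewrite !patchE; case: ifP.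
Qed.

Lemma bddm_pos : bddm (fun u : R => if 0 < u then 1 else 0 : R).
Proof.
split; first by apply: mfun_ifT => //; exact: measurable_fun_ltr.
by exists 1 => x; case: ifP; rewrite ?normr1 ?normr0.
Qed.

Lemma in_oc (h x : R) : (x \in (`]0, h]%classic : set R)) = (0 < x <= h).
Proof. by apply/idP/idP; rewrite in_setE/= in_itv. Qed.

Lemma Rintegral_uT (T : R) : 0 < T -> \int[mu]_x uT T x = T.
Proof.
move=> T0; transitivity (\int[mu]_(x in `]0, T]) (1 : R)); last first.
 rewrite Rintegral_cst// /= lebesgue_measure_itv/= lte_fin T0 /= mul1r. by rewrite oppr0 addr0.
rewrite [RHS]Rintegral_mkcond; apply: eq_Rintegral => x _; by rewrite patchE in_oc.
Qed.

Section shift_defect.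
Variables (k a : R -> R) (rho C psi : R).
Hypotheses (ik : L1 k) (sk : suppos k) (k0 : forall x, 0 <= k x) (rho0 : 0 < rho) (kd : forall u h, 0 < u -> 0 <= h -> k (u + h) <= expR (- (rho * h)) * k u) (ks : small_int k).
Hypotheses (ba : bddm a) (C0 : 0 <= C) (aC : forall t h, 0 < h -> `|a (t + h) - a t| <= C * h) (hka : rconv k a t @[t --> +oo] --> psi).
Local Notation K := (\int[mu]_x k x).

Section fixed_shift.
Variable (h : R).
Hypothesis h0 : 0 < h.
Let e := expR (- (rho * h)).
(** In [k (u + h) = p u + e k u - r u], [p] is the part of the shifted kernel that looks at the
    times between [t] and [t + h], and [r >= 0] measures how much faster than [exp (- rho h)] the
    kernel decays. *)
Let p (u : R) : R := k (u + h) * (if 0 < u then 0 else 1).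
Let r (u : R) : R := e * k u - k (u + h) * (if 0 < u then 1 else 0).

Let ikh : L1 (fun u => k (u + h)).
Proof. by have := L1_translate (- h) ik; under eq_fun do rewrite opprK. Qed.
Let ikp : L1 (fun u => k (u + h) * (if 0 < u then 1 else 0)).
Proof. exact: (L1_bddM ikh bddm_pos). Qed.
Let ir : L1 r. Proof. exact: (L1B (L1Z e ik) ikp). Qed.
Let ip : L1 p.
Proof.
rewrite (_ : p = fun u => k (u + h) - k (u + h) * (if 0 < u then 1 else 0)); first exact: (L1B ikh ikp).
by apply/funext => u; rewrite /p; case: ifP => _; rewrite !(mulr0, mulr1) ?subrr ?subr0.
Qed.
Let split u : k (u + h) = p u + e * k u - r u.
Proof. by rewrite /p /r; case: ifP => _; ring. Qed.
Let r0 u : 0 <= r u.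
Proof.
rewrite /r; case: ifP => [u0|]; first by rewrite mulr1 subr_ge0; apply: kd => //; exact: ltW.
by rewrite mulr0 subr0 mulr_ge0// expR_ge0.
Qed.
Let p0 u : 0 <= p u. Proof. by rewrite /p mulr_ge0//; case: ifP. Qed.
Let mk : mfunT k := L1_mfun ik.

Let pE : \int[mu]_u p u = \int[mu]_(x in `]0, h]) k x.
Proof.
have mp := L1_mfun ip.
rewrite -(@Rint_translate _ p (- h))// [RHS]Rintegral_mkcond.
apply: eq_Rintegral => x _; rewrite patchE /p subrK subr_gt0 ltNge in_oc.
have [|] := boolP (0 < x <= h).
 by move=> /andP[_ ->]; rewrite mulr1.
rewrite negb_and -leNgt => /orP[x0|/negbTE ->]; last by rewrite mulr0.
by rewrite sk// mul0r.
Qed.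
Let rE : \int[mu]_u r u = \int[mu]_u p u - (1 - e) * K.
Proof.
have : \int[mu]_u k (u + h) = K by exact: Rint_translate.
under eq_Rintegral do rewrite split.
rewrite RintB_L1//; last exact: (L1D ip (L1Z e ik)).
rewrite RintegralD//; last exact: (L1Z e ik).
by rewrite RintegralZl//; move: (\int[mu]_u p u) (\int[mu]_u r u) K => x y z; lra.
Qed.

(** [L] is the upper limit of [a]. At a time [t] with [a t] near [L], the Lipschitz bound keeps [a]
    near [L] up to [t + h], so [p * a] is nearly [L] times the mass of [p], while [r * a] is
    asymptotically at most [L] times the mass of [r]. As [k * a] tends to [psi] at [t] and at
    [t + h], this bounds [L K - psi]. *)
Lemma shift_defect L : (forall n, 0 < n -> \forall t \near +oo, a t <= L + n) ->
 (forall n, 0 < n -> ~ (\forall t \near +oo, a t <= L - n)) ->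
 (1 - e) * (L * K - psi) <= C * h * \int[mu]_(x in `]0, h]) k x.
Proof.
move=> hup hfr; rewrite -pE; have [ma [Ma hMa]] := ba.
have P0 : 0 <= \int[mu]_u p u by apply: Rintegral_ge0 => // x _.
have rI0 : 0 <= \int[mu]_u r u by apply: Rintegral_ge0 => // x _.
have main n : 0 < n -> (L - n - C * h) * \int[mu]_u p u <=
  (1 - e) * psi + (L + n) * \int[mu]_u r u + n. move=> n0; pose m s := Num.max (a s) (L + n). have bm : bddm m.
  split; first exact: measurable_maxr. exists (Ma + `|L + n|) => x; rewrite /m; case: (leP (a x) (L + n)) => _. by rewrite lerDr; apply: le_trans (hMa 0). by apply: le_trans (hMa x) _; rewrite lerDl.
 have mL : m t @[t --> +oo] --> L + n. apply: (@cvg_trans _ ((fun=> L + n) x @[x --> +oo])); last exact: cvg_cst.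
  apply: near_eq_cvg; apply: filterS (hup n n0) => t at0. by rewrite /m max_r. have c1 := rconv_cvg ir bm mL. have c2 : rconv k a (t + h) @[t --> +oo] --> psi.
  by apply: (cvg_comp (fun t : R => t + h) (rconv k a) _ hka); exact: cvg_addrr. have cX : rconv k a (t + h) - e * rconv k a t + rconv r m t @[t --> +oo] --> psi - e * psi + (L + n) * \int[mu]_x r x.
  apply: cvgD => //; apply: cvgB => //; apply: cvgM => //; exact: cvg_cst. have hX : \forall t \near +oo, rconv k a (t + h) - e * rconv k a t + rconv r m t < psi - e * psi + (L + n) * \int[mu]_x r x + n.
  by apply: (cvgr_lt _ cX); rewrite ltrDl. have [t [at1 Xt]] : exists t, L - n < a t /\ rconv k a (t + h) - e * rconv k a t + rconv r m t < psi - e * psi + (L + n) * \int[mu]_x r x + n.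
  apply: contrapT => no; apply: (hfr n n0); apply: filterS hX => t Xt. by rewrite leNgt; apply/negP => at1; apply: no; exists t. have ika := rconv_L1_pt t ik ba.
 have ipa := rconv_L1_pt t ip ba. have ira := rconv_L1_pt t ir ba. have irm := rconv_L1_pt t ir bm. have E : rconv k a (t + h) = rconv p a t + e * rconv k a t - rconv r a t.
  rewrite {1}/rconv; under eq_Rintegral => s _. rewrite addrAC split !mulrDl mulNr -mulrA; over. rewrite RintB_L1//; last exact: (L1D ipa (L1Z e ika)).
  by rewrite RintegralD//; [rewrite RintegralZl//|exact: (L1Z e ika)]. have l1 : rconv r a t <= rconv r m t. by apply: Rint_le_L1 => // s; apply: ler_wpM2l => //; rewrite /m le_max lexx.
 have l2 : (L - n - C * h) * \int[mu]_u p u <= rconv p a t. have -> : \int[mu]_u p u = \int[mu]_s p (t - s) by rewrite Rintegral_reflect//; exact: L1_mfun.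
  have ipt : L1 (fun s => p (t - s)) by exact: L1_reflect. rewrite -RintegralZl//; apply: Rint_le_L1 => //; first exact: L1Z.
  move=> s; rewrite mulrC /p; case: (ltP 0 (t - s)) => [ts|ts]; first by rewrite !(mulr0, mul0r). rewrite mulr1; have [ht|ht] := leP (t - s + h) 0; first by rewrite sk// !mul0r.
  apply: ler_wpM2l => //; move: ts; rewrite le_eqVlt => /orP[/eqP ts|ts]. have -> : s = t by apply/eqP; rewrite eq_sym -subr_eq0 ts.
   by rewrite lerBlDr; apply: ltW; apply: lt_le_trans at1 _; rewrite lerDl mulr_ge0// ltW. have s0 : 0 < s - t by rewrite subr_gt0 -subr_lt0.
  have := aC t s0; rewrite [t + _]addrC subrK ler_norml => /andP[ha _]. have hc : C * (s - t) <= C * h by apply: ler_wpM2l => //; rewrite -subr_ge0 opprB [h + _]addrC ltW. exact: tau_lip hc ha at1.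
 by rewrite -[leRHS]addrA; apply: (tau_main2 l1 _ l2 (e := e) (k := rconv k a t)); move: Xt; rewrite E addrA.
rewrite leNgt; apply/negP => con.
rewrite rE in main; set P := \int[mu]_u p u in P0 main con *.
pose D := (1 - e) * (L * K - psi) - C * h * P.
have D0 : 0 < D by rewrite subr_gt0.
have P1 : 0 < 2 * P + 1 by exact: tau_pos.
pose n := D / (2 * (2 * P + 1)).
have n0 : 0 < n by rewrite divr_gt0// mulr_gt0.
have e1 : 0 <= 1 - e by rewrite subr_ge0 -expR0 ler_expR oppr_le0 mulr_ge0// ltW.
have Kp : 0 <= K by apply: Rintegral_ge0 => // x _.
have nE : n * (2 * P + 1) = D / 2 by exact: tau_nE.
have nK : 0 <= n * ((1 - e) * K) by apply: mulr_ge0; [exact: ltW|exact: mulr_ge0].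
by apply: (tau_contra (main n n0) _ nK); rewrite nE tau_half.
Qed.
End fixed_shift.

(** Were [L K > psi], dividing [shift_defect] by [h] would leave a positive constant on the left, as
    [1 - e >= rho h / 2] when [rho h <= 1], and on the right a multiple of the mass of [k] on []0,
    h]], which vanishes with [h]. *)
Lemma tauberian_upper (eps : R) : 0 < eps -> \forall t \near +oo, a t * K <= psi + eps.
Proof.
move=> eps0; have [ma [Ma hMa]] := ba.
have Kp : 0 <= K by apply: Rintegral_ge0 => // x _.
pose S := [set x : R | \forall t \near +oo, a t <= x].
have S0 : S !=set0.
 by exists Ma; apply: nearW => t; exact: le_trans (ler_norm _) (hMa t).
have hlb : has_lbound S.
 exists (- Ma) => x Sx; have [t tx] : exists t, a t <= x by exact: (@filter_ex _ _ _ _ Sx). by apply: le_trans tx; have := hMa t; rewrite ler_norml => /andP[].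
pose L := inf S.
have hup n : 0 < n -> \forall t \near +oo, a t <= L + n.
 move=> n0; have [x Sx xL] := inf_adherent n0 (conj S0 hlb). by apply: filterS Sx => t /le_trans; apply; exact: ltW.
have hfr n : 0 < n -> ~ (\forall t \near +oo, a t <= L - n).
 move=> n0 h; have : L <= L - n by exact: (ge_inf hlb). by rewrite leNgt ltrBlDr ltrDl n0.
have LK : L * K <= psi.
 rewrite leNgt; apply/negP => con; pose D := L * K - psi. have D0 : 0 < D by rewrite subr_gt0. have C1 : 0 < C + 1 by rewrite ltr_wpDl. have d0 : 0 < rho * D / (4 * (C + 1)) by rewrite divr_gt0 ?mulr_gt0.
 have [h1 h10 hh] := ks d0. pose h := Num.min (h1 / 2) (1 / rho). have h0 : 0 < h by rewrite /h lt_min !divr_gt0.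
 have hh1 : h < h1 by rewrite /h gt_min; apply/orP; left; exact: tau_half. have rh1 : rho * h <= 1. have : h <= 1 / rho by rewrite /h ge_min lexx orbT. by rewrite ler_pdivlMr// mulrC.
 have hP := hh h; rewrite h0 hh1 in hP; have {}hP := hP isT. have := shift_defect h0 hup hfr. set P := (X in _ <= C * h * X); rewrite -/D => key. have rh0 : 0 < rho * h by rewrite mulr_gt0.
 have e1 : rho * h / 2 <= 1 - expR (- (rho * h)). have e2 : expR (- (rho * h)) <= (1 + rho * h)^-1.
   rewrite expRN lef_pV2 ?posrE ?expR_gt0 ?expR_ge1Dx//. by rewrite ltr_wpDl. exact: tau_e e2 (tau_inv rh0 rh1).
 have k1 : rho * h / 2 * D <= C * h * P by apply: le_trans key; apply: ler_wpM2r => //; exact: ltW. have k2 : C * h * P <= (C + 1) * h * (rho * D / (4 * (C + 1))).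
  apply: ler_pM => //; first by rewrite mulr_ge0// ltW. by apply: Rintegral_ge0 => // x _. by apply: ler_wpM2r; [exact: ltW|rewrite lerDl].
 have k3 : (C + 1) * h * (rho * D / (4 * (C + 1))) = rho * h * D / 4 by exact: tau_k3. have k4 : 0 < rho * h * D by rewrite mulr_gt0. by rewrite k3 in k2; exact: tau_k4 k1 k2 k4.
have K1 : 0 < K + 1 by exact: tau_pos1.
have d0 : 0 < eps / (K + 1) by rewrite divr_gt0.
apply: filterS (hup _ d0) => t ht.
have := ler_wpM2r Kp ht; move=> /le_trans; apply; rewrite mulrDl; apply: lerD => //.
by rewrite mulrAC ler_pdivrMr//; apply: ler_wpM2l; [exact: ltW|rewrite lerDl].
Qed.
End shift_defect.

Lemma tauberian_lipschitz (k a : R -> R) (rho C psi : R) : L1 k -> suppos k -> (forall x, 0 <= k x) -> 0 < rho ->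
 (forall u h, 0 < u -> 0 <= h -> k (u + h) <= expR (- (rho * h)) * k u) -> small_int k ->
 bddm a -> 0 <= C -> (forall t h, 0 < h -> `|a (t + h) - a t| <= C * h) ->
 rconv k a t @[t --> +oo] --> psi -> a t * \int[mu]_x k x @[t --> +oo] --> psi.
Proof.
move=> ik sk k0 rho0 kd ks ba C0 aC hka; have [ma [Ma hMa]] := ba.
have ban : bddm (fun t => - a t).
 by split; [exact: mcompT|exists Ma => x; rewrite normrN].
have hkan : rconv k (fun t => - a t) t @[t --> +oo] --> - psi.
 rewrite (_ : rconv k _ = fun t => - rconv k a t); first exact: cvgN. apply/funext => t; rewrite /rconv; under eq_Rintegral do rewrite mulrN.
 by rewrite /Rintegral; under eq_integral do rewrite EFinN; rewrite integralN ?fineN//; exact: integrable_add_def (rconv_L1_pt t ik ba).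
have aCn t h : 0 < h -> `|- a (t + h) - - a t| <= C * h.
 by move=> h0; rewrite -opprD normrN; exact: aC.
apply/cvgrPdist_le => e e0.
have h1 := tauberian_upper ik sk k0 rho0 kd ks ba C0 aC hka e0.
have h2 := tauberian_upper ik sk k0 rho0 kd ks ban C0 aCn hkan e0.
apply: filterS2 h1 h2 => t; rewrite mulNr => t1 t2.
by rewrite ler_norml; apply/andP; exact: tau_pair.
Qed.

(** [be] need not be Lipschitz, so it is averaged over a window of length [de]. The averages
    converge by the Lipschitz case, and [g * be] is close to [g] convolved with them, since it
    varies little over [de] when the mass of [g] near 0 is small. *)
Lemma tauberian (k g be : R -> R) (rho psi : R) : L1 k -> suppos k -> (forall x, 0 <= k x) -> 0 < rho ->
 (forall u h, 0 < u -> 0 <= h -> k (u + h) <= expR (- (rho * h)) * k u) -> small_int k ->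
 L1 g -> suppos g -> (forall x, 0 <= g x) -> (forall u v, 0 < u -> u <= v -> g v <= g u) -> small_int g ->
 bddm be -> rconv k be t @[t --> +oo] --> psi ->
 rconv g be t * \int[mu]_x k x @[t --> +oo] --> psi * \int[mu]_x g x.
Proof.
move=> ik sk k0 rho0 kd ks ig sg g0 gn gs bb hk.
have [mb [M hM]] := bb; have M0 : 0 <= M by exact: le_trans (hM 0).
set K := \int[mu]_x k x; have K0 : 0 <= K by apply: Rintegral_ge0 => // x _.
apply/cvgrPdist_le => e e0.
have MK : 0 < 2 * M * K + 1 by rewrite tau_pos1// !mulr_ge0.
(* The averaging error is at most [2 M] times this number, and has to stay below [e / 2] after
   multiplication by [K]. *)
have e1 : 0 < e / 2 / (2 * M * K + 1) by rewrite !divr_gt0.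
have [h0 h00 hG] := gs _ e1.
pose de := h0 / 2; have de0 : 0 < de by rewrite divr_gt0.
pose w x := de^-1 * uT de x.
have iw : L1 w by apply: L1Z; exact: uT_L1.
have w0 x : 0 <= w x by apply: mulr_ge0; [by rewrite invr_ge0 ltW|by rewrite /uT; case: ifP].
have wI : \int[mu]_x w x = 1.
 by rewrite /w RintegralZl ?Rintegral_uT ?mulVf ?gt_eqF//; exact: uT_L1.
have wtI t : \int[mu]_s w (t - s) = 1 by rewrite Rintegral_reflect//; exact: L1_mfun.
have sw : suppos w by move=> s s0; rewrite /w /uT ltNge s0 mulr0.
have wn u v : 0 < u -> u <= v -> w v <= w u.
 move=> u0 uv; rewrite /w ler_wpM2l ?invr_ge0 ?(ltW de0)// /uT u0 (lt_le_trans u0 uv)/=. by case: (leP v de) => [vd|_]; [rewrite (le_trans uv vd)|by case: ifP].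
pose a := rconv w be; have ba : bddm a by exact: rconv_bddm.
have bgb : bddm (rconv g be) by exact: rconv_bddm.
have bkb : bddm (rconv k be) by exact: rconv_bddm.
have comm m t : L1 m -> rconv m a t = rconv w (rconv m be) t.
 move=> im; rewrite (rconvA t im iw bb) (rconvA t iw im bb). have -> // : rconv m w = rconv w m. by apply/funext => s; rewrite rconvC//; exact: L1_mfun.
have ka : rconv k a t @[t --> +oo] --> psi.
 rewrite (_ : rconv k a = rconv w (rconv k be)); last by apply/funext => t; exact: comm. by have := rconv_cvg iw bkb hk; rewrite wI mulr1.
have aL t h : 0 < h -> `|a (t + h) - a t| <= 2 * M / de * h.
 move=> hp; apply: le_trans (rconv_shift t iw sw w0 wn bb hM M0 hp) _. rewrite -[leRHS]mulrA; apply: ler_wpM2l; first by rewrite mulr_ge0.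
 have -> : de^-1 * h = \int[mu]_x (de^-1 * uT h x). by rewrite RintegralZl ?Rintegral_uT//; exact: uT_L1. rewrite Rintegral_mkcond; apply: Rint_le_L1.
 - apply: (L1_le _ iw). by apply/(measurable_restrictT _ _).1 => //; exact: mfunTS (L1_mfun iw). by move=> x; rewrite patchE; case: ifP => _; rewrite ?normr0// ger0_norm.
 - by apply: L1Z; exact: uT_L1. move=> x; rewrite patchE; rewrite in_oc; case: ifP => hx. by rewrite /w; apply: ler_wpM2l; [by rewrite invr_ge0 ltW|rewrite /uT hx; case: ifP].
 by apply: mulr_ge0; [by rewrite invr_ge0 ltW|by rewrite /uT; case: ifP].
have C0 : 0 <= 2 * M / de by rewrite divr_ge0 ?mulr_ge0// ltW.
have aK := tauberian_lipschitz ik sk k0 rho0 kd ks ba C0 aL ka.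
have baK : bddm (fun t => a t * K).
 have [ma [Ma hMa]] := ba; split; first exact: mfunM. by exists (Ma * K) => x; rewrite normrM (ger0_norm K0) ler_wpM2r.
have := rconv_cvg ig baK aK; move=> /cvgrPdist_le /(_ (e / 2)).
rewrite divr_gt0// => /(_ isT); apply: filterS => t ht.
have gaK : rconv g (fun t => a t * K) t = rconv g a t * K.
 rewrite /rconv; under eq_Rintegral do rewrite mulrA. by rewrite Rintegral_Zr//; exact: (L1_mfun (rconv_L1_pt t ig ba)).
rewrite gaK in ht.
have dif : `|rconv g a t - rconv g be t| <= 2 * M * (e / 2 / (2 * M * K + 1)).
 have i1 := rconv_L1_pt t iw bgb. have i2 : L1 (fun s => w (t - s) * rconv g be t) by apply: (rconv_L1_pt t iw); split=> //; exists `|rconv g be t|.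
 have -> : rconv g be t = \int[mu]_s (w (t - s) * rconv g be t). rewrite Rintegral_Zr; last exact: mreflect (L1_mfun iw). by rewrite wtI mul1r.
 rewrite (comm g t ig) {1}/rconv -RintB_L1//. apply: le_trans (le_normr_Rintegral measurableT (L1B i1 i2)) _.
 have -> : 2 * M * (e / 2 / (2 * M * K + 1)) = \int[mu]_s (2 * M * (e / 2 / (2 * M * K + 1)) * w (t - s)). rewrite RintegralZl//; last exact: L1_reflect. by rewrite wtI mulr1.
 apply: Rint_le_L1; [exact: (integrable_norm (L1B i1 i2))|by apply: L1Z; exact: L1_reflect|]. move=> s; rewrite -mulrBr normrM (ger0_norm (w0 _)) mulrC.
 have [hs|hs] := boolP ((0 < t - s) && (t - s <= de)); last first. by rewrite /w /uT (negbTE hs) !mulr0. apply: ler_wpM2r => //; move/andP: hs => [hs1 hs2].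
 have := rconv_shift s ig sg g0 gn bb hM M0 hs1; rewrite [s + _]addrC subrK distrC => /le_trans; apply. apply: ler_wpM2l; first by rewrite mulr_ge0.
 by apply: hG; rewrite hs1/=; apply: le_lt_trans hs2 _; rewrite /de ltr_pdivrMr// ltr_pMr// ltr1n.
have k1 : 2 * M * (e / 2 / (2 * M * K + 1)) * K <= e / 2.
 have -> : 2 * M * (e / 2 / (2 * M * K + 1)) * K = (2 * M * K) * (e / 2) / (2 * M * K + 1) by rewrite tau_mk// mulrAC.
 by rewrite ler_pdivrMr// mulrC; apply: ler_wpM2l; [by rewrite divr_ge0// ltW|by rewrite lerDl].
have k2 : `|rconv g a t * K - rconv g be t * K| <= e / 2.
 rewrite -mulrBl normrM (ger0_norm K0); apply: le_trans k1; exact: ler_wpM2r.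
rewrite (_ : e = e / 2 + e / 2); last by rewrite -splitr.
by apply: le_trans (lerD ht k2); apply: ler_distD.
Qed.
End tauberian.

(** * Limiting distributions *)

Section clip_lemmas.
Variable R : realType.
Implicit Types M N x : R.

Lemma clip_norm_le M x : 0 <= M -> `|clip M x| <= M.
Proof. by move=> M0; rewrite /clip ler_norml le_max ge_max lexx/= ge_min lexx orbT andbT; lra. Qed.

Lemma clip_id M x : `|x| <= M -> clip M x = x.
Proof. by rewrite ler_norml => /andP[h1 h2]; rewrite /clip min_l// max_r. Qed.

Lemma clip_dist M N x : 0 <= N -> N <= M -> `|clip M x - clip N x| <= `|x - clip N x|.
Proof.
move=> N0 NM; rewrite /clip.
case: (leP x N) => h1; case: (leP x M) => h2; try (exfalso; lra).
- case: (leP (- N) x) => h3; case: (leP (- M) x) => h4; try (exfalso; lra); first by [].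
  by []. by rewrite !ler0_norm; lra.
- case: (leP (- N) N) => h3; last by exfalso; lra.
 by case: (leP (- M) x) => h4; [|exfalso; lra].
case: (leP (- N) N) => h3; last by exfalso; lra.
case: (leP (- M) M) => h4; last by exfalso; lra.
by rewrite !ger0_norm; lra.
Qed.

Lemma clip_continuous M : continuous (clip M).
Proof.
move=> x; have h : {for x, continuous (fun y => Num.max (- M) (Num.min y M))}; last exact: h.
by apply: continuous_max; [exact: cst_continuous|apply: continuous_min; [exact: cvg_id|exact: cst_continuous]].
Qed.

Lemma continuous_compR (T : topologicalType) (x : T -> R) (g : R -> R) : continuous x -> continuous g ->
 continuous (fun z => g (x z)).
Proof. by move=> cx cg z; apply: continuous_comp; [exact: cx|exact: cg]. Qed.

Lemma continuousMR (T : topologicalType) (x y : T -> R) : continuous x -> continuous y ->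
 continuous (fun z => x z * y z).
Proof. by move=> cx cy z; apply: cvgM; [exact: cx|exact: cy]. Qed.

Lemma clip0 x : clip 0 x = 0.
Proof. by rewrite /clip oppr0; case: (leP x 0) => h; [rewrite max_l|rewrite max_l]. Qed.
End clip_lemmas.

Section l2_approximation.
Context d (T : measurableType d) (R : realType) (P : probability T R).

Lemma L2_bnd (U : T -> R) (M : R) : mfunT U -> (forall w, `|U w| <= M) -> L2 P U.
Proof.
move=> mU hM; apply: (@L2_le _ _ _ _ _ (M ^+ 2)) => //; rewrite -(int_cst_le P (M ^+ 2)).
apply: ge0_le_integral => //.
- by move=> w _; exact: lee_sqr0.
- by apply/mEFinP; exact: mfunX.
move=> w _; rewrite lee_fin -[leLHS]real_normK ?num_real//.
by apply: lerXn2r; rewrite ?nnegrE//; exact: le_trans (hM w).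
Qed.

(** [x y - x' y' = (x - x') y + (y - y') x'], with Young's inequality of weight [de] on each
    product. *)
Lemma prod_pt (x x' y y' de : R) : 0 < de -> `|x'| <= `|x| ->
 `|x * y - x' * y'| <= (2 * de)^-1 * (x - x') ^+ 2 + (2 * de)^-1 * (y - y') ^+ 2 + (de / 2 * x ^+ 2 + de / 2 * y ^+ 2).
Proof.
move=> de0 xx; have amgm (a b : R) : `|a * b| <= (2 * de)^-1 * a ^+ 2 + de / 2 * b ^+ 2.
 have h : (2 * de)^-1 * a ^+ 2 + de / 2 * b ^+ 2 - `|a * b| = (2 * de)^-1 * (`|a| - de * `|b|) ^+ 2. by rewrite normrM -[a ^+ 2]real_normK ?num_real// -[b ^+ 2]real_normK ?num_real//; field; lra.
 by rewrite -subr_ge0 h mulr_ge0 ?sqr_ge0// invr_ge0 mulr_ge0// ltW.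
rewrite (_ : x * y - x' * y' = (x - x') * y + (y - y') * x'); last by ring.
apply: le_trans (ler_normD _ _) _.
have h1 := amgm (x - x') y; have h2 := amgm (y - y') x'.
have h3 : de / 2 * x' ^+ 2 <= de / 2 * x ^+ 2.
 rewrite ler_wpM2l ?divr_ge0 ?(ltW de0)//. by rewrite -[x' ^+ 2]real_normK ?num_real// -[x ^+ 2]real_normK ?num_real// lerXn2r ?nnegrE.
by move: h1 h2 h3; lra.
Qed.

Lemma prod_approx (x x' y y' : T -> R) (e B de : R) : L2 P x -> L2 P x' -> L2 P y -> L2 P y' ->
 (forall w, `|x' w| <= `|x w|) -> \int[P]_w ((x w - x' w) ^+ 2) <= e -> \int[P]_w ((y w - y' w) ^+ 2) <= e ->
 \int[P]_w (x w ^+ 2) <= B -> \int[P]_w (y w ^+ 2) <= B -> 0 < de ->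
 `|\int[P]_w (x w * y w) - \int[P]_w (x' w * y' w)| <= e / de + de * B.
Proof.
move=> hx hx' hy hy' xx ex ey Bx By de0.
have sub (U V : T -> R) : L2 P U -> L2 P V -> P.-integrable setT (EFin \o (fun w => (U w - V w) ^+ 2)).
 move=> hU hV; have [_] := L2_lin 1 (-1) hU hV; apply: eq_integrable => // w _ /=. by rewrite mul1r mulN1r.
have iZ r (U : T -> R) : P.-integrable setT (EFin \o U) -> P.-integrable setT (EFin \o (fun w => r * U w)).
 by move=> iU'; exact: (@integrableZl _ _ _ P _ measurableT r (EFin \o U) iU').
have iD (U V : T -> R) : P.-integrable setT (EFin \o U) -> P.-integrable setT (EFin \o V) -> P.-integrable setT (EFin \o (fun w => U w + V w)).
 by move=> iU iV; exact: (integrableD measurableT iU iV).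
have i1 := iZ (2 * de)^-1 _ (sub _ _ hx hx'); have i2 := iZ (2 * de)^-1 _ (sub _ _ hy hy').
have i3 := iZ (de / 2) _ hx.2; have i4 := iZ (de / 2) _ hy.2.
have i12 := iD _ _ i1 i2; have i34 := iD _ _ i3 i4.
have ixy := L2M hx hy; have ixy' := L2M hx' hy'.
have idf : P.-integrable setT (EFin \o (fun w => x w * y w - x' w * y' w)).
 exact: (integrableB measurableT ixy ixy').
rewrite -RintegralB//; apply: le_trans (le_normr_Rintegral measurableT idf) _.
apply: (@le_trans _ _ (\int[P]_w ((2 * de)^-1 * (x w - x' w) ^+ 2 + (2 * de)^-1 * (y w - y' w) ^+ 2 + (de / 2 * x w ^+ 2 + de / 2 * y w ^+ 2)))).
 apply: le_Rintegral => //; [exact: (integrable_norm idf)|exact: iD|]. by move=> w _; exact: prod_pt.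
rewrite RintegralD// (RintegralD measurableT i1 i2) (RintegralD measurableT i3 i4).
have Zl r (U : T -> R) : P.-integrable setT (EFin \o U) -> \int[P]_w (r * U w) = r * \int[P]_w U w.
 by move=> iU; rewrite RintegralZl.
rewrite (Zl _ _ (sub _ _ hx hx')) (Zl _ _ (sub _ _ hy hy')) (Zl _ _ hx.2) (Zl _ _ hy.2).
have d2 : 0 <= (2 * de)^-1 by rewrite invr_ge0 mulr_ge0// ltW.
have d3 : 0 <= de / 2 by rewrite divr_ge0// ltW.
have := lerD (lerD (ler_wpM2l d2 ex) (ler_wpM2l d2 ey)) (lerD (ler_wpM2l d3 Bx) (ler_wpM2l d3 By)).
move=> /le_trans; apply; apply: eq_ler.
have aux (u v s : R) : 0 < u -> (2 * u)^-1 * v + (2 * u)^-1 * v + (u / 2 * s + u / 2 * s) = v / u + u * s.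
 by move=> u0; field; lra.
exact: aux.
Qed.
End l2_approximation.

Lemma norm_quarter (R : realFieldType) (a1 a2 a3 a4 C e : R) : `|a3 - a4| <= e / 4 -> `|a2 - a4| <= e / 4 ->
 `|C - a3| <= e / 4 -> `|a1 - a2| <= e / 4 -> `|a1 - C| <= e.
Proof.
rewrite !ler_norml => /andP[p1 p2] /andP[p3 p4] /andP[p5 p6] /andP[p7 p8].
by apply/andP; split; lra.
Qed.

(** * Second moments under weak convergence *)

Section limit_law.
Context d (Omega : measurableType d) (R : realType) (P : probability Omega R).
Variables (Y : R -> Omega -> Cspace R) (Q : probability (borelC R) R).
Hypothesis hQ : functional_limiting_distribution P Y Q.

Lemma eval_continuous (s : halfline R) : continuous (fun z : Cspace R => z s).
Proof.
move=> z; pose inc := (fun z : continuousType (halfline R) R => ((z : halfline R -> R) : {family compact, halfline R -> R})).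
have ic : (inc @ nbhs (z : Cspace R)) --> inc z by exact: (@initial_continuous _ _ inc z).
exact: ((pointwise_cvgP _ _).1 (pointwise_cvg_compact_family _ ic) s).
Qed.

Lemma borelC_measurable (x : Cspace R -> R) : continuous x -> mfunT (x : borelC R -> R).
Proof.
move=> /continuousP cx; apply: (measurability _ (RGenOpens.measurableE R)).
move=> _ [_ [a [b ->] <-]]; rewrite setTI; apply: sub_sigma_algebra.
by apply: cx; exact: interval_open.
Qed.

(** Uniform integrability of squares along the family, with the tail measured by clipping, a
    continuous operation with bounded values that weak convergence can test. *)
Definition unif_sqr_int (x : Cspace R -> R) := [/\ continuous x,
 exists B : R, forall t, 0 <= t -> L2 P (fun w => x (Y t w)) /\ \int[P]_w (x (Y t w) ^+ 2) <= B &
 forall e : R, 0 < e -> exists2 N : R, 0 <= N & forall t, 0 <= t ->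
  (\int[P]_w ((x (Y t w) - clip N (x (Y t w))) ^+ 2)%:E <= e%:E)%E].

Lemma unif_sqr_int1 : unif_sqr_int (cst 1).
Proof.
split; first exact: (@cst_continuous (Cspace R) R).
 exists 1 => t t0; split; first exact: L2_cst. have -> : (fun w => cst 1 (Y t w) ^+ 2) = cst 1 :> (Omega -> R) by apply/funext => w; rewrite /cst expr1n.
 by have := int_cst_le P 1; rewrite /Rintegral => ->.
move=> e e0; exists 1 => // t t0; rewrite (eq_integral (cst 0%E)) ?integral0 ?lee_fin ?(ltW e0)//.
by move=> w _; rewrite /cst clip_id ?normr1// subrr expr0n.
Qed.

(** The tail functional is unbounded: weak convergence is tested on the bounded continuous
    [(clip (N + k) x - clip N x) ^ 2], and Fatou's lemma lets [k] grow. *)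
Lemma limit_fatou (x : Cspace R -> R) (N e : R) : continuous x -> 0 <= N ->
 (forall t, 0 <= t -> mfunT (fun w => x (Y t w))) ->
 (forall t, 0 <= t -> (\int[P]_w ((x (Y t w) - clip N (x (Y t w))) ^+ 2)%:E <= e%:E)%E) ->
 (\int[Q]_z ((x z - clip N (x z)) ^+ 2)%:E <= e%:E)%E.
Proof.
move=> cx N0 mx hN; have [u [uoo hu]] := hQ.
have mxb := borelC_measurable cx.
have mclip M : mfunT (clip M : R -> R) by apply: cmfun; exact: clip_continuous.
pose f (k : nat) (z : Cspace R) := (clip (N + k%:R) (x z) - clip N (x z)) ^+ 2.
have cf k : continuous (f k).
 apply: (@continuous_compR R (Cspace R) x (fun a => (clip (N + k%:R) a - clip N a) ^+ 2) cx).
 have c1 : continuous (fun a : R => clip (N + k%:R) a - clip N a). by move=> a; apply: cvgB; exact: clip_continuous. exact: continuousMR.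
apply: (@fatou_le _ _ _ Q (fun k z => f k z) (fun z => (x z - clip N (x z)) ^+ 2) (fun=> e)).
- by move=> k; apply: borelC_measurable.
- by move=> k z; exact: sqr_ge0.
- apply: mfunX; apply: mfunB => //; exact: mcompT.
- by move=> z; exact: sqr_ge0.
- apply: aeW => z.
 apply: (@cvg_trans _ ((fun=> (x z - clip N (x z)) ^+ 2) k @[k --> \oo])); last exact: cvg_cst.
 apply: near_eq_cvg; near=> k; rewrite /f [in RHS]clip_id//. have : `|x z| <= k%:R by near: k; exact: nbhs_infty_ger. by move=> /le_trans; apply; rewrite lerDr.
- move=> k; have bf : exists M : R, forall z, `|f k z| <= M.
  exists ((N + k%:R + N) ^+ 2) => z; rewrite /f normrX lerXn2r ?nnegrE ?addr_ge0//. by apply: le_trans (ler_normB _ _) _; apply: lerD; apply: clip_norm_le => //; exact: addr_ge0.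
 have := hu _ (cf k) bf; rewrite unlock => hc. have <- := cvg_lim (@ereal_hausdorff R) hc. apply: lime_le; first by apply/cvg_ex; eexists; exact: hc. near=> n.
 have un0 : 0 <= u n by near: n; move/cvgryPge: uoo; apply. apply: le_trans (hN _ un0); apply: ge0_le_integral => //.
 + by move=> w _; exact: lee_sqr0.
 + apply/mEFinP; apply: mfunX; apply: mfunB; apply: mcompT => //; exact: mx.
 + apply/mEFinP; apply: mfunX; apply: mfunB; first exact: mx. by apply: mcompT => //; exact: mx. move=> w _; rewrite lee_fin /= /f -[leLHS]real_normK ?num_real// -[leRHS]real_normK ?num_real//.
 by apply: lerXn2r; rewrite ?nnegrE//; apply: clip_dist => //; rewrite lerDl.
- exact: cvg_cst.
Unshelve. all: end_near. Qed.

Section one.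
Variable x : Cspace R -> R.
Hypothesis hx : unif_sqr_int x.
Let mx t : 0 <= t -> mfunT (fun w => x (Y t w)).
Proof. by move=> t0; have [_ [B hB] _] := hx; have [[]] := hB t t0. Qed.

Lemma limit_sqr (B : R) : (forall t, 0 <= t -> L2 P (fun w => x (Y t w)) /\ \int[P]_w (x (Y t w) ^+ 2) <= B) ->
 (\int[Q]_z (x z ^+ 2)%:E <= B%:E)%E.
Proof.
move=> hB; have [cx _ _] := hx.
have := @limit_fatou x 0 B cx (lexx 0) mx; rewrite (eq_integral (fun z : borelC R => (x z ^+ 2)%:E)); last first.
 by move=> z _; rewrite clip0 subr0.
apply=> t t0; rewrite (eq_integral (fun w => (x (Y t w) ^+ 2)%:E)); last by move=> w _; rewrite clip0 subr0.
by have [h1 h2] := hB t t0; rewrite L2_Rint// lee_fin.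
Qed.

Lemma limit_L2 : L2 Q (x : borelC R -> R).
Proof.
have [cx [B hB] _] := hx.
by apply: (L2_le (borelC_measurable cx) (limit_sqr hB)).
Qed.
End one.

(** Weak convergence applies to the product of the clipped functionals, and [prod_approx] controls
    the error of clipping in the same way under [P] and under [Q]. *)
Lemma limit_prod (x y : Cspace R -> R) (C : R) : unif_sqr_int x -> unif_sqr_int y ->
 (\int[P]_w (x (Y t w) * y (Y t w))) @[t --> +oo] --> C -> \int[Q]_z (x z * y z) = C.
Proof.
move=> hx hy hC; have [u [uoo hu]] := hQ.
have [cx [B1 hB1] ux] := hx; have [cy [B2 hB2] uy] := hy.
have xQ := limit_L2 hx; have yQ := limit_L2 hy.
have B10 : 0 <= B1 by apply: le_trans (hB1 0 (lexx 0)).2; apply: Rintegral_ge0 => // w _; exact: sqr_ge0.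
have B20 : 0 <= B2 by apply: le_trans (hB2 0 (lexx 0)).2; apply: Rintegral_ge0 => // w _; exact: sqr_ge0.
pose B := B1 + B2; have B0 : 0 <= B by exact: addr_ge0.
have B1B : B1 <= B by rewrite lerDl.
have B2B : B2 <= B by rewrite lerDr.
apply/eqP; rewrite -subr_eq0 -normr_le0; apply/ler_addgt0Pr => e e0; rewrite add0r.
have B1p : 0 < 1 + B by rewrite ltr_pwDl.
(* With clipping error [de ^ 2], [prod_approx] costs [de ^ 2 / de + de B = de (1 + B) = e / 4]. *)
pose de := e / 4 / (1 + B); have de0 : 0 < de by rewrite !divr_gt0.
have deE : de ^+ 2 / de + de * B = e / 4.
 by rewrite expr2 mulfK ?gt_eqF// -{1}[de]mulr1 -mulrDr /de divfK// gt_eqF.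
have de20 : 0 < de ^+ 2 by rewrite exprn_gt0.
have [N1 N10 h1] := ux _ de20; have [N2 N20 h2] := uy _ de20.
have mclip M : mfunT (clip M : R -> R) by apply: cmfun; exact: clip_continuous.
pose x' z := clip N1 (x z); pose y' z := clip N2 (y z).
have xx z : `|x' z| <= `|x z|.
 by have := @clip_dist R N1 0 (x z) (lexx 0) N10; rewrite clip0 !subr0.
have gen d' (T : measurableType d') (M : probability T R) (U : T -> R) N : 0 <= N ->
  L2 M U -> (\int[M]_w ((U w - clip N (U w)) ^+ 2)%:E <= (de ^+ 2)%:E)%E -> L2 M (fun w => clip N (U w)) /\ \int[M]_w ((U w - clip N (U w)) ^+ 2) <= de ^+ 2.
 move=> Nn hU hi; have hc : L2 M (fun w => clip N (U w)). apply: (@L2_bnd _ _ _ _ _ N); last by move=> w; exact: clip_norm_le. by apply: mcompT => //; have [] := hU.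
 split => //; rewrite -lee_fin -L2_Rint//. have := L2_lin 1 (-1) hU hc; rewrite (_ : (fun w => _) = fun w => U w - clip N (U w))//. by apply/funext => w; rewrite mul1r mulN1r.
have mxP t : 0 <= t -> mfunT (fun w => x (Y t w)) by move=> t0; have [[]] := hB1 t t0.
have myP t : 0 <= t -> mfunT (fun w => y (Y t w)) by move=> t0; have [[]] := hB2 t t0.
have [xQ' exQ] := gen _ _ Q _ _ N10 xQ (limit_fatou cx N10 mxP h1).
have [yQ' eyQ] := gen _ _ Q _ _ N20 yQ (limit_fatou cy N20 myP h2).
have BxQ : \int[Q]_z (x z ^+ 2) <= B.
 by rewrite -lee_fin -L2_Rint//; apply: le_trans (limit_sqr hx hB1) _; rewrite lee_fin.
have ByQ : \int[Q]_z (y z ^+ 2) <= B.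
 by rewrite -lee_fin -L2_Rint//; apply: le_trans (limit_sqr hy hB2) _; rewrite lee_fin.
have aQ := prod_approx xQ xQ' yQ yQ' xx exQ eyQ BxQ ByQ de0; rewrite deE in aQ.
have aP t : 0 <= t -> `|\int[P]_w (x (Y t w) * y (Y t w)) - \int[P]_w (x' (Y t w) * y' (Y t w))| <= e / 4.
 move=> t0; have [xP Bx] := hB1 t t0; have [yP By] := hB2 t t0. have [xP' exP] := gen _ _ P _ _ N10 xP (h1 t t0). have [yP' eyP] := gen _ _ P _ _ N20 yP (h2 t t0).
 by rewrite -deE; apply: prod_approx => //; [exact: le_trans B1B|exact: le_trans B2B].
have cxy : continuous (fun z => x' z * y' z).
 by apply: (@continuousMR R (Cspace R)); apply: (@continuous_compR R (Cspace R)) => //; exact: clip_continuous.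
have bxy : exists M : R, forall z, `|x' z * y' z| <= M.
 by exists (N1 * N2) => z; rewrite normrM; apply: ler_pM => //; exact: clip_norm_le.
have := hu _ cxy bxy; rewrite unlock => hc.
have iQ := L2M xQ' yQ'.
have {}hc : (\int[P]_w (x' (Y (u n) w) * y' (Y (u n) w))) @[n --> \oo] --> \int[Q]_z (x' z * y' z).
 apply: (fine_cvg (f := fun n => (\int[P]_w ((x' (Y (u n) w) * y' (Y (u n) w)))%:E)%E)). by rewrite /Rintegral fineK; [exact: hc|exact: integrable_fin_num iQ].
have hCu : (\int[P]_w (x (Y (u n) w) * y (Y (u n) w))) @[n --> \oo] --> C.
 exact: (cvg_comp u _ uoo hC).
have e4 : 0 < e / 4 by rewrite divr_gt0.
have near1 : \forall n \near \oo, `|\int[Q]_z (x' z * y' z) - \int[P]_w (x' (Y (u n) w) * y' (Y (u n) w))| <= e / 4.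
 by move/cvgrPdist_le: hc; apply.
have near2 : \forall n \near \oo, `|C - \int[P]_w (x (Y (u n) w) * y (Y (u n) w))| <= e / 4.
 by move/cvgrPdist_le: hCu; apply.
have near3 : \forall n \near \oo, 0 <= u n by move/cvgryPge: uoo; apply.
have [n [n1 [n2 n3]]] := filter_ex (filterI near1 (filterI near2 near3)).
exact: norm_quarter (aP _ n3) n1 n2 aQ.
Qed.
End limit_law.

Section l2_expectation.
Context d (T : measurableType d) (R : realType) (P : probability T R).

Lemma L2_Lfun1 (U : T -> R) : L2 P U -> U \in Lfun P 1.
Proof. by move=> hU; apply/Lfun1_integrable; exact: L2_int. Qed.

Lemma L2_Lfun2 (U : T -> R) : L2 P U -> U \in Lfun P 2%:E.
Proof.
move=> hU; have [mU iU] := hU; rewrite inE; apply/andP; split; rewrite inE//=.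
rewrite /finite_norm unlock poweR_lty//.
rewrite (eq_integral (fun w => (U w ^+ 2)%:E)); first by rewrite L2_Rint// ltry.
by move=> w _ /=; rewrite powR_mulrn// real_normK// num_real.
Qed.

Lemma Lfun2_L2 (U : T -> R) : U \in Lfun P 2%:E -> L2 P U.
Proof.
move=> hU; split; last exact: Lfun2_integrable_sqr.
by move: hU; rewrite inE => /andP[+ _]; rewrite inE.
Qed.

Lemma L2_expectation (U : T -> R) : L2 P U -> ('E_P[U] = (\int[P]_w U w)%:E)%E.
Proof. by move=> hU; rewrite unlock /Rintegral fineK//; exact: integrable_fin_num (L2_int hU). Qed.

Lemma L2_covariance (U V : T -> R) : L2 P U -> L2 P V ->
 covariance P U V = (\int[P]_w (U w * V w) - \int[P]_w U w * \int[P]_w V w)%:E.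
Proof.
move=> hU hV; have iUV := L2M hU hV.
have h3 : (U * V)%R \in Lfun P 1 by exact/Lfun1_integrable.
rewrite (covarianceE (L2_Lfun1 hU) (L2_Lfun1 hV) h3).
rewrite (L2_expectation hU) (L2_expectation hV) EFinB EFinM; congr (_ - _)%E.
by rewrite unlock /Rintegral fineK//; exact: integrable_fin_num iUV.
Qed.

Lemma L2_Lnorm (U : T -> R) (x : R) : (\int[P]_w (U w ^+ 2)%:E = x%:E)%E ->
 Lnorm P 2%:E (fun w => (U w)%:E) = (Num.sqrt x)%:E.
Proof.
move=> hx; have x0 : 0 <= x by rewrite -lee_fin -hx; apply: integral_ge0 => w _; exact: lee_sqr0.
rewrite unlock (eq_integral (fun w => (U w ^+ 2)%:E)).
 by rewrite hx poweR_EFin powR12_sqrt.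
by move=> w _ /=; rewrite powR_mulrn// real_normK// num_real.
Qed.
End l2_expectation.

Lemma Rintegral_halfline (R : realType) (G H : R -> R) : L1 H -> suppos H -> (forall x, 0 < x -> G x = H x) ->
 \int[lebesgue_measure]_(x in `[0, +oo[) G x = \int[lebesgue_measure]_x H x.
Proof.
move=> iH sH GH.
transitivity (\int[lebesgue_measure]_(x in `]0%R, +oo[) G x).
 rewrite /Rintegral; congr fine; rewrite integral_itv_obnd_cbnd//. apply: (eq_measurable_fun (EFin \o H)). by move=> x; rewrite inE/= in_itv/= andbT => x0 /=; rewrite GH.
 by apply/mEFinP; apply: mfunTS; exact: L1_mfun iH.
rewrite Rintegral_mkcond; apply: eq_Rintegral => x _; rewrite patchE.
have -> : (x \in (`]0, +oo[%classic : set R)) = (0 < x).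
 by apply/idP/idP; rewrite in_setE/= in_itv/= andbT.
by case: ltP => x0; [exact: GH|rewrite sH].
Qed.

(** * Tightness and long-run covariances of the solution *)

Section limiting_regime.
Context d (Omega : measurableType d) (R : realType) (P : probability Omega R).
Variables (F : R -> set (set Omega)) (W : R -> Omega -> R).
Hypotheses (hF : usual_conditions P F) (hW : is_brownian P F W).
Notation mu := (leb R).
Variables (alpha rho lambda : R) (Rl : R -> R).
Hypotheses (alpha1 : 2^-1 < alpha) (alpha2 : alpha < 1) (rho0 : 0 < rho) (lambda0 : 0 < lambda) (hRl : is_resolvent (gamma_kernel alpha rho) lambda Rl).
Variables (m0 c Mv : R) (drift vs : R -> R).
Hypothesis cdrift : {within `[0, +oo[, continuous drift}.
Hypotheses (cvs : {within `[0, +oo[, continuous vs}) (Mvs : forall t, 0 <= t -> `|vs t| <= Mv) (hM : scaling_equation lambda m0 c (resolvent_density Rl) drift vs).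
Variables (k0 k1 k2 : R).
Hypotheses (hk0 : 0 <= k0) (hk2 : 0 < k2) (hk1 : k1 ^+ 2 <= 4 * k2 * k0).
Hypotheses (c0 : 0 < c) (hc : c < (2 * alpha - 1) / (8 * k2)).
Local Notation sg := (diffusion_coef k0 k1 k2).
Local Notation f := (resf Rl).
Local Notation q := (mom_order alpha).
Local Notation b := (lambda^-1).
Variables (X0 : Omega -> R) (X : R -> Omega -> R) (v0 : R).
Hypotheses (aX0 : meas_wrt (F 0) X0) (hE : ('E_P[X0] = m0%:E)%E) (hV : ('V_P[X0] = v0%:E)%E) (hv0 : v0 = c * sg m0 ^+ 2 / (1 - c * k2)).
Hypothesis hX : is_solution P F W lambda m0 (resolvent_density Rl) drift vs sg X0 X.
Variables (mu_inf : R).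
Local Notation phi := (phi lambda Rl m0 drift).
Hypothesis hmu : drift t @[t --> +oo] --> mu_inf.

Let mX t : 0 <= t -> mfunT (X t).
Proof. by move=> t0; have [h _ _] := hX; apply: (mF_meas hF t0); apply/(meas_wrtP hF) => //; exact: h. Qed.
Let cX w : {within `[0, +oo[, continuous (X^~ w)}. Proof. by have [_ h _] := hX. Qed.
Let inc n := solution_increment hF hW alpha1 alpha2 rho0 lambda0 hRl cdrift cvs Mvs hM hk0 hk2 hk1 c0 hc aX0 hX n (drift_bddm cdrift hmu).
Let sL2 t := @solution_L2 _ _ _ _ F W hF hW _ _ _ _ alpha1 alpha2 rho0 lambda0 hRl _ _ _ _ _ cvs Mvs hM _ _ _ hk0 hk2 hk1 c0 hc _ _ _ aX0 hE hV hX t.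
Let ssqr t := @stationary_sqr _ _ _ _ F W hF hW _ _ _ _ alpha1 alpha2 rho0 lambda0 hRl _ _ _ _ _ cvs Mvs hM _ _ _ hk0 hk2 hk1 c0 hc _ _ _ aX0 hE hV hv0 hX t.
Let scov s t := @stationary_cov _ _ _ _ F W hF hW _ _ _ _ alpha1 alpha2 rho0 lambda0 hRl _ _ _ _ _ cvs Mvs hM _ _ _ hk0 hk2 hk1 c0 hc _ _ _ aX0 hE hV hv0 hX s t.

Let q0 : (0 < q)%N. Proof. by []. Qed.
Let be := q%:R * (2 * alpha - 1) - 1.
Let be0 : 0 < be. Proof. by rewrite subr_gt0; exact: mom_order_gt. Qed.
(** Chosen so that [th ^ (4 q) / 2 = 2 ^ (- q (2 alpha - 1))]: the moment bound of an increment over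
    [2 ^ - m] then has the form required by [Kolmogorov_tight]. The excess [be] of the exponent over
    1 makes [th < 1]. *)
Let th := 2 `^ (- (be / (4 * q%:R))).

Let pow2X (x : R) n : (2 `^ x) ^+ n = 2 `^ (x * n%:R) :> R.
Proof. by rewrite -powR_mulrn ?powR_ge0// -powRrM. Qed.

Let thE m : (((2 ^+ m)^-1) `^ (2 * alpha - 1)) ^+ q = (th ^+ q.*2 ^+ 2 / 2) ^+ m.
Proof.
have q1 : q%:R != 0 :> R by rewrite pnatr_eq0.
have -> : (2 ^+ m)^-1 = 2 `^ (- m%:R) :> R by rewrite powRN powR_mulrn.
have half : (2 : R)^-1 = 2 `^ (- 1) by rewrite powRN powRr1.
rewrite -powRrM pow2X /th !pow2X half -powRD ?pnatr_eq0 ?implybT// pow2X.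
congr (_ `^ _); rewrite -mul2n natrM /be; move: q1; move: (q%:R) (m%:R) => x y x0.
by field.
Qed.

Let fm := resf_measurable alpha1 alpha2 rho0 hRl.
Let f0 := resf_ge0 alpha1 alpha2 rho0 lambda0 hRl.
Let f2 := resf2_L1 alpha1 alpha2 rho0 lambda0 hRl.
Let fs : suppos f := @resf_supp R Rl.
Let fn := resf_nincr alpha1 alpha2 rho0 lambda0 hRl.
Let k x := f x ^+ 2.
Let g h x := f (x + h) * f x.
Let a21 : 0 < 2 * alpha - 1.
Proof. by rewrite subr_gt0 mulrC -ltr_pdivrMr// div1r. Qed.

Let k_small : small_int k.
Proof.
move=> e e0.
pose D := (lambda * gamC alpha) ^+ 2 / (2 * alpha - 1).
have D0 : 0 <= D by rewrite divr_ge0 ?sqr_ge0// ltW.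
have D1 : 0 < D + 1 by rewrite ltr_wpDl.
have e1 : 0 < e / (D + 1) by rewrite divr_gt0.
exists ((e / (D + 1)) `^ (2 * alpha - 1)^-1); first exact: powR_gt0.
move=> h /andP[h0 hh]; apply: le_trans (resf2_small alpha1 alpha2 rho0 lambda0 hRl h0) _.
have hp : h `^ (2 * alpha - 1) <= e / (D + 1).
 have := ge0_ler_powR (ltW a21) (ltW h0) (powR_ge0 _ _) (ltW hh). by rewrite -powRrM mulVf ?gt_eqF// powRr1// ltW.
rewrite mulrCA mulrC -/D; apply: (@le_trans _ _ (D * (e / (D + 1)))); first exact: ler_wpM2l.
by rewrite mulrA mulrAC ler_piMl ?(ltW e0)// ler_pdivrMr// mul1r lerDl.
Qed.

Definition vsq (u : R) : R := if 0 <= u then vext vs u ^+ 2 else 0.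

Let vb : bddm vsq.
Proof.
split.
 apply: mfun_ifT => //; first exact: measurable_fun_ler. by apply: mfunX; apply: cmfun; exact: vext_continuous.
exists (Mv ^+ 2) => x; rewrite /vsq; case: ifP => _; last by rewrite normr0 sqr_ge0.
by rewrite normrX; apply: lerXn2r; rewrite ?nnegrE ?(le_trans (normr_ge0 _) (vext_bound Mvs x))//; exact: vext_bound.
Qed.

Section shift.
Variable h : R.
Hypothesis h0 : 0 <= h.
Let gk x : g h x <= k x.
Proof.
rewrite /g /k expr2; have [x0|x0] := leP x 0; first by rewrite (fs x0) !mulr0.
by apply: ler_wpM2r => //; apply: fn => //; rewrite lerDl.
Qed.
Let g0 x : 0 <= g h x. Proof. exact: mulr_ge0. Qed.
Let ig : L1 (g h).
Proof.
apply: (L1_le _ f2) => [|x]; last by rewrite ger0_norm.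
apply: mfunM => //; apply: mcompT => //; exact: mfunD.
Qed.
Let sgs : suppos (g h). Proof. by move=> x x0; rewrite /g (fs x0) mulr0. Qed.
Let gn u w : 0 < u -> u <= w -> g h w <= g h u.
Proof.
move=> u0 uw; apply: ler_pM => //; last exact: fn.
by apply: fn; [rewrite ltr_wpDr|rewrite lerD2r].
Qed.

Lemma quad_rconv s : 0 <= s ->
 \int[mu]_(u in `[0, s + h]) (f (s + h - u) * f (s - u) * vext vs u ^+ 2) = rconv (g h) vsq s.
Proof.
move=> s0; rewrite Rintegral_mkcond; apply: eq_Rintegral => u _; rewrite patchE /g /vsq addrAC.
have -> : (u \in (`[0, s + h]%classic : set R)) = (0 <= u <= s + h).
 by apply/idP/idP; rewrite in_setE/= in_itv.
case: (leP 0 u) => [u0|u0] /=; last by rewrite mulr0.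
case: leP => // shu; rewrite (@fs (s - u)) ?mulr0 ?mul0r//.
by rewrite subr_le0 (le_trans _ (ltW shu))// lerDl.
Qed.

Lemma cov_cvg_const : (forall t, 0 <= t -> vs t = 1) -> rconv (g h) vsq t @[t --> +oo] --> \int[mu]_x g h x.
Proof.
move=> v1; have vc : vsq t @[t --> +oo] --> (1 : R).
 apply: (@cvg_trans _ ((fun=> (1 : R)) x @[x --> +oo])); last exact: cvg_cst. apply: near_eq_cvg; near=> t.
 have t0 : 0 <= t by near: t; exact: nbhs_pinfty_ge. by rewrite /vsq /vext t0 v1 ?le_max ?lexx// expr1n.
by have := rconv_cvg ig vb vc; rewrite mul1r.
Unshelve. all: end_near. Qed.

(** What is known is the convergence of [f ^ 2 * vsq]. The Tauberian theorem transfers it from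
    [f ^ 2], which decays at rate [2 rho], to the nonincreasing kernel [f (x + h) f x], whose mass
    near 0 is small because it lies below [f ^ 2]. *)
Lemma cov_cvg (l : R) : rconv k vsq t @[t --> +oo] --> l ->
 rconv (g h) vsq t @[t --> +oo] --> l / (\int[mu]_x k x) * \int[mu]_x g h x.
Proof.
move=> hl; have kp x : 0 <= k x by exact: sqr_ge0.
have ks : suppos k by move=> x x0; rewrite /k (fs x0) expr0n.
have kd u h1 : 0 < u -> 0 <= h1 -> k (u + h1) <= expR (- (2 * rho * h1)) * k u.
 move=> u0 h10; rewrite /k (_ : expR _ = expR (- (rho * h1)) ^+ 2); last first. by rewrite -expRM_natl; congr expR; rewrite mulrN mulrA.
 rewrite -exprMn; apply: lerXn2r; rewrite ?nnegrE ?mulr_ge0 ?expR_ge0//. exact: (resf_decay alpha1 alpha2 rho0 lambda0 hRl).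
have gsm : small_int (g h) by exact: (small_int_le ig f2 gk k_small).
have r2 : 0 < 2 * rho by rewrite mulr_gt0.
have := tauberian f2 ks kp r2 kd k_small ig sgs g0 gn gsm vb hl.
have K0 : 0 <= \int[mu]_x k x by apply: Rintegral_ge0 => // x _.
(* If the integral of [f ^ 2] is 0, so is that of the smaller kernel, and the convolution and the
   claimed limit are both 0. *)
have [Kz|Kn] := eqVneq (\int[mu]_x k x) 0; last first.
 move=> hh; set K := \int[mu]_x k x in hh Kn *; set G := \int[mu]_x g h x in hh *. have h2 : rconv (g h) vsq t * K / K @[t --> +oo] --> l * G / K by apply: cvgM => //; exact: cvg_cst.
 have E : (fun t => rconv (g h) vsq t * K / K) = rconv (g h) vsq by apply/funext => t; rewrite mulfK. by rewrite -E mulrAC.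
move=> _.
have gz : \int[mu]_x g h x = 0.
 apply/eqP; rewrite eq_le -{1}Kz (Rint_le_L1 ig f2 gk)/=. by apply: Rintegral_ge0 => // x _.
rewrite gz mulr0 (_ : rconv (g h) vsq = cst 0); first exact: cvg_cst.
apply/funext => t; have [_ [M hvM]] := vb.
apply/eqP; rewrite -normr_le0; apply: le_trans (rconv_bound t ig vb hvM) _.
by under eq_Rintegral do rewrite (ger0_norm (g0 _)); rewrite gz mulr0.
Qed.
End shift.

Lemma scaling_rconv t : 0 <= t -> rconv k vsq t = c * lambda ^+ 2 * (1 - phi t ^+ 2).
Proof.
move=> t0; have l0 : lambda != 0 by rewrite gt_eqF.
have [mv _] := vb.
have : rconv k vsq t * b ^+ 2 = c * (1 - phi t ^+ 2).
 rewrite -(@phi_quad _ alpha rho lambda Rl alpha1 alpha2 rho0 lambda0 hRl m0 c Mv drift vs cvs Mvs hM)//. rewrite [RHS]Rintegral_mkcond /rconv -Rintegral_Zr; last first.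
  apply: mfunM => //; apply: mfunX; exact: mreflect. apply: eq_Rintegral => u _; rewrite patchE /vpsi /vsq /k.
 have -> : (u \in (`[0, t]%classic : set R)) = (0 <= u <= t). by apply/idP/idP; rewrite in_setE/= in_itv. case: (leP 0 u) => [u0|u0] /=; last by rewrite mulr0 mul0r.
 case: leP => [_|tu]; first by rewrite mul0r addr0 !exprMn; move: (f _) (vext _ _) => x y; ring. by rewrite (@fs (t - u)) ?subr_le0 ?ltW// expr0n !mul0r.
move=> h; rewrite mulrAC -h -mulrA -exprMn mulVf// expr1n mulr1.
by [].
Qed.

Lemma solution_tight : C_tight P (shifted_path X).
Proof.
have th0 : 0 < th by exact: powR_gt0.
have th1 : th < 1.
 have e0 : 0 < be / (4 * q%:R) by apply: divr_gt0 => //; apply: mulr_gt0 => //; exact: ltr0Sn. rewrite /th powRN invf_lt1 ?powR_gt0//.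
 have := gt0_ltr_powR e0; move=> /(_ 1 2); rewrite !nnegrE powR1; apply => //; exact: ltr1n.
apply: (@Kolmogorov_tight _ _ _ P X (v0 + m0 ^+ 2) th q mX cX th0 th1 q0).
 by move=> t t0; rewrite (L2_Rint (sL2 t0)) ssqr.
move=> e e0.
have [n _ hn] := init_set_tail hF m0 aX0 (L2_cst P 1) e0.
have mA : measurable (init_set m0 X0 n).
 by apply/measurable_indicP; exact: (mF_meas hF (lexx 0) (init_set_mF hF m0 aX0 n)).
exists (init_set m0 X0 n); split => //.
 have := hn n (leqnn n); rewrite (eq_integral (fun w => (\1_(~` init_set m0 X0 n) w)%:E)). by rewrite integral_indic ?setIT//; exact: measurableC.
 by move=> w _; rewrite /cst mulr1 indicE; case: (_ \in _); rewrite ?expr1n ?expr0n.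
have [C C0 hC] := inc n; exists C => // s m s0.
have h01 : 0 < ((2 : R) ^+ m)^-1 <= 1 by rewrite invr_gt0 exprn_gt0//= invf_le1 ?exprn_gt0// exprn_ege1// ler1n.
by have := hC _ _ s0 h01; rewrite thE.
Qed.
Let smean t := @solution_mean _ _ _ _ F W hF hW _ _ _ _ alpha1 alpha2 rho0 lambda0 hRl _ _ _ _ _ cvs Mvs hM _ _ _ hk0 hk2 hk1 c0 hc _ _ _ aX0 hE hV hX t.
Let ssig t := @stationary_sigma _ _ _ _ F W hF hW _ _ _ _ alpha1 alpha2 rho0 lambda0 hRl _ _ _ _ _ cvs Mvs hM _ _ _ hk0 hk2 hk1 c0 hc _ _ _ aX0 hE hV hv0 hX t.
Let sui e := @clip_ui _ _ _ _ F W hF hW _ _ _ _ alpha1 alpha2 rho0 lambda0 hRl _ _ _ _ _ cvs Mvs hM _ _ _ hk0 hk2 hk1 c0 hc _ _ _ aX0 hE hV hX e.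

Lemma fake_stationary t : 0 <= t -> [/\ ('E_P[X t] = m0%:E)%E, ('V_P[X t] = v0%:E)%E &
 ('E_P[(fun w => (sg (X t w) ^+ 2)%R)] = (sg m0 ^+ 2 / (1 - c * k2))%:E)%E].
Proof.
move=> t0; split.
- by rewrite (L2_expectation (sL2 t0)) smean.
- rewrite /variance (L2_covariance (sL2 t0) (sL2 t0)) smean//.
 have -> : \int[P]_w (X t w * X t w) = v0 + m0 ^+ 2 by rewrite -(ssqr t0). by rewrite expr2 addrK.
- by rewrite unlock; exact: ssig.
Qed.

Variables (ell vs2 : R).
Hypothesis hphi : phi t @[t --> +oo] --> ell.
Local Notation fd := (resolvent_density Rl).
Hypothesis hvs2 : vs2 = c * lambda ^+ 2 * (1 - ell ^+ 2) / \int[mu]_(s in `[0%R, +oo[) (fd s ^+ 2) \/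
 ((forall t : R, 0 <= t -> vs t = 1) /\ vs2 = 1).

Definition limit_cov (h : R) : R := ell ^+ 2 * v0 +
 vs2 * v0 / (c * lambda ^+ 2) * \int[mu]_(u in `[0%R, +oo[) (fd (h + u) * fd u).

Let fE x : 0 < x -> fd x = f x. Proof. by move=> x0; rewrite /resf /ppart x0. Qed.

Let f2E : \int[mu]_(s in `[0%R, +oo[) (fd s ^+ 2) = \int[mu]_x (f x ^+ 2).
Proof.
apply: Rintegral_halfline => //; first by move=> x x0; rewrite (fs x0) expr0n.
by move=> x x0; rewrite fE.
Qed.

Let gE h : 0 <= h -> \int[mu]_(u in `[0%R, +oo[) (fd (h + u) * fd u) = \int[mu]_x (f (x + h) * f x).
Proof.
move=> h0; apply: Rintegral_halfline.
- apply: (L1_le _ f2) => [|x].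
  by apply: mfunM => //; apply: mcompT => //; exact: mfunD. rewrite ger0_norm ?mulr_ge0// expr2; have [x0|x0] := leP x 0; first by rewrite (fs x0) !mulr0.
 by apply: ler_wpM2r => //; apply: fn => //; rewrite lerDl.
- by move=> x x0; rewrite (fs x0) mulr0.
- by move=> x x0; rewrite [fd x]fE// fE ?ltr_wpDl// [h + x]addrC.
Qed.

Lemma shift_cvg (m : R -> R) (l s : R) : m t @[t --> +oo] --> l -> m (t + s) @[t --> +oo] --> l.
Proof.
move=> hm; apply: (cvg_comp (fun t : R => t + s) m _ hm); exact: cvg_addrr.
Qed.

Lemma conv_cvg h : 0 <= h ->
 rconv (fun x => f (x + h) * f x) vsq t @[t --> +oo] --> vs2 * \int[mu]_x (f (x + h) * f x).
Proof.
move=> h0; case: hvs2 => [->|[v1 ->]]; last first.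
 rewrite mul1r; exact: (cov_cvg_const h0 v1).
rewrite f2E; apply: (cov_cvg h0).
apply: (@cvg_trans _ ((fun t => c * lambda ^+ 2 * (1 - phi t ^+ 2)) x @[x --> +oo])).
 apply: near_eq_cvg; near=> t. have t0 : 0 <= t by near: t; exact: nbhs_pinfty_ge. by rewrite (scaling_rconv t0).
apply: cvgM; first exact: cvg_cst.
by apply: cvgB; [exact: cvg_cst|rewrite expr2; exact: cvgM].
Unshelve. all: end_near. Qed.

Lemma cov_limit (s t : R) : 0 <= s -> s <= t ->
 \int[P]_w (X (T + s) w * X (T + t) w) @[T --> +oo] --> m0 ^+ 2 + limit_cov (t - s).
Proof.
move=> s0 st; have h0 : 0 <= t - s by rewrite subr_ge0.
rewrite /limit_cov (gE h0).
have c1 := shift_cvg s hphi; have c2 := shift_cvg t hphi; have c3 := shift_cvg s (conv_cvg h0).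
have cc : m0 ^+ 2 + v0 * phi (T + s) * phi (T + t) + v0 / (c * lambda ^+ 2) * rconv (fun x => f (x + (t - s)) * f x) vsq (T + s)
  @[T --> +oo] --> m0 ^+ 2 + v0 * ell * ell + v0 / (c * lambda ^+ 2) * (vs2 * \int[mu]_x (f (x + (t - s)) * f x)).
 apply: cvgD; last by apply: cvgM; [exact: cvg_cst|exact: c3]. apply: cvgD; first exact: cvg_cst. by apply: cvgM; [apply: cvgM; [exact: cvg_cst|exact: c1]|exact: c2].
have aux (x y z u v w : R) : x + z * y * y + z / w * (v * u) = x + (y ^+ 2 * z + v * z / w * u) by ring.
rewrite aux in cc; apply: cvg_trans cc; apply: near_eq_cvg; near=> T.
have T0 : 0 <= T by near: T; exact: nbhs_pinfty_ge.
have Ts : 0 <= T + s by exact: addr_ge0.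
have TT : T + s <= T + t by rewrite lerD2l.
rewrite (scov Ts TT) -(@quad_rconv (t - s) h0 (T + s) Ts).
by have -> : T + s + (t - s) = T + t by rewrite -addrA [s + _]addrC subrK.
Unshelve. all: end_near. Qed.

Section limiting_distribution.
Variable Q : probability (borelC R) R.
Hypothesis hQ : functional_limiting_distribution P (shifted_path X) Q.

Let val t (s : halfline R) : 0 <= t -> (fun w => (shifted_path X t w : Cspace R) s) = X (t + set_val s).
Proof. by move=> t0; apply/funext => w; rewrite (shifted_path_val cX). Qed.

Let eval_unif (s : halfline R) : unif_sqr_int P (shifted_path X) (fun z : Cspace R => z s).
Proof.
have ts t : 0 <= t -> 0 <= t + set_val s by move=> t0; rewrite addr_ge0// half_val_ge0.
split; first exact: eval_continuous.
 exists (v0 + m0 ^+ 2) => t t0; have vE := val s t0. split; first by rewrite vE; exact: sL2 (ts _ t0). rewrite -(ssqr (ts _ t0)) le_eqVlt; apply/orP; left; apply/eqP; apply: eq_Rintegral => w _.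
 by rewrite (shifted_path_val cX).
move=> e e0; have [N N0 hN] := sui e0; exists N; first exact: ltW.
move=> t t0; have := hN _ (ts _ t0); apply: le_trans; apply: eq_ler.
by apply: eq_integral => w _; rewrite (shifted_path_val cX).
Qed.

Lemma eval_L2 (s : halfline R) : L2 Q (eval_at s).
Proof. exact: (limit_L2 hQ (eval_unif s)). Qed.

Lemma eval_mean (s : halfline R) : \int[Q]_z (eval_at s z) = m0.
Proof.
(* The mean is a product moment with the constant functional 1. *)
have := @limit_prod _ _ _ _ _ _ hQ (fun z : Cspace R => z s) (cst 1) m0 (eval_unif s) (unif_sqr_int1 P _).
rewrite (_ : \int[Q]_z _ = \int[Q]_z (eval_at s z)); last by apply: eq_Rintegral => z _; rewrite /cst mulr1.
apply; apply: (@cvg_trans _ ((fun=> m0) T @[T --> +oo])); last exact: cvg_cst.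
apply: near_eq_cvg; near=> t.
have t0 : 0 <= t by near: t; exact: nbhs_pinfty_ge.
rewrite -(smean (t := t + set_val s)); last by rewrite addr_ge0// half_val_ge0.
by apply: eq_Rintegral => w _; rewrite /cst mulr1 (shifted_path_val cX).
Unshelve. all: end_near. Qed.

Lemma eval_cov (s t : halfline R) : set_val s <= set_val t ->
 covariance Q (eval_at s) (eval_at t) = (limit_cov (set_val t - set_val s))%:E.
Proof.
move=> st; rewrite (L2_covariance (eval_L2 s) (eval_L2 t)) !eval_mean.
have -> : \int[Q]_z (eval_at s z * eval_at t z) = m0 ^+ 2 + limit_cov (set_val t - set_val s).
 apply: (@limit_prod _ _ _ _ _ _ hQ (fun z : Cspace R => z s) (fun z => z t) _ (eval_unif s) (eval_unif t)). apply: cvg_trans (cov_limit (half_val_ge0 s) st); apply: near_eq_cvg; near=> T.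
 have T0 : 0 <= T by near: T; exact: nbhs_pinfty_ge. by apply: eq_Rintegral => w _; rewrite !(shifted_path_val cX).
by rewrite expr2 addrAC subrr add0r.
Unshelve. all: end_near. Qed.

Lemma limit_stationary : weakly_L2_stationary Q /\
 has_covariance_function Q (fun t1 t2 => limit_cov (t2 - t1)).
Proof.
split; last by move=> t1 t2 t12; exact: eval_cov.
split; first by move=> s; exact: L2_Lfun2 (eval_L2 s).
 by exists m0 => s; rewrite (L2_expectation (eval_L2 s)) eval_mean.
move=> h s t s' t' h0 hs ht.
have [st|ts] := leP (set_val s) (set_val t).
 have st' : set_val s' <= set_val t' by rewrite hs ht lerD2r. rewrite (eval_cov st') (eval_cov st); congr (limit_cov _)%:E. by rewrite hs ht opprD addrACA subrr addr0.
have ts' : set_val t' <= set_val s' by rewrite hs ht lerD2r ltW.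
rewrite covarianceC [RHS]covarianceC (eval_cov ts') (eval_cov (ltW ts)); congr (limit_cov _)%:E.
by rewrite hs ht opprD addrACA subrr addr0.
Qed.
End limiting_distribution.
End limiting_regime.

(** Turns the condition of part 2 into [ell_inf = 0], that is, the convergence of [phi] to 0 on
    which the coupling rests. *)
Lemma mean_reversion_level (R : fieldType) (A nu l m : R) : l != 0 -> m != 0 -> m = A * (nu / l) ->
 A / (l * m) * nu = 1.
Proof.
move=> l0 mz E; have -> : A / (l * m) * nu = A * (nu / l) / m by field; rewrite l0 mz.
by rewrite -E divff.
Qed.

Theorem theorem5p2 (R : realType)
  (d : measure_display) (Omega : measurableType d) (P : probability Omega R)
  (F : R -> set (set Omega)) (W : R -> Omega -> R)
  (hF : usual_conditions P F) (hW : is_brownian P F W)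
  (alpha rho lambda : R)
  (halpha : 2^-1 < alpha < 1) (hrho : 0 < rho) (hlambda : 0 < lambda)
  (Rl : R -> R) (hRl : is_resolvent (gamma_kernel alpha rho) lambda Rl)
  (f : R -> R) (hf : f = resolvent_density Rl)
  (a : R) (ha : a = lim (Rl t @[t --> +oo]))
  (m0 : R) (hm0 : m0 != 0)
  (mu : R -> R) (mu_inf : R) (hmu : C1_halfline mu)
  (hmu0 : ~ {ae lebesgue_measure, forall t : R, 0 <= t -> mu t = 0})
  (hmu_inf : mu t @[t --> +oo] --> mu_inf) (hmu_sgn : 0 <= mu_inf / m0)
  (ell_inf : R) (hell : ell_inf = 1 - (1 - a) / (lambda * m0) * mu_inf)
  (kappa0 kappa1 kappa2 : R)
  (hk0 : 0 <= kappa0) (hk2 : 0 < kappa2)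
  (hk1 : kappa1 ^+ 2 <= 4 * kappa2 * kappa0)
  (sigma : R -> R) (hsigma : sigma = diffusion_coef kappa0 kappa1 kappa2)
  (c : R) (hc : 0 < c < (2 * alpha - 1) / (8 * kappa2))
  (vs : R -> R) (vs2_inf : R)
  (hvs :
     (is_stabilizer lambda m0 c f mu vs /\
      vs2_inf = c * lambda ^+ 2 * (1 - ell_inf ^+ 2) /
                \int[lebesgue_measure]_(s in `[0%R, +oo[) (f s ^+ 2)) \/
     ((forall t : R, 0 <= t -> vs t = 1) /\
      scaling_equation lambda m0 c f mu vs /\
      vs2_inf = 1))
  (v0 : R) (hv0 : v0 = c * sigma m0 ^+ 2 / (1 - c * kappa2))
  (X0 : Omega -> R) (hX0 : is_initial P F W X0)
  (p : R) (hp : 2 / (2 * alpha - 1) < p) (hX0p : X0 \in Lfun P p%:E)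
  (hX0E : ('E_P[X0] = m0%:E)%E) (hX0V : ('V_P[X0] = v0%:E)%E)
  (X : R -> Omega -> R)
  (hX : is_solution P F W lambda m0 f mu vs sigma X0 X) :
  (forall t : R, 0 <= t ->
     [/\ ('E_P[X t] = m0%:E)%E,
         ('V_P[X t] = v0%:E)%E &
         ('E_P[(fun w => (sigma (X t w) ^+ 2)%R)] =
            (sigma m0 ^+ 2 / (1 - c * kappa2))%:E)%E]) /\
  (m0 = (1 - a) * (mu_inf / lambda) ->
   forall (X0' : Omega -> R) (X' : R -> Omega -> R),
     is_initial P F W X0' -> X0' \in Lfun P 2%:E ->
     is_solution P F W lambda m0 f mu vs sigma X0' X' ->
     Lnorm P 2%:E (fun w => (X' t w - X t w)%:E) @[t --> +oo] --> 0%E) /\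
  (C_tight P (shifted_path X) /\
   forall Q : probability (borelC R) R,
     functional_limiting_distribution P (shifted_path X) Q ->
     weakly_L2_stationary Q /\
     has_covariance_function Q (fun t1 t2 =>
       ell_inf ^+ 2 * v0 +
       vs2_inf * v0 / (c * lambda ^+ 2) *
       \int[lebesgue_measure]_(u in `[0%R, +oo[) (f (t2 - t1 + u) * f u))).

Proof.
have [alpha1 alpha2] := andP halpha; have [c0 hc1] := andP hc.
have cdr : {within `[0, +oo[, continuous mu} by have [] := hmu.
rewrite hf in hvs hX *; rewrite hsigma in hv0 hX *; have aX0 := hX0.1.
have hM : scaling_equation lambda m0 c (resolvent_density Rl) mu vs.
  by case: hvs => [[[_ _ _ h] _]|[_ [h _]]].
have cvs : {within `[0, +oo[, continuous vs}.
  case: hvs => [[[h _ _ _] _]//|[v1 _]].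
  have := @cst_continuous (subspace (`[0, +oo[ : set R)) R 1; apply: subspace_eq_continuous.
  by move=> x /set_mem; rewrite /= in_itv/= andbT => x0; change (1 = vs x); rewrite v1.
have [Mv Mvs] : exists Mv, forall t : R, 0 <= t -> `|vs t| <= Mv.
  by case: hvs => [[[_ h _ _] _]//|[v1 _]]; exists 1 => t t0; rewrite v1// normr1.
have aE : a = 1 - \int[lebesgue_measure]_x resf Rl x.
  by rewrite ha; apply: cvg_lim => //; exact: (Rl_cvg alpha1 alpha2 hrho hlambda hRl).
have hphi : phi lambda Rl m0 mu t @[t --> +oo] --> ell_inf.
  have -> : ell_inf = 1 - mu_inf * (\int[lebesgue_measure]_x resf Rl x) / (lambda * m0).
    by rewrite hell aE subKr [_ / _ * _]mulrC mulrA.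
  exact: (phi_cvg alpha1 alpha2 hrho hlambda hRl cdr hmu_inf).
split; [|split].
- move=> t t0; exact: (fake_stationary hF hW alpha1 alpha2 hrho hlambda hRl cvs Mvs hM hk0 hk2 hk1 c0 hc1 aX0 hX0E hX0V hv0 hX t0).
- move=> m0E X0' X' [aX0' _] X0'2 hX'.
  have ell0 : ell_inf = 0.
    have l0 : lambda != 0 by rewrite gt_eqF.
    by rewrite hell (mean_reversion_level l0 hm0 m0E) subrr.
  rewrite ell0 in hphi.
  have U2 : L2 P (fun w => X0' w - X0 w).
    (* [X0' - X0] is [X0' - centred - m0], and [centred] is square integrable through the variance
       of [X0]. *)
    have h1 := L2_lin 1 (-1) (Lfun2_L2 X0'2) (centred_L2 hF aX0 hX0E hX0V).
    have := L2_lin 1 (- m0) h1 (L2_cst P 1); rewrite (_ : (fun w => _) = fun w => X0' w - X0 w)//.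
    by apply/funext => w; rewrite /centred /cst; ring.
  have h2 := coupling_cvg hF hW alpha1 alpha2 hrho hlambda hRl cvs Mvs hM hk2 hk1 c0 hc1 aX0 aX0' hX hX' U2 hphi.
  apply: (@cvg_trans _ (((Num.sqrt (\int[P]_w ((X' t w - X t w) ^+ 2)))%:E) @[t --> +oo])).
    apply: near_eq_cvg; near=> t.
    have t0 : 0 <= t by near: t; exact: nbhs_pinfty_ge.
    by rewrite (L2_Lnorm (coupling_sqr hF hW alpha1 alpha2 hrho hlambda hRl cvs Mvs hM hk2 hk1 c0 hc1 aX0 aX0' hX hX' U2 t0)).
  apply: cvg_EFin; first exact: nearW.
  rewrite -[0]sqrtr0; apply: (cvg_comp _ _ h2); exact: sqrt_continuous.
split.
  exact: (solution_tight hF hW alpha1 alpha2 hrho hlambda hRl cdr cvs Mvs hM hk0 hk2 hk1 c0 hc1 aX0 hX0E hX0V hv0 hX hmu_inf).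
move=> Q hQ.
have hv2 : vs2_inf = c * lambda ^+ 2 * (1 - ell_inf ^+ 2) / \int[lebesgue_measure]_(s in `[0%R, +oo[) (resolvent_density Rl s ^+ 2) \/
    ((forall t : R, 0 <= t -> vs t = 1) /\ vs2_inf = 1).
  by case: hvs => [[_ h]|[h1 [_ h2]]]; [left|right].
exact: (limit_stationary hF hW alpha1 alpha2 hrho hlambda hRl cvs Mvs hM hk0 hk2 hk1 c0 hc1 aX0 hX0E hX0V hv0 hX hphi hv2 hQ).
Unshelve. all: end_near. Qed.
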